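(* Let $K$ be a primitive quartic CM field whose real quadratic subfield $K_0$ has class number one. Let $\ell$ be a prime with $\ell\mathcal{O}_{K_0}=\mathfrak{l}_1\mathfrak{l}_2$, where $\mathfrak{l}_1\neq\mathfrak{l}_2$ are prime ideals of norm $\ell$ generated by totally positive elements, and let $\mathfrak{l}\in\{\mathfrak{l}_1,\mathfrak{l}_2\}$. Let $A$ be a principally polarized ordinary abelian surface defined over a finite field $\mathbb{F}_q$ of characteristic different from $\ell$, with complex multiplication by an order of $K$ having locally maximal real multiplication at $\mathfrak{l}$, and let $\pi$ be its $q$-Frobenius endomorphism. Let $r$ be the smallest integer such that $A[\mathfrak{l}]\subset A(\mathbb{F}_{q^r})$ and let $n$ be the largest integer such that $A[\mathfrak{l}^n]\subset A(\mathbb{F}_{q^r})$. If $\nu_{\mathfrak{l},A}(\pi^r)<2n$, then $$k_{\mathfrak{l},A}=2n-\nu_{\mathfrak{l},A}(\pi^r).$$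
   Context: A quartic CM field is primitive if it contains no imaginary quadratic subfield. An order $\mathcal{O}$ of $K$ has locally maximal real multiplication at $\mathfrak{l}$ if, with $\mathcal{O}_0=\mathcal{O}\cap K_0$, the index $[\mathcal{O}_{K_0}:\mathcal{O}_0]$ is prime to $\ell$; then $\mathcal{O}_{\mathfrak{l}}:=\mathcal{O}\otimes_{\mathcal{O}_0}\mathcal{O}_{K_0,\mathfrak{l}}$, with $\mathcal{O}_{K_0,\mathfrak{l}}$ the completion of $\mathcal{O}_{K_0}$ at $\mathfrak{l}$. ''Complex multiplication by $\mathcal{O}$'' means an embedding $K\hookrightarrow\mathrm{End}(A)\otimes\mathbb{Q}$ identifying $\mathcal{O}$ with $\mathrm{End}(A)$. For $m\ge1$, $A[\mathfrak{l}^m]=\{x\in A(\overline{\mathbb{F}}_q):\beta x=0\ \forall\beta\in\mathfrak{l}^m\cap\mathcal{O}_0\}\cong(\mathbb{Z}/\ell^m\mathbb{Z})^2$. For $\theta\in\mathcal{O}=\mathrm{End}(A)$ with image $\theta_{\mathfrak{l}}\in\mathcal{O}_{\mathfrak{l}}$, the $\mathfrak{l}$-adic exponent is $\nu_{\mathfrak{l},A}(\theta)=\max\{m\ge0:\theta_{\mathfrak{l}}\in\mathcal{O}_{K_0,\mathfrak{l}}+\mathfrak{l}^m\mathcal{O}_{\mathfrak{l}}\}$. Tate pairing: let $\lambda$ be the principal polarization of $A$. For $P,Q\in A[\mathfrak{l}^n]\subset A(\mathbb{F}_{q^r})$ put $T_{\ell^n}(P,Q)=W_{\ell^n}(\pi^r(\bar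 P)-\bar P,\lambda(Q))\in\mu_{\ell^n}$, where $W_{\ell^n}:A[\ell^n]\times\hat A[\ell^n]\to\mu_{\ell^n}$ is the Weil pairing and $\bar P$ is any point with $\ell^n\bar P=P$. Define $$k_{\mathfrak{l},A}=\max_{P\in A[\mathfrak{l}^n]}\{k:T_{\ell^n}(P,P)\in\mu_{\ell^k}\setminus\mu_{\ell^{k-1}}\},$$ i.e. $\ell^{k_{\mathfrak{l},A}}$ is the maximal order of a self-pairing $T_{\ell^n}(P,P)$, $P\in A[\mathfrak{l}^n]$. *)

(* Defs.v *)
From HB Require Import structures.
From mathcomp Require Import all_boot all_order all_algebra all_field.
From mathcomp Require Import mpoly.

Set Implicit Arguments.
Unset Strict Implicit.
Unset Printing Implicit Defensive.

Import GRing.Theory Num.Theory.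

Local Open Scope ring_scope.

Definition is_max (P : nat -> Prop) (m : nat) : Prop :=
  P m /\ forall j, P j -> (j <= m)%N.

Definition is_min (P : nat -> Prop) (m : nat) : Prop :=
  P m /\ forall j, P j -> (m <= j)%N.

(* Classical language: a variety is a set of points over the algebraically closed
field [k], with the Zariski topology and regular functions.  A point of
projective space of dimension [d - 1] is a vector of ['rV[k]_d] whose first
nonzero coordinate is [1], so equality of points is Leibniz equality and a point
is rational over a subfield iff its coordinates are in this subfield.  Maps
between varieties are functions on vectors and matter only on points.

The predicate [F : {pred k}] stands for a perfect subfield of [k]; [predT] is
[k] itself.  Objects "over [F]" are given by polynomials over [F]. *)

Definition is_point (k : closedFieldType) (d : nat) (x : 'rV[k]_d) : Prop :=
  exists i, x 0 i = 1 /\ forall j : 'I_d, (j < i)%N -> x 0 j = 0.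

Definition ev (k : closedFieldType) (d : nat) (f : {mpoly k[d]})
  (x : 'rV[k]_d) : k := f.@[fun i => x 0 i].

Definition form_over (k : closedFieldType) (F : {pred k}) (d m : nat)
  (f : {mpoly k[d]}) : Prop := f \is m.-homog /\ f \is a mpolyOver d F.

Definition closed_set (k : closedFieldType) (F : {pred k}) (d : nat)
    (Z : 'rV[k]_d -> Prop) : Prop :=
  exists S : {mpoly k[d]} -> Prop,
    (forall f, S f -> exists m, form_over F m f) /\
    (forall x, Z x <-> is_point x /\ forall f, S f -> ev f x = 0).

Definition irreducible_set (k : closedFieldType) (d : nat)
    (X : 'rV[k]_d -> Prop) : Prop :=
  (exists x, X x) /\
  forall Z1 Z2 : 'rV[k]_d -> Prop,
    closed_set predT Z1 -> closed_set predT Z2 ->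
    (forall x, X x -> Z1 x \/ Z2 x) ->
    (forall x, X x -> Z1 x) \/ (forall x, X x -> Z2 x).

(* Irreducibility is over [k], i.e. geometric. *)
Definition projective_variety (k : closedFieldType) (F : {pred k}) (d : nat)
    (X : 'rV[k]_d -> Prop) : Prop :=
  closed_set F X /\ irreducible_set X.

Definition has_chain (k : closedFieldType) (d : nat) (X : 'rV[k]_d -> Prop)
    (m : nat) : Prop :=
  exists Z : nat -> 'rV[k]_d -> Prop,
    (forall i, (i <= m)%N ->
       projective_variety predT (Z i) /\ forall x, Z i x -> X x) /\
    (forall i, (i < m)%N ->
       (forall x, Z i x -> Z i.+1 x) /\ exists x, Z i.+1 x /\ ~ Z i x).

Definition has_dimension (k : closedFieldType) (d : nat)
    (X : 'rV[k]_d -> Prop) (g : nat) : Prop := is_max (has_chain X) g.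

Definition open_in (k : closedFieldType) (F : {pred k}) (d : nat)
    (X U : 'rV[k]_d -> Prop) : Prop :=
  exists Z, closed_set F Z /\ forall x, X x -> (U x <-> ~ Z x).

Definition regular_on (k : closedFieldType) (F : {pred k}) (d : nat)
    (X U : 'rV[k]_d -> Prop) (h : 'rV[k]_d -> k) : Prop :=
  forall x, X x -> U x ->
    exists (m : nat) (f g : {mpoly k[d]}),
      [/\ form_over F m f, form_over F m g, ev g x <> 0 &
          forall y, X y -> U y -> ev g y <> 0 -> h y = ev f y / ev g y].

(* In the last clause [f y] and the vector of values have the same class in
   projective space, since the latter is nonzero. *)
Definition morphism_over (k : closedFieldType) (F : {pred k}) (d e : nat)
    (X : 'rV[k]_d -> Prop) (Y : 'rV[k]_e -> Prop) (f : 'rV[k]_d -> 'rV[k]_e) :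
    Prop :=
  (forall x, X x -> Y (f x)) /\
  (forall x, X x ->
    exists (m : nat) (G : 'I_e -> {mpoly k[d]}),
      [/\ forall j, form_over F m (G j),
          \row_j ev (G j) x <> 0 &
          forall y, X y -> \row_j ev (G j) y <> 0 ->
            exists c : k, \row_j ev (G j) y = c *: f y]).

Definition isomorphism_over (k : closedFieldType) (F : {pred k}) (d e : nat)
    (X : 'rV[k]_d -> Prop) (Y : 'rV[k]_e -> Prop) (f : 'rV[k]_d -> 'rV[k]_e) :
    Prop :=
  morphism_over F X Y f /\
  exists g, [/\ morphism_over F Y X g,
                forall x, X x -> g (f x) = x & forall y, Y y -> f (g y) = y].

(* The Segre embedding, lexicographic on coordinates; it preserves
   [is_point]. *)
Definition segre (k : closedFieldType) (d e : nat) (x : 'rV[k]_d)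
  (y : 'rV[k]_e) : 'rV[k]_(d * e) := mxvec (x^T *m y).

Definition product (k : closedFieldType) (d e : nat) (X : 'rV[k]_d -> Prop)
    (Y : 'rV[k]_e -> Prop) (w : 'rV[k]_(d * e)) : Prop :=
  exists x y, [/\ X x, Y y & w = segre x y].

(* A line bundle, as a cocycle of transition functions.  The sign convention is
   that of Cartier divisors: the bundle of a divisor with local equations [f_i]
   has transition functions [f_i / f_j]. *)

Record cocycle (k : closedFieldType) (d : nat) := Cocycle {
  index : Type;
  chart : index -> 'rV[k]_d -> Prop;
  trans : index -> index -> 'rV[k]_d -> k }.

Definition line_bundle (k : closedFieldType) (F : {pred k}) (d : nat)
    (X : 'rV[k]_d -> Prop) (L : cocycle k d) : Prop :=
  [/\ forall i : index L, open_in F X (chart i),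
      forall x, X x -> exists i : index L, chart i x,
      forall i j : index L,
        regular_on F X (fun x => chart i x /\ chart j x) (trans i j),
      forall (i j : index L) x, X x -> chart i x -> chart j x ->
        trans i j x <> 0 &
      forall (i j l : index L) x, X x -> chart i x -> chart j x -> chart l x ->
        trans i j x * trans j l x = trans i l x].

Definition pullback (k : closedFieldType) (d e : nat)
    (f : 'rV[k]_d -> 'rV[k]_e) (L : cocycle k e) : cocycle k d :=
  @Cocycle k d (index L) (fun i x => chart i (f x))
    (fun i j x => trans i j (f x)).

Definition tensor (k : closedFieldType) (d : nat) (L M : cocycle k d) :
    cocycle k d :=
  @Cocycle k d (index L * index M)%type
    (fun i x => chart i.1 x /\ chart i.2 x)
    (fun i j x => trans i.1 j.1 x * trans i.2 j.2 x).

Definition dual_bundle (k : closedFieldType) (d : nat) (L : cocycle k d) :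
    cocycle k d :=
  @Cocycle k d (index L) (@chart k d L) (fun i j x => (trans i j x)^-1).

Definition bundle_power (k : closedFieldType) (d : nat) (L : cocycle k d)
    (m : nat) : cocycle k d :=
  @Cocycle k d (index L) (@chart k d L) (fun i j x => trans i j x ^+ m).

(* If the bundle of a divisor with local equations [f_i] is trivial, the
   divisor is that of a rational function [g], and [h_i = g / f_i] is a
   trivialization. *)
Definition trivialization (k : closedFieldType) (d : nat)
    (X : 'rV[k]_d -> Prop) (L : cocycle k d) (h : index L -> 'rV[k]_d -> k) :
    Prop :=
  [/\ forall i, regular_on predT X (chart i) (h i),
      forall i x, X x -> chart i x -> h i x <> 0 &
      forall i j x, X x -> chart i x -> chart j x ->
        trans i j x * h i x = h j x].

Definition trivial_bundle (k : closedFieldType) (d : nat)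
    (X : 'rV[k]_d -> Prop) (L : cocycle k d) : Prop :=
  exists h, @trivialization k d X L h.

Definition isomorphic_bundles (k : closedFieldType) (d : nat)
    (X : 'rV[k]_d -> Prop) (L M : cocycle k d) : Prop :=
  trivial_bundle X (tensor L (dual_bundle M)).

(* O(1) *)
Definition hyperplane_bundle (k : closedFieldType) (d : nat) : cocycle k d :=
  @Cocycle k d 'I_d (fun i x => x 0 i <> 0) (fun i j x => x 0 j / x 0 i).

Definition ample (k : closedFieldType) (d : nat) (X : 'rV[k]_d -> Prop)
    (L : cocycle k d) : Prop :=
  exists m : nat, (0 < m)%N /\
  exists (e : nat) (Y : 'rV[k]_e -> Prop) (f : 'rV[k]_d -> 'rV[k]_e),
    [/\ closed_set predT Y, isomorphism_over predT X Y f &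
        isomorphic_bundles X (bundle_power L m)
          (pullback f (hyperplane_bundle k e))].

Record group_data (k : closedFieldType) (d : nat) := GroupData {
  pts : 'rV[k]_d -> Prop;
  zero : 'rV[k]_d;
  add : 'rV[k]_d -> 'rV[k]_d -> 'rV[k]_d;
  opp : 'rV[k]_d -> 'rV[k]_d }.

(* Commutativity of [add] is a consequence of completeness. *)
Definition abelian_variety (k : closedFieldType) (F : {pred k}) (d : nat)
    (A : group_data k d) : Prop :=
  [/\ projective_variety F (pts A),
      pts A (zero A) /\ (forall i, zero A 0 i \in F),
      exists h, morphism_over F (product (pts A) (pts A)) (pts A) h /\
        forall x y, pts A x -> pts A y -> h (segre x y) = add A x y,
      morphism_over F (pts A) (pts A) (opp A) &
      forall x y z, pts A x -> pts A y -> pts A z ->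
        [/\ add A x (add A y z) = add A (add A x y) z,
            add A (zero A) x = x, add A x (zero A) = x,
            add A (opp A x) x = zero A & add A x (opp A x) = zero A]].

Definition mult (k : closedFieldType) (d : nat) (A : group_data k d) (m : nat)
  (x : 'rV[k]_d) : 'rV[k]_d := iter m (add A x) (zero A).

Definition abelian_surface (k : closedFieldType) (F : {pred k}) (d : nat)
    (A : group_data k d) : Prop :=
  abelian_variety F A /\ has_dimension (pts A) 2.

(* The p-torsion over [k] has order p^2, the largest possible for a surface in
   characteristic p. *)
Definition ordinary_surface (k : closedFieldType) (p d : nat)
    (A : group_data k d) : Prop :=
  exists s : seq 'rV[k]_d,
    [/\ uniq s, size s = (p ^ 2)%N &
        forall x, x \in s <-> pts A x /\ mult A p x = zero A].

Definition homomorphism_over (k : closedFieldType) (F : {pred k}) (d e : nat)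
    (A : group_data k d) (B : group_data k e) (f : 'rV[k]_d -> 'rV[k]_e) :
    Prop :=
  morphism_over F (pts A) (pts B) f /\
  forall x y, pts A x -> pts A y -> f (add A x y) = add B (f x) (f y).

Definition translation (k : closedFieldType) (d : nat) (A : group_data k d)
  (a x : 'rV[k]_d) : 'rV[k]_d := add A x a.

Definition Pic0 (k : closedFieldType) (d : nat) (A : group_data k d)
    (L : cocycle k d) : Prop :=
  line_bundle predT (pts A) L /\
  forall a, pts A a ->
    isomorphic_bundles (pts A) (pullback (translation A a) L) L.

(* Restriction of a bundle on [X * Y] to [X * {y}] and to [{x} * Y]. *)
Definition fibre_r (k : closedFieldType) (d e : nat) (y : 'rV[k]_e)
  (M : cocycle k (d * e)) : cocycle k d := pullback (fun x => segre x y) M.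

Definition fibre_l (k : closedFieldType) (d e : nat) (x : 'rV[k]_d)
  (M : cocycle k (d * e)) : cocycle k e := pullback (fun y => segre x y) M.

(* [B] is the dual abelian variety of [A] with Poincare bundle [P] (over [F]),
   by the universal property for families of elements of Pic0 parametrized by
   projective varieties over [k].  As [B] is itself such a variety, this
   determines the pair up to a unique isomorphism; the bundle at [zero B] is
   trivial, so that the group law of [B] is the tensor product. *)
Definition dual_variety (k : closedFieldType) (F : {pred k}) (d b : nat)
    (A : group_data k d) (B : group_data k b) (P : cocycle k (d * b)) : Prop :=
  [/\ abelian_variety F B,
      line_bundle F (product (pts A) (pts B)) P,
      forall y, pts B y -> Pic0 A (fibre_r y P),
      trivial_bundle (pts B) (fibre_l (zero A) P) /\
      trivial_bundle (pts A) (fibre_r (zero B) P) &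
      forall (e : nat) (S : 'rV[k]_e -> Prop) (M : cocycle k (d * e)),
        projective_variety predT S ->
        line_bundle predT (product (pts A) S) M ->
        (forall s, S s -> Pic0 A (fibre_r s M)) ->
        trivial_bundle S (fibre_l (zero A) M) ->
        let classifies (phi : 'rV[k]_e -> 'rV[k]_b) :=
          morphism_over predT S (pts B) phi /\
          exists h : 'rV[k]_(d * e) -> 'rV[k]_(d * b),
            (forall x s, pts A x -> S s -> h (segre x s) = segre x (phi s)) /\
            isomorphic_bundles (product (pts A) S) (pullback h P) M in
        (exists phi, classifies phi) /\
        (forall phi psi, classifies phi -> classifies psi ->
           forall s, S s -> phi s = psi s)].

(* [lam] is an isomorphism from [A] to its dual sending [x] to the class of
   [t_x^* L (x) L^-1] for some ample [L] (defined over [k]). *)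
Definition principal_polarization (k : closedFieldType) (F : {pred k})
    (d b : nat) (A : group_data k d) (B : group_data k b)
    (P : cocycle k (d * b)) (lam : 'rV[k]_d -> 'rV[k]_b) : Prop :=
  [/\ homomorphism_over F A B lam,
      isomorphism_over F (pts A) (pts B) lam &
      exists L : cocycle k d,
        [/\ line_bundle predT (pts A) L, ample (pts A) L &
            forall x, pts A x ->
              isomorphic_bundles (pts A) (fibre_r (lam x) P)
                (tensor (pullback (translation A x) L) (dual_bundle L))]].

(* [zeta] is the Weil pairing [W_m(x, y)] of [x] in A[m] and [y] in B[m], where
   [(B, P)] is the dual of [A].  If [D] is a divisor in the class of [y] and
   [m]^* D = div(g), then [zeta = g(z + x) / g(z)]; in terms of the local
   equations [f_i] of [D], [h_i = g / (f_i o [m])] trivializes the pullback of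
   the bundle of [D] by [m], and [f_i o [m]] is invariant under translation by
   [x]. *)
Definition weil_pairing (k : closedFieldType) (d b : nat)
    (A : group_data k d) (B : group_data k b) (P : cocycle k (d * b))
    (m : nat) (x : 'rV[k]_d) (y : 'rV[k]_b) (zeta : k) : Prop :=
  [/\ pts A x /\ mult A m x = zero A,
      pts B y /\ mult B m y = zero B &
      let L := pullback (mult A m) (fibre_r y P) in
      exists h : index L -> 'rV[k]_d -> k,
        trivialization (pts A) h /\
        forall (i : index L) z, pts A z -> chart i z ->
          h i (add A z x) = zeta * h i z].

Definition Fq (k : closedFieldType) (q : nat) : {pred k} :=
  [pred x | x ^+ q == x].

Arguments Fq k q : clear implicits.

Definition frobenius (k : closedFieldType) (q d : nat) (x : 'rV[k]_d) :
  'rV[k]_d := map_mx (fun c => c ^+ q) x.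

Definition rational_point (k : closedFieldType) (q d : nat)
    (A : group_data k d) (x : 'rV[k]_d) : Prop :=
  pts A x /\ forall i, x 0 i \in Fq k q.

Definition embeddings (K : fieldExtType rat) (E : {subfield K}) : Type :=
  {rmorphism subvs_of E -> algC}.

Definition totally_real (K : fieldExtType rat) (E : {subfield K}) : Prop :=
  forall (s : embeddings E) (x : subvs_of E), s x \is Num.real.

Definition totally_imaginary (K : fieldExtType rat) (E : {subfield K}) : Prop :=
  forall s : embeddings E, exists x : subvs_of E, s x \isn't Num.real.

Definition totally_positive (K : fieldExtType rat) (E : {subfield K})
    (a : subvs_of E) : Prop :=
  forall s : embeddings E, 0 < s a.

Definition quartic_CM (K : fieldExtType rat) (K0 : {subfield K}) : Prop :=
  [/\ \dim {:K} = 4, \dim K0 = 2, totally_real K0 &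
      totally_imaginary {:K}%AS].

Definition primitive_field (K : fieldExtType rat) : Prop :=
  ~ exists E : {subfield K}, \dim E = 2 /\ totally_imaginary E.

Definition ring_of_integers (K : fieldExtType rat) (E : {subfield K}) (x : K) :
  Prop := x \in E /\ integralOver (intr : int -> K) x.

(* The index of the additive group [H] in [G]. *)
Definition index_is (K : fieldExtType rat) (G H : K -> Prop) (m : nat) : Prop :=
  exists s : seq K,
    [/\ size s = m, forall x, x \in s -> G x,
        forall i j, (i < j < m)%N -> ~ H (s`_i - s`_j) &
        forall x, G x -> exists2 y, y \in s & H (x - y)].

Definition is_ideal (K : fieldExtType rat) (R I : K -> Prop) : Prop :=
  [/\ forall x, I x -> R x, I 0, forall x y, I x -> I y -> I (x + y) &
      forall a x, R a -> I x -> I (a * x)].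

Definition nonzero_ideal (K : fieldExtType rat) (R I : K -> Prop) : Prop :=
  is_ideal R I /\ exists2 x, I x & x <> 0.

Definition principal_ideal (K : fieldExtType rat) (R : K -> Prop) (a x : K) :
  Prop := exists2 y, R y & x = a * y.

Definition prime_ideal (K : fieldExtType rat) (R I : K -> Prop) : Prop :=
  [/\ is_ideal R I, ~ I 1 &
      forall x y, R x -> R y -> I (x * y) -> I x \/ I y].

Definition ideal_mul (K : fieldExtType rat) (I J : K -> Prop) (x : K) : Prop :=
  exists s : seq (K * K),
    (forall u, u \in s -> I u.1 /\ J u.2) /\ x = \sum_(u <- s) u.1 * u.2.

Fixpoint ideal_pow (K : fieldExtType rat) (R I : K -> Prop) (m : nat) :
    K -> Prop :=
  if m is m'.+1 then ideal_mul I (ideal_pow R I m') else R.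

Definition class_number_one (K : fieldExtType rat) (E : {subfield K}) : Prop :=
  forall I J : K -> Prop,
    nonzero_ideal (ring_of_integers E) I ->
    nonzero_ideal (ring_of_integers E) J ->
    exists a b : K,
      [/\ ring_of_integers E a, ring_of_integers E b, a <> 0, b <> 0 &
          forall x, (exists2 y, I y & x = a * y) <->
                    (exists2 y, J y & x = b * y)].

Definition is_order (K : fieldExtType rat) (O : K -> Prop) : Prop :=
  [/\ O 1, forall x y, O x -> O y -> O (x - y) /\ O (x * y),
      exists s : seq K, forall x, O x <->
        exists c : nat -> int, x = \sum_(i < size s) s`_i *~ c i &
      forall x, exists2 N : nat, (0 < N)%N & O (x *+ N)].

Definition real_suborder (K : fieldExtType rat) (K0 : {subfield K})
  (O : K -> Prop) (x : K) : Prop := O x /\ x \in K0.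

Definition locally_maximal_rm (K : fieldExtType rat) (K0 : {subfield K})
    (O : K -> Prop) (ell : nat) : Prop :=
  exists2 m, index_is (ring_of_integers K0) (real_suborder K0 O) m &
             coprime m ell.

(* A coherent sequence represents an element of the inverse limit of the
   [O_K0 / I ^ m], where [r m] is taken modulo [I ^ m]. *)
Definition in_completion (K : fieldExtType rat) (K0 : {subfield K})
    (I : K -> Prop) (r : nat -> K) : Prop :=
  forall m, ring_of_integers K0 (r m) /\
    ideal_pow (ring_of_integers K0) I m (r m.+1 - r m).

Definition completion_eq (K : fieldExtType rat) (K0 : {subfield K})
    (I : K -> Prop) (r s : nat -> K) : Prop :=
  forall m, ideal_pow (ring_of_integers K0) I m (r m - s m).

Definition balanced (K : fieldExtType rat) (K0 : {subfield K})
    (O I : K -> Prop) (M : zmodType) (f : K -> (nat -> K) -> M) : Prop :=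
  [/\ forall x r s, O x -> in_completion K0 I r -> in_completion K0 I s ->
        completion_eq K0 I r s -> f x r = f x s,
      forall x y r, O x -> O y -> in_completion K0 I r ->
        f (x + y) r = f x r + f y r,
      forall x r s, O x -> in_completion K0 I r -> in_completion K0 I s ->
        f x (fun m => r m + s m) = f x r + f x s &
      forall a x r, real_suborder K0 O a -> O x -> in_completion K0 I r ->
        f (a * x) r = f x (fun m => a * r m)].

(* Elements of O_I = O (x)_(O_0) O_(K0,I) are represented by formal sums of pure
   tensors; two formal sums are equal in the tensor product iff every balanced
   biadditive map takes the same value on them. *)
Definition tensor_eq (K : fieldExtType rat) (K0 : {subfield K})
    (O I : K -> Prop) (u v : seq (K * (nat -> K))) : Prop :=
  forall (M : zmodType) (f : K -> (nat -> K) -> M), balanced K0 O I f ->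
    \sum_(t <- u) f t.1 t.2 = \sum_(t <- v) f t.1 t.2.

(* The image of [theta] in O_I belongs to O_(K0,I) + I ^ m O_I.  A triple
   [(b, x, r)] stands for the element [b (x (x) r)] of I ^ m O_I. *)
Definition in_local_suborder (K : fieldExtType rat) (K0 : {subfield K})
    (O I : K -> Prop) (m : nat) (theta : K) : Prop :=
  exists (r : nat -> K) (u : seq (K * K * (nat -> K))),
    [/\ in_completion K0 I r,
        forall i, (i < size u)%N ->
          let t := nth (0, 0, fun=> 0) u i in
          [/\ ideal_pow (ring_of_integers K0) I m t.1.1, O t.1.2 &
              in_completion K0 I t.2] &
        tensor_eq K0 O I [:: (theta, fun=> 1)]
          ((1, r) :: [seq (t.1.2, fun j => t.1.1 * t.2 j) | t <- u])].

(* [iota] is an isomorphism from [O] to the ring of [F]-endomorphisms of [A],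
   where endomorphisms are identified when they agree on [pts A]; since [O]
   spans [K] over the rationals, it extends uniquely to an embedding of [K] in
   End(A) (x) Q. *)
Definition complex_multiplication (k : closedFieldType) (F : {pred k})
    (d : nat) (A : group_data k d) (K : fieldExtType rat) (O : K -> Prop)
    (iota : K -> 'rV[k]_d -> 'rV[k]_d) : Prop :=
  [/\ forall a, O a -> homomorphism_over F A A (iota a),
      forall x, pts A x -> iota 1 x = x,
      forall a b x, O a -> O b -> pts A x ->
        iota (a + b) x = add A (iota a x) (iota b x) /\
        iota (a * b) x = iota a (iota b x),
      forall a b, O a -> O b ->
        (forall x, pts A x -> iota a x = iota b x) -> a = b &
      forall f, homomorphism_over F A A f ->
        exists2 a, O a & forall x, pts A x -> f x = iota a x].

(* A[I ^ m] *)
Definition ideal_torsion (k : closedFieldType) (d : nat) (A : group_data k d)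
    (K : fieldExtType rat) (K0 : {subfield K}) (O I : K -> Prop)
    (iota : K -> 'rV[k]_d -> 'rV[k]_d) (m : nat) (x : 'rV[k]_d) : Prop :=
  pts A x /\
  forall a, ideal_pow (ring_of_integers K0) I m a -> real_suborder K0 O a ->
    iota a x = zero A.

Definition adic_exponent (k : closedFieldType) (d : nat) (A : group_data k d)
    (K : fieldExtType rat) (K0 : {subfield K}) (O I : K -> Prop)
    (iota : K -> 'rV[k]_d -> 'rV[k]_d) (f : 'rV[k]_d -> 'rV[k]_d) (nu : nat) :
    Prop :=
  exists theta : K,
    [/\ O theta, forall x, pts A x -> iota theta x = f x &
        is_max (fun m => in_local_suborder K0 O I m theta) nu].

Definition tate_pairing (k : closedFieldType) (d b : nat) (A : group_data k d)
    (B : group_data k b) (P : cocycle k (d * b)) (lam : 'rV[k]_d -> 'rV[k]_b)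
    (q r m : nat) (x y : 'rV[k]_d) (zeta : k) : Prop :=
  exists z : 'rV[k]_d,
    [/\ pts A z, mult A m z = x &
        weil_pairing A B P m
          (add A (iter r (@frobenius k q d) z) (opp A z)) (lam y) zeta].

(* [zeta] is in mu_(ell ^ j) and not in mu_(ell ^ (j - 1)), the latter condition
   being void for j = 0. *)
Definition exact_order (k : closedFieldType) (ell j : nat) (zeta : k) : Prop :=
  zeta ^+ (ell ^ j) = 1 /\
  forall i, (i < j)%N -> zeta ^+ (ell ^ i) <> 1.

Definition self_pairing_exponent (k : closedFieldType) (d b : nat)
    (A : group_data k d) (B : group_data k b) (P : cocycle k (d * b))
    (lam : 'rV[k]_d -> 'rV[k]_b) (q r : nat)
    (K : fieldExtType rat) (K0 : {subfield K}) (O I : K -> Prop)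
    (iota : K -> 'rV[k]_d -> 'rV[k]_d) (ell n : nat) : nat -> Prop :=
  is_max (fun j => exists (x : 'rV[k]_d) (zeta : k),
    [/\ ideal_torsion A K0 O I iota n x,
        tate_pairing A B P lam q r (ell ^ n) x x zeta &
        exact_order ell j zeta]).

(* Main.v *)
(** The points of [A] form an abelian group on which [O] acts. The theorem of the square,
    divisibility and the non-degeneracy of the Weil pairing [e] of the polarization yield the
    Rosati involution, the bound [m ^ 4] for the number of [m]-torsion points, and the fact that
    an endomorphism killing the [m]-torsion is a multiple of [m].

    The involution extends to a field morphism of [K] which moves the Frobenius power [theta], by
    [theta^+ * theta = q ^ r] and ordinarity, and fixes [K0], since [K] is primitive. Elements of
    [O] lying in [K0] are thus self-adjoint for [e]; those approximating the projector onto the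
    completion at [l] make the [l]-primary torsion orthogonal to the complementary part.

    On the [l ^ (2 n)]-torsion, [theta - 1 = ell ^ n * c + ell ^ nu * gamma] where [gamma] does
    not act on the [l]-torsion as an integer. If [ell ^ n * z = x] this gives
    [e (theta z - z, x) = e (x, x) ^ c * e (gamma x, x) ^ (ell ^ (nu - n))] and [e (x, x) = 1],
    so the order divides [ell ^ (2 n - nu)]. It is attained when [x] lifts a point [x0] such that
    [x0] and [gamma x0] form a basis of the [l]-torsion, for then [e (gamma x, x)] has order
    [ell ^ n]. *)
Require Import Defs.
From HB Require Import structures.
From mathcomp Require Import all_boot all_order all_algebra all_field.
From mathcomp Require Import mpoly ring zify.
From Stdlib Require Import Classical ClassicalEpsilon FunctionalExtensionality.

Set Implicit Arguments.
Unset Strict Implicit.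
Unset Printing Implicit Defensive.

Import Order.TTheory GRing.Theory Num.Theory.
Import Defs.

Local Open Scope ring_scope.

(** Varieties being bare sets of points, neither sheaf cohomology nor quotient varieties nor degrees
    are at hand. Global functions are controlled by a graded Nullstellensatz, and the number of
    torsion points by the growth of the space of forms of degree [D] on the surface. An upper bound
    suffices: it excludes a fifth independent point of [A[ell]].

    Dividing an endomorphism by [m] on points gives a map known to be regular only after composition
    with a power of Frobenius, since points do not see inseparability. This power is harmless:
    Frobenius divides [q] in [O], and [m] is prime to [q].

    [O] contains only the endomorphisms over the finite field, so every map constructed
    geometrically, such as the adjoint of an endomorphism, must also be shown to commute with
    Frobenius.

    The completion at [l] is the ring of [ell]-adic integers, so its elements act on torsion points
    as natural numbers; this is how the tensor product defining the exponent is turned into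
    statements about points. *)

Lemma fchoice (T U : Type) (R : T -> U -> Prop) :
  (forall x, exists y, R x y) -> exists f, forall x, R x (f x).
Proof.
move=> h; exists (fun x => proj1_sig (constructive_indefinite_description _ (h x))).
by move=> x; case: constructive_indefinite_description.
Qed.

(** * Projective sets and regular functions *)

Section Forms.

Variables (k : closedFieldType) (d : nat).
Implicit Types (F G : 'rV[k]_d -> k) (x y : 'rV[k]_d).

(** Forms are carried as functions on vectors so that identities between them are checked pointwise;
    the zero function is a form of every degree. *)
Definition fform (m : nat) (F : 'rV[k]_d -> k) : Prop :=
  exists2 f : {mpoly k[d]}, f \is m.-homog & forall x, F x = ev f x.

Lemma fform_ext m F G : F =1 G -> fform m F -> fform m G.
Proof. by move=> e [f hf h]; exists f => // x; rewrite -e. Qed.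

Lemma fform_deg m n F : m = n -> fform m F -> fform n F.
Proof. by move=> <-. Qed.

Lemma fform_ev m (f : {mpoly k[d]}) : f \is m.-homog -> fform m (ev f).
Proof. by move=> hf; exists f. Qed.

Lemma fformC c : fform 0 (fun=> c).
Proof.
exists c%:MP => [|x]; last by rewrite /ev mevalC.
by rewrite -[c%:MP]mulr1 mul_mpolyC dhomogZ ?dhomog1.
Qed.

Lemma fform0 m : fform m (fun=> 0).
Proof. by exists 0 => [|x]; rewrite ?dhomog0 // /ev meval0. Qed.

Lemma fformX i : fform 1 (fun x => x 0 i).
Proof.
exists 'X_i => [|x]; last by rewrite /ev mevalXU.
by rewrite dhomogX /= mdeg1.
Qed.

Lemma fformD m F G : fform m F -> fform m G -> fform m (fun x => F x + G x).
Proof.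
move=> [f hf ef] [g hg eg]; exists (f + g) => [|x]; first by rewrite dhomogD.
by rewrite ef eg /ev mevalD.
Qed.

Lemma fformM m n F G :
  fform m F -> fform n G -> fform (m + n) (fun x => F x * G x).
Proof.
move=> [f hf ef] [g hg eg]; exists (f * g) => [|x]; first exact: dhomogM.
by rewrite ef eg /ev mevalM.
Qed.

Lemma fformZ m c F : fform m F -> fform m (fun x => c * F x).
Proof. by move=> hF; have := fformM (fformC c) hF. Qed.

Lemma fformN m F : fform m F -> fform m (fun x => - F x).
Proof. by move=> /(fformZ (-1)); apply: fform_ext => x; rewrite mulN1r. Qed.

Lemma fformB m F G : fform m F -> fform m G -> fform m (fun x => F x - G x).
Proof. by move=> hF /fformN; apply: fformD. Qed.

Lemma fformXn m n F : fform m F -> fform (n * m) (fun x => F x ^+ n).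
Proof.
move=> hF; elim: n => [|n IH].
  by apply: (@fform_ext _ (fun=> 1)) => //; exact: fformC.
by apply: fform_ext (fformM hF IH) => x; rewrite exprS.
Qed.

Lemma fform_sum m (I : Type) (r : seq I) (P : pred I) (F : I -> 'rV[k]_d -> k) :
  (forall i, P i -> fform m (F i)) -> fform m (fun x => \sum_(i <- r | P i) F i x).
Proof.
move=> h; elim: r => [|i r IH].
  by apply: fform_ext (fform0 m) => x; rewrite big_nil.
have [Pi|nPi] := boolP (P i).
  by apply: fform_ext (fformD (h i Pi) IH) => x; rewrite big_cons Pi.
by apply: fform_ext IH => x; rewrite big_cons (negPf nPi).
Qed.

Lemma fform_prod (I : Type) (r : seq I) (w : I -> nat) (F : I -> 'rV[k]_d -> k) :
  (forall i, fform (w i) (F i)) ->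
  fform (\sum_(i <- r) w i) (fun x => \prod_(i <- r) F i x).
Proof.
move=> h; elim: r => [|i r IH].
  rewrite big_nil; apply: fform_ext (fformC 1) => x; by rewrite big_nil.
rewrite big_cons; apply: fform_ext (fformM (h i) IH) => x; by rewrite big_cons.
Qed.

Lemma fform_over m (f : {mpoly k[d]}) : form_over predT m f <-> f \is m.-homog.
Proof.
split=> [[]//|hf]; split=> //; exact/allP.
Qed.

Lemma ev_homogE (f : {mpoly k[d]}) x : ev f x =
  \sum_(u <- msupp f) f@_u * \prod_i x 0 i ^+ u i.
Proof. by rewrite /ev mevalE. Qed.


Lemma ev_scale m (f : {mpoly k[d]}) c x :
  f \is m.-homog -> ev f (c *: x) = c ^+ m * ev f x.
Proof.
move=> /dhomogP hf; rewrite !ev_homogE mulr_sumr; apply: eq_big_seq => u /hf <-.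
rewrite mulrCA; congr (_ * _).
have -> : \prod_i (c *: x) 0 i ^+ u i = \prod_i (c ^+ u i * x 0 i ^+ u i).
  by apply: eq_bigr => i _; rewrite mxE exprMn.
by rewrite big_split /= prodrXr mdegE.
Qed.

Lemma fform_scale m F c x : fform m F -> F (c *: x) = c ^+ m * F x.
Proof. by case=> f hf ef; rewrite !ef (ev_scale _ _ hf). Qed.

(** Dividing each monomial by a coordinate occurring in it gives the step of the later inductions on
    the degree of a form known only as a function. *)
Lemma fformS m F : fform m.+1 F ->
  exists2 G : 'I_d -> 'rV[k]_d -> k, forall i, fform m (G i) &
    forall x, F x = \sum_i x 0 i * G i x.
Proof.
case=> f hf ef.
suff [G hG eG] : exists2 G : 'I_d -> 'rV[k]_d -> k, forall i, fform m (G i) &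
    forall x, ev f x = \sum_i x 0 i * G i x.
  by exists G => // x; rewrite ef.
have {ef F}: forall u, u \in msupp f -> mdeg u = m.+1 by apply/dhomogP.
have: forall x, ev f x = \sum_(u <- msupp f) f@_u * \prod_i x 0 i ^+ u i.
  by move=> x; rewrite ev_homogE.
elim: (msupp f) {hf} (ev f) => [|u s IH] E eE hs.
  exists (fun _ => fun=> 0) => [i|x]; first exact: fform0.
  by rewrite eE big_nil big1 // => i _; rewrite mulr0.
have [||G hG eG] := IH (fun x => \sum_(v <- s) f@_v * \prod_i x 0 i ^+ v i).
- by [].
- by move=> v vs; apply: hs; rewrite inE vs orbT.
have du := hs u (mem_head _ _).
have [i0 hi0] : exists i, (0 < u i)%N.
  apply/existsP; rewrite -[[exists _, _]]negbK negb_exists; apply/negP=> /forallP h.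
  by move: du; rewrite mdegE big1 // => i _; apply/eqP; rewrite -leqn0 leqNgt h.
pose v := (u - U_(i0))%MM.
have uv : u = (v + U_(i0))%MM by rewrite submK //; apply/mnm_lepP=> i;
  rewrite mnm1E; case: eqP => [<-|].
exists (fun i x => G i x + (if i == i0 then f@_u * \prod_j x 0 j ^+ v j else 0)).
  move=> i; apply: fformD => //; case: eqP => _; last exact: fform0.
  apply: fformZ; exists 'X_[v] => [|x]; last by rewrite /ev mevalX.
  by rewrite dhomogX /=; apply/eqP; move: du; rewrite uv mdegD mdeg1 addn1 => -[].
move=> x; rewrite eE big_cons eG.
rewrite [RHS](eq_bigr (fun i => x 0 i * G i x +
  (if i == i0 then x 0 i * (f@_u * \prod_j x 0 j ^+ v j) else 0))); last first.
  by move=> i _; rewrite mulrDr; case: eqP => // _; rewrite mulr0.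
rewrite big_split /= addrC; congr (_ + _).
rewrite -big_mkcond big_pred1_eq mulrCA; congr (_ * _).
rewrite (bigD1 i0) //= [in RHS](bigD1 i0) //= mulrA; congr (_ * _).
  by rewrite -exprS uv mnmDE mnm1E eqxx addn1.
by apply: eq_bigr => i ni; rewrite uv mnmDE mnm1E eq_sym (negPf ni) addn0.
Qed.

Lemma fform_deg0 F : fform 0 F -> exists c, forall x, F x = c.
Proof.
case=> f /dhomogP hf ef; exists f@_0%MM => x.
have: {in msupp f, forall u, u = 0%MM}.
  by move=> u /hf /eqP; rewrite mdeg_eq0 => /eqP.
rewrite ef ev_homogE; have := msupp_uniq f.
case E: (msupp f) => [|u [|v s]] /= Hu h.
- by rewrite big_nil memN_msupp_eq0 // E.
- rewrite (h u) ?inE // big_seq1 big1 ?mulr1 // => i _; by rewrite mnm0E expr0.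
- by move: Hu; rewrite (h u) ?inE ?eqxx // (h v) ?inE ?eqxx ?orbT // eqxx.
Qed.

Lemma fform_span m : exists N (e : 'I_N -> 'rV[k]_d -> k),
  (forall i, fform m (e i)) /\
  forall F, fform m F -> exists c : 'I_N -> k, forall x, F x = \sum_i c i * e i x.
Proof.
elim: m => [|m [N [e [he hs]]]].
  exists 1%N, (fun _ => fun=> 1); split=> [_|F /fform_deg0 [c hc]]; first exact: fformC.
  by exists (fun=> c) => x; rewrite big_ord1 mulr1.
exists #|{: 'I_d * 'I_N}|,
  (fun i x => x 0 (enum_val i).1 * e (enum_val i).2 x); split.
  by move=> i; have := fformM (fformX (enum_val i).1) (he (enum_val i).2).
move=> F /fformS [G hG eG].
have /fchoice [c hc] : forall i, exists c : 'I_N -> k,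
  forall x, G i x = \sum_j c j * e j x by move=> i; apply: hs.
exists (fun i => c (enum_val i).1 (enum_val i).2) => x.
rewrite eG (eq_bigr (fun i => \sum_j c i j * (x 0 i * e j x))); last first.
  by move=> i _; rewrite hc mulr_sumr; apply: eq_bigr => j _; rewrite mulrCA.
rewrite pair_big /= (reindex (@enum_val _ (mem {: 'I_d * 'I_N}))) //=.
exact: onW_bij (enum_val_bij _).
Qed.

Lemma is_point_neq0 x : is_point x -> x <> 0.
Proof. by case=> i [h _] e; move: h; rewrite e mxE => /eqP; rewrite eq_sym oner_eq0. Qed.

Lemma rV_neq0 x : x <> 0 -> exists i, x 0 i != 0.
Proof.
move=> hx; apply/existsP; rewrite -[[exists _, _]]negbK negb_exists.
apply/negP=> /forallP h; apply: hx; apply/rowP=> i; rewrite mxE.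
by apply/eqP; rewrite -[_ == _]negbK.
Qed.

Lemma is_point_eq c x y : is_point x -> is_point y -> x = c *: y -> x = y.
Proof.
move=> [i [xi hi]] [j [yj hj]] e.
have ec l : x 0 l = c * y 0 l by rewrite e mxE.
have c0 : c != 0.
  by apply: contra_eq_neq xi => c0; rewrite ec c0 mul0r eq_sym oner_neq0.
suff ij : i = j by rewrite e; have := ec j; rewrite -{1}ij xi yj mulr1 => <-; rewrite scale1r.
apply/val_inj; case: (ltngtP i j) => //= h.
  by move: xi; rewrite ec (hj _ h) mulr0 => /eqP; rewrite eq_sym oner_eq0.
by move: (hi _ h); rewrite ec yj mulr1 => /eqP; rewrite (negPf c0).
Qed.

Lemma normalize x : x <> 0 -> exists2 c, c != 0 & is_point (c *: x).
Proof.
move=> /rV_neq0 [i0 hi0].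
have [i hi mi] := @arg_minnP _ i0 (fun i => x 0 i != 0) (@nat_of_ord d) hi0.
exists (x 0 i)^-1; first by rewrite invr_eq0.
exists i; rewrite mxE mulVf //; split=> // j lj; rewrite mxE.
have [->|/mi] := eqVneq (x 0 j) 0; first by rewrite mulr0.
by rewrite leqNgt lj.
Qed.

(** With coefficients [1, a, a ^ 2, ...] the value at each vector of [s] is a nonzero polynomial in
    [a]; any [a] outside the finitely many roots works. *)
Lemma exists_linear_form (s : seq 'rV[k]_d) : (forall x, x \in s -> x <> 0) ->
  exists2 L, fform 1 L & forall x, x \in s -> L x != 0.
Proof.
move=> hs.
pose P x : {poly k} := \poly_(i < d) (if insub i is Some j then x 0 j else 0).
have Pn0 x : x <> 0 -> P x != 0.
  move=> /rV_neq0 [i hi]; apply: contra_neq hi => P0.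
  by have := coef0 k i; rewrite -P0 coef_poly ltn_ord valK.
have: \prod_(x <- s) P x != 0.
  by rewrite prodf_seq_neq0; apply/allP => x /hs /Pn0.
move=> /closed_nonrootP [a]; rewrite rootE horner_prod prodf_seq_neq0 => /allP ha.
exists (fun x => \sum_(i < d) a ^+ i * x 0 i).
  by apply: fform_sum => i _; apply: fformZ (fformX i).
move=> x /ha /=; rewrite horner_poly; congr (_ != _).
by apply: eq_bigr => i _; rewrite valK mulrC.
Qed.

End Forms.

Lemma fform_comp (k : closedFieldType) (d e m n : nat) (F : 'rV[k]_e -> k)
    (G : 'rV[k]_d -> 'rV[k]_e) :
  fform m F -> (forall j, fform n (fun x => G x 0 j)) ->
  fform (m * n) (fun x => F (G x)).
Proof.
elim: m F => [|m IH] F.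
  by move=> /fform_deg0 [c hc] _; apply: fform_ext (fformC _ c) => x; rewrite hc.
move=> /fformS [H hH eH] hG.
apply: (@fform_ext _ _ _ (fun x => \sum_i G x 0 i * H i (G x))) => [x|]; first by rewrite eH.
by apply: fform_sum => i _; rewrite mulSn; apply: fformM => //; apply: IH.
Qed.

Lemma nat_min (P : nat -> Prop) : (exists n, P n) ->
  exists n, P n /\ forall m, P m -> (n <= m)%N.
Proof.
case=> n; elim/ltn_ind: n => n IH Pn.
have [[m [Pm lt]]|h] := classic (exists m, P m /\ (m < n)%N); first exact: (IH m).
exists n; split=> // m Pm; rewrite leqNgt; apply/negP=> lt; apply: h; by exists m.
Qed.

(** Each chosen index minimizes [v] over the tail from which it is taken. *)
Lemma nondecreasing_subsequence (v : nat -> nat) :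
  exists2 s : nat -> nat, {homo s : i j / (i < j)%N} &
    {homo v \o s : i j / (i <= j)%N}.
Proof.
have /fchoice [m hm] : forall N, exists i, (N <= i)%N /\
    forall j, (N <= j)%N -> (v i <= v j)%N.
  move=> N; have [x [[i [Ni ->]] hi]] :=
    @nat_min (fun x => exists i, (N <= i)%N /\ x = v i) (ex_intro _ _
      (ex_intro _ N (conj (leqnn N) erefl))).
  by exists i; split=> // j Nj; apply: hi; exists j.
pose s := fix s j := if j is j'.+1 then m (s j').+1 else m 0%N.
have sS j : (s j < s j.+1)%N by case: (hm (s j).+1).
have hs : {homo s : i j / (i < j)%N}.
  by apply: homo_ltn => //; exact: ltn_trans.
exists s => //; apply: homo_leq => //; first by move=> a b c; exact: leq_trans.
by case=> [|j] /=; [case: (hm 0%N) => _; apply | case: (hm (s j).+1) => _;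
  apply; apply: leq_trans (sS j) (ltnW (sS j.+1))].
Qed.

(** Passing to a nondecreasing subsequence for one exponent after the other makes all exponents
    monotone. *)
Lemma dickson n (u : nat -> 'X_{1..n}) :
  exists i j, (i < j)%N /\ (u i <= u j)%MM.
Proof.
suff [s hs hu] : exists2 s : nat -> nat, {homo s : i j / (i < j)%N} &
    forall l, l \in enum 'I_n -> {homo (fun i => u (s i) l) : i j / (i <= j)%N}.
  exists (s 0%N), (s 1%N); split; first exact: hs.
  by apply/mnm_lepP=> l; apply: (hu l) => //; rewrite mem_enum.
elim: (enum 'I_n) => [|l r [s hs hr]]; first by exists id.
have [t ht hv] := nondecreasing_subsequence (fun i => u (s i) l).
exists (s \o t) => [i j ij|l']; first exact/hs/ht.
rewrite inE => /orP [/eqP ->|lr]; first exact: hv.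
move=> i j ij /=; apply: (hr _ lr); rewrite leq_eqVlt in ij.
by case/orP: ij => [/eqP ->|/ht/ltnW].
Qed.

Section HilbertBasis.

Variables (k : fieldType) (d : nat).
Implicit Types (f : nat -> {mpoly k[d]}) (p q : {mpoly k[d]}).

Let ideal N f p := exists g : nat -> {mpoly k[d]}, p = \sum_(i < N) g i * f i.

Let idealD N f p q : ideal N f p -> ideal N f q -> ideal N f (p + q).
Proof.
move=> [g ->] [h ->]; exists (fun i => g i + h i).
by rewrite -big_split; apply: eq_bigr => i _; rewrite mulrDl.
Qed.

Let idealM N f p q : ideal N f p -> ideal N f (q * p).
Proof.
move=> [g ->]; exists (fun i => q * g i).
by rewrite mulr_sumr; apply: eq_bigr => i _; rewrite mulrA.
Qed.

Let ideal_gen N f i : (i < N)%N -> ideal N f (f i).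
Proof.
move=> iN; exists (fun j => (j == i)%:R); rewrite (bigD1 (Ordinal iN)) //= eqxx mul1r.
by rewrite big1 ?addr0 // => j /negPf; rewrite -val_eqE /= => ->; rewrite mul0r.
Qed.

Let idealW N M f p : (N <= M)%N -> ideal N f p -> ideal M f p.
Proof.
move=> NM [g ->]; elim/big_rec: _ => [|i q _ hq].
  by exists (fun=> 0); rewrite big1 // => i _; rewrite mul0r.
by apply: idealD => //; apply/idealM/ideal_gen/leq_trans/NM.
Qed.

(** A Groebner argument: were every [f N] new, one could keep choosing elements of minimal leading
    monomial outside the ideal of those already chosen. By [dickson] an earlier leading monomial
    divides a later one, and cancelling lowers the latter. The form for sequences is the one that
    stops infinite chains. *)
Lemma hilbert_basis f : exists N (g : nat -> {mpoly k[d]}),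
  f N = \sum_(i < N) g i * f i.
Proof.
apply: NNPP => nf; have {nf} hf N : ~ ideal N f (f N).
  by case=> g eg; apply: nf; exists N, g.
pose I p := exists N, ideal N f p.
have ID p q : I p -> I q -> I (p + q).
  move=> [N hN] [M hM]; exists (maxn N M).
  by apply: idealD; [apply: idealW (leq_maxl _ _) hN|apply: idealW (leq_maxr _ _) hM].
have IM p q : I p -> I (q * p) by case=> N hN; exists N; apply: idealM.
pose J (s : seq {mpoly k[d]}) p := ideal (size s) (nth 0 s) p.
have next s : exists h, (forall x, x \in s -> I x) -> [/\ I h, ~ J s h &
    forall h', I h' -> ~ J s h' -> ~~ (mlead h' < mlead h)%O].
  have [Is|nIs] := classic (forall x, x \in s -> I x); last by exists 0 => /nIs.
  have [h [Ih nh]] : exists h, I h /\ ~ J s h.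
    have [N hN] : exists N, forall x, x \in s -> ideal N f x.
      elim: s Is => [|x s IHs] Is; first by exists 0%N.
      have [|N hN] := IHs; first by move=> y ys; apply: Is; rewrite inE ys orbT.
      have [M hM] := Is x (mem_head _ _); exists (maxn N M) => y.
      rewrite inE => /orP [/eqP ->|/hN h]; first exact: idealW (leq_maxr _ _) hM.
      exact: idealW (leq_maxl _ _) h.
    exists (f N); split; first by exists N.+1; apply: ideal_gen.
    move=> [g eg]; apply: (hf N); rewrite eg; elim/big_rec: _ => [|i q _ hq].
      by exists (fun=> 0); rewrite big1 // => i _; rewrite mul0r.
    by apply: idealD => //; apply/idealM/hN/mem_nth.
  elim/(well_founded_ind (@ltom_wf d)): {h}(mlead h) {-2}h (erefl (mlead h)) Ih nh
    => u IHu h eu Ih nh.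
  have [[h' [Ih' nh' lt]]|no] := classic (exists h', [/\ I h', ~ J s h' &
    (mlead h' < mlead h)%O]); first by apply: (IHu _ _ h' erefl) => //; rewrite -eu.
  exists h => _; split=> // h' Ih' nh'; apply/negP=> lt; apply: no; by exists h'.
have {next} [next hnext] := fchoice next.
pose H := fix H j := if j is j'.+1 then rcons (H j') (next (H j')) else [::].
have IH j : forall x, x \in H j -> I x.
  elim: j => [|j IHj] //= x; rewrite mem_rcons inE => /orP [/eqP ->|/IHj //].
  by case: (hnext (H j) IHj).
have sH j : size (H j) = j by elim: j => //= j IHj; rewrite size_rcons IHj.
have nH j i : (i < j)%N -> nth 0 (H j) i = next (H i).
  elim: j => // j IHj; rewrite ltnS leq_eqVlt /= nth_rcons sH.
  by case/orP=> [/eqP ->|ij]; [rewrite ltnn eqxx | rewrite ij IHj].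
have [i [j [ij le]]] := dickson (fun j => mlead (next (H j))).
set p := next (H j) in le; set q := next (H i) in le.
have [Ip Jp minp] := hnext _ (IH j); have [Iq Jq _] := hnext _ (IH i).
have J0 s : J s 0 by exists (fun=> 0); rewrite big1 // => l _; rewrite mul0r.
have q0 : q != 0 by apply/eqP=> q0; apply: Jq; rewrite -/q q0.
have Jjq : J (H j) q by rewrite /q -(nH _ _ ij); apply: ideal_gen; rewrite sH.
pose r := (p@_(mlead p) / q@_(mlead q)) *: 'X_[mlead p - mlead q] * q.
have lq0 : q@_(mlead q) != 0 by rewrite mleadc_eq0.
have Jr : J (H j) r by apply: idealM.
pose h' := p - r.
have nh' : ~ J (H j) h'.
  by move=> /(idealD Jr); rewrite addrCA subrr addr0.
have Ih' : I h'.
  rewrite /h' -[X in X + _]mul1r -mulNr; apply: ID; apply: IM; first exact: Ip.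
  exact: Iq.
have h0 : h' != 0 by apply/eqP=> h0; apply: nh'; rewrite h0.
have /negP := minp h' Ih' nh'; apply.
have er : p@_(mlead p) = r@_(mlead p).
  have e : ('X_[(mlead p - mlead q)] * q)@_(mlead p) = q@_(mlead q).
    by rewrite mulrC -(mcoeffMX q (mlead p - mlead q) (mlead q)) submK.
  by rewrite /r -scalerAl mcoeffZ e divfK.
have lr : (mlead r <= mlead p)%O.
  rewrite /r -scalerAl; apply: le_trans (mleadZ_le _ _) _.
  by apply: le_trans (mleadM_le _ _) _; rewrite mleadXm submK.
have : (mlead h' <= mlead p)%O.
  by apply: le_trans (mleadB_le _ _) _; rewrite leUx lexx.
rewrite le_eqVlt => /orP [/eqP e|//].
by have := mleadc_eq0 h'; rewrite (negPf h0) e mcoeffB er subrr eqxx.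
Qed.

End HilbertBasis.

Section ClosedSets.

Variables (k : closedFieldType) (d : nat).
Implicit Types (Z X : 'rV[k]_d -> Prop).

(** Closedness over [k] without a family of equations; in this shape a purely local argument can
    prove that a set is closed. *)
Definition clo Z : Prop := (forall x, Z x -> is_point x) /\
  forall x, is_point x -> ~ Z x -> exists m F,
    [/\ fform m F, F x != 0 & forall z, Z z -> F z = 0].

Lemma cloP Z : closed_set predT Z <-> clo Z.
Proof.
split=> [[S [hS hZ]]|[Zp hZ]].
  split=> [x /hZ []//|x px nZ].
  have [f [Sf fx]] : exists f, S f /\ ev f x <> 0.
    apply: NNPP => h; apply: nZ; apply/hZ; split=> // f Sf.
    by apply: NNPP => fx; apply: h; exists f.
  have [m /fform_over hf] := hS f Sf; exists m, (ev f); split; first exact: fform_ev.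
    exact/eqP.
  by move=> z /hZ [_]; apply.
exists (fun f => (exists m, form_over predT m f) /\ forall z, Z z -> ev f z = 0).
split=> [f []//|x]; split=> [Zx|[px h]]; first by split; [apply: Zp | move=> f [_]; apply].
apply: NNPP => /(hZ _ px) [m [F [[f hf ef] /eqP Fx FZ]]].
apply: Fx; rewrite ef; apply: h; split; first by exists m; apply/fform_over.
by move=> z Zz; rewrite -ef FZ.
Qed.

Lemma clo_ext Z Z' : (forall x, Z x <-> Z' x) -> clo Z -> clo Z'.
Proof.
move=> e [hp h]; split=> [x /e /hp //|x px nx].
have [|m [F [hF Fx FZ]]] := h x px; first by move/e.
by exists m, F; split=> // z /e /FZ.
Qed.

Lemma clo_setT : clo (@is_point k d). Proof. by split. Qed.

Lemma clo_set0 : clo (fun _ : 'rV[k]_d => False).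
Proof. by split=> // x _ _; exists 0%N, (fun=> 1); split=> //; [exact: fformC | exact: oner_neq0]. Qed.

Lemma clo_zero m F Z : fform m F -> clo Z -> clo (fun x => Z x /\ F x = 0).
Proof.
move=> hF [hp h]; split=> [x [/hp]//|x px nx].
have [Zx|/(h _ px) [n [G [hG Gx GZ]]]] := classic (Z x).
  exists m, F; split=> // [|z []//]; by apply/eqP=> Fx; apply: nx.
by exists n, G; split=> // z [/GZ].
Qed.

Lemma clo_I Z Z' : clo Z -> clo Z' -> clo (fun x => Z x /\ Z' x).
Proof.
move=> [hp h] [hp' h']; split=> [x [/hp]//|x px nx].
have [Zx|/(h _ px) [n [G [hG Gx GZ]]]] := classic (Z x); last first.
  by exists n, G; split=> // z [/GZ].
have [|n [G [hG Gx GZ]]] := h' _ px; first by move=> Zx'; apply: nx.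
by exists n, G; split=> // z [_ /GZ].
Qed.

Lemma clo_U Z Z' : clo Z -> clo Z' -> clo (fun x => Z x \/ Z' x).
Proof.
move=> [hp h] [hp' h']; split=> [x [/hp|/hp']//|x px nx].
have [|m [F [hF Fx FZ]]] := h _ px; first by move=> Zx; apply: nx; left.
have [|n [G [hG Gx GZ]]] := h' _ px; first by move=> Zx; apply: nx; right.
exists (m + n)%N, (fun x => F x * G x); split; first exact: fformM.
  by rewrite mulf_neq0.
by move=> z [/FZ|/GZ] ->; rewrite ?mul0r ?mulr0.
Qed.

Lemma clo_point (x : 'rV[k]_d) : is_point x -> clo (eq x).
Proof.
move=> px; split=> [y <-//|y py nxy].
have [i [xi hi]] := px.
have [j hj] : exists j, y 0 j != y 0 i * x 0 j.
  apply/existsP; rewrite -[[exists _, _]]negbK negb_exists; apply/negP=> /forallP h.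
  apply: nxy; apply/esym/(@is_point_eq _ _ (y 0 i)) => //; apply/rowP=> j; rewrite mxE.
  by apply/eqP; rewrite -[_ == _]negbK.
exists 1%N, (fun z => z 0 j - z 0 i * x 0 j); split.
- apply: fformB; first exact: fformX.
  by apply: fform_ext (fformZ (x 0 j) (fformX _ i)) => z; rewrite mulrC.
- by rewrite subr_eq0.
- by move=> z <-; rewrite xi mul1r subrr.
Qed.

Definition irr X := irreducible_set X.

Lemma irr_cover X n (Z : nat -> 'rV[k]_d -> Prop) : irr X ->
  (forall i, (i < n)%N -> clo (Z i)) ->
  (forall x, X x -> exists2 i, (i < n)%N & Z i x) ->
  exists2 i, (i < n)%N & forall x, X x -> Z i x.
Proof.
move=> [[x0 Xx0] hX]; elim: n => [|n IH] hZ cov; first by have [] := cov _ Xx0.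
have cn : clo (fun x => exists2 i, (i < n)%N & Z i x).
  elim: n {IH cov} hZ => [|n IH] hZ.
    by apply: clo_ext clo_set0 => x; split=> // -[].
  have h1 := clo_U (IH (fun i ii => hZ i (ltnW ii))) (hZ n (ltnW (ltnSn _))).
  apply: clo_ext h1 => x; split=> [[[i ii Zx]|Zx]|[i]].
  - by exists i => //; apply: ltnW.
  - by exists n.
  - by rewrite ltnS leq_eqVlt => /orP [/eqP -> Zx|ii Zx]; [right|left; exists i].
have [] := hX (fun x => exists2 i, (i < n)%N & Z i x) (Z n).
- exact/cloP.
- exact/cloP/hZ.
- move=> x /cov [i]; rewrite ltnS leq_eqVlt => /orP [/eqP -> Zx|ii Zx]; first by right.
  by left; exists i.
- by move=> h; have [i ii Zi] := IH (fun i ii => hZ i (ltnW ii)) h; exists i => //; apply: ltnW.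
- by move=> h; exists n.
Qed.

Lemma irr_forms X m n F G : clo X -> irr X -> fform m F -> fform n G ->
  (exists2 x, X x & F x != 0) -> (exists2 x, X x & G x != 0) ->
  exists x, [/\ X x, F x != 0 & G x != 0].
Proof.
move=> cX [_ hX] hF hG [x Xx Fx] [y Xy Gy]; apply: NNPP => no.
have [|||h|h] := hX (fun x => is_point x /\ F x = 0) (fun x => is_point x /\ G x = 0).
- exact/cloP/(clo_zero hF)/clo_setT.
- exact/cloP/(clo_zero hG)/clo_setT.
- move=> z Xz; have pz := cX.1 _ Xz; have [Fz|Fz] := eqVneq (F z) 0; first by left.
  by right; split=> //; apply/eqP; apply: contra_notT no => Gz; exists z.
- by have [_ /eqP] := h _ Xx; rewrite (negPf Fx).
- by have [_ /eqP] := h _ Xy; rewrite (negPf Gy).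
Qed.

(** Noetherian induction. A failure yields a strictly descending chain; polynomials vanishing on
    each member but not on its predecessor contradict [hilbert_basis]. *)
Lemma clo_ind (Q : ('rV[k]_d -> Prop) -> Prop) :
  (forall Z, clo Z -> (forall Z', clo Z' -> (forall x, Z' x -> Z x) ->
     (exists x, Z x /\ ~ Z' x) -> Q Z') -> Q Z) ->
  forall Z, clo Z -> Q Z.
Proof.
move=> hQ Z0 cZ0; apply: NNPP => nQ0.
have step : forall Z, exists Z', clo Z -> ~ Q Z ->
    [/\ clo Z', forall x, Z' x -> Z x, exists x, Z x /\ ~ Z' x & ~ Q Z'].
  move=> Z; have [cZ|ncZ] := classic (clo Z); last by exists Z.
  have [QZ|nQ] := classic (Q Z); first by exists Z.
  apply: NNPP => no; apply: nQ; apply: hQ => // Z' cZ' sub ex; apply: NNPP => nQ'.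
  by apply: no; exists Z'.
have [nx hnx] := fchoice step.
pose C j := iter j nx Z0.
have hC j : clo (C j) /\ ~ Q (C j).
  by elim: j => [|j [cj nj]] //=; have [] := hnx (C j) cj nj.
have sub i j x : (i <= j)%N -> C j x -> C i x.
  move=> /subnK <-; elim: (j - i)%N => // l IH; rewrite addSn /= => h; apply: IH.
  by have [cj nj] := hC (l + i)%N; have [_ s _ _] := hnx _ cj nj; apply: s.
have /fchoice [f hf] : forall j, exists f : {mpoly k[d]},
    (exists2 x, C j x & ev f x <> 0) /\ forall x, C j.+1 x -> ev f x = 0.
  move=> j; have [cj nj] := hC j; have [c' _ [x [Cx nx']] _] := hnx _ cj nj.
  have [m [F [[f _ ef] Fx FZ]]] := c'.2 x (cj.1 _ Cx) nx'.
  exists f; split; last by move=> y /FZ; rewrite ef.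
  by exists x => //; rewrite -ef; apply/eqP.
have [N [g eg]] := hilbert_basis f; have [[x Cx] fx _] := hf N; apply: fx.
rewrite eg /ev raddf_sum big1 //= => i _; rewrite mevalM.
have [_ h] := hf i; rewrite [X in _ * X]h ?mulr0 //; exact: sub (ltn_ord i) Cx.
Qed.

Lemma clo_components Z : clo Z -> exists n (Y : nat -> 'rV[k]_d -> Prop),
  (forall i, (i < n)%N -> clo (Y i) /\ irr (Y i)) /\
  forall x, Z x <-> exists2 i, (i < n)%N & Y i x.
Proof.
apply: (@clo_ind (fun Z => _)) => {}Z cZ IH.
have [[x0 Zx0]|em] := classic (exists x, Z x); last first.
  by exists 0%N, (fun=> Z); split=> // x; split=> [Zx|[]//]; case: em; exists x.
have [iZ|niZ] := classic (irr Z).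
  by exists 1%N, (fun=> Z); split=> // y; split=> [Zy|[]//]; exists 0%N.
have [Z1 [Z2 [c1 c2 cov [n1 n2]]]] : exists Z1 Z2, [/\ clo Z1, clo Z2,
    forall x, Z x -> Z1 x \/ Z2 x &
    (exists x, Z x /\ ~ Z1 x) /\ (exists x, Z x /\ ~ Z2 x)].
  apply: NNPP => no; apply: niZ; split; first by exists x0.
  move=> Z1 Z2 /cloP c1 /cloP c2 cov; apply: NNPP => h; apply: no; exists Z1, Z2.
  split=> //; split; apply: NNPP => nn; apply: h; [left|right] => y Zy;
    by apply: NNPP => ny; apply: nn; exists y.
have sub1 x : Z x /\ Z1 x -> Z x by case.
have sub2 x : Z x /\ Z2 x -> Z x by case.
have [|n [Y [hY eY]]] := IH _ (clo_I cZ c1) sub1.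
  by case: n1 => y [Zy ny]; exists y; split=> // -[].
have [|n' [Y' [hY' eY']]] := IH _ (clo_I cZ c2) sub2.
  by case: n2 => y [Zy ny]; exists y; split=> // -[].
exists (n + n')%N, (fun i => if (i < n)%N then Y i else Y' (i - n)%N); split.
  move=> i ii; case: ltnP => [/hY//|ni]; apply: hY'; by rewrite ltn_subLR.
move=> y; split=> [Zy|[i ii]].
  case: (cov y Zy) => [Z1y|Z2y].
    have [i ii Yi] := (eY y).1 (conj Zy Z1y); exists i; last by rewrite ii.
    exact: ltn_addr.
  have [i ii Yi] := (eY' y).1 (conj Zy Z2y); exists (n + i)%N; first by rewrite ltn_add2l.
  by rewrite ltnNge leq_addr /= addKn.
case: ltnP => [lt Yi|ge Yi]; first by case: ((eY y).2 (ex_intro2 _ _ i lt Yi)).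
have lt' : (i - n < n')%N by rewrite ltn_subLR.
by case: ((eY' y).2 (ex_intro2 _ _ (i - n)%N lt' Yi)).
Qed.

(** Finitely many equations are needed to express membership by a first-order formula in
    [definable_graph]. *)
Lemma clo_finite_equations Z : clo Z -> exists n (m : nat -> nat) F,
  (forall i, (i < n)%N -> fform (m i) (F i)) /\
  forall x : 'rV[k]_d, is_point x -> (Z x <-> forall i, (i < n)%N -> F i x = 0).
Proof.
move=> cZ; pose fin W := exists n (m : nat -> nat) F,
  (forall i, (i < n)%N -> fform (m i) (F i)) /\
  forall x : 'rV[k]_d, is_point x -> (W x <-> forall i, (i < n)%N -> F i x = 0).
suff: forall W, clo W -> fin W -> (forall x, Z x -> W x) -> fin Z.
  apply; first exact: clo_setT; last exact: cZ.1.
  by exists 0%N, (fun=> 0%N), (fun _ => fun=> 0); split.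
apply: (@clo_ind (fun W => fin W -> (forall x, Z x -> W x) -> fin Z)) => W cW IH fW sub.
have [e|/not_all_ex_not [x nx]] := classic (forall x, W x -> Z x).
  move: fW => [n [m [F [hF eF]]]]; exists n, m, F; split=> // x px.
  by rewrite -(eF x px); split; [apply: sub | apply: e].
have [Wx nZ] := imply_to_and _ _ nx.
have [m [F [hF Fx FZ]]] := cZ.2 x (cW.1 _ Wx) nZ.
apply: (IH _ (clo_zero hF cW)).
- by move=> y [].
- by exists x; split=> // -[_ /eqP]; rewrite (negPf Fx).
- move: fW => [n [m' [G [hG eG]]]].
  exists n.+1, (fun i => if (i < n)%N then m' i else m),
    (fun i => if (i < n)%N then G i else F); split=> [i _|y py].
    by case: ltnP => // /hG.
  split=> [[Wy Fy] i _|h]; first by case: ltnP => // ii; apply: (eG y py).1.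
  split; last by have := h n (ltnSn n); rewrite ltnn.
  by apply/(eG y py) => i ii; have := h i (ltnW ii); rewrite ii.
- by move=> y Zy; split; [apply: sub | apply: FZ].
Qed.

End ClosedSets.

(** * The graded Nullstellensatz *)

Section Nullstellensatz.

Variables (k : closedFieldType) (d : nat).
Implicit Types (F G : 'rV[k]_d -> k) (J : nat -> ('rV[k]_d -> k) -> Prop).

(** A homogeneous ideal, given by its graded pieces. *)
Definition hideal J : Prop :=
  [/\ forall m F, J m F -> fform m F, forall m, J m (fun=> 0),
      forall m F G, J m F -> J m G -> J m (fun x => F x + G x) &
      forall m n F G, fform m F -> J n G -> J (m + n)%N (fun x => F x * G x)].

Lemma ideal_ext J m n F G : m = n -> F =1 G -> J m F -> J n G.
Proof. by move=> <- /functional_extensionality ->. Qed.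

Lemma hidealZ J m c F : hideal J -> J m F -> J m (fun x => c * F x).
Proof. by case=> _ _ _ hM JF; have := hM _ _ _ _ (fformC _ c) JF. Qed.

Lemma hidealB J m F G : hideal J -> J m F -> J m G -> J m (fun x => F x - G x).
Proof.
move=> hJ JF JG; have [_ _ hD _] := hJ.
apply: ideal_ext (hD _ _ _ JF (hidealZ (-1) hJ JG)) => // x; by rewrite mulN1r.
Qed.

Lemma hideal_sum J m (I : Type) (r : seq I) (F : I -> 'rV[k]_d -> k) : hideal J ->
  (forall i, J m (F i)) -> J m (fun x => \sum_(i <- r) F i x).
Proof.
move=> [_ h0 hD _] h; elim: r => [|i r IH].
  by apply: ideal_ext (h0 m) => // x; rewrite big_nil.
by apply: ideal_ext (hD _ _ _ (h i) IH) => // x; rewrite big_cons.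
Qed.

Definition full J N := forall F, fform N F -> J N F.

Lemma full_le J N M : hideal J -> (N <= M)%N -> full J N -> full J M.
Proof.
move=> hJ /subnK <-; elim: (M - N)%N => // n IH /IH hn F /fformS [G hG eG].
have [_ _ _ hM] := hJ.
have h i : J (n + N).+1 (fun x => x 0 i * G i x).
  exact: (hM 1%N _ _ _ (fformX _ i) (hn _ (hG i))).
by apply: ideal_ext (hideal_sum (index_enum 'I_d) hJ h) => // x; rewrite eG.
Qed.

(** The graded pieces of the ideal generated by [J] and [F]; the first alternative covers the
    degrees below [m]. *)
Definition add_form J m F n G := J n G \/ exists e A H,
  [/\ n = (e + m)%N, J n A, fform e H & forall x, G x = A x + H x * F x].

Lemma hideal_add J m F : hideal J -> fform m F -> hideal (add_form J m F).
Proof.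
move=> hJ hF; have [hf h0 hD hM] := hJ; split.
- move=> n G [/hf //|[e [A [H [-> /hf hA hH eG]]]]].
  apply: (@fform_ext _ _ _ (fun x => A x + H x * F x)) => [x|]; first by rewrite eG.
  by apply: fformD => //; apply: fformM.
- by move=> n; left.
- move=> n G G' [JG|[e [A [H [en JA hH eG]]]]] [JG'|[e' [A' [H' [en' JA' hH' eG']]]]].
  + by left; apply: hD.
  + right; exists e', (fun x => G x + A' x), H'; split=> //; first exact: hD.
    by move=> x; rewrite eG' addrA.
  + right; exists e, (fun x => A x + G' x), H; split=> //; first exact: hD.
    by move=> x; rewrite eG addrAC.
  + have ee : e' = e by apply/eqP; rewrite -(eqn_add2r m) -en -en'.
    right; exists e, (fun x => A x + A' x), (fun x => H x + H' x); split=> //.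
    * exact: hD.
    * by apply: fformD => //; rewrite -ee.
    * by move=> x; rewrite eG eG' mulrDl addrACA.
- move=> n n' G G' hG [JG|[e [A [H [-> JA hH eG]]]]]; first by left; apply: hM.
  right; exists (n + e)%N, (fun x => G x * A x), (fun x => G x * H x); split.
  + by rewrite addnA.
  + exact: hM.
  + exact: fformM.
  + by move=> x; rewrite eG mulrDr mulrA.
Qed.

(** Serves to extract from a possibly inhomogeneous relation of [hilbert_basis] its part of the
    right degree. *)
Lemma pihomogM (m n : nat) (g f : {mpoly k[d]}) : f \is m.-homog ->
  pihomog mdeg n (g * f) =
  if (m <= n)%N then pihomog mdeg (n - m) g * f else 0.
Proof.
move=> hf; rewrite [in LHS](pihomog_partitionE (leqnn (msize g))) mulr_suml raddf_sum /=.
rewrite (eq_bigr (fun i : 'I_(msize g) =>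
  if (i + m == n)%N then pihomog mdeg i g * f else 0)); last first.
  move=> i _; have hi : pihomog mdeg i g * f \is (i + m).-homog.
    by apply: dhomogM hf; apply: pihomogP.
  case: eqP => [<-|/eqP ne]; first exact: pihomog_dE.
  by apply: (pihomog_ne0 _ hi).
case: leqP => [mn|nm]; last first.
  rewrite big1 // => i _; case: eqP => // e; by move: nm; rewrite -e ltnNge leq_addl.
have [lt|ge] := ltnP (n - m) (msize g).
  rewrite (bigD1 (Ordinal lt)) //= subnK // eqxx big1 ?addr0 // => i ni.
  case: eqP => // e; case/eqP: ni; apply/val_inj; by rewrite /= -e addnK.
rewrite big1 => [|i _]; last first.
  case: eqP => // e; have := ltn_ord i; by rewrite ltnNge (leq_trans ge) // -e addnK.
suff -> : pihomog mdeg (n - m) g = 0 by rewrite mul0r.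
rewrite pihomogE big_seq_cond big1 // => u /andP[/msize_mdeg_lt lt /eqP e].
by move: lt; rewrite e ltnNge ge.
Qed.

Definition bad J := hideal J /\ forall N, ~ full J N.

(** The ascending chain condition replaces Zorn's lemma: endless enlargement would produce a
    sequence of forms none of which lies in the ideal of its predecessors. *)
Lemma maximal_bad J0 : bad J0 -> exists J, [/\ bad J,
  forall m F, J0 m F -> J m F &
  forall m F, fform m F -> ~ J m F -> exists N, full (add_form J m F) N].
Proof.
move=> bJ0; apply: NNPP => no.
have /fchoice [nx hnx] : forall J, exists y : nat * ('rV[k]_d -> k),
    bad J -> (forall m F, J0 m F -> J m F) ->
    [/\ fform y.1 y.2, ~ J y.1 y.2 & bad (add_form J y.1 y.2)].
  move=> J; have [[bJ sJ]|nb] := classic (bad J /\ forall m F, J0 m F -> J m F);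
    last by exists (0%N, fun=> 0) => b1 b2; case: nb.
  apply: NNPP => h; apply: no; exists J; split=> // m F hF nJ; apply: NNPP => nf.
  apply: h; exists (m, F) => _ _; split=> //; split; first by apply: hideal_add => //; case: bJ.
  by move=> N fN; apply: nf; exists N.
pose C j := iter j (fun J => add_form J (nx J).1 (nx J).2) J0.
have sub i j m F : (i <= j)%N -> C i m F -> C j m F.
  by move=> /subnK <-; elim: (j - i)%N => // l IH h; rewrite addSn /=; left; apply: IH.
have hC j : bad (C j).
  elim: j => [|j bj] //=; have [] // := hnx _ bj.
  by move=> m F; apply: sub (leq0n j).
have hn j : [/\ fform (nx (C j)).1 (nx (C j)).2, ~ C j (nx (C j)).1 (nx (C j)).2 &
    C j.+1 (nx (C j)).1 (nx (C j)).2].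
  have [h1 h2 _] := hnx _ (hC j) (fun m F => @sub 0%N j m F (leq0n j)).
  split=> //; right; exists 0%N, (fun=> 0), (fun=> 1).
  have [[_ h0 _ _] _] := hC j; split; [by [] | exact: h0 | exact: fformC |].
  by move=> x; rewrite add0r mul1r.
have /fchoice [f hf] : forall j, exists f : {mpoly k[d]},
    f \is (nx (C j)).1.-homog /\ forall x, (nx (C j)).2 x = ev f x.
  by move=> j; have [[f hf ef] _ _] := hn j; exists f.
have [N [g eg]] := hilbert_basis f.
have [_ nN _] := hn N; apply: nN.
pose n := (nx (C N)).1.
have e : f N = \sum_(i < N)
    (if ((nx (C i)).1 <= n)%N then pihomog mdeg (n - (nx (C i)).1) (g i) * f i else 0).
  rewrite -(pihomog_dE (hf N).1) eg raddf_sum; apply: eq_bigr => i _ /=.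
  exact: pihomogM (hf i).1.
have [hCN _] := hC N; have [_ h0 _ hM] := hCN.
suff h (i : 'I_N) : C N n (ev (if ((nx (C i)).1 <= n)%N
    then pihomog mdeg (n - (nx (C i)).1) (g i) * f i else 0)).
  apply: ideal_ext (hideal_sum (index_enum 'I_N) hCN h) => // x.
  by rewrite (hf N).2 e /ev [RHS](raddf_sum (meval (fun i => x 0 i))).
case: leqP => [le|_]; last by apply: ideal_ext (h0 n) => // x; rewrite /ev meval0.
apply: (@ideal_ext (C N) ((n - (nx (C i)).1) + (nx (C i)).1)%N n
  (fun x => ev (pihomog mdeg (n - (nx (C i)).1) (g i)) x * (nx (C i)).2 x)).
- by rewrite subnK.
- by move=> x; rewrite (hf i).2 /ev mevalM.
apply: hM; first by apply: fform_ev; apply: pihomogP.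
by have [_ _ h] := hn i; apply: sub h; apply: ltn_ord.
Qed.

(** If neither factor is in [J], adjoining either one gives all forms of some degree. Writing a form
    through [F], and its cofactor through [G], leaves a multiple of [F * G]. *)
Lemma maximal_bad_prime J m n F G : bad J ->
  (forall m F, fform m F -> ~ J m F -> exists N, full (add_form J m F) N) ->
  fform m F -> fform n G -> J (m + n)%N (fun x => F x * G x) -> J m F \/ J n G.
Proof.
move=> [hJ bJ] mx hF hG JFG; apply: NNPP => /not_or_and [nF nG].
have [N fN] := mx _ _ hF nF; have [M fM] := mx _ _ hG nG.
have [hf _ hD hM] := hJ.
have fN' := full_le (hideal_add hJ hF) (leq_addr (M + m) N) fN.
apply: (bJ (N + (M + m))%N) => U hU.
have [//|[e [A [H [eN JA hH eU]]]]] := fN' U hU.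
have fM' : full (add_form J n G) e.
  apply: full_le fM; first exact: hideal_add.
  by rewrite -(leq_add2r m) -eN leq_addl.
have hFH B : J e B -> J (N + (M + m))%N (fun x => F x * B x).
  by move=> JB; apply: ideal_ext (hM _ _ _ _ hF JB) => //; rewrite addnC -eN.
have [JH|[e' [B [H' [eN' JB hH' eH]]]]] := fM' H hH.
  by apply: ideal_ext (hD _ _ _ JA (hFH _ JH)) => // x; rewrite eU mulrC.
have JH' : J (N + (M + m))%N (fun x => H' x * (F x * G x)).
  by apply: ideal_ext (hM _ _ _ _ hH' JFG) => //; rewrite addnCA addnC -eN' -eN.
apply: ideal_ext (hD _ _ _ (hD _ _ _ JA (hFH _ JB)) JH') => // x.
rewrite eU eH mulrDl -addrA [F x * B x]mulrC; congr (_ + (_ + _)).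
by rewrite -mulrA [G x * _]mulrC.
Qed.

(* If [J] is maximal among the ideals containing no full degree, it is prime and, for a
   coordinate [x_j] outside [J], the graded pieces of the quotient are spanned by the
   multiples of a fixed finite family by powers of [x_j]; hence binary forms in
   [x_i], [x_j] of large degree are dependent modulo [J] and some [x_i - c x_j] is
   in [J]. *)
Lemma linear_relation J i j : bad J ->
  (forall m F, fform m F -> ~ J m F -> exists N, full (add_form J m F) N) ->
  ~ J 1%N (fun x => x 0 j) -> exists c, J 1%N (fun x => x 0 i - c * x 0 j).
Proof.
move=> bJ mx nj; have [hJ bJ'] := bJ; have [hf h0 hD hM] := hJ.
have [N' fN0] := mx _ _ (fformX _ j) nj.
pose N := N'.+1; have fN := full_le (hideal_add hJ (fformX _ j)) (leqnSn N') fN0.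
have [D [e [he spn]]] := fform_span k d N.
have red h U : fform (h + N) U -> exists2 c : 'I_D -> k, True &
    J (h + N)%N (fun x => U x - x 0 j ^+ h * \sum_l c l * e l x).
  elim: h U => [|h IH] U hU.
    have [c hc] := spn U hU; exists c => //.
    by apply: ideal_ext (h0 _) => // x; rewrite expr0 mul1r -hc subrr.
  have fN' := full_le (hideal_add hJ (fformX _ j)) (leq_addl h.+1 N) fN.
  have [JU|[e' [A [H [eN JA hH eU]]]]] := fN' U hU.
    by exists (fun=> 0) => //; apply: ideal_ext JU => // x; rewrite big1 ?mulr0 ?subr0 // => l _;
       rewrite mul0r.
  have ee : e' = (h + N)%N by move: eN; rewrite addn1 addSn => -[].
  rewrite ee in hH; have [c _ hc] := IH _ hH; exists c => //.
  have hc' : J (h.+1 + N)%N (fun x => x 0 j * (H x - x 0 j ^+ h * \sum_l c l * e l x)).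
    exact: ideal_ext (hM _ _ _ _ (fformX _ j) hc).
  apply: ideal_ext (hD _ _ _ JA hc') => // x.
  by rewrite eU mulrBr addrA [H x * _]mulrC exprS mulrA.
pose w (r : 'I_D.+1) (x : 'rV[k]_d) := x 0 i ^+ r * x 0 j ^+ (D + N - r).
have hw r : fform (D + N) (w r).
  have := fformM (fformXn r (fformX k i)) (fformXn (D + N - r) (fformX k j)).
  by rewrite !muln1 subnKC // (leq_trans _ (leq_addr _ _)) // -ltnS.
have /fchoice [c hc] : forall r, exists c : 'I_D -> k,
    J (D + N)%N (fun x => w r x - x 0 j ^+ D * \sum_l c l * e l x).
  by move=> r; have [c _] := red D _ (hw r); exists c.
pose C := \matrix_(r < D.+1, l < D) c r l.
have [a a0 aC] : exists2 a : 'rV[k]_D.+1, a != 0 & a *m C = 0.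
  have rk : kermx C != 0.
    rewrite -mxrank_eq0 mxrank_ker subn_eq0 -ltnNge ltnS; exact: rank_leq_col.
  by case/rowV0Pn: rk => v vk v0; exists v => //; apply/sub_kermxP.
pose p := \poly_(r < D.+1) a 0 (inord r).
have p0 : p != 0.
  apply: contra_neq a0 => p0; apply/rowP=> r; rewrite mxE.
  by have := coef_poly D.+1 (fun r => a 0 (inord r)) r; rewrite -/p p0 coef0 ltn_ord inord_val.
have JS : J (D + N)%N (fun x => \sum_r a 0 r * w r x).
  have := @hideal_sum J _ _ (index_enum 'I_D.+1) _ hJ (fun r => hidealZ (a 0 r) hJ (hc r)).
  apply: ideal_ext => // x.
  have -> : \sum_r a 0 r * (w r x - x 0 j ^+ D * \sum_l c r l * e l x) =
      \sum_r (a 0 r * w r x - x 0 j ^+ D * \sum_l a 0 r * (c r l * e l x)).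
    by apply: eq_bigr => r _; rewrite mulrBr -mulr_sumr; congr (_ - _); rewrite mulrCA.
  rewrite sumrB -mulr_sumr exchange_big /= [X in _ - _ * X]big1 ?mulr0 ?subr0 //.
  move=> l _; have /rowP/(_ l) := aC; rewrite !mxE => ac.
  transitivity ((\sum_j a 0 j * C j l) * e l x); last by rewrite ac mul0r.
  by rewrite mulr_suml; apply: eq_bigr => r _; rewrite mxE mulrA.
have [s es] := closed_field_poly_normal p.
have lc0 : lead_coef p != 0 by rewrite lead_coef_eq0.
have ss : (size s <= D)%N.
  have := size_poly D.+1 (fun r => a 0 (inord r)).
  by rewrite -/p es size_scale // size_prod_XsubC ltnS.
(* The relation splits into homogeneous linear factors; its degree [size s] may be below [D], whence
   the remaining power of [x 0 j]. *)
have fact x : \sum_r a 0 r * w r x =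
    x 0 j ^+ (D + N - size s) * (lead_coef p * \prod_(z <- s) (x 0 i - z * x 0 j)).
  have [xj|xj] := eqVneq (x 0 j) 0.
    have x0n n : (n < D + N)%N -> x 0 j ^+ (D + N - n) = 0.
      by move=> lt; rewrite xj expr0n subn_eq0 leqNgt lt.
    rewrite x0n ?mul0r; last by rewrite (leq_ltn_trans ss) // -[X in (X < _)%N]addn0 ltn_add2l.
    rewrite big1 // => r _; rewrite /w x0n ?mulr0 // (leq_trans (ltn_ord r)) //.
    by rewrite -addn1 leq_add2l.
  have ep : p.[x 0 i / x 0 j] = lead_coef p * \prod_(z <- s) (x 0 i / x 0 j - z).
    rewrite {1}es hornerZ horner_prod; congr (_ * _); apply: eq_bigr => z _.
    by rewrite !hornerE.
  have -> : \prod_(z <- s) (x 0 i - z * x 0 j) =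
      x 0 j ^+ size s * \prod_(z <- s) (x 0 i / x 0 j - z).
    elim: (s) => [|z t IHt]; first by rewrite !big_nil expr0 mulr1.
    by rewrite !big_cons IHt exprS mulrACA mulrBr [x 0 j * (_ / _)]mulrC divfK // [x 0 j * z]mulrC.
  rewrite [lead_coef p * (_ * _)]mulrCA -ep mulrA -exprD subnK; last first.
    by rewrite (leq_trans ss) ?leq_addr.
  rewrite horner_poly mulr_sumr; apply: eq_bigr => r _; rewrite inord_val [RHS]mulrCA; congr (_ * _).
  rewrite /w expr_div_n [RHS]mulrCA; congr (_ * _).
  by apply: expfB_cond; rewrite (negPf xj) add0n (leq_trans _ (leq_addr _ _)) // -ltnS.
have prime := @maximal_bad_prime J _ _ _ _ bJ mx.
have n1 c0 : c0 != 0 -> ~ J 0%N (fun=> c0).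
  move=> c00 J1; apply: (bJ' 1%N) => F hF.
  by apply: ideal_ext (hM _ _ _ _ hF (hidealZ c0^-1 hJ J1)) => // y; rewrite mulVf // mulr1.
have npow n : ~ J n (fun x => x 0 j ^+ n).
  elim: n => [|n IHn Jn]; first by apply: n1; rewrite oner_neq0.
  have hn : fform n (fun x : 'rV[k]_d => x 0 j ^+ n).
    by apply: fform_deg (fformXn n (fformX k j)); rewrite muln1.
  have Jn' : J (1 + n)%N (fun x => x 0 j * x 0 j ^+ n).
    by apply: ideal_ext Jn => // x; rewrite exprS.
  by case: (prime _ _ _ _ (fformX _ j) hn Jn').
apply: NNPP => no.
have hl z : fform 1 (fun x : 'rV[k]_d => x 0 i - z * x 0 j).
  by apply: fformB; [|apply: fformZ]; apply: fformX.
have hprod (t : seq k) : fform (size t) (fun x : 'rV[k]_d => \prod_(z <- t) (x 0 i - z * x 0 j)).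
  by have := fform_prod t hl; rewrite big_const_seq iter_addn_0 count_predT mul1n.
have nprod (t : seq k) : ~ J (size t) (fun x => \prod_(z <- t) (x 0 i - z * x 0 j)).
  elim: t => [|z t IHt] /= Jt.
    by apply: (n1 1); rewrite ?oner_neq0 //; apply: ideal_ext Jt => // x; rewrite big_nil.
  have Jt' : J (1 + size t)%N (fun x => (x 0 i - z * x 0 j) *
      \prod_(z <- t) (x 0 i - z * x 0 j)).
    by apply: ideal_ext Jt => // x; rewrite big_cons.
  by case: (prime _ _ _ _ (hl z) (hprod t) Jt') => // Jz; apply: no; exists z.
have [|||/npow//|] := prime (D + N - size s)%N (size s) (fun x => x 0 j ^+ (D + N - size s))
  (fun x => lead_coef p * \prod_(z <- s) (x 0 i - z * x 0 j)).
- by apply: fform_deg (fformXn (D + N - size s) (fformX k j)); rewrite muln1.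
- by apply: fformZ; apply: hprod.
- rewrite subnK; last by rewrite (leq_trans ss) ?leq_addr.
  exact: ideal_ext JS.
- move=> /(hidealZ (lead_coef p)^-1 hJ) Jp; apply: (nprod s).
  by apply: ideal_ext Jp => // x; rewrite mulKf.
Qed.

Theorem projective_nullstellensatz J0 : hideal J0 ->
  (forall x, is_point x -> exists m F, J0 m F /\ F x != 0) -> exists N, full J0 N.
Proof.
move=> hJ0 nz; apply: NNPP => nf.
have [|J [bJ sJ mx]] := @maximal_bad J0; first by split=> // N fN; apply: nf; exists N.
have [hJ bJ'] := bJ; have [hf h0 hD hM] := hJ.
have [j nj] : exists j, ~ J 1%N (fun x => x 0 j).
  apply: not_all_ex_not => all1; apply: (bJ' 1%N) => F /fformS [G hG eG].
  have h i : J 1%N (fun x => G i x * x 0 i) := hM 0%N _ _ _ (hG i) (all1 i).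
  apply: ideal_ext (hideal_sum (index_enum 'I_d) hJ h) => // x.
  by rewrite eG; apply: eq_bigr => i _; rewrite mulrC.
have /fchoice [c hc] : forall i, exists c, J 1%N (fun x => x 0 i - c * x 0 j).
  by move=> i; apply: linear_relation.
have npow n : ~ J n (fun x => x 0 j ^+ n).
  elim: n => [J1|n IHn Jn].
    by apply: (bJ' 1%N) => F hF; apply: ideal_ext (hM _ _ _ _ hF J1) => // y; rewrite expr0 mulr1.
  have hn : fform n (fun x : 'rV[k]_d => x 0 j ^+ n).
    by apply: fform_deg (fformXn n (fformX k j)); rewrite muln1.
  have Jn' : J (1 + n)%N (fun x => x 0 j * x 0 j ^+ n).
    by apply: ideal_ext Jn => // x; rewrite exprS.
  by case: (maximal_bad_prime bJ mx (fformX _ j) hn Jn').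
(* Modulo [J] each coordinate is a constant multiple of [x 0 j], so every form is congruent to its
   value at [v] times a power of [x 0 j]. As no power of [x 0 j] is in [J], [v] is a common zero of
   [J]. *)
pose v : 'rV[k]_d := \row_i c i.
have cong m F : fform m F -> J m (fun x => F x - F v * x 0 j ^+ m).
  elim: m F => [|m IH] F.
    move=> /fform_deg0 [b hb]; apply: ideal_ext (h0 0%N) => // x.
    by rewrite !hb expr0 mulr1 subrr.
  move=> /fformS [G hG eG].
  have t1 i : J m.+1 (fun x => x 0 i * (G i x - G i v * x 0 j ^+ m)).
    by apply: ideal_ext (hM _ _ _ _ (fformX _ i) (IH _ (hG i))).
  have t2 i : J m.+1 (fun x => (G i v * x 0 j ^+ m) * (x 0 i - c i * x 0 j)).
    have hG' : fform m (fun x => G i v * x 0 j ^+ m).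
      by apply: fformZ; apply: fform_deg (fformXn m (fformX k j)); rewrite muln1.
    by apply: ideal_ext (hM _ _ _ _ hG' (hc i)) => //; rewrite addn1.
  have := @hideal_sum J _ _ (index_enum 'I_d) _ hJ (fun i => hD _ _ _ (t1 i) (t2 i)).
  apply: ideal_ext => // x; rewrite !eG mulr_suml -sumrB; apply: eq_bigr => i _.
  by rewrite [v 0 i]mxE exprS; ring.
have Jv m F : J m F -> F v = 0.
  move=> JF; apply: NNPP => /eqP Fv; apply: (npow m).
  have := hidealB hJ JF (cong m F (hf _ _ JF)) => /(hidealZ (F v)^-1 hJ).
  by apply: ideal_ext => // x; rewrite opprB addrC subrK mulKf.
have v0 : v <> 0.
  move=> v0; apply: nj; apply: ideal_ext (cong 1%N _ (fformX _ j)) => // x.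
  by rewrite /= v0 mxE mul0r subr0.
have [b b0 pv] := normalize v0.
have [m [F [JF]]] := nz _ pv.
have [hf0 _ _ _] := hJ0; by rewrite (fform_scale _ _ (hf0 _ _ JF)) (Jv _ _ (sJ _ _ JF)) mulr0 eqxx.
Qed.

End Nullstellensatz.

(** * Local sections, global sections and global functions *)

Section Local.

Variables (k : closedFieldType) (d : nat) (X : 'rV[k]_d -> Prop).
Implicit Types (x y : 'rV[k]_d) (s t f g : 'rV[k]_d -> k) (P Q : 'rV[k]_d -> Prop).

Definition near x P : Prop := exists m C,
  [/\ fform m C, C x != 0 & forall y, X y -> C y != 0 -> P y].

(* Sections of O(n) are evaluated at normalized points. *)
Definition sec_at (n : nat) s x : Prop := exists m F G,
  [/\ fform (m + n) F, fform m G, G x != 0 &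
      forall y, X y -> G y != 0 -> s y = F y / G y].

Definition reg_at f x := sec_at 0 f x.

Lemma near_here x P : X x -> near x P -> P x.
Proof. by move=> Xx [m [C [_ Cx h]]]; apply: h. Qed.

Lemma near_mono x P Q : (forall y, X y -> P y -> Q y) -> near x P -> near x Q.
Proof.
move=> h [m [C [hC Cx hP]]]; exists m, C; split=> // y Xy Cy; apply: h => //; exact: hP.
Qed.

Lemma near_all x P : (forall y, X y -> P y) -> near x P.
Proof.
by move=> h; exists 0%N, (fun=> 1); split=> [|//|y Xy _]; [exact: fformC|exact: oner_neq0|exact: h].
Qed.

Lemma near_and x P Q : near x P -> near x Q -> near x (fun y => P y /\ Q y).
Proof.
move=> [m [C [hC Cx hP]]] [n [D [hD Dx hQ]]].
exists (m + n)%N, (fun y => C y * D y); split; first exact: fformM.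
  by rewrite mulf_neq0.
by move=> y Xy; rewrite mulf_eq0 => /norP [Cy Dy]; split; [apply: hP|apply: hQ].
Qed.

Lemma near_fin (I : finType) x (P : I -> 'rV[k]_d -> Prop) :
  (forall i, near x (P i)) -> near x (fun y => forall i, P i y).
Proof.
move=> h; suff : near x (fun y => forall i, i \in enum I -> P i y).
  by apply: near_mono => y _ hy i; apply: hy; rewrite mem_enum.
elim: (enum I) => [|i r IH]; first by apply: near_all.
apply: near_mono (near_and (h i) IH) => y _ [Pi Pr] j.
by rewrite inE => /orP [/eqP ->|/Pr].
Qed.

Lemma near_near x P : near x P -> near x (fun y => near y P).
Proof.
move=> [m [C [hC Cx hP]]]; exists m, C; split=> // y Xy Cy.
by exists m, C; split.
Qed.

Lemma near_form m F x : fform m F -> F x != 0 -> near x (fun y => F y != 0).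
Proof. by move=> hF Fx; exists m, F; split. Qed.

Lemma sec_near n s t x : near x (fun y => s y = t y) -> sec_at n t x -> sec_at n s x.
Proof.
move=> [m [C [hC Cx hst]]] [m' [F [G [hF hG Gx e]]]].
exists (m + m')%N, (fun y => C y * F y), (fun y => C y * G y); split.
- by rewrite -addnA; apply: fformM.
- exact: fformM.
- by rewrite mulf_neq0.
- move=> y Xy; rewrite mulf_eq0 => /norP [Cy Gy].
  by rewrite hst // e // -mulf_div divff // mul1r.
Qed.

Lemma sec_ext n s t x : (forall y, X y -> s y = t y) -> sec_at n t x -> sec_at n s x.
Proof. by move=> h; apply: sec_near; apply: near_all. Qed.

Lemma sec_deg n n' s x : n = n' -> sec_at n s x -> sec_at n' s x.
Proof. by move=> <-. Qed.

Lemma sec_form n F x : fform n F -> sec_at n F x.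
Proof.
move=> hF; exists 0%N, F, (fun=> 1); split=> //; [exact: fformC|exact: oner_neq0|].
by move=> y _ _; rewrite divr1.
Qed.

Lemma secM n n' s t x : sec_at n s x -> sec_at n' t x ->
  sec_at (n + n') (fun y => s y * t y) x.
Proof.
move=> [m [F [G [hF hG Gx e]]]] [m' [F' [G' [hF' hG' Gx' e']]]].
exists (m + m')%N, (fun y => F y * F' y), (fun y => G y * G' y); split.
- by rewrite addnACA; apply: fformM.
- exact: fformM.
- by rewrite mulf_neq0.
- by move=> y Xy; rewrite mulf_eq0 => /norP [Gy Gy']; rewrite e // e' // mulf_div.
Qed.

Lemma secD n s t x : sec_at n s x -> sec_at n t x -> sec_at n (fun y => s y + t y) x.
Proof.
move=> [m [F [G [hF hG Gx e]]]] [m' [F' [G' [hF' hG' Gx' e']]]].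
exists (m + m')%N, (fun y => F y * G' y + G y * F' y), (fun y => G y * G' y); split.
- apply: fformD; first by rewrite addnAC; apply: fformM.
  by rewrite -addnA; apply: fformM.
- exact: fformM.
- by rewrite mulf_neq0.
- move=> y Xy; rewrite mulf_eq0 => /norP [Gy Gy']; rewrite e // e' // addf_div //.
  by rewrite [G y * F' y]mulrC.
Qed.

Lemma secXn n s x l : sec_at n s x -> sec_at (l * n) (fun y => s y ^+ l) x.
Proof.
move=> h; elim: l => [|l IH].
  by apply: (@sec_ext _ _ (fun=> 1)) => //; apply: sec_form; exact: fformC.
by rewrite mulSn; apply: (@sec_ext _ _ (fun y => s y * s y ^+ l)); [move=> y _; rewrite exprS|apply: secM].
Qed.

Lemma sec_neq0 n s x : X x -> sec_at n s x -> s x != 0 -> near x (fun y => s y != 0).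
Proof.
move=> Xx [m [F [G [hF hG Gx e]]]]; rewrite e // => nz.
have Fx : F x != 0 by apply: contra_neq nz => ->; rewrite mul0r.
exists (m + n + m)%N, (fun y => F y * G y); split; first exact: fformM.
  by rewrite mulf_neq0.
move=> y Xy; rewrite mulf_eq0 => /norP [Fy Gy]; rewrite e //.
by rewrite mulf_neq0 ?invr_eq0.
Qed.

Lemma sec_nearby n s x : sec_at n s x -> near x (fun y => sec_at n s y).
Proof.
by move=> [m [F [G [hF hG Gx e]]]]; exists m, G; split=> // y Xy Gy; exists m, F, G.
Qed.

Lemma secV n s t x : X x -> sec_at n s x -> sec_at n t x -> t x != 0 ->
  reg_at (fun y => s y / t y) x.
Proof.
move=> Xx [m [F [G [hF hG Gx e]]]] [m' [F' [G' [hF' hG' Gx' e']]]].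
rewrite e' // => nz.
have Fx' : F' x != 0 by apply: contra_neq nz => ->; rewrite mul0r.
exists (m + (m' + n) + m')%N, (fun y => (F y * G' y) * G' y), (fun y => (G y * F' y) * G' y).
split.
- by rewrite addn0; apply: fformM => //; rewrite addnCA addnC; apply: fformM => //; rewrite addnC.
- by do 2?apply: fformM.
- by rewrite !mulf_neq0.
- move=> y Xy; rewrite !mulf_eq0 => /norP [/norP [Gy Fy'] Gy']; rewrite e // e' //.
  by field; rewrite Gy Gy' Fy'.
Qed.

Lemma regC c x : reg_at (fun=> c) x.
Proof. exact/sec_form/fformC. Qed.

Lemma regM f g x : reg_at f x -> reg_at g x -> reg_at (fun y => f y * g y) x.
Proof. exact: secM. Qed.

Lemma regV f x : X x -> reg_at f x -> f x != 0 -> reg_at (fun y => (f y)^-1) x.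
Proof.
move=> Xx hf fx; have := secV Xx (regC 1 x) hf fx; apply: sec_ext => y _.
by rewrite div1r.
Qed.

Lemma regXn f x l : reg_at f x -> reg_at (fun y => f y ^+ l) x.
Proof. by move=> /(secXn l); apply: sec_deg; rewrite muln0. Qed.

(* For a regular function unit_at is invertibility in the local ring. *)
Definition unit_at f x := reg_at f x /\ f x != 0.

Lemma unitC c x : c != 0 -> unit_at (fun=> c) x.
Proof. by split=> //; apply: regC. Qed.

Lemma unitM f g x : unit_at f x -> unit_at g x -> unit_at (fun y => f y * g y) x.
Proof. by move=> [rf nf] [rg ng]; split; [apply: regM | rewrite mulf_neq0]. Qed.

Lemma unitV f x : X x -> unit_at f x -> unit_at (fun y => (f y)^-1) x.
Proof. by move=> Xx [rf nf]; split; [apply: regV | rewrite invr_eq0]. Qed.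

Lemma unitXn f x l : unit_at f x -> unit_at (fun y => f y ^+ l) x.
Proof. by move=> [rf nf]; split; [apply: regXn | rewrite expf_neq0]. Qed.

Lemma unit_near f g x : X x -> near x (fun y => f y = g y) -> unit_at g x -> unit_at f x.
Proof.
by move=> Xx h [rg ng]; split; [apply: sec_near rg | rewrite (near_here Xx h)].
Qed.

Lemma unit_ext f g x : X x -> (forall y, X y -> f y = g y) -> unit_at g x -> unit_at f x.
Proof. by move=> Xx h; apply: unit_near => //; apply: near_all. Qed.

Lemma unit_nearby f x : X x -> unit_at f x -> near x (fun y => unit_at f y).
Proof.
move=> Xx [rf nf]; apply: near_mono (near_and (sec_nearby rf) (sec_neq0 Xx rf nf)).
by move=> y _ [].
Qed.

Lemma irr_near x y P Q : clo X -> irr X -> X x -> X y -> near x P -> near y Q ->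
  exists z, [/\ X z, P z & Q z].
Proof.
move=> cX iX Xx Xy [m [C [hC Cx hP]]] [n [D [hD Dy hQ]]].
have [||z [Xz Cz Dz]] := irr_forms cX iX hC hD; [by exists x|by exists y|].
by exists z; split=> //; [apply: hP|apply: hQ].
Qed.

Lemma clo_near Z : clo X -> (forall x, Z x -> X x) ->
  (forall x, X x -> ~ Z x -> near x (fun y => ~ Z y)) -> clo Z.
Proof.
move=> [pX hX] sub h; split=> [x /sub/pX//|x px nZ].
have [Xx|nX] := classic (X x).
  have [m [C [hC Cx hZ]]] := h x Xx nZ; exists m, C; split=> // z Zz.
  by apply/eqP/negPn/negP => Cz; apply: (hZ z (sub _ Zz) Cz).
have [m [F [hF Fx FX]]] := hX x px nX; exists m, F; split=> // z /sub; exact: FX.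
Qed.

Lemma clo_away Z x : clo Z -> X x -> is_point x -> ~ Z x -> near x (fun y => ~ Z y).
Proof.
move=> [pZ hZ] Xx px nZ; have [m [F [hF Fx FZ]]] := hZ x px nZ.
by exists m, F; split=> // y _ Fy Zy; move: Fy; rewrite FZ ?eqxx.
Qed.

(** The forms [G] for which [s * G] is a form on [X] make a homogeneous ideal, and local regularity
    says that it has no zero. *)
Theorem global_sections n s : clo X -> (forall x, X x -> sec_at n s x) ->
  exists N, forall U, fform N U -> exists2 V, fform (N + n) V &
    forall y, X y -> s y * U y = V y.
Proof.
move=> cX hs.
pose J m G := fform m G /\ exists2 V, fform (m + n) V & forall y, X y -> s y * G y = V y.
have hJ : hideal J.
  split.
  - by move=> m F [].
  - move=> m; split; first exact: fform0.
    by exists (fun=> 0); [exact: fform0 | move=> y _; rewrite mulr0].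
  - move=> m F G [hF [V hV eV]] [hG [W hW eW]]; split; first exact: fformD.
    exists (fun x => V x + W x); first exact: fformD.
    by move=> y Xy; rewrite mulrDr eV // eW.
  - move=> m m' F G hF [hG [V hV eV]]; split; first exact: fformM.
    exists (fun x => F x * V x); first by rewrite -addnA; apply: fformM.
    by move=> y Xy; rewrite mulrCA eV.
have [x px|N hN] := projective_nullstellensatz hJ.
  have [Xx|nX] := classic (X x).
    have [m [F [G [hF hG Gx e]]]] := hs x Xx.
    (* Squared so that the identity also holds where [G] vanishes and [s] is not given by
       [F / G]. *)
    exists (m + m)%N, (fun y => G y * G y); split; last by rewrite mulf_neq0.
    split; first exact: fformM.
    exists (fun y => G y * F y); first by rewrite -addnA; apply: fformM.
    move=> y Xy; have [->|Gy] := eqVneq (G y) 0; first by rewrite !mul0r mulr0.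
    by rewrite e // mulrA divfK // mulrC.
  have [m [F [hF Fx FX]]] := cX.2 x px nX; exists m, F; split=> //; split=> //.
  exists (fun=> 0); [exact: fform0 | by move=> y Xy; rewrite FX // mulr0].
by exists N => U hU; have [_] := hN U hU.
Qed.

(** Multiplication by [f] maps the finite-dimensional space of forms of degree [N] on [X] to itself,
    and each value of [f] is an eigenvalue. *)
Lemma global_values f : clo X -> (forall x, X x -> reg_at f x) ->
  exists2 r : seq k, uniq r & forall x, X x -> f x \in r.
Proof.
move=> cX hf; have [N hN] := global_sections cX hf.
have [D [e [he spn]]] := fform_span k d N.
have /fchoice [M hM] : forall i, exists c : 'I_D -> k,
    forall x, X x -> f x * e i x = \sum_j c j * e j x.
  move=> i; have [V hV eV] := hN _ (he i); rewrite addn0 in hV.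
  by have [c hc] := spn V hV; exists c => x Xx; rewrite eV.
pose A := \matrix_(i, j) M j i.
pose p := char_poly A.
have [r er] := closed_field_poly_normal p.
exists (undup r) => [|x Xx]; first exact: undup_uniq.
rewrite mem_undup.
have p0 : p != 0 by rewrite monic_neq0 // char_poly_monic.
have : root p (f x).
  rewrite -eigenvalue_root_char; apply/eigenvalueP.
  exists (\row_i e i x).
    apply/rowP=> i; rewrite !mxE hM //; apply: eq_bigr => j _.
    by rewrite !mxE mulrC.
  have [i xi] := rV_neq0 (is_point_neq0 (cX.1 _ Xx)).
  have [c hc] := spn _ (fform_deg (muln1 N) (fformXn N (fformX k i))).
  apply/eqP=> /rowP e0; move: (expf_neq0 N xi); rewrite hc big1 ?eqxx // => j _.
  by have := e0 j; rewrite !mxE => ->; rewrite mulr0.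
by rewrite er rootZ ?lead_coef_eq0 // root_prod_XsubC.
Qed.

Lemma sec_zero_clo n s : clo X -> (forall x, X x -> sec_at n s x) ->
  clo (fun x => X x /\ s x = 0).
Proof.
move=> cX hs; apply: clo_near => // [x []//|x Xx nZ].
have sx : s x != 0 by apply/eqP=> sx; apply: nZ.
by apply: near_mono (sec_neq0 Xx (hs x Xx) sx) => y _ /eqP h [].
Qed.

Lemma global_const f : clo X -> irr X -> (forall x, X x -> reg_at f x) ->
  exists c, forall x, X x -> f x = c.
Proof.
move=> cX iX hf; have [r _ hr] := global_values cX hf.
have [||i ii hi] := @irr_cover _ _ X (size r) (fun i x => X x /\ f x - r`_i = 0) iX.
- move=> i _; apply: (@sec_zero_clo 0) => // x Xx.
  by apply: secD; [exact: hf | exact: regC].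
- move=> x Xx; exists (seq.index (f x) r); first by rewrite index_mem hr.
  by split=> //; rewrite nth_index ?subrr // hr.
exists r`_i => x Xx; have [_ /eqP] := hi x Xx; by rewrite subr_eq0 => /eqP.
Qed.

End Local.

(** * Morphisms and Segre products *)

Section Morphisms.

Variable k : closedFieldType.

Definition morph_at (d e : nat) (X : 'rV[k]_d -> Prop) (f : 'rV[k]_d -> 'rV[k]_e)
    (x : 'rV[k]_d) : Prop :=
  exists m (G : 'rV[k]_d -> 'rV[k]_e),
    [/\ forall j, fform m (fun y => G y 0 j), G x <> 0 &
        forall y, X y -> G y <> 0 -> exists c, G y = c *: f y].

Definition morph (d e : nat) (X : 'rV[k]_d -> Prop) (Y : 'rV[k]_e -> Prop) f : Prop :=
  (forall x, X x -> Y (f x)) /\ forall x, X x -> morph_at X f x.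

Lemma morphP d e (X : 'rV[k]_d -> Prop) (Y : 'rV[k]_e -> Prop) f :
  morphism_over predT X Y f <-> morph X Y f.
Proof.
split=> -[h1 h2]; split=> // x Xx.
  have [m [G [hG Gx eG]]] := h2 x Xx; exists m, (fun y => \row_j ev (G j) y).
  split=> // j; apply: (@fform_ext _ _ _ (ev (G j))) => [y|]; first by rewrite mxE.
  by apply: fform_ev; apply/fform_over.
have [m [G [hG Gx eG]]] := h2 x Xx.
have /fchoice [g hg] : forall j, exists f : {mpoly k[d]},
  f \is m.-homog /\ forall y, G y 0 j = ev f y by move=> j; have [f' h e'] := hG j; exists f'.
have eg y : \row_j ev (g j) y = G y by apply/rowP=> j; rewrite mxE (hg j).2.
exists m, g; split=> [j||y Xy]; first by apply/fform_over; case: (hg j).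
  by rewrite eg.
by rewrite eg; apply: eG.
Qed.

Lemma morphism_over_morph d e F (X : 'rV[k]_d -> Prop) (Y : 'rV[k]_e -> Prop) f :
  morphism_over F X Y f -> morph X Y f.
Proof.
move=> [h1 h2]; apply/morphP; split=> // x Xx.
have [m [G [hG Gx eG]]] := h2 x Xx; exists m, G; split=> // j.
by apply/fform_over; case: (hG j).
Qed.

Section Pull.

Variables (d e : nat) (X : 'rV[k]_d -> Prop) (Y : 'rV[k]_e -> Prop).
Variable f : 'rV[k]_d -> 'rV[k]_e.
Hypothesis fXY : forall x, X x -> Y (f x).

Lemma morph_near x P : morph_at X f x -> near Y (f x) P -> X x ->
  near X x (fun y => P (f y)).
Proof.
move=> [m [G [hG Gx eG]]] [n [C [hC Cx hP]]] Xx.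
have [l Gl] := rV_neq0 Gx.
(* The factor [G y 0 l] keeps [G y] nonzero, so that [G] represents [f] on the whole
   neighbourhood. *)
exists (n * m + m)%N, (fun y => C (G y) * G y 0 l); split.
- by apply: fformM => //; apply: fform_comp.
- rewrite mulf_neq0 //; have [c ec] := eG x Xx Gx.
  rewrite ec (fform_scale _ _ hC) mulf_neq0 // expf_neq0 //.
  by apply: contra_neq Gl => c0; rewrite ec c0 scale0r mxE.
- move=> y Xy; rewrite mulf_eq0 => /norP [CG Gyl]; apply: hP; first exact: fXY.
  have [|c ec] := eG y Xy; first by move=> G0; move: Gyl; rewrite G0 mxE eqxx.
  by apply: contra_neq CG => Cf; rewrite ec (fform_scale _ _ hC) Cf mulr0.
Qed.

Lemma morph_reg x g : X x -> morph_at X f x -> reg_at Y g (f x) ->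
  reg_at X (fun y => g (f y)) x.
Proof.
move=> Xx [m [G [hG Gx eG]]] [n [A [B [hA hB Bx e']]]].
have [l Gl] := rV_neq0 Gx.
have [c ec] := eG x Xx Gx.
have c0 : c != 0 by apply: contra_neq Gl => c0; rewrite ec c0 scale0r mxE.
exists (n * m + m)%N, (fun y => A (G y) * G y 0 l), (fun y => B (G y) * G y 0 l); split.
- rewrite addn0; apply: fformM => //; apply: fform_comp => //.
  by rewrite addn0 in hA.
- by apply: fformM => //; apply: fform_comp.
- by rewrite mulf_neq0 // ec (fform_scale _ _ hB) mulf_neq0 // expf_neq0.
- move=> y Xy; rewrite mulf_eq0 => /norP [BG Gyl].
  have [|c' ec'] := eG y Xy; first by move=> G0; move: Gyl; rewrite G0 mxE eqxx.
  have Bf : B (f y) != 0.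
    by apply: contra_neq BG => Bf; rewrite ec' (fform_scale _ _ hB) Bf mulr0.
  have c0' : c' != 0 by apply: contra_neq Gyl => c0'; rewrite ec' c0' scale0r mxE.
  rewrite e' //; last exact: fXY.
  rewrite -mulf_div divff // mulr1 ec' (fform_scale _ _ hA) (fform_scale _ _ hB) addn0.
  by rewrite -mulf_div divff ?mul1r // expf_neq0.
Qed.

Lemma morph_unit x g : X x -> morph_at X f x -> unit_at Y g (f x) ->
  unit_at X (fun y => g (f y)) x.
Proof. by move=> Xx hf [rg ng]; split=> //; apply: morph_reg. Qed.

Lemma morph_comp_at h (g : 'rV[k]_e -> 'rV[k]_h) x : X x ->
  morph_at X f x -> morph_at Y g (f x) -> morph_at X (fun y => g (f y)) x.
Proof.
move=> Xx [m [G [hG Gx eG]]] [n [H [hH Hx eH]]].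
have [l Gl] := rV_neq0 Gx.
have [c ec] := eG x Xx Gx.
have c0 : c != 0 by apply: contra_neq Gl => c0; rewrite ec c0 scale0r mxE.
have HZ c' y : H (c' *: y) = c' ^+ n *: H y.
  by apply/rowP=> j; rewrite mxE (fform_scale c' y (hH j)).
exists (m + n * m)%N, (fun y => G y 0 l *: H (G y)); split.
- move=> j; apply: (@fform_ext _ _ _ (fun y => G y 0 l * H (G y) 0 j)) => [y|].
    by rewrite mxE.
  by apply: fformM => //; apply: (@fform_comp _ _ _ n m (fun y => H y 0 j)).
- have [j Hj] := rV_neq0 Hx => /rowP/(_ j)/eqP; apply/negP.
  by rewrite !mxE mulf_neq0 // ec HZ mxE mulf_neq0 // expf_neq0.
- move=> y Xy nz.
  have Gyl : G y 0 l != 0 by apply/eqP=> G0; apply: nz; rewrite G0 scale0r.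
  have [|c' ec'] := eG y Xy; first by move=> G0; move: Gyl; rewrite G0 mxE eqxx.
  have [|c'' ec''] := eH (f y) (fXY Xy).
    by move=> H0; apply: nz; rewrite ec' HZ H0 !scaler0.
  by exists (G y 0 l * c' ^+ n * c''); rewrite -scalerA -ec'' {2}ec' HZ scalerA.
Qed.

Lemma morph_clo Z : clo X -> (forall y, Y y -> is_point y) -> (forall x, X x -> morph_at X f x) ->
  clo Z -> clo (fun x => X x /\ Z (f x)).
Proof.
move=> cX pY hf cZ; apply: (clo_near cX) => [x []//|x Xx nZ].
have nZ' : ~ Z (f x) by move=> Zf; apply: nZ.
have := morph_near (hf x Xx) (clo_away cZ (fXY Xx) (pY _ (fXY Xx)) nZ') Xx.
by apply: near_mono => y _ h [].
Qed.

Lemma irr_image : clo X -> (forall y, Y y -> is_point y) ->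
  (forall x, X x -> morph_at X f x) ->
  (forall y, Y y -> exists2 x, X x & f x = y) -> irr X -> irr Y.
Proof.
move=> cX pY hf sur [[x0 Xx0] hX]; split; first by exists (f x0); apply: fXY.
move=> Z1 Z2 /cloP c1 /cloP c2 cov.
have [|||h|h] := hX (fun x => X x /\ Z1 (f x)) (fun x => X x /\ Z2 (f x)).
- by apply/cloP; apply: morph_clo.
- by apply/cloP; apply: morph_clo.
- by move=> x Xx; have [] := cov _ (fXY Xx); [left|right].
- by left=> y /sur [x Xx <-]; case: (h x Xx).
- by right=> y /sur [x Xx <-]; case: (h x Xx).
Qed.

End Pull.

Lemma morph_comp d e h (X : 'rV[k]_d -> Prop) (Y : 'rV[k]_e -> Prop)
    (Z : 'rV[k]_h -> Prop) f g :
  morph X Y f -> morph Y Z g -> morph X Z (fun x => g (f x)).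
Proof.
move=> [f1 f2] [g1 g2]; split=> x Xx; first exact/g1/f1.
by apply: (morph_comp_at f1) => //; [apply: f2 | apply/g2/f1].
Qed.

Lemma morph_at_ext d e (X : 'rV[k]_d -> Prop) (f g : 'rV[k]_d -> 'rV[k]_e) x :
  (forall y, X y -> f y = g y) -> morph_at X f x -> morph_at X g x.
Proof.
move=> efg [m [G [hG Gx eG]]]; exists m, G; split=> // y Xy /(eG y Xy) [c ->].
by exists c; rewrite efg.
Qed.

Lemma morph_ext d e (X : 'rV[k]_d -> Prop) (Y : 'rV[k]_e -> Prop) f g :
  (forall y, X y -> f y = g y) -> morph X Y f -> morph X Y g.
Proof.
move=> efg [f1 f2]; split=> x Xx; first by rewrite -efg //; apply: f1.
by apply: morph_at_ext efg _; apply: f2.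
Qed.

Lemma morph_id d (X : 'rV[k]_d -> Prop) : (forall x, X x -> is_point x) ->
  morph X X (fun x => x).
Proof.
move=> pX; split=> // x Xx; exists 1%N, (fun x => x); split.
- by move=> j; apply: fformX.
- exact/is_point_neq0/pX.
- by move=> y _ _; exists 1; rewrite scale1r.
Qed.

Lemma morph_const d e (X : 'rV[k]_d -> Prop) (Y : 'rV[k]_e -> Prop) y0 :
  is_point y0 -> Y y0 -> morph X Y (fun=> y0).
Proof.
move=> p0 Y0; split=> // x _; exists 0%N, (fun=> y0); split.
- by move=> j; apply: fformC.
- exact: is_point_neq0.
- by move=> y _ _; exists 1; rewrite scale1r.
Qed.

Lemma coord_reg d e (X : 'rV[k]_d -> Prop) (f : 'rV[k]_d -> 'rV[k]_e) x i j : X x ->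
  morph_at X f x -> f x 0 j != 0 -> reg_at X (fun y => f y 0 i / f y 0 j) x.
Proof.
move=> Xx [m [G [hG Gx eG]]] fj.
have [c ec] := eG x Xx Gx.
exists m, (fun y => G y 0 i), (fun y => G y 0 j); split=> //; first by rewrite addn0.
  by rewrite ec mxE mulf_neq0 //; apply/eqP=> c0; apply: Gx; rewrite ec c0 scale0r.
move=> y Xy Gj; have [|c' ec'] := eG y Xy; first by move=> G0; move: Gj; rewrite G0 mxE eqxx.
have c0' : c' != 0 by apply: contra_neq Gj => c0'; rewrite ec' c0' scale0r mxE.
by rewrite ec' !mxE -mulf_div divff // mul1r.
Qed.

Lemma index_allpairs (S T : eqType) (s : seq S) (t : seq T) x y :
  x \in s -> y \in t -> seq.index (x, y) [seq (a, b) | a <- s, b <- t] =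
  (seq.index x s * size t + seq.index y t)%N.
Proof.
elim: s => //= a s IH; rewrite inE index_cat size_map => xs yt.
have [<-|ne] /= := eqVneq a x.
  rewrite map_f // mul0n add0n; elim: t yt {IH} => //= b t IHt; rewrite inE xpair_eqE eqxx /=.
  by have [//|nb /= /IHt ->] := eqVneq b y.
have -> : ((x, y) \in [seq (a, b) | b <- t]) = false.
  by apply/mapP=> -[b _ [ex]]; rewrite ex eqxx in ne.
by rewrite IH ?mulSn ?addnA //; move: xs; rewrite eq_sym (negPf ne).
Qed.

Lemma mxvec_index_val m n (i : 'I_m) (j : 'I_n) :
  mxvec_index i j = (i * n + j)%N :> nat.
Proof.
have -> : mxvec_index i j = enum_rank (i, j) :> nat by [].
have e : [seq (a, b) | a <- enum 'I_m, b <- enum 'I_n] = enum {: 'I_m * 'I_n}.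
  by rewrite [RHS]enumT unlock.
have lt : (enum_rank (i, j) < size (enum {: 'I_m * 'I_n}))%N by rewrite -cardE.
rewrite -(index_uniq (i, j) lt (enum_uniq _)) nth_enum_rank -e.
by rewrite index_allpairs ?mem_enum // !index_enum_ord size_enum_ord.
Qed.

Lemma segreE d e (x : 'rV[k]_d) (y : 'rV[k]_e) i j :
  segre x y 0 (mxvec_index i j) = x 0 i * y 0 j.
Proof. by rewrite /segre mxvecE mxE big_ord1 mxE. Qed.

Lemma is_point_segre d e (x : 'rV[k]_d) (y : 'rV[k]_e) :
  is_point x -> is_point y -> is_point (segre x y).
Proof.
move=> [i [xi hi]] [j [yj hj]]; exists (mxvec_index i j); rewrite segreE xi yj mulr1.
split=> // l; case/mxvec_indexP: l => i' j'; rewrite !mxvec_index_val segreE => lt.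
have [li|ii] := ltnP i' i; first by rewrite hi ?mul0r.
rewrite hj ?mulr0 // ltnNge; apply/negP=> jj.
by move: lt; rewrite ltnNge leq_add // leq_mul2r ii orbT.
Qed.

Lemma segre_inj d e (x x' : 'rV[k]_d) (y y' : 'rV[k]_e) : is_point x -> is_point y ->
  is_point x' -> is_point y' -> segre x y = segre x' y' -> x = x' /\ y = y'.
Proof.
move=> px py px' py' es.
have E i j : x 0 i * y 0 j = x' 0 i * y' 0 j by rewrite -!segreE es.
split.
  have [j [yj _]] := py; apply: (@is_point_eq _ _ (y' 0 j)) => //; apply/rowP=> i.
  by rewrite mxE mulrC -E yj mulr1.
have [i [xi _]] := px; apply: (@is_point_eq _ _ (x' 0 i)) => //; apply/rowP=> j.
by rewrite mxE -E xi mul1r.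
Qed.

Definition fst_point d e (w : 'rV[k]_(d * e)) : 'rV[k]_d :=
  epsilon (inhabits 0) (fun x => exists y : 'rV[k]_e,
    [/\ is_point x, is_point y & w = segre x y]).

Definition snd_point d e (w : 'rV[k]_(d * e)) : 'rV[k]_e :=
  epsilon (inhabits 0) (fun y => exists x : 'rV[k]_d,
    [/\ is_point x, is_point y & w = segre x y]).

Lemma fst_segre d e (x : 'rV[k]_d) (y : 'rV[k]_e) : is_point x -> is_point y ->
  fst_point (segre x y) = x.
Proof.
move=> px py; rewrite /fst_point.
have [|y' [px' py' es]] := epsilon_spec (inhabits 0) (fun x' : 'rV[k]_d =>
  exists y' : 'rV[k]_e, [/\ is_point x', is_point y' & segre x y = segre x' y']).
  by exists x, y.
by have [<-] := segre_inj px py px' py' es.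
Qed.

Lemma snd_segre d e (x : 'rV[k]_d) (y : 'rV[k]_e) : is_point x -> is_point y ->
  snd_point (segre x y) = y.
Proof.
move=> px py; rewrite /snd_point.
have [|x' [px' py' es]] := epsilon_spec (inhabits 0) (fun y' : 'rV[k]_e =>
  exists x' : 'rV[k]_d, [/\ is_point x', is_point y' & segre x y = segre x' y']).
  by exists y, x.
by have [_ <-] := segre_inj px py px' py' es.
Qed.

Section Product.

Variables (d e : nat) (X : 'rV[k]_d -> Prop) (Y : 'rV[k]_e -> Prop).
Hypotheses (pX : forall x, X x -> is_point x) (pY : forall y, Y y -> is_point y).

Lemma product_point w : product X Y w -> is_point w.
Proof. by move=> [x [y [/pX px /pY py ->]]]; apply: is_point_segre. Qed.

Lemma morph_fst : morph (product X Y) X (@fst_point d e).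
Proof.
split=> w [x [y [Xx Yy ->]]]; first by rewrite fst_segre //; [apply: pX|apply: pY].
have [j [yj _]] := pY Yy.
exists 1%N, (fun w => \row_i w 0 (mxvec_index i j)); split.
- move=> i; apply: (@fform_ext _ _ _ (fun w => w 0 (mxvec_index i j))) => [v|].
    by rewrite mxE.
  exact: fformX.
- have [i [xi _]] := pX Xx => /rowP/(_ i)/eqP; rewrite !mxE segreE xi yj mulr1.
  by rewrite oner_eq0.
- move=> v [x' [y' [Xx' Yy' ->]]] _; exists (y' 0 j).
  rewrite fst_segre; [|exact: pX|exact: pY].
  by apply/rowP=> i; rewrite !mxE segreE mulrC.
Qed.

Lemma morph_snd : morph (product X Y) Y (@snd_point d e).
Proof.
split=> w [x [y [Xx Yy ->]]]; first by rewrite snd_segre //; [apply: pX|apply: pY].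
have [i [xi _]] := pX Xx.
exists 1%N, (fun w => \row_j w 0 (mxvec_index i j)); split.
- move=> j; apply: (@fform_ext _ _ _ (fun w => w 0 (mxvec_index i j))) => [v|].
    by rewrite mxE.
  exact: fformX.
- have [j [yj _]] := pY Yy => /rowP/(_ j)/eqP; rewrite !mxE segreE xi yj mulr1.
  by rewrite oner_eq0.
- move=> v [x' [y' [Xx' Yy' ->]]] _; exists (x' 0 i).
  rewrite snd_segre; [|exact: pX|exact: pY].
  by apply/rowP=> j; rewrite !mxE segreE.
Qed.

Lemma morph_pair_at h (Z : 'rV[k]_h -> Prop) f g z : morph_at Z f z -> morph_at Z g z ->
  morph_at Z (fun z => segre (f z : 'rV_d) (g z : 'rV_e)) z.
Proof.
move=> [m [F [hF Fz eF]]] [n [G [hG Gz eG]]].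
exists (m + n)%N, (fun z => segre (F z) (G z)); split.
- move=> l; case/mxvec_indexP: l => i j.
  apply: (@fform_ext _ _ _ (fun z => F z 0 i * G z 0 j)) => [v|]; first by rewrite segreE.
  exact: fformM.
- have [i Fi] := rV_neq0 Fz; have [j Gj] := rV_neq0 Gz.
  move=> /rowP/(_ (mxvec_index i j))/eqP; apply/negP.
  by rewrite segreE mxE mulf_neq0.
- move=> y Zy nz.
  have [|c ec] := eF y Zy.
    move=> F0; apply: nz; apply/rowP=> l; case/mxvec_indexP: l => i j.
    by rewrite segreE F0 !mxE mul0r.
  have [|c' ec'] := eG y Zy.
    move=> G0; apply: nz; apply/rowP=> l; case/mxvec_indexP: l => i j.
    by rewrite segreE G0 !mxE mulr0.
  exists (c * c'); apply/rowP=> l; case/mxvec_indexP: l => i j.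
  by rewrite segreE [RHS]mxE segreE ec ec' !mxE mulrACA.
Qed.

Lemma morph_pair h (Z : 'rV[k]_h -> Prop) f g : morph Z X f -> morph Z Y g ->
  morph Z (product X Y) (fun z => segre (f z) (g z)).
Proof.
move=> [f1 f2] [g1 g2]; split=> z Zz.
  by exists (f z), (g z); split; [apply: f1|apply: g1|].
by apply: morph_pair_at; [apply: f2 | apply: g2].
Qed.

End Product.

End Morphisms.

(** * Line bundles *)

(* A line bundle on [X] is handled through a family [D] of set-theoretic frames: [D x] is
   a [k]-valued function which, near [x], is a local frame of the bundle seen inside the
   sheaf of all functions.  The bundle is trivial iff one function [H] makes all the
   [H * D x] regular units at [x]; tensor product, dual and pullback become pointwise
   product, inverse and composition. *)
Section Frames.

Variable k : closedFieldType.

Definition triv (d : nat) (X : 'rV[k]_d -> Prop) (D : 'rV[k]_d -> 'rV[k]_d -> k) : Prop :=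
  exists H, forall x, X x -> unit_at X (fun z => H z * D x z) x.

(** The frames at neighbouring points differ by a unit, so that the family does come from a line
    bundle. *)
Definition coh (d : nat) (X : 'rV[k]_d -> Prop) (D : 'rV[k]_d -> 'rV[k]_d -> k) : Prop :=
  forall x, X x -> near X x (fun z => unit_at X (fun v => D z v / D x v) z).

(** [u] splits the cocycle by arbitrary functions, [trans i j = u j / u i], and near [x] each [D x]
    agrees with such a [u i] up to a unit. *)
Definition rep_by (d : nat) (X : 'rV[k]_d -> Prop) (L : cocycle k d)
    (D : 'rV[k]_d -> 'rV[k]_d -> k) (u : Defs.index L -> 'rV[k]_d -> k) : Prop :=
  [/\ forall i j z, X z -> chart i z -> chart j z -> trans i j z * u i z = u j z,
      forall i z, X z -> chart i z -> u i z != 0,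
      forall x, X x -> exists i : Defs.index L, chart i x,
      forall (i : Defs.index L) x, X x -> chart i x -> near X x (chart i) &
      forall i x, X x -> chart i x -> unit_at X (fun z => u i z / D x z) x].

Definition rep (d : nat) (X : 'rV[k]_d -> Prop) (L : cocycle k d)
    (D : 'rV[k]_d -> 'rV[k]_d -> k) : Prop := exists u, @rep_by d X L D u.

Section Basic.

Variables (d : nat) (X : 'rV[k]_d -> Prop).
Implicit Types (D E : 'rV[k]_d -> 'rV[k]_d -> k) (L M : cocycle k d).

Lemma triv_ext D E : (forall x z, X x -> X z -> D x z = E x z) -> triv X D -> triv X E.
Proof.
move=> e [H hH]; exists H => x Xx; apply: unit_ext (hH x Xx) => // z Xz.
by rewrite e.
Qed.

Lemma trivM D E : triv X D -> triv X E -> triv X (fun x z => D x z * E x z).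
Proof.
move=> [H hH] [H' hH']; exists (fun z => H z * H' z) => x Xx.
by apply: unit_ext (unitM (hH x Xx) (hH' x Xx)) => // z Xz; rewrite mulrACA.
Qed.

Lemma trivV D : triv X D -> triv X (fun x z => (D x z)^-1).
Proof.
move=> [H hH]; exists (fun z => (H z)^-1) => x Xx.
by apply: unit_ext (unitV Xx (hH x Xx)) => // z Xz; rewrite invfM.
Qed.

Lemma trivXn D n : triv X D -> triv X (fun x z => D x z ^+ n).
Proof.
move=> [H hH]; exists (fun z => H z ^+ n) => x Xx.
by apply: unit_ext (unitXn n (hH x Xx)) => // z Xz; rewrite exprMn.
Qed.

Lemma unit_triv D : (forall x, X x -> unit_at X (D x) x) -> triv X D.
Proof. by move=> h; exists (fun=> 1) => x Xx; apply: unit_ext (h x Xx) => // z _; rewrite mul1r. Qed.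

Lemma coh_self D x : X x -> coh X D -> D x x != 0.
Proof.
move=> Xx /(_ x Xx) /(near_here Xx) [_]; apply: contra_neq => ->; by rewrite mul0r.
Qed.

Lemma coh_neq0 D x : X x -> coh X D -> near X x (fun z => D x z != 0).
Proof.
move=> Xx /(_ x Xx); apply: near_mono => z Xz [_]; apply: contra_neq => ->.
by rewrite invr0 mulr0.
Qed.

Lemma coh_triv1 D : coh X D -> triv X (fun x z => D x z * (D x z)^-1).
Proof.
move=> cD; apply: unit_triv => x Xx; apply: unit_near (unitC X x (oner_neq0 k)) => //.
by apply: near_mono (coh_neq0 Xx cD) => z Xz; exact: divff.
Qed.

Lemma cohM D E : coh X D -> coh X E -> coh X (fun x z => D x z * E x z).
Proof.
move=> cD cE x Xx; apply: near_mono (near_and (cD x Xx) (cE x Xx)) => z Xz [h1 h2].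
by apply: unit_ext (unitM h1 h2) => // v Xv; rewrite mulf_div.
Qed.

Lemma cohV D : coh X D -> coh X (fun x z => (D x z)^-1).
Proof.
move=> cD x Xx; apply: near_mono (cD x Xx) => z Xz h.
by apply: unit_ext (unitV Xz h) => // v Xv; rewrite !invfM.
Qed.

Lemma open_inP (U : 'rV[k]_d -> Prop) : (forall x, X x -> is_point x) ->
  (forall x, X x -> U x -> near X x U) -> open_in predT X U.
Proof.
move=> pX hU.
exists (fun x => is_point x /\ forall m F, fform m F ->
  (forall z, X z -> ~ U z -> F z = 0) -> F x = 0); split.
  apply/cloP; split=> [x []//|x px nx].
  apply: NNPP => no; apply: nx; split=> // m F hF hz; apply/eqP/negPn/negP => Fx.
  by apply: no; exists m, F; split=> // z [_ /(_ _ _ hF)]; apply.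
move=> x Xx; split=> [Ux [_ h]|nx].
  have [m [C [hC Cx hP]]] := hU x Xx Ux.
  by move: Cx; rewrite (h m C) ?eqxx // => z Xz nU; apply/eqP/negPn/negP => /(hP z Xz).
by apply: NNPP => nU; apply: nx; split=> [|m F _ hz]; [apply: pX|apply: hz].
Qed.

Lemma open_in_near F (U : 'rV[k]_d -> Prop) x : (forall x, X x -> is_point x) ->
  open_in F X U -> X x -> U x -> near X x U.
Proof.
move=> pX [Z [[S [hS hZ]] hU]] Xx Ux.
have nZ : ~ Z x by apply/hU.
have [f [Sf fx]] : exists f, S f /\ ev f x <> 0.
  apply: NNPP => no; apply: nZ; apply/hZ; split; first exact: pX.
  by move=> f Sf; apply: NNPP => fx; apply: no; exists f.
have [m [hf _]] := hS f Sf; exists m, (ev f); split; first exact: fform_ev.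
  exact/eqP.
by move=> y Xy /eqP fy; apply/hU => // /hZ [_ /(_ f Sf)].
Qed.

Lemma regular_on_reg F (U : 'rV[k]_d -> Prop) h x : near X x U ->
  regular_on F X U h -> X x -> U x -> reg_at X h x.
Proof.
move=> nU hr Xx Ux; have [m [f [g [[hf _] [hg _] gx e]]]] := hr x Xx Ux.
have [n [C [hC Cx hP]]] := nU.
exists (n + m)%N, (fun y => C y * ev f y), (fun y => C y * ev g y); split.
- by rewrite addn0; apply: fformM => //; apply: fform_ev.
- by apply: fformM => //; apply: fform_ev.
- by rewrite mulf_neq0 //; apply/eqP.
- move=> y Xy; rewrite mulf_eq0 => /norP [Cy /eqP gy].
  by rewrite (e y Xy (hP y Xy Cy) gy) -mulf_div divff // mul1r.
Qed.

Lemma reg_regular_on (U : 'rV[k]_d -> Prop) h :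
  (forall x, X x -> U x -> reg_at X h x) -> regular_on predT X U h.
Proof.
move=> hr x Xx Ux; have [m [F [G [[f hf ef] [g hg eg] Gx e]]]] := hr x Xx Ux.
rewrite addn0 in hf; exists m, f, g; split.
- exact/fform_over.
- exact/fform_over.
- by rewrite -eg; apply/eqP.
- by move=> y Xy _; rewrite -eg -ef => /eqP; apply: e.
Qed.

Lemma line_bundle_rep F L : (forall x, X x -> is_point x) ->
  line_bundle F X L -> exists D, rep X L D.
Proof.
move=> pX [op cov reg nz coc].
have /fchoice [i0 hi0] : forall x, exists i : option (Defs.index L), X x ->
    if i is Some i' then chart i' x else False.
  by move=> x; have [/cov [i ci]|nX] := classic (X x); [exists (Some i)|exists None].
(* The chart is chosen independently at each point, so [u i] need not be regular; only the quotients
   [u j / u i] are. *)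
pose u (i : Defs.index L) z := if i0 z is Some j then trans j i z else 0.
have eu i j z : X z -> chart i z -> chart j z -> trans i j z * u i z = u j z.
  move=> Xz ci cj; have := hi0 z Xz; rewrite /u; case: (i0 z) => // j0 c0.
  by rewrite mulrC (coc j0 i j z).
have nu i z : X z -> chart i z -> u i z != 0.
  move=> Xz ci; have := hi0 z Xz; rewrite /u; case: (i0 z) => // j0 c0.
  exact/eqP/nz.
have near_chart (i : Defs.index L) x : X x -> chart i x -> near X x (chart i).
  by move=> Xx; apply: open_in_near (op i) Xx.
exists (fun x z => if i0 x is Some i then u i z else 0), u; split=> // i x Xx ci.
have := hi0 x Xx; case: (i0 x) => // j cj.
apply: (@unit_near _ _ _ _ (trans j i)) => //.
  apply: near_mono (near_and (near_chart _ _ Xx ci) (near_chart _ _ Xx cj)) => z Xz [czi czj].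
  by rewrite -(eu j i z) // mulfK // nu.
split; last exact/eqP/nz.
apply: (regular_on_reg _ (reg j i)) => //.
exact: near_and (near_chart _ _ Xx cj) (near_chart _ _ Xx ci).
Qed.

Lemma rep_trivialization L D u h : rep_by X D u -> @trivialization k d X L h ->
  exists2 H, forall i z, X z -> chart i z -> h i z = H z * u i z &
    forall x, X x -> unit_at X (fun z => H z * D x z) x.
Proof.
move=> [eu nu cov op hu] [hreg hnz eh].
have /fchoice [H hH] : forall z, exists c, X z ->
    forall i : Defs.index L, chart i z -> h i z = c * u i z.
  move=> z; have [Xz|nX] := classic (X z); last by exists 0.
  have [i ci] := cov z Xz; exists (h i z / u i z) => _ j cj.
  by rewrite -(eh i j z) // -(eu i j z) // mulrCA divfK // nu.
exists H => [i z Xz ci|x Xx]; first exact: hH.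
have [i ci] := cov x Xx.
have uh : unit_at X (h i) x.
  by split; [apply: regular_on_reg (op _ _ Xx ci) (hreg i) Xx ci|apply/eqP/hnz].
apply: unit_near (unitM uh (unitV Xx (hu i x Xx ci))) => //.
apply: near_mono (near_and (op _ _ Xx ci) (sec_neq0 Xx (hu i x Xx ci).1 (hu i x Xx ci).2)).
move=> z Xz [cz nz]; rewrite (hH z Xz i cz) invf_div -mulrA; congr (_ * _).
by rewrite mulrCA divff ?mulr1 // nu.
Qed.

Lemma trivialization_rep L D u H : @rep_by d X L D u ->
  (forall x, X x -> unit_at X (fun z => H z * D x z) x) ->
  @trivialization k d X L (fun i z => H z * u i z).
Proof.
move=> [eu nu cov op hu] hH.
have un i x : X x -> chart i x -> unit_at X (fun z => H z * u i z) x.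
  move=> Xx ci; apply: unit_near (unitM (hH x Xx) (hu i x Xx ci)) => //.
  apply: near_mono (sec_neq0 Xx (hu i x Xx ci).1 (hu i x Xx ci).2) => z Xz.
  rewrite mulf_eq0 invr_eq0 => /norP [_ nD].
  by rewrite -mulrA [D x z * _]mulrC divfK.
split=> [i|i x Xx ci|i j x Xx ci cj].
- by apply: reg_regular_on => x Xx ci; case: (un i x Xx ci).
- by apply/eqP; case: (un i x Xx ci).
- by rewrite mulrCA eu.
Qed.

Lemma rep_triv L D : rep X L D -> (trivial_bundle X L <-> triv X D).
Proof.
move=> [u hu]; split=> [[h hh]|[H hH]].
  by have [H _ hH] := rep_trivialization hu hh; exists H.
by exists (fun i z => H z * u i z); apply: trivialization_rep hH.
Qed.

Lemma rep_line L D : (forall x, X x -> is_point x) -> rep X L D -> line_bundle predT X L.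
Proof.
move=> pX [u [eu nu cov op hu]].
have et i j z : X z -> chart i z -> chart j z -> trans i j z = u j z / u i z.
  by move=> Xz ci cj; rewrite -(eu i j z) // mulfK // nu.
split=> [i|//|i j|i j x Xx ci cj|i j l x Xx ci cj cl].
- by apply: open_inP => // x Xx ci; apply: op.
- apply: reg_regular_on => x Xx [ci cj].
  have := unitM (hu j x Xx cj) (unitV Xx (hu i x Xx ci)) => -[r _]; apply: sec_near r.
  apply: near_mono (near_and (near_and (op i x Xx ci) (op j x Xx cj))
    (sec_neq0 Xx (hu i x Xx ci).1 (hu i x Xx ci).2)) => z Xz [[di dj]].
  rewrite mulf_eq0 invr_eq0 => /norP [n1 n2].
  by rewrite et //; field; rewrite n1 n2.
- by apply/eqP; rewrite et // mulf_neq0 ?invr_eq0 ?nu.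
- by rewrite !et // mulrC mulrA divfK // nu.
Qed.

Lemma rep_coh L D : rep X L D -> coh X D.
Proof.
move=> [u [eu nu cov op hu]] x Xx; have [i ci] := cov x Xx.
have hx := hu i x Xx ci.
apply: near_mono (near_and (op i x Xx ci) (unit_nearby Xx hx)) => z Xz [cz uz].
apply: unit_near (unitM uz (unitV Xz (hu i z Xz cz))) => //.
have nb := near_near (op i x Xx ci).
apply: near_mono (near_and (op i z Xz cz) (sec_neq0 Xz uz.1 uz.2)) => v Xv [cv].
rewrite mulf_eq0 invr_eq0 => /norP [nuv nDv].
by rewrite invf_div mulf_div [D x v * _]mulrC -mulf_div divff ?mul1r //; apply: nu.
Qed.

Lemma rep_tensor L M D E : rep X L D -> rep X M E ->
  rep X (tensor L M) (fun x z => D x z * E x z).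
Proof.
move=> [u [eu nu cov op hu]] [v [ev nv cov' op' hv]].
exists (fun i z => u i.1 z * v i.2 z); split=> /=.
- by move=> [i i'] [j j'] z Xz /= [ci ci'] [cj cj']; rewrite mulrACA eu // ev.
- by move=> [i i'] z Xz /= [ci ci']; rewrite mulf_neq0 ?nu ?nv.
- by move=> x Xx; have [i ci] := cov x Xx; have [j cj] := cov' x Xx; exists (i, j).
- by move=> [i i'] x Xx /= [ci ci']; apply: near_and; [apply: op|apply: op'].
- move=> [i i'] x Xx /= [ci ci'].
  by apply: unit_ext (unitM (hu i x Xx ci) (hv i' x Xx ci')) => // z _; rewrite mulf_div.
Qed.

Lemma rep_dual L D : rep X L D -> rep X (dual_bundle L) (fun x z => (D x z)^-1).
Proof.
move=> [u [eu nu cov op hu]]; exists (fun i z => (u i z)^-1); split=> //=.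
- by move=> i j z Xz ci cj; rewrite -invfM eu.
- by move=> i z Xz ci; rewrite invr_eq0 nu.
- move=> i x Xx ci; apply: unit_ext (unitV Xx (hu i x Xx ci)) => // z _.
  by rewrite !invfM.
Qed.

Lemma rep_power L D n : rep X L D -> rep X (bundle_power L n) (fun x z => D x z ^+ n).
Proof.
move=> [u [eu nu cov op hu]]; exists (fun i z => u i z ^+ n); split=> //=.
- by move=> i j z Xz ci cj; rewrite -exprMn eu.
- by move=> i z Xz ci; rewrite expf_neq0 // nu.
- move=> i x Xx ci; apply: unit_ext (unitXn n (hu i x Xx ci)) => // z _.
  by rewrite expr_div_n.
Qed.

Lemma rep_iso L M D E : rep X L D -> rep X M E ->
  (isomorphic_bundles X L M <-> triv X (fun x z => D x z / E x z)).
Proof. by move=> rL rM; apply: rep_triv; apply: rep_tensor rL (rep_dual rM). Qed.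

(** The way back from frames to cocycles, with one chart per point; the universal property of the
    dual variety is stated for cocycles. *)
Definition frame_bundle D : cocycle k d :=
  @Cocycle k d 'rV[k]_d
    (fun x z => [/\ X x, X z & unit_at X (fun v => D z v / D x v) z])
    (fun x y z => D y z / D x z).

Lemma frame_near D x z : coh X D -> @chart _ _ (frame_bundle D) x z ->
  near X z (@chart _ _ (frame_bundle D) x).
Proof.
move=> cD [Xx Xz uz].
apply: near_mono (near_and (cD z Xz) (near_and (unit_nearby Xz uz)
  (near_near (coh_neq0 Xz cD)))) => v Xv [h1 [h2 h3]]; split=> //.
apply: unit_near (unitM h1 h2) => //; apply: near_mono h3 => w Xw nw.
by rewrite mulrA divfK.
Qed.

Lemma frame_neq0 D x z : coh X D -> @chart _ _ (frame_bundle D) x z -> D x z != 0.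
Proof. by move=> cD [Xx Xz [_]]; apply: contra_neq => ->; rewrite invr0 mulr0. Qed.

Lemma frame_bundle_line D : (forall x, X x -> is_point x) -> coh X D ->
  line_bundle predT X (frame_bundle D).
Proof.
move=> pX cD; split=> /=.
- by move=> x; apply: open_inP => // z Xz; apply: frame_near.
- by move=> x Xx; exists x; split=> //; apply: near_here (cD x Xx).
- move=> x y; apply: reg_regular_on => z Xz [[_ _ ux] [_ _ uy]].
  have [] := unitM ux (unitV Xz uy) => h _; apply: sec_near h.
  apply: near_mono (coh_neq0 Xz cD) => v Xv nv.
  by rewrite invf_div mulf_div [D x v * _]mulrC -mulf_div divff // mul1r.
- move=> x y z Xz cx cy; apply/eqP; rewrite mulf_neq0 ?invr_eq0 //; exact: frame_neq0 cD _.
- by move=> x y w z Xz cx cy cw; rewrite mulrC mulrA divfK //; apply: frame_neq0 cD cy.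
Qed.

Lemma frame_bundle_rep D : coh X D -> rep X (frame_bundle D) D.
Proof.
move=> cD; exists (fun x z => D x z); split=> /=.
- by move=> x y z Xz cx cy; rewrite divfK //; apply: frame_neq0 cD cx.
- by move=> x z Xz; apply: frame_neq0.
- by move=> x Xx; exists x; split=> //; apply: near_here (cD x Xx).
- by move=> x z Xz; apply: frame_near.
- move=> x z Xz [_ _ ux]; apply: unit_ext (unitV Xz ux) => // v Xv.
  by rewrite invf_div.
Qed.

End Basic.

Section Pullback.

Variables (d e : nat) (X : 'rV[k]_d -> Prop) (Y : 'rV[k]_e -> Prop).
Variable f : 'rV[k]_d -> 'rV[k]_e.
Hypothesis mf : morph X Y f.

Lemma triv_pull D : triv Y D -> triv X (fun x z => D (f x) (f z)).
Proof.
have [f1 f2] := mf; move=> [H hH]; exists (fun z => H (f z)) => x Xx.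
by apply: (morph_unit f1 Xx (f2 x Xx) (hH _ (f1 _ Xx))).
Qed.

Lemma coh_pull D : coh Y D -> coh X (fun x z => D (f x) (f z)).
Proof.
have [f1 f2] := mf; move=> cD x Xx.
apply: near_mono (morph_near f1 (f2 x Xx) (cD _ (f1 _ Xx)) Xx) => z Xz h.
exact: (morph_unit f1 Xz (f2 z Xz) h).
Qed.

Lemma rep_by_pull L D u : @rep_by e Y L D u ->
  @rep_by d X (pullback f L) (fun x z => D (f x) (f z)) (fun i z => u i (f z)).
Proof.
have [f1 f2] := mf; move=> [eu nu cov op hu]; split=> /=.
- by move=> i j z /f1; apply: eu.
- by move=> i z /f1; apply: nu.
- by move=> x /f1; apply: cov.
- by move=> i x Xx ci; apply: (morph_near f1 (f2 x Xx) (op i _ (f1 _ Xx) ci) Xx).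
- by move=> i x Xx ci; apply: (morph_unit f1 Xx (f2 x Xx) (hu i _ (f1 _ Xx) ci)).
Qed.

Lemma rep_pull L D : rep Y L D -> rep X (pullback f L) (fun x z => D (f x) (f z)).
Proof. by move=> [u hu]; exists (fun i z => u i (f z)); apply: rep_by_pull. Qed.

End Pullback.

Definition lead_index (e : nat) (x : 'rV[k]_e) : option 'I_e := [pick i | x 0 i == 1].

(** Near a point [x] the bundle O(1) is framed by a coordinate that equals 1 at [x]; the default 0
    is for vectors without such a coordinate. *)
Definition hyper_frame (e : nat) (x z : 'rV[k]_e) : k :=
  if lead_index x is Some i then z 0 i else 0.

Lemma lead_indexP e (x : 'rV[k]_e) : is_point x -> exists2 i, lead_index x = Some i & x 0 i = 1.
Proof.
move=> [i [xi _]]; rewrite /lead_index; case: pickP => [j /eqP xj|/(_ i)]; first by exists j.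
by rewrite xi eqxx.
Qed.

Lemma rep_hyperplane e (Y : 'rV[k]_e -> Prop) : (forall y, Y y -> is_point y) ->
  rep Y (hyperplane_bundle k e) (@hyper_frame e).
Proof.
move=> pY; exists (fun i z => z 0 i); split=> /=.
- by move=> i j z _ /eqP ci _; rewrite divfK.
- by move=> i z _ /eqP.
- by move=> x /pY [i [xi _]]; exists i; rewrite xi; apply/eqP/oner_neq0.
- move=> i x Yx /eqP ci; apply: near_mono (near_form _ (fformX k i) ci) => z _ /eqP //.
- move=> i x Yx /eqP ci; have [j ej xj] := lead_indexP (pY _ Yx).
  have xj0 : x 0 j != 0 by rewrite xj oner_neq0.
  rewrite /hyper_frame ej; split; last by rewrite mulf_neq0 ?invr_eq0.
  by apply: (@secV _ _ _ 1) => //; apply: sec_form; apply: fformX.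
Qed.

End Frames.

(** * The commutative group of points *)

Section Groups.

Variables (k : closedFieldType) (d : nat).

Record agroup (A : group_data k d) : Prop := AGroup {
  ag_clo : clo (pts A);
  ag_irr : irr (pts A);
  ag_zero : pts A (zero A);
  ag_add : forall x y, pts A x -> pts A y -> pts A (add A x y);
  ag_opp : forall x, pts A x -> pts A (opp A x);
  ag_assoc : forall x y z, pts A x -> pts A y -> pts A z ->
    add A x (add A y z) = add A (add A x y) z;
  ag_comm : forall x y, pts A x -> pts A y -> add A x y = add A y x;
  ag_add0 : forall x, pts A x -> add A (zero A) x = x;
  ag_oppl : forall x, pts A x -> add A (opp A x) x = zero A;
  ag_madd : exists2 h, morph (product (pts A) (pts A)) (pts A) h &
    forall x y, pts A x -> pts A y -> h (segre x y) = add A x y;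
  ag_mopp : morph (pts A) (pts A) (opp A) }.

Lemma abelian_agroup F A : abelian_variety F A ->
  (forall x y, pts A x -> pts A y -> add A x y = add A y x) -> agroup A.
Proof.
move=> [[cA iA] [zA _] [h [mh eh]] mo ax] com.
have mh' := morphism_over_morph mh; have mo' := morphism_over_morph mo.
have adA x y : pts A x -> pts A y -> pts A (add A x y).
  by move=> Ax Ay; rewrite -eh //; apply: mh'.1; exists x, y.
split=> //.
- apply/cloP; have [S [hS hZ]] := cA; exists S; split=> // f /hS [m [hf _]].
  by exists m; apply/fform_over.
- exact: mo'.1.
- by move=> x y z Ax Ay Az; have [] := ax x y z Ax Ay Az.
- by move=> x Ax; have [] := ax x x x Ax Ax Ax.
- by move=> x Ax; have [] := ax x x x Ax Ax Ax.
- by exists h.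
Qed.

Section Group.

Variables (A : group_data k d) (hA : agroup A).

Definition ptb (x : 'rV[k]_d) : bool :=
  if excluded_middle_informative (pts A x) then true else false.

Lemma ptbP x : reflect (pts A x) (ptb x).
Proof. by rewrite /ptb; case: excluded_middle_informative => h; constructor. Qed.

(** The [let] keeps [hA] in the type, so that the group structure declared below can depend on
    it. *)
Definition Gp : Type := let _ := hA in {x : 'rV[k]_d | ptb x}.

HB.instance Definition _ := SubType.copy Gp {x : 'rV[k]_d | ptb x}.
HB.instance Definition _ := [Choice of Gp by <:].

Implicit Types x y z : Gp.

Lemma ptsG x : pts A (val x).
Proof. exact/ptbP/(valP x). Qed.

Lemma pointG x : is_point (val x).
Proof. exact: (ag_clo hA).1 (ptsG x). Qed.

Definition mkG u (Au : pts A u) : Gp := Sub u (introT (ptbP u) Au).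

Definition inG (u : 'rV[k]_d) : Gp := insubd (mkG (ag_zero hA)) u.

Lemma inGK u : pts A u -> val (inG u) = u.
Proof. by move=> /ptbP pu; rewrite /inG insubdK. Qed.

Lemma valGK x : inG (val x) = x.
Proof. by apply/val_inj; rewrite inGK //; apply: ptsG. Qed.

Definition addG x y := inG (add A (val x) (val y)).
Definition oppG x := inG (opp A (val x)).

Lemma val_addG x y : val (addG x y) = add A (val x) (val y).
Proof. by rewrite inGK //; apply: (ag_add hA); apply: ptsG. Qed.

Lemma addGA : associative addG.
Proof. by move=> x y z; apply/val_inj; rewrite !val_addG (ag_assoc hA) //; apply: ptsG. Qed.

Lemma addGC : commutative addG.
Proof. by move=> x y; apply/val_inj; rewrite !val_addG (ag_comm hA) //; apply: ptsG. Qed.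

Lemma add0G : left_id (inG (zero A)) addG.
Proof.
move=> x; apply/val_inj; rewrite val_addG inGK; last exact: (ag_zero hA).
by rewrite (ag_add0 hA) //; apply: ptsG.
Qed.

Lemma addNG : left_inverse (inG (zero A)) oppG addG.
Proof.
move=> x; apply/val_inj; rewrite val_addG inGK; last exact: (ag_zero hA).
rewrite inGK; last exact: (ag_opp hA (ptsG x)).
by rewrite (ag_oppl hA) //; apply: ptsG.
Qed.

HB.instance Definition _ := GRing.isZmodule.Build Gp addGA addGC add0G addNG.

Lemma valD x y : val (x + y) = add A (val x) (val y).
Proof. exact: val_addG. Qed.

Lemma val0 : val (0 : Gp) = zero A.
Proof. by rewrite inGK //; apply: (ag_zero hA). Qed.

Lemma valN x : val (- x) = opp A (val x).
Proof. by rewrite inGK //; apply: (ag_opp hA (ptsG x)). Qed.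

Lemma valMn x n : val (x *+ n) = mult A n (val x).
Proof.
elim: n => [|n IH]; first by rewrite mulr0n val0.
by rewrite mulrS valD IH.
Qed.

Lemma inG0 : inG (zero A) = 0.
Proof. by []. Qed.

Lemma pts_mult n u : pts A u -> pts A (mult A n u).
Proof. by move=> Au; rewrite -(inGK Au) -valMn; apply: ptsG. Qed.

Lemma inGD u v : pts A u -> pts A v -> inG (add A u v) = inG u + inG v.
Proof. by move=> Au Av; apply/val_inj; rewrite valD !inGK //; apply: (ag_add hA). Qed.

Lemma inGMn u n : pts A u -> inG (mult A n u) = inG u *+ n.
Proof. by move=> Au; apply/val_inj; rewrite valMn !inGK //; apply: pts_mult. Qed.

Lemma inG_eq0 u : pts A u -> inG u = 0 <-> u = zero A.
Proof.
by move=> Au; split=> [e|->//]; rewrite -(inGK Au) e val0.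
Qed.

Lemma morph_addG e (X : 'rV[k]_e -> Prop) f g : morph X (pts A) f -> morph X (pts A) g ->
  morph X (pts A) (fun u => add A (f u) (g u)).
Proof.
move=> mf mg; have [h mh eh] := ag_madd hA.
apply: morph_ext (morph_comp (morph_pair mf mg) mh) => u Xu.
by rewrite eh //; [apply: mf.1|apply: mg.1].
Qed.

Lemma morph_constG e (X : 'rV[k]_e -> Prop) x : morph X (pts A) (fun=> val x).
Proof. by apply: morph_const; [apply: pointG|apply: ptsG]. Qed.

Lemma morph_idG : morph (pts A) (pts A) id.
Proof. by apply: morph_id => x; apply: (ag_clo hA).1. Qed.

Lemma morph_trans x : morph (pts A) (pts A) (fun u => add A u (val x)).
Proof. by apply: morph_addG; [apply: morph_idG|apply: morph_constG]. Qed.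

Lemma morph_mult n : morph (pts A) (pts A) (mult A n).
Proof.
elim: n => [|n IH]; last by apply: (morph_addG morph_idG IH).
by have := morph_constG (pts A) 0; rewrite val0.
Qed.

End Group.

End Groups.

Arguments inG {k d A} hA u.
Arguments Gp {k d A} hA.

(** * The Weil pairing of a polarization *)

Section PicardZero.

Variables (k : closedFieldType) (d : nat) (A : group_data k d) (hA : agroup A).
Implicit Types (N M : 'rV[k]_d -> 'rV[k]_d -> k).

Definition pic0 N : Prop := coh (pts A) N /\ forall a, pts A a ->
  triv (pts A) (fun x z => N (add A x a) (add A z a) / N x z).

Lemma triv_near (e : nat) (X : 'rV[k]_e -> Prop) D E :
  (forall x, X x -> near X x (fun z => D x z = E x z)) -> triv X D -> triv X E.
Proof.
move=> h [H hH]; exists H => x Xx; apply: unit_near (hH x Xx) => //.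
by apply: near_mono (h x Xx) => z _ ->.
Qed.

Lemma trans_pts a : pts A a -> morph (pts A) (pts A) (fun u => add A u a).
Proof. by move=> Aa; have := morph_trans (mkG hA Aa). Qed.

Lemma slice_morph (e : nat) (S : 'rV[k]_e -> Prop) s : (forall t, S t -> is_point t) -> S s ->
  morph (pts A) (product (pts A) S) (fun x => segre x s).
Proof.
move=> pS Ss; apply: morph_pair; first exact: (morph_idG hA).
by apply: morph_const => //; apply: pS.
Qed.

Lemma slice_morph0 (e : nat) (S : 'rV[k]_e -> Prop) a : (forall t, S t -> is_point t) -> pts A a ->
  morph S (product (pts A) S) (fun s => segre a s).
Proof.
move=> pS Aa; apply: morph_pair; last exact: morph_id.
by apply: morph_const => //; apply: (ag_clo hA).1.
Qed.

Lemma triv_pic0 N : coh (pts A) N -> triv (pts A) N -> pic0 N.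
Proof.
move=> cN tN; split=> // a Aa; exact: trivM (triv_pull (trans_pts Aa) tN) (trivV tN).
Qed.

Lemma unit_const_triv (e : nat) (X : 'rV[k]_e -> Prop) (c : 'rV[k]_e -> k) :
  (forall x, X x -> c x != 0) -> triv X (fun x _ => c x).
Proof. by move=> hc; apply: unit_triv => x Xx; apply: unitC; apply: hc. Qed.

Definition hom (e : nat) (X : group_data k e) (f : 'rV[k]_d -> 'rV[k]_e) : Prop :=
  morph (pts A) (pts X) f /\
  forall x y, pts A x -> pts A y -> f (add A x y) = add X (f x) (f y).

End PicardZero.

Section Dual.

Variables (k : closedFieldType) (d b : nat) (A : group_data k d) (B : group_data k b).
Variables (hA : agroup A) (hB : agroup B).
Variable D : 'rV[k]_(d * b) -> 'rV[k]_(d * b) -> k.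
Variables (lam : 'rV[k]_d -> 'rV[k]_b) (L : 'rV[k]_d -> 'rV[k]_d -> k).

Local Notation X := (pts A).
Local Notation Y := (pts B).

Definition Pf (y : 'rV[k]_b) (x z : 'rV[k]_d) : k := D (segre x y) (segre z y).

Definition classifies (e : nat) (S : 'rV[k]_e -> Prop) M (phi : 'rV[k]_e -> 'rV[k]_b) :=
  morph S Y phi /\ triv (product X S) (fun w v =>
    D (segre (fst_point w) (phi (snd_point w))) (segre (fst_point v) (phi (snd_point v)))
    / M w v).

Record dual_frames : Prop := DualFrames {
  df_coh : coh (product X Y) D;
  df_pic0 : forall y, Y y -> pic0 A (Pf y);
  df_triv0 : triv X (Pf (zero B));
  df_triv0' : triv Y (fun y v => D (segre (zero A) y) (segre (zero A) v));
  df_univ : forall (e : nat) (S : 'rV[k]_e -> Prop) M, clo S -> irr S ->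
    coh (product X S) M ->
    (forall s, S s -> pic0 A (fun x z => M (segre x s) (segre z s))) ->
    triv S (fun s t => M (segre (zero A) s) (segre (zero A) t)) ->
    (exists phi, classifies S M phi) /\
    (forall phi psi, classifies S M phi -> classifies S M psi ->
      forall s, S s -> phi s = psi s) }.

Hypothesis hD : dual_frames.

Let pX x : X x -> is_point x. Proof. exact: (ag_clo hA).1. Qed.
Let pY y : Y y -> is_point y. Proof. exact: (ag_clo hB).1. Qed.

(** The class of [N] in the dual variety is [y]. *)
Definition cls (N : 'rV[k]_d -> 'rV[k]_d -> k) (y : 'rV[k]_b) : Prop :=
  triv X (fun x z => Pf y x z / N x z).

Lemma Pf_coh y : Y y -> coh X (Pf y).
Proof. by move=> /(df_pic0 hD) []. Qed.

Lemma classifies_slice (e : nat) (S : 'rV[k]_e -> Prop) M phi s :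
  (forall t, S t -> is_point t) -> S s ->
  classifies S M phi -> cls (fun x z => M (segre x s) (segre z s)) (phi s).
Proof.
move=> pS Ss [mphi /(triv_pull (slice_morph hA pS Ss))]; apply: triv_ext => x z Xx Xz.
by rewrite !fst_segre ?snd_segre //; try exact: pX; apply: pS.
Qed.

(** A one-point variety: over it the universal property classifies single elements of Pic0. *)
Let S1 : 'rV[k]_1 -> Prop := eq (const_mx 1).

Let pt1 : is_point (const_mx 1 : 'rV[k]_1).
Proof. by exists 0; split=> [|j]; rewrite ?mxE // ord1. Qed.

Let pS1 s : S1 s -> is_point s.
Proof. by move=> <-. Qed.

Let cS1 : clo S1.
Proof. exact: clo_point. Qed.

Let iS1 : irr S1.
Proof.
split; first by exists (const_mx 1).
move=> Z1 Z2 _ _ h; have [h1|h1] := h _ erefl; [left|right]; by move=> x <-.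
Qed.

Let mfst1 : morph (product X S1) X (@fst_point k d 1).
Proof. exact: morph_fst pX pS1. Qed.

Section Point.

Variable N : 'rV[k]_d -> 'rV[k]_d -> k.
Hypothesis hN : pic0 A N.

Let M (w v : 'rV[k]_(d * 1)) := N (fst_point w) (fst_point v).

Let hM : [/\ coh (product X S1) M,
  forall s, S1 s -> pic0 A (fun x z => M (segre x s) (segre z s)) &
  triv S1 (fun s t => M (segre (zero A) s) (segre (zero A) t))].
Proof.
split.
- by have [cN _] := hN; have := coh_pull mfst1 cN.
- move=> s Ss; have e x z : X x -> X z -> M (segre x s) (segre z s) = N x z.
    by move=> Xx Xz; rewrite /M !fst_segre //; try exact: pX; apply: pS1.
  have [cN tN] := hN; split.
    move=> x Xx; apply: near_mono (cN x Xx) => z Xz h; apply: unit_ext h => // v Xv.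
    by rewrite !e.
  move=> a Xa; apply: triv_ext (tN a Xa) => x z Xx Xz.
  by rewrite !e //; apply: (ag_add hA).
- apply: triv_ext (unit_const_triv (c := fun=> N (zero A) (zero A)) _) => [s t Ss St|_ _].
    by rewrite /M !fst_segre //; first [exact: pX (ag_zero hA) | exact: pS1].
  by apply: coh_self (ag_zero hA) _; case: hN.
Qed.

Lemma cls_exists : exists2 y, Y y & cls N y.
Proof.
have [cM pM tM] := hM; have [[phi hphi] _] := df_univ hD cS1 iS1 cM pM tM.
exists (phi (const_mx 1)); first by case: hphi => [[h _] _]; apply: h.
have := classifies_slice pS1 (erefl : S1 (const_mx 1)) hphi.
by apply: triv_ext => x z Xx Xz; rewrite /M !fst_segre //; apply: pX.
Qed.

Lemma cls_unique y y' : Y y -> Y y' -> cls N y -> cls N y' -> y = y'.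
Proof.
move=> Yy Yy' h h'; have [cM pM tM] := hM; have [_ uni] := df_univ hD cS1 iS1 cM pM tM.
have c z : Y z -> cls N z -> classifies S1 M (fun=> z).
  move=> Yz hz; split; first by apply: morph_const => //; apply: pY.
  by have := triv_pull mfst1 hz.
exact: (uni _ _ (c y Yy h) (c y' Yy' h') _ (erefl : S1 (const_mx 1))).
Qed.

End Point.

Lemma cls_equiv N M y : Y y -> coh X M -> coh X N -> triv X (fun x z => N x z / M x z) ->
  cls N y -> cls M y.
Proof.
move=> Yy cM cN h1 h2; apply: triv_near (trivM h2 h1) => x Xx.
apply: near_mono (coh_neq0 Xx cN) => z Xz nN.
by rewrite mulrA divfK.
Qed.

Lemma cls_triv N : coh X N -> triv X N -> cls N (zero B).
Proof. by move=> cN tN; apply: trivM (df_triv0 hD) (trivV tN). Qed.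

Lemma cls0_triv N : coh X N -> cls N (zero B) -> triv X N.
Proof.
move=> cN h; apply: triv_near (trivM (trivV h) (df_triv0 hD)) => x Xx.
apply: near_mono (near_and (coh_neq0 Xx cN) (coh_neq0 Xx (Pf_coh (ag_zero hB)))).
by move=> z Xz [nN nP]; rewrite invf_div divfK.
Qed.

Lemma cls_triv_eq0 N y : pic0 A N -> Y y -> triv X N -> cls N y -> y = zero B.
Proof.
move=> hN Yy tN h; apply: (cls_unique hN) => //; first exact: (ag_zero hB).
by apply: cls_triv => //; case: hN.
Qed.

(* The restriction of this bundle on [A * A] to each [A * {s}] is trivial, hence it is
   classified by the zero morphism. *)
Lemma pic0_primitive N : pic0 A N -> triv (product X X) (fun w v =>
  N (add A (fst_point w) (snd_point w)) (add A (fst_point v) (snd_point v)) /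
  (N (fst_point w) (fst_point v) * N (snd_point w) (snd_point v))).
Proof.
move=> hN; have [cN tN] := hN; set M := (fun w v => _).
have m1 := morph_fst pX pX; have m2 := morph_snd pX pX.
have cM : coh (product X X) M.
  have c1 := coh_pull m1 cN; have c2 := coh_pull m2 cN.
  by have := cohM (coh_pull (morph_addG hA m1 m2) cN) (cohV (cohM c1 c2)).
have ns s : X s -> N s s != 0 by move=> Xs; apply: coh_self cN.
have eM s x z : X s -> X x -> X z -> M (segre x s) (segre z s) =
    N (add A x s) (add A z s) / N x z * (N s s)^-1.
  by move=> Xs Xx Xz; rewrite /M !fst_segre ?snd_segre ?invfM ?mulrA //; apply: pX.
have trM s : X s -> triv X (fun x z => M (segre x s) (segre z s)).
  move=> Xs; have h := trivM (tN s Xs) (unit_const_triv (X := X) (fun _ _ => invr_neq0 (ns s Xs))).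
  by apply: triv_ext h => x z Xx Xz; rewrite eM.
have cMs s : X s -> coh X (fun x z => M (segre x s) (segre z s)).
  by move=> Xs; have := coh_pull (slice_morph hA pX Xs) cM.
have pM s : X s -> pic0 A (fun x z => M (segre x s) (segre z s)).
  by move=> Xs; apply: triv_pic0 => //; [apply: cMs|apply: trM].
have tM : triv X (fun s t => M (segre (zero A) s) (segre (zero A) t)).
  have nz : X (zero A) := ag_zero hA.
  apply: (@triv_near _ _ _ (fun s t => (N (zero A) (zero A))^-1)); last first.
    by apply: unit_const_triv => s _; rewrite invr_eq0; apply: ns.
  move=> s Xs; apply: near_mono (coh_neq0 Xs cN) => t Xt nt.
  rewrite /M !fst_segre ?snd_segre ?(ag_add0 hA) //; try exact: pX.
  by rewrite invfM mulrCA divff ?mulr1.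
have [[phi hphi] _] := df_univ hD (ag_clo hA) (ag_irr hA) cM pM tM.
have phi0 s : X s -> phi s = zero B.
  move=> Xs; apply: (@cls_triv_eq0 (fun x z => M (segre x s) (segre z s))).
  - exact: pM.
  - by case: hphi => [[h _] _]; apply: h.
  - exact: trM.
  - exact: classifies_slice pX Xs hphi.
have t0 := triv_pull m1 (df_triv0 hD).
have [_ tphi] := hphi.
apply: triv_near (trivM (trivV tphi) t0) => w Ww.
have Xf : X (fst_point w) := m1.1 w Ww.
apply: near_mono (near_and (coh_neq0 Ww cM) (coh_neq0 Ww (coh_pull m1 (Pf_coh (ag_zero hB)))))
  => v Wv [nM nP].
rewrite !phi0; [|exact: m2.1|exact: m2.1].
by rewrite -/(Pf _ _ _) invf_div divfK.
Qed.

Lemma pic0_add (e : nat) (Z : 'rV[k]_e -> Prop) f g N : pic0 A N ->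
  morph Z X f -> morph Z X g ->
  triv Z (fun x z => N (add A (f x) (g x)) (add A (f z) (g z)) /
    (N (f x) (f z) * N (g x) (g z))).
Proof.
move=> hN mf mg; apply: triv_ext (triv_pull (morph_pair mf mg) (pic0_primitive hN)).
move=> x z Zx Zz; rewrite !fst_segre ?snd_segre //; apply: pX; by [apply: mf.1|apply: mg.1].
Qed.

Lemma hom0 e (C : group_data k e) (hC : agroup C) f : hom A C f -> f (zero A) = zero C.
Proof.
move=> [mf af]; have A0 := ag_zero hA.
have := af _ _ A0 A0; rewrite (ag_add0 hA) // => /(congr1 (inG hC)).
rewrite inGD; try exact: mf.1.
move=> /esym/eqP; rewrite -[X in _ == X]addr0 (inj_eq (addrI _)) => /eqP f0.
by apply/(inG_eq0 hC (mf.1 _ A0)).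
Qed.

Lemma pic0_pull f N : hom A A f -> pic0 A N -> pic0 A (fun x z => N (f x) (f z)).
Proof.
move=> [mf af] [cN tN]; split=> [|a Xa]; first by have := coh_pull mf cN.
apply: triv_ext (triv_pull mf (tN (f a) (mf.1 _ Xa))) => x z Xx Xz.
by rewrite !af.
Qed.

(** The dual homomorphism: the universal property is applied to the Poincare bundle pulled back
    along [f] on the first factor. *)
Lemma dual_hom f : hom A A f -> exists2 phi, morph Y Y phi &
  forall y, Y y -> cls (fun x z => Pf y (f x) (f z)) (phi y).
Proof.
move=> hf; have [mf af] := hf.
have m1 := morph_fst pX pY; have m2 := morph_snd pX pY.
pose M (w v : 'rV[k]_(d * b)) := D (segre (f (fst_point w)) (snd_point w))
   (segre (f (fst_point v)) (snd_point v)).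
have eM y x z : Y y -> X x -> X z -> M (segre x y) (segre z y) = Pf y (f x) (f z).
  by move=> Yy Xx Xz; rewrite /M !fst_segre ?snd_segre //; by [apply: pX|apply: pY].
have [|||[phi hphi] _] := @df_univ hD b Y M (ag_clo hB) (ag_irr hB).
- by have := coh_pull (morph_pair (morph_comp m1 mf) m2) (df_coh hD).
- move=> y Yy; have := pic0_pull hf (df_pic0 hD Yy).
  move=> [c t]; split.
    move=> x Xx; apply: near_mono (c x Xx) => z Xz h; apply: unit_ext h => // v Xv.
    by rewrite !eM.
  move=> a Xa; apply: triv_ext (t a Xa) => x z Xx Xz.
  by rewrite !eM //; apply: (ag_add hA).
- apply: triv_ext (df_triv0' hD) => y v Yy Yv.
  by rewrite /M !fst_segre ?snd_segre ?(hom0 hA hf) //; by [exact: pX (ag_zero hA)|apply: pY].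
exists phi; first by case: hphi.
move=> y Yy; apply: triv_ext (classifies_slice pY Yy hphi) => x z Xx Xz.
by rewrite eM.
Qed.

End Dual.

Section Polarized.

Variables (k : closedFieldType) (d b : nat) (A : group_data k d) (B : group_data k b).
Variables (hA : agroup A) (hB : agroup B).
Variable D : 'rV[k]_(d * b) -> 'rV[k]_(d * b) -> k.
Hypothesis hD : dual_frames A B D.

Local Notation X := (pts A).
Local Notation Y := (pts B).
Local Notation GA := (Gp hA).
Local Notation GB := (Gp hB).
Local Notation Pf := (Pf D).
Local Notation cls := (cls A D).

Implicit Types (x z t : GA) (y : GB) (N M : 'rV[k]_d -> 'rV[k]_d -> k).

Record polarized (lam : 'rV[k]_d -> 'rV[k]_b) (L : 'rV[k]_d -> 'rV[k]_d -> k) : Prop :=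
  Polarized {
    pol_hom : hom A B lam;
    pol_inv : exists mu, [/\ morph Y X mu, forall u, X u -> mu (lam u) = u &
      forall v, Y v -> lam (mu v) = v];
    pol_coh : coh X L;
    pol_eq : forall w, X w -> triv X (fun u v => Pf (lam w) u v /
      (L (add A u w) (add A v w) / L u v)) }.

Variables (lam : 'rV[k]_d -> 'rV[k]_b) (L : 'rV[k]_d -> 'rV[k]_d -> k).
Hypothesis hpol : polarized lam L.

Definition lamG x : GB := inG hB (lam (val x)).

Lemma val_lamG x : val (lamG x) = lam (val x).
Proof. by rewrite inGK //; apply: (pol_hom hpol).1.1; apply: ptsG. Qed.

Lemma lamG_add : {morph lamG : x z / x + z}.
Proof.
move=> x z; apply/val_inj; rewrite valD !val_lamG valD.
by apply: (pol_hom hpol).2; apply: ptsG.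
Qed.

Lemma lamG_sub : zmod_morphism lamG.
Proof. by move=> x z; apply: (addIr (lamG z)); rewrite -lamG_add !subrK. Qed.

HB.instance Definition _ := GRing.isZmodMorphism.Build GA GB lamG lamG_sub.

Lemma lamG_muln x n : lamG (x *+ n) = lamG x *+ n.
Proof. exact: raddfMn. Qed.

Lemma lamG0 : lamG 0 = 0.
Proof. exact: raddf0. Qed.

Lemma lamG_bij : bijective lamG.
Proof.
have [mu [mmu muK lmu]] := pol_inv hpol.
exists (fun y => inG hA (mu (val y))) => [x|y]; apply/val_inj.
  by rewrite val_lamG muK ?valGK //; apply: ptsG.
rewrite val_lamG inGK; last by apply: mmu.1; apply: ptsG.
by apply: lmu; apply: ptsG.
Qed.

Lemma PfG_pic0 y : pic0 A (Pf (val y)).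
Proof. by apply: (df_pic0 hD); apply: ptsG. Qed.

Lemma PfG_coh y : coh X (Pf (val y)).
Proof. by case: (PfG_pic0 y). Qed.

(* The theorem of the square, read off from [pol_eq] and the translation invariance of
   the classes in [Pic0]. *)
Lemma Pf_add y y' : triv X (fun u v =>
  Pf (val (y + y')) u v / (Pf (val y) u v * Pf (val y') u v)).
Proof.
have [g gK Kg] := lamG_bij.
rewrite -(Kg y) -(Kg y') -raddfD /=; set x := g y; set x' := g y'; rewrite !val_lamG.
have cL := pol_coh hpol; have eP := pol_eq hpol.
have mt := trans_pts hA (ptsG x'); have mt2 := trans_pts hA (ptsG x).
have mt12 := trans_pts hA (ptsG (x + x')).
have [cP tP] := PfG_pic0 (lamG x); rewrite val_lamG in cP tP.
have ta := eP _ (ptsG (x + x')).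
have tb := triv_pull mt (eP _ (ptsG x)).
have tc := eP _ (ptsG x').
have te := tP _ (ptsG x').
apply: triv_near (trivM (trivM (trivM ta (trivV tb)) te) (trivV tc)) => u Xu.
have cPt := coh_pull mt cP; have cL12 := coh_pull mt12 cL; have cLt := coh_pull mt cL.
apply: near_mono (near_and (coh_neq0 Xu cPt) (near_and (coh_neq0 Xu cL12)
  (near_and (coh_neq0 Xu cLt) (coh_neq0 Xu cL)))) => v Xv [n1 [n2 [n3 n4]]].
have e w : X w -> add A (add A w (val x')) (val x) = add A w (val (x + x')).
  by move=> Xw; rewrite [x + x']addrC valD (ag_assoc hA) //; apply: ptsG.
rewrite !e //; set p12 := Pf _ u v; set p1 := Pf (lam (val x)) u v.
set p2 := Pf (lam (val x')) u v; set pt := Pf (lam (val x)) (add A u _) _ in n1 *.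
set l12 := L _ (add A v (val (x + x'))) in n2 *.
set lt := L (add A u (val x')) _ in n3 *; set l := L u v in n4 *.
have [->|n5] := eqVneq p1 0; first by rewrite invr0 !mulr0 !mul0r invr0 mulr0.
have [->|n6] := eqVneq p2 0; first by rewrite !mulr0 mul0r invr0 !mulr0.
by field; rewrite n1 n2 n3 n4 n5 n6.
Qed.

Lemma cls_mul N M y y' : coh X N -> coh X M ->
  cls N (val y) -> cls M (val y') -> cls (fun u v => N u v * M u v) (val (y + y')).
Proof.
move=> cN cM h h'; apply: triv_near (trivM (Pf_add y y') (trivM h h')) => u Xu.
apply: near_mono (near_and (coh_neq0 Xu (PfG_coh y)) (coh_neq0 Xu (PfG_coh y'))).
by move=> v Xv [n1 n2]; rewrite mulf_div mulrA divfK // mulf_neq0.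
Qed.

Lemma pic0_cls N : pic0 A N -> exists y, cls N (val y).
Proof.
by move=> hN; have [y Yy h] := cls_exists hA hD hN; exists (inG hB y); rewrite inGK.
Qed.

Lemma cls_inj N y y' : pic0 A N -> cls N (val y) -> cls N (val y') -> y = y'.
Proof.
by move=> hN h h'; apply/val_inj; apply: (cls_unique hA hB hD hN) => //; apply: ptsG.
Qed.

Lemma cls_val0 N : coh X N -> triv X N -> cls N (val (0 : GB)).
Proof. by move=> cN tN; rewrite val0; apply: cls_triv. Qed.

Lemma cls_Pf y : cls (Pf (val y)) (val y).
Proof. by apply: coh_triv1; apply: PfG_coh. Qed.

Lemma multG_pull m N : pic0 A N -> pic0 A (fun u v => N (mult A m u) (mult A m v)).
Proof.
move=> hN; apply: (pic0_pull (f := mult A m)) hN; split; first exact: morph_mult hA m.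
move=> u v Xu Xv; rewrite -[u](inGK hA) // -[v](inGK hA) // -valD -!valMn -valD.
by rewrite mulrnDl.
Qed.

(** By [pic0_add] an element of Pic0 is additive in the argument, so its pullback by [mult A m] is
    its [m]-th power. *)
Lemma cls_mult m N y : pic0 A N -> cls N (val y) ->
  cls (fun u v => N (mult A m u) (mult A m v)) (val (y *+ m)).
Proof.
move=> hN h; elim: m => [|m IH].
  apply: cls_val0; first by case: (multG_pull 0 hN).
  apply: unit_triv => u Xu; exact: (unitC X u (coh_self (ag_zero hA) hN.1)).
have hm := multG_pull m hN; have hm1 := multG_pull m.+1 hN.
rewrite mulrS; apply: (cls_equiv _ _ _ _ (cls_mul hN.1 hm.1 h IH)).
- by apply: ptsG.
- by case: hm1.
- by apply: cohM; [case: hN|case: hm].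
have t := pic0_add hA hB hD hN (morph_idG hA) (morph_mult hA m).
by apply: triv_ext (trivV t) => u v _ _; rewrite invf_div.
Qed.

(** [H] trivializes the pullback of the bundle of [y] by [mult A m]: it is the function whose
    quotient by a translate is the Weil pairing. *)
Definition wtriv m y H := forall u, X u ->
  unit_at X (fun v => H v * Pf (val y) (mult A m u) (mult A m v)) u.

Lemma wtriv_exists m y : y *+ m = 0 -> exists H, wtriv m y H.
Proof.
move=> ym; have := cls_mult m (PfG_pic0 y) (cls_Pf y); rewrite ym val0.
by move=> /(cls0_triv hB hD (multG_pull m (PfG_pic0 y)).1).
Qed.

Lemma wtriv_neq0 m y H u : wtriv m y H -> X u -> H u != 0.
Proof. by move=> h Xu; have [_] := h u Xu; rewrite mulf_eq0 => /norP []. Qed.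

(** The quotient is a global regular function, hence constant; this makes the pairing well
    defined. *)
Lemma wtriv_unique m y H H' : wtriv m y H -> wtriv m y H' ->
  exists c, forall u, X u -> H' u = c * H u.
Proof.
move=> h h'.
have [|c hc] := @global_const _ _ X (fun u => H' u / H u) (ag_clo hA) (ag_irr hA).
  move=> u Xu; have [r _] := unitM (h' u Xu) (unitV Xu (h u Xu)).
  apply: sec_near r; apply: near_mono (coh_neq0 Xu (multG_pull m (PfG_pic0 y)).1) => v Xv n.
  by rewrite invfM mulrACA divff // mulr1.
by exists c => u Xu; rewrite -(hc u Xu) divfK // (wtriv_neq0 h).
Qed.

Lemma wtriv_trans m y H t : t *+ m = 0 -> wtriv m y H ->
  wtriv m y (fun u => H (add A u (val t))).
Proof.
move=> tm h u Xu; have mt := trans_pts hA (ptsG t).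
have e v : X v -> mult A m (add A v (val t)) = mult A m v.
  by move=> Xv; rewrite -[v](inGK hA) // -valD -!valMn mulrnDl tm addr0.
have := morph_unit mt.1 Xu (mt.2 u Xu) (h _ (mt.1 u Xu)).
by apply: unit_ext => // v Xv; rewrite !e.
Qed.

Definition we m t y : k := epsilon (inhabits 0)
  (fun c => exists2 H, wtriv m y H & forall z, H (val (z + t)) = c * H (val z)).

Lemma we_spec m t y : t *+ m = 0 -> y *+ m = 0 ->
  exists2 H, wtriv m y H & forall z, H (val (z + t)) = we m t y * H (val z).
Proof.
move=> tm ym; apply: (epsilon_spec (inhabits 0) (fun c => exists2 H, wtriv m y H &
  forall z, H (val (z + t)) = c * H (val z))).
have [H hH] := wtriv_exists ym; have [c hc] := wtriv_unique hH (wtriv_trans tm hH).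
by exists c, H => // z; rewrite valD (hc _ (ptsG z)).
Qed.

Lemma weP m t y H z : t *+ m = 0 -> y *+ m = 0 -> wtriv m y H ->
  H (val (z + t)) = we m t y * H (val z).
Proof.
move=> tm ym h; have [H' h' e'] := we_spec tm ym.
have [c hc] := wtriv_unique h' h.
by rewrite (hc _ (ptsG _)) e' mulrCA -(hc _ (ptsG z)).
Qed.

Lemma we_eq m t y H c : t *+ m = 0 -> y *+ m = 0 -> wtriv m y H ->
  (exists z, H (val (z + t)) = c * H (val z)) -> we m t y = c.
Proof.
move=> tm ym h [z hz]; apply: (mulIf (wtriv_neq0 h (ptsG z))).
by rewrite -(weP z tm ym h).
Qed.

Lemma we0l m y : y *+ m = 0 -> we m 0 y = 1.
Proof.
move=> ym; have [H h] := wtriv_exists ym; apply: (we_eq _ ym h); first exact: mul0rn.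
by exists 0; rewrite addr0 mul1r.
Qed.

Lemma weDl m t t' y : t *+ m = 0 -> t' *+ m = 0 -> y *+ m = 0 ->
  we m (t + t') y = we m t y * we m t' y.
Proof.
move=> tm tm' ym; have [H h] := wtriv_exists ym; apply: (we_eq _ ym h).
  by rewrite mulrnDl tm tm' addr0.
by exists 0; rewrite addrA (weP _ tm' ym h) (weP _ tm ym h) mulrCA mulrA.
Qed.

Lemma weDr m t y y' : t *+ m = 0 -> y *+ m = 0 -> y' *+ m = 0 ->
  we m t (y + y') = we m t y * we m t y'.
Proof.
move=> tm ym ym'; have [H h] := wtriv_exists ym; have [H' h'] := wtriv_exists ym'.
have [V hV] := Pf_add y y'; have mm := morph_mult hA m.
have yym : (y + y') *+ m = 0 by rewrite mulrnDl ym ym' addr0.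
have hw : wtriv m (y + y') (fun u => V (mult A m u) * (H u * H' u)).
  move=> u Xu.
  have h0 := morph_unit mm.1 Xu (mm.2 u Xu) (hV _ (mm.1 u Xu)).
  apply: unit_near (unitM h0 (unitM (h u Xu) (h' u Xu))) => //.
  apply: near_mono (near_and (coh_neq0 Xu (multG_pull m (PfG_pic0 y)).1)
    (coh_neq0 Xu (multG_pull m (PfG_pic0 y')).1)) => v Xv [n1 n2].
  by field; rewrite n1 n2.
apply: (we_eq tm yym hw); exists 0.
rewrite (weP _ tm ym h) (weP _ tm ym' h') -!valMn mulrnDl tm addr0.
by ring.
Qed.

Lemma weMnl m t y n : t *+ m = 0 -> y *+ m = 0 -> we m (t *+ n) y = we m t y ^+ n.
Proof.
move=> tm ym; elim: n => [|n IH]; first by rewrite mulr0n we0l.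
by rewrite mulrS weDl ?IH ?exprS // mulrnAC tm mul0rn.
Qed.

Lemma we_neq0 m t y : t *+ m = 0 -> y *+ m = 0 -> we m t y != 0.
Proof.
move=> tm ym; have [H h] := wtriv_exists ym.
have := wtriv_neq0 h (ptsG (0 + t)); rewrite (weP _ tm ym h).
by rewrite mulf_eq0 => /norP [].
Qed.

Lemma we0r m t : t *+ m = 0 -> we m t 0 = 1.
Proof.
move=> tm; apply: (mulIf (we_neq0 tm (mul0rn _ m))).
by rewrite -weDr ?mul0rn // addr0 mul1r.
Qed.

Lemma weMnr m t y n : t *+ m = 0 -> y *+ m = 0 -> we m t (y *+ n) = we m t y ^+ n.
Proof.
move=> tm ym; elim: n => [|n IH]; first by rewrite mulr0n we0r.
by rewrite mulrS weDr ?IH ?exprS // mulrnAC ym mul0rn.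
Qed.

(** Composing a trivialization at level [m] with [mult A m'] gives one at level [m * m']. *)
Lemma we_level m m' t y : t *+ (m * m') = 0 -> y *+ m = 0 ->
  we (m * m') t y = we m (t *+ m') y.
Proof.
move=> tm ym; have [H h] := wtriv_exists ym; have mm := morph_mult hA m'.
have ymm : y *+ (m * m') = 0 by rewrite mulrnA ym mul0rn.
have tm' : t *+ m' *+ m = 0 by rewrite -mulrnA mulnC.
have e v : X v -> mult A m (mult A m' v) = mult A (m * m') v.
  by move=> Xv; rewrite -[v](inGK hA) // -!valMn -mulrnA mulnC.
have hw : wtriv (m * m') y (fun u => H (mult A m' u)).
  move=> u Xu; have := morph_unit mm.1 Xu (mm.2 u Xu) (h _ (mm.1 u Xu)).
  by apply: unit_ext => // v Xv; rewrite !e.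
apply: (we_eq tm ymm hw); exists 0.
by rewrite -!valMn mulrnDl (weP _ tm' ym h).
Qed.

(** A trivialization for [y] composed with [f], and corrected by [V] after [mult A m], is one for
    [y']; the correction is invariant under translation by the torsion point [t]. *)
Lemma we_adjoint m f t y y' : hom A A f -> cls (fun u v => Pf (val y) (f u) (f v)) (val y') ->
  t *+ m = 0 -> y *+ m = 0 -> y' *+ m = 0 -> we m (inG hA (f (val t))) y = we m t y'.
Proof.
move=> hf hc tm ym ym'; have [mf af] := hf; have mm := morph_mult hA m.
have fm u : X u -> f (mult A m u) = mult A m (f u).
  move=> Xu; elim: m {tm ym ym' mm} => [|m IH]; first by rewrite /mult /= (hom0 hA hA hf).
  rewrite -[mult A m.+1 u]/(add A u (mult A m u)) af ?IH //; exact: (pts_mult hA).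
have [H h] := wtriv_exists ym; have [V hV] := hc.
have hw : wtriv m y' (fun u => V (mult A m u) * H (f u)).
  move=> u Xu.
  have h1 := morph_unit mm.1 Xu (mm.2 u Xu) (hV _ (mm.1 u Xu)).
  have h2 := morph_unit mf.1 Xu (mf.2 u Xu) (h _ (mf.1 u Xu)).
  apply: unit_near (unitM h1 h2) => //.
  apply: near_mono (coh_neq0 Xu (coh_pull mf (multG_pull m (PfG_pic0 y)).1)) => v Xv.
  rewrite -!fm // => n1; by field.
have ftm : inG hA (f (val t)) *+ m = 0.
  rewrite -inGMn; last by apply: mf.1; apply: ptsG.
  by rewrite -fm -?valMn ?tm ?val0 ?(hom0 hA hA hf) ?inG0 //; apply: ptsG.
apply/esym; apply: (we_eq tm ym' hw); exists 0.
rewrite -!valMn mulrnDl tm addr0 valD af; try exact: ptsG.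
have ft : X (f (val t)) by apply: mf.1; apply: ptsG.
have f0 : f (val (0 : GA)) = val (0 : GA) by rewrite val0 (hom0 hA hA hf).
rewrite f0; set s := inG hA (f (val t)) in ftm *.
have -> : f (val t) = val s by rewrite inGK.
by rewrite -valD (weP _ ftm ym h) mulrCA.
Qed.

(* Along the orbit of [t'] with [t = m t'], the product of the translates of [H] trivializes
   a bundle whose frames telescope, so it is constant. *)
Lemma we_alternating m t' : t' *+ m *+ m = 0 -> we m (t' *+ m) (lamG (t' *+ m)) = 1.
Proof.
move=> tmm; set t := t' *+ m; have tm : t *+ m = 0 := tmm.
have ym : lamG t *+ m = 0 by rewrite -raddfMn tm raddf0.
have [H h] := wtriv_exists ym.
have cL := pol_coh hpol; have [V hV] := pol_eq hpol (ptsG t).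
have mm := morph_mult hA m; have mt := trans_pts hA (ptsG t).
pose N u v := L (mult A m u) (mult A m v).
have cN : coh X N := coh_pull mm cL.
(* By [pol_eq] the bundle of [lamG t] is the quotient of a translate of [L] by [L]. Dividing by [V]
   makes this explicit, and such quotients telescope along the orbit of [t']. *)
pose H2 u := H u / V (mult A m u).
have addm (z w : GA) : mult A m (add A (val z) (val w)) = val (z *+ m + w *+ m).
  by rewrite -valD -valMn mulrnDl.
have hH2 u : X u -> unit_at X (fun v => H2 v * (N (add A u (val t')) (add A v (val t')) / N u v)) u.
  move=> Xu.
  have h1 := morph_unit mm.1 Xu (mm.2 u Xu) (hV _ (mm.1 u Xu)).
  have e v : X v -> N (add A u (val t')) (add A v (val t')) =
      L (add A (mult A m u) (val t)) (add A (mult A m v) (val t)).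
    by move=> Xv; rewrite /N -[u](inGK hA) // -[v](inGK hA) // !addm -!valMn -!valD.
  have cl : coh X (fun u v => L (add A (mult A m u) (val t)) (add A (mult A m v) (val t))).
    by have := coh_pull mm (coh_pull mt cL).
  apply: unit_near (unitM (h u Xu) (unitV Xu h1)) => //.
  have nV : near X u (fun v => V (mult A m v) != 0).
    apply: near_mono (sec_neq0 Xu h1.1 h1.2) => v Xv.
    by rewrite mulf_eq0 => /norP [].
  apply: near_mono (near_and nV (near_and (coh_neq0 Xu (multG_pull m (PfG_pic0 (lamG t))).1)
    (near_and (coh_neq0 Xu cN) (coh_neq0 Xu cl)))) => v Xv [n0 [n1 [n2 n3]]].
  rewrite e // /H2; rewrite -/(N u v); rewrite val_lamG in n1 *.
  by field; rewrite n0 n1 n2 n3.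
pose tr j u := add A u (val (t' *+ j)).
have mtr j : morph X X (tr j) := trans_pts hA (ptsG (t' *+ j)).
have trS j u : X u -> add A (tr j u) (val t') = tr j.+1 u.
  by move=> Xu; rewrite /tr -[u](inGK hA) // -!valD mulrSr addrA.
have tele n u : X u -> unit_at X (fun v => \prod_(j < n) H2 (tr j v) *
    (N (tr n u) (tr n v) / N u v)) u.
  move=> Xu; elim: n => [|n IH].
    apply: unit_near (unitC X u (oner_neq0 k)) => //.
    apply: near_mono (coh_neq0 Xu cN) => v Xv n1; rewrite big_ord0 mul1r.
    have e w : X w -> tr 0%N w = w by move=> Xw; rewrite /tr -[w](inGK hA) // -valD addr0.
    by rewrite !e // divff.
  have h1 := morph_unit (mtr n).1 Xu ((mtr n).2 u Xu) (hH2 _ ((mtr n).1 u Xu)).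
  apply: unit_near (unitM IH h1) => //.
  apply: near_mono (coh_neq0 Xu (coh_pull (mtr n) cN)) => v Xv n1.
  rewrite !trS // big_ord_recr /=; set Pn := \prod_(j < n) _; set i := (N u v)^-1.
  by field.
have [|c hc] := @global_const _ _ X (fun u => \prod_(j < m) H2 (tr j u)) (ag_clo hA) (ag_irr hA).
  move=> u Xu; have [r _] := tele m u Xu; apply: sec_near r.
  apply: near_mono (coh_neq0 Xu cN) => v Xv n1.
  have e w : X w -> mult A m (tr m w) = mult A m w.
    by move=> Xw; rewrite /tr -[w](inGK hA) // addm tmm addr0 valMn.
  by rewrite /N !e // -/(N u v) divff // mulr1.
have nz j z : H2 (tr j (val z)) != 0.
  have [_] := hH2 _ ((mtr j).1 _ (ptsG z)); by rewrite mulf_eq0 => /norP [].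
(* Replacing [z] by [z + t'] shifts the product by one factor; as the product is constant, its first
   factor and the next one after the last agree. *)
have key z : H2 (tr m (val z)) = H2 (tr 0%N (val z)).
  have e1 := hc _ (ptsG z); have e2 := hc _ (ptsG (z + t')).
  have et j : tr j (val (z + t')) = tr j.+1 (val z).
    by rewrite /tr -!valD mulrS addrA.
  have: \prod_(j < m.+1) H2 (tr j (val z)) = \prod_(j < m.+1) H2 (tr j (val z)) by [].
  rewrite {1}big_ord_recl big_ord_recr /= e1.
  rewrite (eq_bigr (fun j : 'I_m => H2 (tr j (val (z + t'))))); last by move=> j _; rewrite et.
  rewrite e2 mulrC => /(mulfI _) -> //; rewrite -e1; apply/prodf_neq0 => j _; exact: nz.
apply: (we_eq tm ym h); exists 0; have := key 0.
have e0 : tr 0%N (val (0 : GA)) = val (0 : GA) by rewrite /tr -valD addr0.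
(* At [z = 0] both values of [V] are taken at 0 and cancel, which leaves equal values of [H] at [t]
   and at 0. *)
rewrite e0 /H2 /tr -valD -!valMn add0r tmm mul0rn mul1r => /divIf; apply.
have /negP := nz 0%N 0; rewrite e0 /H2 -valMn mul0rn => n1; apply/eqP=> V0; apply: n1.
by rewrite V0 invr0 mulr0.
Qed.

End Polarized.

(** * Purely inseparable descent and torsion *)

Section Definable.

Variable k : closedFieldType.

Definition pfun (N : nat) (F : 'rV[k]_N -> k) : Prop := exists f : {mpoly k[N]}, forall x, F x = ev f x.

Lemma pfunC N c : pfun (fun _ : 'rV[k]_N => c).
Proof. by exists c%:MP => x; rewrite /ev mevalC. Qed.

Lemma pfunX N i : pfun (fun x : 'rV[k]_N => x 0 i).
Proof. by exists 'X_i => x; rewrite /ev mevalXU. Qed.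

Lemma pfunD N (F G : 'rV[k]_N -> k) : pfun F -> pfun G -> pfun (fun x => F x + G x).
Proof. by move=> [f ef] [g eg]; exists (f + g) => x; rewrite ef eg /ev mevalD. Qed.

Lemma pfunM N (F G : 'rV[k]_N -> k) : pfun F -> pfun G -> pfun (fun x => F x * G x).
Proof. by move=> [f ef] [g eg]; exists (f * g) => x; rewrite ef eg /ev mevalM. Qed.

Lemma pfunN N (F : 'rV[k]_N -> k) : pfun F -> pfun (fun x => - F x).
Proof. by move=> [f ef]; exists (- f) => x; rewrite ef /ev mevalN. Qed.

Lemma pfunB N (F G : 'rV[k]_N -> k) : pfun F -> pfun G -> pfun (fun x => F x - G x).
Proof. by move=> hF /pfunN; apply: pfunD. Qed.

Lemma pfun_fform N m (F : 'rV[k]_N -> k) : fform m F -> pfun F.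
Proof. by case=> f _ ef; exists f. Qed.

Lemma pfun_comp N M (F : 'rV[k]_M -> k) (g : 'rV[k]_N -> 'rV[k]_M) :
  pfun F -> (forall j, pfun (fun x => g x 0 j)) -> pfun (fun x => F (g x)).
Proof.
move=> [f ef] /fchoice [G hG]; exists (f \mPo [tuple G j | j < M]) => x.
rewrite ef /ev comp_mpoly_meval; apply: meval_eq => j.
by rewrite tnth_mktuple hG.
Qed.

Definition tolist (N : nat) (x : 'rV[k]_N) : seq k := [seq x 0 i | i <- enum 'I_N].

Lemma nth_tolist N (x : 'rV[k]_N) (i : 'I_N) : (tolist x)`_i = x 0 i.
Proof. by rewrite (nth_map i) ?nth_ord_enum // size_enum_ord. Qed.

Lemma nth_tolist_ge N (x : 'rV[k]_N) i : (N <= i)%N -> (tolist x)`_i = 0.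
Proof. by move=> Ni; rewrite nth_default // size_map size_enum_ord. Qed.

Definition mpoly_term N (f : {mpoly k[N]}) : GRing.term k :=
  foldr (fun (m : 'X_{1..N}) t => GRing.Add (GRing.Mul (GRing.Const f@_m)
    (foldr (fun (i : 'I_N) s => GRing.Mul (GRing.Exp (GRing.Var k i) (m i)) s)
       (GRing.NatConst k 1) (index_enum 'I_N))) t) (GRing.NatConst k 0) (msupp f).

Lemma eval_mpoly_term N (f : {mpoly k[N]}) x : GRing.eval (tolist x) (mpoly_term f) = ev f x.
Proof.
rewrite ev_homogE /mpoly_term; elim: (msupp f) => [|m s IH]; first by rewrite big_nil.
rewrite big_cons /= IH; congr (_ * _ + _).
elim: (index_enum _) => [|i r IHr] /=; first by rewrite big_nil.
by rewrite big_cons IHr nth_tolist.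
Qed.

Lemma rterm_mpoly_term N (f : {mpoly k[N]}) : GRing.rterm (mpoly_term f).
Proof.
rewrite /mpoly_term; elim: (msupp f) => //= m s ->; rewrite andbT.
by elim: (index_enum _).
Qed.

Lemma rterm_mpoly N (t : GRing.term k) : GRing.rterm t -> exists f : {mpoly k[N]},
  forall x, GRing.eval (tolist x) t = ev f x.
Proof.
elim: t => //=.
- move=> i _; have [lt|ge] := ltnP i N.
    by exists 'X_(Ordinal lt) => x; rewrite /ev mevalXU -nth_tolist.
  by exists 0 => x; rewrite nth_tolist_ge // /ev meval0.
- by move=> c _; exists c%:MP => x; rewrite /ev mevalC.
- by move=> n _; exists (n%:R)%:MP => x; rewrite /ev mevalC.
- move=> t IHt s IHs /andP [/IHt [f ef] /IHs [g eg]]; exists (f + g) => x.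
  by rewrite ef eg /ev mevalD.
- by move=> t IHt /IHt [f ef]; exists (- f) => x; rewrite ef /ev mevalN.
- by move=> t IHt n /IHt [f ef]; exists (f *+ n) => x; rewrite ef /ev mevalMn.
- move=> t IHt s IHs /andP [/IHt [f ef] /IHs [g eg]]; exists (f * g) => x.
  by rewrite ef eg /ev mevalM.
- by move=> t IHt n /IHt [f ef]; exists (f ^+ n) => x; rewrite ef /ev rmorphXn.
Qed.

(** Constructible sets, as the quantifier-free definable ones. *)
Definition qfdef (N : nat) (P : 'rV[k]_N -> Prop) : Prop :=
  exists2 f : GRing.formula k, GRing.qf_form f && GRing.rformula f &
    forall x, P x <-> GRing.qf_eval (tolist x) f.

Lemma qfdef_ext N (P Q : 'rV[k]_N -> Prop) : (forall x, P x <-> Q x) -> qfdef P -> qfdef Q.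
Proof. by move=> e [f hf ef]; exists f => // x; rewrite -e. Qed.

Lemma qfdef0 N (F : 'rV[k]_N -> k) : pfun F -> qfdef (fun x => F x = 0).
Proof.
case=> f ef; exists (GRing.Equal (mpoly_term f) (GRing.NatConst k 0)) => [|x] /=.
  by rewrite rterm_mpoly_term.
by rewrite eval_mpoly_term ef; split=> /eqP.
Qed.

Lemma qfdef_and N (P Q : 'rV[k]_N -> Prop) : qfdef P -> qfdef Q -> qfdef (fun x => P x /\ Q x).
Proof.
move=> [f /andP[hf hf'] ef] [g /andP[hg hg'] eg]; exists (GRing.And f g) => [|x] /=.
  by rewrite hf hf' hg hg'.
by rewrite ef eg; split=> /andP.
Qed.

Lemma qfdef_not N (P : 'rV[k]_N -> Prop) : qfdef P -> qfdef (fun x => ~ P x).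
Proof. by move=> [f hf ef]; exists (GRing.Not f) => //= x; rewrite ef; split=> /negP. Qed.

Lemma qfdef_neq N (F : 'rV[k]_N -> k) : pfun F -> qfdef (fun x => F x != 0).
Proof.
by move=> /qfdef0/qfdef_not; apply: qfdef_ext => x; split=> [h|/eqP//]; apply/eqP.
Qed.

Lemma qfdef_all N n (P : nat -> 'rV[k]_N -> Prop) : (forall i, (i < n)%N -> qfdef (P i)) ->
  qfdef (fun x => forall i, (i < n)%N -> P i x).
Proof.
elim: n => [|n IH] h.
  apply: (@qfdef_ext _ (fun=> (0 : k) = 0)) (qfdef0 (pfunC N 0)) => x; by split.
apply: (@qfdef_ext _ (fun x => (forall i, (i < n)%N -> P i x) /\ P n x)).
  move=> x; split=> [[h1 h2] i|h1]; last by split=> [i ii|]; apply: h1 => //; apply: ltnW.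
  by rewrite ltnS leq_eqVlt => /orP [/eqP ->|/h1].
by apply: qfdef_and; [apply: IH => i ii; apply: h; apply: ltnW|apply: h].
Qed.

Lemma qfdef_forall N (I : finType) (P : I -> 'rV[k]_N -> Prop) : (forall i, qfdef (P i)) ->
  qfdef (fun x => forall i, P i x).
Proof.
move=> h; apply: (@qfdef_ext _ (fun x => forall j, (j < #|I|)%N ->
    forall i, enum_rank i = j :> nat -> P i x)).
  move=> x; split=> [hx i|hx j _ i _]; last exact: hx.
  by apply: (hx (enum_rank i)).
apply: qfdef_all => j jj; have := h (enum_val (Ordinal jj)); apply: qfdef_ext => x.
split=> [Px i ei|]; last by apply; rewrite enum_valK.
suff -> : i = enum_val (Ordinal jj) by [].
by rewrite -[i]enum_rankK; congr enum_val; apply/val_inj.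
Qed.

Lemma closed_axiom : GRing.closed_field_axiom k.
Proof. exact: solve_monicpoly. Qed.

(** Chevalley's theorem, from quantifier elimination over an algebraically closed field. *)
Lemma qfdef_ex N M (Q : 'rV[k]_(N + M) -> Prop) : qfdef Q ->
  qfdef (fun x => exists y, Q (row_mx x y)).
Proof.
move=> [f /andP [qf rf] ef]; pose g := foldr GRing.Exists f (iota N M).
have rg : GRing.rformula g by rewrite /g; elim: (iota N M).
have QE := GRing.quantifier_elim_rformP (@ClosedFieldQE.wf_ex_elim k)
  (ClosedFieldQE.holds_ex_elim closed_axiom).
exists (GRing.quantifier_elim (@ClosedFieldQE.ex_elim k) g).
  exact: GRing.quantifier_elim_wf (@ClosedFieldQE.wf_ex_elim k) _ rg.
move=> x; split=> [[y Qy]|/(QE _ _ rg)/GRing.foldExistsP [e he hf]].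
  apply/QE => //; apply/GRing.foldExistsP; exists (tolist (row_mx x y)).
    move=> i; rewrite !inE mem_iota negb_and -leqNgt -ltnNge => /orP [lt|ge].
      by rewrite (nth_tolist x (Ordinal lt)) (nth_tolist (row_mx x y) (lshift M (Ordinal lt)))
        row_mxEl.
    by rewrite !nth_tolist_ge // (leq_trans (leq_addr M N)).
  by apply/GRing.qf_evalP => //; apply/ef.
exists (\row_j e`_(N + j)); apply/ef/GRing.qf_evalP => //.
apply: GRing.eq_holds hf => i; have [lt|ge] := ltnP i N.
  rewrite (nth_tolist _ (lshift M (Ordinal lt))) row_mxEl -(nth_tolist x (Ordinal lt)).
  by rewrite -he // !inE mem_iota leqNgt lt.
have [lt|ge'] := ltnP i (N + M).
  have lt' : (i - N < M)%N by rewrite ltn_subLR.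
  have ei : i = rshift N (Ordinal lt') by rewrite /= subnKC.
  by rewrite {2}ei nth_tolist row_mxEr mxE /= subnKC.
by rewrite nth_tolist_ge // -he ?nth_tolist_ge // !inE mem_iota negb_and -leqNgt -ltnNge ge' orbT.
Qed.

End Definable.

Section Generic.

Variables (k : closedFieldType) (d : nat) (X : 'rV[k]_d -> Prop).
Hypotheses (cX : clo X) (iX : irr X).
Implicit Types (P Q : 'rV[k]_d -> Prop).

(** Validity on a nonempty open subset; by irreducibility two such subsets meet, which is
    [gen_and]. *)
Definition gen P : Prop := exists2 x, X x & near X x P.

Lemma gen_and P Q : gen P -> gen Q -> gen (fun x => P x /\ Q x).
Proof.
move=> [x Xx hP] [y Xy hQ].
have [z [Xz h1 h2]] := irr_near cX iX Xx Xy (near_near hP) (near_near hQ).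
by exists z => //; apply: near_and.
Qed.

Lemma gen_mono P Q : (forall x, X x -> P x -> Q x) -> gen P -> gen Q.
Proof. by move=> h [x Xx hP]; exists x => //; apply: near_mono hP. Qed.

Lemma gen_ex P : gen P -> exists2 x, X x & P x.
Proof. by move=> [x Xx hP]; exists x => //; apply: near_here hP. Qed.

Lemma gen_all P : (forall x, X x -> P x) -> gen P.
Proof. by move=> h; have [[x Xx] _] := iX; exists x => //; apply: near_all. Qed.

Lemma gen_seq (T : eqType) (s : seq T) (P : T -> 'rV[k]_d -> Prop) :
  (forall i, i \in s -> gen (P i)) -> gen (fun x => forall i, i \in s -> P i x).
Proof.
elim: s => [|i s IH] h; first exact: gen_all.
have h1 := h i (mem_head _ _).
have h2 : gen (fun x => forall j, j \in s -> P j x).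
  by apply: IH => j js; apply: h; rewrite inE js orbT.
apply: gen_mono (gen_and h1 h2) => x _ [Pi Ps] j; by rewrite inE => /orP [/eqP ->|/Ps].
Qed.

(* On the dense open subset where the first coordinate that is not identically zero does
   not vanish, normalized points have this coordinate equal to 1, so polynomials and forms
   define the same functions. *)
Lemma affine_chart : exists i0 : 'I_d,
  (forall x (j : 'I_d), X x -> (j < i0)%N -> x 0 j = 0) /\ gen (fun x => x 0 i0 = 1).
Proof.
have [[x0 Xx0] _] := iX.
have [|n [[i [x [Xx xi ei]]] mn]] := @nat_min (fun n => exists i : 'I_d, exists x,
    [/\ X x, x 0 i != 0 & i = n :> nat]).
  by have [i [xi _]] := cX.1 _ Xx0; exists i, i, x0; split; rewrite // xi oner_neq0.
have h y : X y -> y 0 i != 0 -> y 0 i = 1.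
  move=> Xy yi; have [j [yj hj]] := cX.1 _ Xy.
  have [lt|gt|/val_inj -> //] := ltngtP i j; first by rewrite hj ?eqxx in yi.
  have : (n <= j)%N by apply: mn; exists j, y; split; rewrite // yj oner_neq0.
  by rewrite -ei leqNgt gt.
exists i; split=> [y j Xy ji|]; last first.
  exists x => //.
  by apply: near_mono (near_form _ (fformX k i) xi) => y Xy; apply: h.
apply/eqP/negPn/negP => yj; have : (n <= j)%N by apply: mn; exists j, y.
by rewrite -ei leqNgt ji.
Qed.

Lemma pfun_form F : pfun F -> exists m G, fform m G /\ gen (fun x => F x = G x).
Proof.
case=> f ef; have [i0 [_ g0]] := affine_chart.
pose M := msize f.
exists M, (fun x : 'rV[k]_d => \sum_(e < M) x 0 i0 ^+ (M - e) * ev (pihomog mdeg e f) x); split.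
  apply: fform_sum => e _; apply: fform_deg (fformM (fformXn (M - e) (fformX k i0))
    (fform_ev (pihomogP mdeg e f))).
  by rewrite muln1 subnK // ltnW.
apply: gen_mono g0 => x _ x1; rewrite ef {1}(pihomog_partitionE (leqnn M)).
rewrite /ev raddf_sum /=.
by apply: eq_bigr => e _; rewrite x1 expr1n mul1r.
Qed.

Lemma gen_pfun F : pfun F -> gen (fun x => F x = 0) \/ gen (fun x => F x != 0).
Proof.
move=> /pfun_form [m [G [hG e]]].
have [[x Xx Gx]|no] := classic (exists2 x, X x & G x != 0).
  right; have h : gen (fun x => G x != 0) by exists x => //; exact: (near_form _ hG Gx).
  by apply: gen_mono (gen_and e h) => y _ [->].
left; apply: gen_mono e => x Xx ->; apply/eqP/negPn/negP => Gx; apply: no; by exists x.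
Qed.

(** Every polynomial is generically zero or generically nonzero on an irreducible set, so each
    formula has a generic truth value. *)
Lemma gen_qfdef P : qfdef P -> gen P \/ gen (fun x => ~ P x).
Proof.
case=> f /andP [qf rf] ef.
suff [b hb] : exists b, gen (fun x => GRing.qf_eval (tolist x) f = b).
  case: b hb => hb; [left|right]; apply: gen_mono hb => x _ hx; rewrite ef hx //.
elim: f qf rf {ef} => //=.
- by move=> b _ _; exists b; apply: gen_all.
- move=> t s _ /andP [rt rs].
  have [f ef] := rterm_mpoly d rt; have [g eg] := rterm_mpoly d rs.
  have [|h|h] := @gen_pfun (fun x => ev f x - ev g x).
  + by apply: pfunB; [exists f|exists g].
  + exists true; apply: gen_mono h => x _ /eqP.
    by rewrite subr_eq0 ef eg => ->.
  + by exists false; apply: gen_mono h => x _; rewrite subr_eq0 ef eg => /negPf.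
- move=> f IHf g IHg /andP [qf qg] /andP [rf rg].
  have [b hb] := IHf qf rf; have [c hc] := IHg qg rg.
  by exists (b && c); apply: gen_mono (gen_and hb hc) => x _ [-> ->].
- move=> f IHf g IHg /andP [qf qg] /andP [rf rg].
  have [b hb] := IHf qf rf; have [c hc] := IHg qg rg.
  by exists (b || c); apply: gen_mono (gen_and hb hc) => x _ [-> ->].
- move=> f IHf g IHg /andP [qf qg] /andP [rf rg].
  have [b hb] := IHf qf rf; have [c hc] := IHg qg rg.
  by exists (b ==> c); apply: gen_mono (gen_and hb hc) => x _ [-> ->].
- by move=> f IHf qf rf; have [b hb] := IHf qf rf; exists (~~ b);
    apply: gen_mono hb => x _ ->.
Qed.

(** A constructible set that is not generic has a generic complement, whose open part a dense set
    must meet. *)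
Lemma dense_gen P : qfdef P ->
  (forall m C, fform m C -> (exists2 x, X x & C x != 0) ->
    exists x, [/\ X x, C x != 0 & P x]) -> gen P.
Proof.
move=> /gen_qfdef [//|[x Xx [m [C [hC Cx h]]]]] dn.
have [|y [Xy Cy Py]] := dn m C hC; first by exists x.
by case: (h y Xy Cy).
Qed.

End Generic.

Lemma addn_pred_small (w h m s : nat) :
  s = (w + h).-1 -> (s <= m)%N -> (m <= w)%N -> (0 < h)%N -> h = 1%N.
Proof. lia. Qed.

Section GenericRoot.

Variables (k : closedFieldType) (d : nat) (X : 'rV[k]_d -> Prop).
Hypotheses (cX : clo X) (iX : irr X).
Variables (p : nat) (hp : p \in [pchar k]).

Local Notation gen := (gen X).
Local Notation R := {mpoly k[d]}.

(** Polynomials over [R] stand for polynomials over the function field of [X]: denominators are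
    cleared and identities are read after specialization at a generic [y]. *)
Definition spec (y : 'rV[k]_d) (F : {poly R}) : {poly k} :=
  map_poly (meval (fun i => y 0 i)) F.

Lemma specM y F G : spec y (F * G) = spec y F * spec y G.
Proof. exact: rmorphM. Qed.

Lemma specD y F G : spec y (F + G) = spec y F + spec y G.
Proof. exact: rmorphD. Qed.

Lemma specB y F G : spec y (F - G) = spec y F - spec y G.
Proof. exact: rmorphB. Qed.

Lemma specC y (c : R) : spec y c%:P = (ev c y)%:P.
Proof. exact: map_polyC. Qed.

Lemma specZ y (c : R) F : spec y (c *: F) = ev c y *: spec y F.
Proof. by rewrite /spec map_polyZ. Qed.

Lemma coef_spec y F i : (spec y F)`_i = ev F`_i y.
Proof. by rewrite coef_map. Qed.

Lemma size_spec_lead y F : ev (lead_coef F) y != 0 -> size (spec y F) = size F.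
Proof. by move=> h; rewrite /spec size_map_poly_id0. Qed.

Lemma atom_poly (h : {mpoly k[d + 1]}) : exists F : {poly R},
  forall y t, ev h (row_mx y (const_mx t)) = (spec y F).[t].
Proof.
exists (\sum_(m <- msupp h)
  ((h@_m)%:MP * \prod_(i < d) ('X_i : R) ^+ (m (lshift 1 i)))%:P * 'X^(m (rshift d ord0))) => y t.
rewrite ev_homogE /spec rmorph_sum horner_sum; apply: eq_bigr => m _ /=.
rewrite rmorphM /= map_polyC map_polyXn !hornerE /= rmorphM /= mevalC -mulrA.
congr (_ * _); rewrite big_split_ord /= big_ord1 row_mxEr mxE rmorph_prod; congr (_ * _).
by apply: eq_bigr => i _; rewrite row_mxEl rmorphXn /= mevalXU.
Qed.

(** For fixed [y] the truth at [t] is decided by which of finitely many polynomials vanish at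
    [t]. *)
Lemma atoms (f : GRing.formula k) : GRing.qf_form f -> GRing.rformula f ->
  exists s : seq {poly R}, forall (y : 'rV[k]_d) (t t' : k),
    (forall F, F \in s -> ((spec y F).[t] == 0) = ((spec y F).[t'] == 0)) ->
    GRing.qf_eval (tolist (row_mx y (const_mx t : 'rV_1))) f =
    GRing.qf_eval (tolist (row_mx y (const_mx t' : 'rV_1))) f.
Proof.
have bin f1 f2 (s1 s2 : seq {poly R}) (op : bool -> bool -> bool) :
  (forall y t t', (forall F, F \in s1 -> ((spec y F).[t] == 0) = ((spec y F).[t'] == 0)) ->
    GRing.qf_eval (tolist (row_mx y (const_mx t : 'rV_1))) f1 =
    GRing.qf_eval (tolist (row_mx y (const_mx t' : 'rV_1))) f1) ->
  (forall y t t', (forall F, F \in s2 -> ((spec y F).[t] == 0) = ((spec y F).[t'] == 0)) ->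
    GRing.qf_eval (tolist (row_mx y (const_mx t : 'rV_1))) f2 =
    GRing.qf_eval (tolist (row_mx y (const_mx t' : 'rV_1))) f2) ->
  forall y t t', (forall F, F \in s1 ++ s2 -> ((spec y F).[t] == 0) = ((spec y F).[t'] == 0)) ->
    op (GRing.qf_eval (tolist (row_mx y (const_mx t : 'rV_1))) f1)
       (GRing.qf_eval (tolist (row_mx y (const_mx t : 'rV_1))) f2) =
    op (GRing.qf_eval (tolist (row_mx y (const_mx t' : 'rV_1))) f1)
       (GRing.qf_eval (tolist (row_mx y (const_mx t' : 'rV_1))) f2).
  move=> h1 h2 y t t' h; rewrite (h1 y t t') ?(h2 y t t') // => F Fs;
    by apply: h; rewrite mem_cat Fs ?orbT.
elim: f => //=.
- by move=> b _ _; exists [::].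
- move=> t1 t2 _ /andP [r1 r2].
  have [f1 e1] := rterm_mpoly (d + 1) r1; have [f2 e2] := rterm_mpoly (d + 1) r2.
  have [F eF] := atom_poly (f1 - f2); exists [:: F] => y t t' /(_ F (mem_head _ _)).
  by rewrite !e1 !e2 -!eF /ev !mevalB !subr_eq0.
- move=> f IHf g IHg /andP [qf qg] /andP [rf rg].
  have [s hs] := IHf qf rf; have [s' hs'] := IHg qg rg.
  by exists (s ++ s'); apply: (bin _ _ _ _ andb).
- move=> f IHf g IHg /andP [qf qg] /andP [rf rg].
  have [s hs] := IHf qf rf; have [s' hs'] := IHg qg rg.
  by exists (s ++ s'); apply: (bin _ _ _ _ orb).
- move=> f IHf g IHg /andP [qf qg] /andP [rf rg].
  have [s hs] := IHf qf rf; have [s' hs'] := IHg qg rg.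
  by exists (s ++ s'); apply: (bin _ _ _ _ implb).
- move=> f IHf qf rf; have [s hs] := IHf qf rf; exists s => y t t' h.
  by rewrite (hs y t t').
Qed.

Variables (Gr : 'rV[k]_(d + 1) -> Prop) (g : 'rV[k]_d -> k).
Hypotheses (hGr : qfdef Gr)
  (eGr : gen (fun y => forall t, Gr (row_mx y (const_mx t)) <-> t = g y)).

Let van F := gen (fun y => (spec y F).[g y] = 0).
Let nvan F := gen (fun y => (spec y F).[g y] != 0).

Let van_nvan F : van F -> ~ nvan F.
Proof.
by move=> h /(gen_and cX iX h) /gen_ex [y _ [-> ]]; rewrite eqxx.
Qed.


Let pfun_horner F :
  pfun (fun w : 'rV[k]_(d + 1) => (spec (lsubmx w) F).[w 0 (rshift d ord0)]).
Proof.
have pl (c : R) : pfun (fun w : 'rV[k]_(d + 1) => ev c (lsubmx w)).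
  apply: (pfun_comp (g := fun w => lsubmx w)); first by exists c.
  move=> j; have [f ef] := pfunX k (lshift 1 j).
  by exists f => w; rewrite -ef mxE.
elim/poly_ind: F => [|F c [f ef]].
  by have [f ef] := pfunC (d + 1) (0 : k); exists f => w; rewrite -ef /spec rmorph0 horner0.
have [h eh] := pfunD (pfunM (ex_intro _ f ef) (pfunX k (rshift d ord0))) (pl c).
exists h => w; rewrite -eh specD specM /spec map_polyX map_polyC /=.
by rewrite !hornerE.
Qed.

(** The function [g] is arbitrary, but its graph is definable, so the vanishing of [F] at [g] is a
    definable condition on [y]. *)
Let decide F : van F \/ nvan F.
Proof.
have dF : qfdef (fun y => exists t : 'rV[k]_1, Gr (row_mx y t) /\
    (spec y F).[t 0 ord0] = 0).
  have := qfdef_and hGr (qfdef0 (pfun_horner F)) => /qfdef_ex; apply: qfdef_ext => y.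
  by split=> -[t [h1 h2]]; exists t; split=> //; move: h2; rewrite row_mxKl row_mxEr.
have [h|h] := gen_qfdef cX iX dF; [left|right].
  apply: gen_mono (gen_and cX iX h eGr) => y _ [[t [Gt Ft]] eG].
  have et : t = const_mx (t 0 ord0) by apply/rowP=> i; rewrite !mxE ord1.
  by move: Gt; rewrite et => /eG <-.
apply: gen_mono (gen_and cX iX h eGr) => y _ [no eG]; apply/eqP=> Fg; apply: no.
by exists (const_mx (g y)); split; [apply/eG | rewrite mxE].
Qed.

(** A leading coefficient that is nonzero in [R] may vanish on [X]; such terms are dropped one by
    one. *)
Let truncate (F : {poly R}) : exists F' : {poly R}, [/\ (size F' <= size F)%N,
  gen (fun y => spec y F = spec y F') & F' = 0 \/ gen (fun y => ev (lead_coef F') y != 0)].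
Proof.
move: {2}(size F) (leqnn (size F)) => n; elim: n F => [|n IH] F hn.
  exists F; split=> //; first exact: gen_all.
  by left; apply/eqP; rewrite -size_poly_leq0.
have pl : pfun (ev (lead_coef F)) by exists (lead_coef F).
have [h|h] := gen_pfun cX iX pl; last by exists F; split=> //; [exact: gen_all|right].
pose F1 := \poly_(i < (size F).-1) F`_i.
have s1 : (size F1 <= (size F).-1)%N by apply: size_poly.
have [|F' [s' g' h']] := IH F1.
  by apply: leq_trans s1 _; rewrite -subn1 leq_subLR add1n.
exists F'; split=> //; first by rewrite (leq_trans s') // (leq_trans s1) // leq_pred.
apply: gen_mono (gen_and cX iX h g') => y _ [l0 <-]; apply/polyP=> i.
rewrite !coef_spec coef_poly; case: ltnP => // le.
rewrite /ev meval0; move: le; rewrite leq_eqVlt => /orP [/eqP <-|lt]; first exact: l0.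
by rewrite nth_default ?meval0 //; case: (size F) lt.
Qed.

Let pdiv (F M : {poly R}) : gen (fun y => ev (lead_coef M) y != 0) -> exists (c : R) (Q S : {poly R}),
  [/\ (size S < size M)%N, gen (fun y => ev c y != 0) & c *: F = Q * M + S].
Proof.
move=> lM; exists (lead_coef M ^+ scalp F M), (F %/ M), (F %% M); split.
- rewrite Pdiv.Idomain.ltn_modp; apply/eqP=> M0; have [y _] := gen_ex lM.
  by rewrite M0 lead_coef0 /ev meval0 eqxx.
- by apply: gen_mono lM => y _ h; rewrite /ev rmorphXn expf_neq0.
- exact: Pdiv.Idomain.divp_eq.
Qed.

Let pchar_polyk : p \in [pchar {poly k}].
Proof. by rewrite (rmorph_pchar polyC hp). Qed.

Lemma coef_binomial_pow (c : k) (q N : nat) : (0 < q)%N -> (0 < N)%N ->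
  (('X^q - c%:P) ^+ N)`_(q * N.-1) = - (c *+ N).
Proof.
move=> q0; case: N => // N _; rewrite exprDn coef_sum.
rewrite (bigD1 (Ordinal (_ : (1 < N.+2)%N))) //= subn1 bin1 expr1 big1 ?addr0 => [|i ni].
  by rewrite -exprM coefMn coefXnM ltnn subnn -polyCN coefC eqxx mulNrn.
rewrite -exprM coefMn -polyCN -polyC_exp coefMC coefXn eqn_pmul2l //.
case: eqP; last by rewrite mul0r mul0rn.
move=> e; case/eqP: ni; apply/val_inj => /=; move: (ltn_ord i) e; move: (i : nat); clear; lia.
Qed.

(** Since [g y] is singled out by a zero pattern, it is the only root of its minimal polynomial over
    the function field. In characteristic [p] this says that some [p]-power of it is rational. *)
Theorem generic_root : exists e (a l : R), gen (fun y => ev l y != 0 /\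
  ev l y * g y ^+ (p ^ e) = ev a y).
Proof.
have p_pr : prime p := pcharf_prime hp.
have [f /andP [qf rf] ef] := hGr; have [s hs] := atoms qf rf.
pose b F : bool := if excluded_middle_informative (van F) then true else false.
have bP F : gen (fun y => ((spec y F).[g y] == 0) = b F).
  rewrite /b; case: excluded_middle_informative => /= h.
    by apply: gen_mono h => y _ ->; rewrite eqxx.
  by have [//|] := decide F; apply: gen_mono => y _ /negPf.
have bs := gen_seq cX iX (fun F (_ : F \in s) => bP F).
have key : gen (fun y => forall t, (forall F, F \in s -> ((spec y F).[t] == 0) = b F) -> t = g y).
  apply: gen_mono (gen_and cX iX bs eGr) => y _ [hb eG] t ht; apply/eG; apply/ef.
  by rewrite (hs y t (g y)) => [|F Fs]; [apply/ef/eG | rewrite ht // hb].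
(* The minimal polynomial of [g] over the function field. *)
have [mu [vmu lmu minmu]] : exists mu, [/\ van mu, gen (fun y => ev (lead_coef mu) y != 0) &
    forall S, van S -> (size S < size mu)%N -> gen (fun y => spec y S = 0)].
  have [|n [[mu [vmu lmu smu]] mn]] := @nat_min (fun n => exists mu, [/\ van mu,
      gen (fun y => ev (lead_coef mu) y != 0) & size mu = n]).
    (* Were [g] transcendental, any [t] avoiding finitely many values would share the zero pattern
       of [g y], and so be equal to it. *)
    apply: NNPP => no.
    have zero F : van F -> gen (fun y => spec y F = 0).
      move=> vF; have [F' [_ eF [F0|lF]]] := truncate F.
        by apply: gen_mono eF => y _ ->; rewrite F0 /spec rmorph0.
      case: no; exists (size F'), F'; split=> //.
      by apply: gen_mono (gen_and cX iX vF eF) => y _ [h1 <-].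
    have allz : gen (fun y => forall F, F \in s -> b F -> spec y F = 0).
      apply: gen_seq => // F Fs; rewrite /b; case: excluded_middle_informative => /= h.
        by apply: gen_mono (zero F h).
      exact: gen_all.
    have [y Xy [[hz hb] hk]] := gen_ex (gen_and cX iX (gen_and cX iX allz bs) key).
    pose Q := ('X - (g y)%:P) * \prod_(F <- s | ~~ b F) spec y F.
    have Q0 : Q != 0.
      rewrite mulf_neq0 ?polyXsubC_eq0 // prodf_seq_neq0; apply/allP => F Fs.
      apply/implyP => nb; apply/eqP => F0; have := hb F Fs.
      by rewrite F0 horner0 eqxx (negPf nb).
    have /closed_nonrootP [t] := Q0; rewrite rootM root_XsubC negb_or => /andP [tg].
    rewrite rootE horner_prod prodf_seq_neq0 => /allP ht.
    case/eqP: tg; apply: hk => F Fs; have := ht F Fs.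
    have [bF _|nb /= /negPf //] := boolP (b F).
    by rewrite hz // horner0 eqxx.
  exists mu; split=> // S vS lt; have [S' [sS' eS [S0|lS]]] := truncate S.
    by apply: gen_mono eS => y _ ->; rewrite S0 /spec rmorph0.
  have : (n <= size S')%N.
    apply: mn; exists S'; split=> //.
    by apply: gen_mono (gen_and cX iX vS eS) => y _ [h1 <-].
  by rewrite -smu leqNgt (leq_ltn_trans sS').
pose Q := \prod_(F <- s | ~~ b F) F.
have nQ : gen (fun y => (spec y Q).[g y] != 0).
  apply: gen_mono bs => y _ hb; rewrite /spec rmorph_prod horner_prod prodf_seq_neq0.
  by apply/allP => F Fs; apply/implyP => /negPf nb; rewrite [_ == 0](hb F Fs) nb.
(* The ideal generated by [Q] and [mu]; its element [h] of least degree is their gcd. *)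
pose I h := exists U V, gen (fun y => spec y h = spec y (U * Q + V * mu)).
have [h [Ih lh minh]] : exists h, [/\ I h, gen (fun y => ev (lead_coef h) y != 0) &
    forall S, I S -> (size S < size h)%N -> gen (fun y => spec y S = 0)].
  have [|n [[h [Ih lh sh]] mn]] := @nat_min (fun n => exists h, [/\ I h,
      gen (fun y => ev (lead_coef h) y != 0) & size h = n]).
    exists (size mu), mu; split=> //; exists 0, 1; apply: gen_all => // y _.
    by rewrite mul0r add0r mul1r.
  exists h; split=> // S [U [V eUV]] lt; have [S' [sS' eS [S0|lS]]] := truncate S.
    by apply: gen_mono eS => y _ ->; rewrite S0 /spec rmorph0.
  have : (n <= size S')%N.
    apply: mn; exists S'; split=> //; exists U, V.
    by apply: gen_mono (gen_and cX iX eUV eS) => y _ [<- <-].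
  by rewrite -sh leqNgt (leq_ltn_trans sS').
have divh F : I F -> exists c W, gen (fun y => ev c y != 0 /\
    ev c y *: spec y F = spec y W * spec y h).
  move=> [U [V eF]]; have [c [W [S [sS c0 eS]]]] := pdiv F lh.
  have [U' [V' eh]] := Ih.
  exists c, W; have /(minh _)/(_ sS) S0 : I S.
    exists (c%:P * U - W * U'), (c%:P * V - W * V').
    apply: gen_mono (gen_and cX iX eF eh) => y _ [e1 e2].
    have -> : S = c *: F - W * h by rewrite eS addrC addKr.
    by rewrite -mul_polyC specB [in RHS]specD !specM !specB !specM !specC e1 e2 !specD !specM; ring.
  by apply: gen_mono (gen_and cX iX c0 S0) => y _ [h1 h2]; rewrite -specZ eS specD h2 addr0 specM.
have [|c1 [W1 d1]] := divh Q.
  by exists 1, 0; apply: gen_all => // y _; rewrite mul1r mul0r addr0.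
have [|c2 [W2 d2]] := divh mu.
  by exists 0, 1; apply: gen_all => // y _; rewrite mul0r mul1r add0r.
have nh : gen (fun y => (spec y h).[g y] != 0).
  apply: gen_mono (gen_and cX iX nQ d1) => y _ [Qg [c0 e1]].
  apply: contra_neq Qg => hg; have /(congr1 (fun P => P.[g y])) := e1.
  by rewrite hornerZ hornerM hg mulr0 => /eqP; rewrite mulf_eq0 (negPf c0) => /eqP.
have vW2 : van W2.
  apply: gen_mono (gen_and cX iX vmu (gen_and cX iX nh d2)) => y _ [m0 [hg [_ /(congr1 (fun P => P.[g y]))]]].
  by rewrite hornerZ hornerM m0 mulr0 => /esym/eqP; rewrite mulf_eq0 (negPf hg) orbF => /eqP.
(* [h] divides [Q], so it does not vanish at [g]; hence its cofactor in [mu] does, and by minimality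
   this cofactor has the degree of [mu]. *)
have sh : size h = 1%N.
  have [W [_ eW lW]] := truncate W2.
  have [y Xy [eWy [lhy [[c0 e2] [lmuy hgy]]]]] := gen_ex (gen_and cX iX eW
    (gen_and cX iX lh (gen_and cX iX d2 (gen_and cX iX lmu nh)))).
  have smu : size (spec y mu) = size mu := size_spec_lead lmuy.
  have shy : size (spec y h) = size h := size_spec_lead lhy.
  have mu0 : spec y mu != 0 by rewrite -size_poly_gt0 smu lt0n size_poly_eq0; apply/eqP=> m0;
    move: lmuy; rewrite m0 lead_coef0 /ev meval0 eqxx.
  have h0 : spec y h != 0 by apply: contra_neq hgy => ->; rewrite horner0.
  have W0 : spec y W2 != 0.
    apply: contra_neq mu0 => W0; have := e2; rewrite W0 mul0r => /eqP.
    by rewrite scaler_eq0 (negPf c0) => /eqP.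
  have szs : size mu = (size (spec y W2) + size h).-1.
    by rewrite -shy -size_mul // -e2 size_scale // smu.
  case: lW => [W00|lW]; first by move: W0; rewrite eWy W00 /spec rmorph0 eqxx.
  have [ge|lt] := leqP (size mu) (size W); last first.
    have /minmu : van W by apply: gen_mono (gen_and cX iX vW2 eW) => z _ [h1 <-].
    move=> /(_ lt) /(gen_and cX iX lW) /gen_ex [z _ [lz z0]].
    have := size_spec_lead lz; rewrite z0 size_poly0 => /esym/eqP.
    by rewrite size_poly_eq0 => /eqP W00; move: lz; rewrite W00 lead_coef0 /ev meval0 eqxx.
  have [z Xz [[eWz lWz] [[_ ez2] [lmuz lhz]]]] := gen_ex (gen_and cX iX (gen_and cX iX eW lW)
    (gen_and cX iX d2 (gen_and cX iX lmu lh))).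
  have := congr1 (fun P : {poly k} => size P) ez2.
  have hz0 : spec z h != 0 by rewrite -size_poly_gt0 (size_spec_lead lhz) -shy size_poly_gt0.
  have Wz0 : spec z W2 != 0.
    rewrite eWz -size_poly_gt0 (size_spec_lead lWz) (leq_trans _ ge) //.
    by rewrite -smu size_poly_gt0.
  rewrite size_mul // eWz (size_spec_lead lWz) (size_spec_lead lhz).
  have := size_scale_leq (ev c2 z) (spec z mu); rewrite (size_spec_lead lmuz) => le1 e1.
  by apply: (addn_pred_small e1 le1 ge); rewrite -shy size_poly_gt0.
have [U [V eh]] := Ih.
have allP0 : gen (fun y => forall F, F \in s -> b F -> forall t, root (spec y mu) t -> root (spec y F) t).
  apply: gen_seq => // F Fs; rewrite /b; case: excluded_middle_informative => /= [vF|nvF];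
    last exact: gen_all.
  have [c [W [S [sS c0 eS]]]] := pdiv F lmu.
  have /minmu/(_ sS) S0 : van S.
    apply: gen_mono (gen_and cX iX vF vmu) => y _ [F0 m0].
    have -> : S = c *: F - W * mu by rewrite eS addrC addKr.
    by rewrite specB specM specZ !hornerE F0 m0 !mulr0 subr0.
  apply: gen_mono (gen_and cX iX c0 S0) => y _ [c0y S0y] _ t rt.
  have := congr1 (spec y) eS; rewrite specZ specD S0y addr0 specM => e1.
  by rewrite -(rootZ _ _ c0y) e1 rootM rt orbT.
pose N := (size mu).-1.
(* A root of [mu] is a root of every [F] that vanishes at [g], and of no other since [Q] is prime to
   [mu]; it thus has the zero pattern of [g y]. *)
have onlyroot : gen (fun y => spec y mu = ev (lead_coef mu) y *: ('X - (g y)%:P) ^+ N).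
  apply: gen_mono (gen_and cX iX (gen_and cX iX allP0 key) (gen_and cX iX bs
    (gen_and cX iX (gen_and cX iX eh lh) lmu))) => y _ [[hP hk] [hb [[ehy lhy] lmuy]]].
  have [r er] := closed_field_poly_normal (spec y mu).
  have lc : lead_coef (spec y mu) = ev (lead_coef mu) y.
    by rewrite [LHS]lead_coefE (size_spec_lead lmuy) coef_spec.
  have lc0 : lead_coef (spec y mu) != 0 by rewrite lc.
  have rz z : z \in r -> z = g y.
    move=> zr; have rt : root (spec y mu) z by rewrite er rootZ // root_prod_XsubC.
    apply: hk => F Fs; have [bF|nb] := boolP (b F).
      by apply/eqP/rootP/(hP F Fs bF z rt).
    apply/negbTE/eqP=> Fz.
    have Qz : (spec y Q).[z] = 0.
      rewrite /spec rmorph_prod horner_prod; apply/eqP; rewrite prodf_seq_eq0.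
      by apply/hasP; exists F => //; rewrite nb -/(spec _ _) Fz eqxx.
    have := congr1 (fun P : {poly k} => P.[z]) ehy.
    rewrite specD !specM !hornerE Qz (rootP rt) !mulr0 addr0.
    have : size (spec y h) = 1%N by rewrite (size_spec_lead lhy).
    by move=> /eqP/size_poly1P [c c0 ->]; rewrite hornerC => /eqP; rewrite (negPf c0).
  have er' : r = nseq (size r) (g y) by apply/all_pred1P/allP => z /rz ->; rewrite /= eqxx.
  have sr : size r = N.
    by rewrite /N -(size_spec_lead lmuy) er size_scale // size_prod_XsubC.
  by rewrite er lc er' big_nseq iter_mulr_1 sr.
have N0 : (0 < N)%N.
  have [y Xy [[m0 e1] l0]] := gen_ex (gen_and cX iX (gen_and cX iX vmu onlyroot) lmu).
  rewrite lt0n; apply/eqP=> N0; move: m0; rewrite e1 N0 expr0 hornerZ hornerC mulr1.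
  by apply/eqP.
have [N' cop eN] := pfactor_coprime p_pr N0; set e := logn p N in eN.
have N'0 : (0 < N')%N by rewrite lt0n; apply/eqP=> z; move: N0; rewrite eN z.
have N'k : (N'%:R : k) != 0.
  by rewrite -(dvdn_pcharf hp) -prime_coprime.
(* In the [N']-th power of ['X^(p ^ e) - c], with [c = g y ^+ (p ^ e)], the coefficient next to the
   leading one is [- N' c], and [N'] is invertible in [k]. *)
exists e, (- mu`_(p ^ e * N'.-1)), (N'%:R *: lead_coef mu).
apply: gen_mono (gen_and cX iX onlyroot lmu) => y _ [e1 l0].
rewrite /ev mevalZ mevalN; split; first by rewrite mulf_neq0.
have pe : [pchar {poly k}].-nat (p ^ e)%N.
  by rewrite (eq_pnat _ (pcharf_eq pchar_polyk)) pnatX pnat_id.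
rewrite -/(ev _ _) -/(ev _ _) -(coef_spec y mu) e1 coefZ eN mulnC exprM.
rewrite exprDn_pchar // -polyCN -polyC_exp.
have -> : (- g y) ^+ (p ^ e) = - (g y ^+ (p ^ e)).
  have pek : [pchar k].-nat (p ^ e)%N by rewrite (eq_pnat _ (pcharf_eq hp)) pnatX pnat_id.
  by rewrite exprNn_pchar.
have q0 : (0 < p ^ e)%N by rewrite expn_gt0 prime_gt0.
rewrite polyCN (coef_binomial_pow _ q0 N'0).
by rewrite mulrN opprK -mulr_natl; ring.
Qed.

End GenericRoot.

Section Image.

Variables (k : closedFieldType) (d e : nat).
Variables (X : 'rV[k]_d -> Prop) (Y : 'rV[k]_e -> Prop) (phi : 'rV[k]_d -> 'rV[k]_e).
Hypotheses (cX : clo X) (iX : irr X) (cY : clo Y) (iY : irr Y) (mphi : morph X Y phi).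
Hypothesis dense_phi : forall m C, fform m C -> (exists2 y, Y y & C y != 0) ->
  exists2 x, X x & C (phi x) != 0.

(** The relation collects the values of [f] on the fibres of [phi]. It uses coordinates that are
    generically 1, so that polynomial conditions on vectors describe normalized points. *)
Lemma definable_graph f x0 : X x0 -> reg_at X f x0 -> exists Gr : 'rV[k]_(e + 1) -> Prop,
  qfdef Gr /\ gen Y (fun y => (exists t, Gr (row_mx y t)) /\
    forall t, Gr (row_mx y (const_mx t)) -> exists x, [/\ X x, phi x = y & f x = t]).
Proof.
move=> Xx0 [mf [F [H [hF hH Hx0 eF]]]].
have [m [G [hG Gx0 eG]]] := mphi.2 x0 Xx0.
have [i0 [hi0 gi0]] := affine_chart cX iX.
have [j0 [hj0 gj0]] := affine_chart cY iY.
have [n [dE [E [hE eE]]]] := clo_finite_equations cX.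
pose W (w : 'rV[k]_((e + 1) + d)) :=
  let x := rsubmx w in let y := lsubmx (lsubmx w) in let t := lsubmx w 0 (rshift e ord0) in
  [/\ forall i, (i < n)%N -> E i x = 0,
      (forall j : 'I_d, (j < i0)%N -> x 0 j = 0) /\ x 0 i0 - 1 = 0,
      G x 0 j0 != 0, forall j, y 0 j * G x 0 j0 - G x 0 j = 0 &
      H x != 0 /\ t * H x - F x = 0].
have px (P : 'rV[k]_d -> k) : pfun P -> pfun (fun w : 'rV[k]_((e + 1) + d) => P (rsubmx w)).
  move=> hP; apply: (pfun_comp (g := fun w => rsubmx w)) hP _ => j.
  by have [g eg] := pfunX k (rshift (e + 1) j); exists g => w; rewrite -eg mxE.
have pl j : pfun (fun w : 'rV[k]_((e + 1) + d) => lsubmx w 0 j).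
  by have [g eg] := pfunX k (lshift d j); exists g => w; rewrite -eg mxE.
have pll j : pfun (fun w : 'rV[k]_((e + 1) + d) => lsubmx (lsubmx w) 0 j).
  by have [g eg] := pl (lshift 1 j); exists g => w; rewrite -eg mxE.
have pG j : pfun (fun w : 'rV[k]_((e + 1) + d) => G (rsubmx w) 0 j).
  by apply: (px (fun x => G x 0 j)); apply: pfun_fform (hG j).
have dW : qfdef W.
  have d1 : qfdef (fun w : 'rV[k]_((e + 1) + d) => forall i, (i < n)%N -> E i (rsubmx w) = 0).
    by apply: qfdef_all => i ii; apply/qfdef0/px/pfun_fform/(hE i ii).
  have d2 : qfdef (fun w : 'rV[k]_((e + 1) + d) =>
      (forall j : 'I_d, (j < i0)%N -> rsubmx w 0 j = 0) /\ rsubmx w 0 i0 - 1 = 0).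
    apply: qfdef_and; last first.
      by apply: qfdef0; apply: pfunB (pfunC _ 1); apply: (px (fun x => x 0 i0)); apply: pfunX.
    apply: qfdef_forall => j; have [lt|ge] := ltnP j i0; last first.
      by apply: qfdef_ext (qfdef0 (pfunC _ 0)) => w; split.
    have := qfdef0 (px (fun x => x 0 j) (pfunX k j)); apply: qfdef_ext => w.
    by split=> // ->.
  have d3 := qfdef_neq (pG j0).
  have d4 : qfdef (fun w : 'rV[k]_((e + 1) + d) => forall j,
      lsubmx (lsubmx w) 0 j * G (rsubmx w) 0 j0 - G (rsubmx w) 0 j = 0).
    by apply: qfdef_forall => j; apply: qfdef0; apply: pfunB => //; apply: pfunM.
  have d5 := qfdef_neq (px H (pfun_fform hH)).
  have d6 := qfdef0 (pfunB (pfunM (pl (rshift e ord0)) (px H (pfun_fform hH)))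
    (px F (pfun_fform hF))).
  have := qfdef_and d1 (qfdef_and d2 (qfdef_and d3 (qfdef_and d4 (qfdef_and d5 d6)))).
  by apply: qfdef_ext => w; split=> [[? [? [? [? ?]]]]|[? ? ? ? ?]].
exists (fun v => exists x, W (row_mx v x)); split; first exact: qfdef_ex.
have sound y t : Y y -> y 0 j0 = 1 -> (exists x, W (row_mx (row_mx y (const_mx t)) x)) ->
    exists x, [/\ X x, phi x = y & f x = t].
  move=> Yy yj0 [x]; rewrite /W row_mxKr !row_mxKl row_mxEr mxE.
  move=> [Ex [xz /eqP]]; rewrite subr_eq0 => /eqP x1 Gj yG [Hx /eqP].
  rewrite subr_eq0 => /eqP tF.
  have ptx : is_point x by exists i0.
  have Xx : X x by apply/eE.
  have Gx : G x <> 0 by move=> G0; move: Gj; rewrite G0 mxE eqxx.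
  have [c ec] := eG x Xx Gx.
  exists x; split=> //; last first.
    by rewrite eF // -tF mulfK.
  have c0 : c != 0 by apply: contra_neq Gj => c0; rewrite ec c0 scale0r mxE.
  have pj : phi x 0 j0 != 0 by move: Gj; rewrite ec mxE mulf_eq0 (negPf c0).
  apply: (@is_point_eq _ _ (phi x 0 j0)); [exact/(cY.1 _ (mphi.1 _ Xx))|exact: cY.1|].
  apply/rowP=> j; rewrite mxE; have /eqP := yG j; rewrite subr_eq0 ec !mxE => /eqP.
  by rewrite mulrCA => /(mulfI c0) <-; rewrite mulrC.
have ex1 : gen Y (fun y => exists t : 'rV_1, exists x, W (row_mx (row_mx y t) x)).
  apply: (dense_gen cY iY); first exact: (qfdef_ex (qfdef_ex dW)).
  move=> l C hC [y1 Yy1 Cy1].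
  have [y2 Yy2 y2j] := gen_ex gj0.
  have [||y3 [Yy3 Cy3 y3j]] := irr_forms cY iY hC (fformX k j0); first by exists y1.
    by exists y2 => //; rewrite y2j oner_neq0.
  have [|x1 Xx1] := dense_phi (fformM hC (fformX k j0)).
    by exists y3; rewrite // mulf_neq0.
  rewrite mulf_eq0 => /norP [Cx1 x1j].
  have n1 := morph_near mphi.1 (mphi.2 _ Xx1)
    (near_form Y (fformM hC (fformX k j0)) (mulf_neq0 Cx1 x1j)) Xx1.
  have n0 : near X x0 (fun x => H x != 0 /\ G x <> 0).
    have [l0 Gl] := rV_neq0 Gx0.
    apply: near_mono (near_and (near_form X hH Hx0) (near_form X (hG l0) Gl)) => x _ [-> Gx].
    by split=> // G0; move: Gx; rewrite G0 mxE eqxx.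
  have g0 : gen X (fun x => H x != 0 /\ G x <> 0) by exists x0.
  have g1 : gen X (fun x => C (phi x) * phi x 0 j0 != 0) by exists x1.
  have [x Xx [x1' [[Hx Gx] CP]]] := gen_ex (gen_and cX iX gi0 (gen_and cX iX g0 g1)).
  move: CP; rewrite mulf_eq0 => /norP [Cx pj].
  have [c ec] := eG x Xx Gx.
  have c0 : c != 0 by apply/eqP=> c0; apply: Gx; rewrite ec c0 scale0r.
  have pj1 : phi x 0 j0 = 1.
    have [j [yj hj]] := cY.1 _ (mphi.1 _ Xx).
    have [lt|gt|/val_inj <- //] := ltngtP j j0.
      by move: (hj0 _ _ (mphi.1 _ Xx) lt); rewrite yj => /eqP; rewrite oner_eq0.
    by move: pj; rewrite hj ?eqxx.
  exists (phi x); split; [exact: mphi.1|exact: Cx|].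
  exists (const_mx (F x / H x)), x; rewrite /W row_mxKr !row_mxKl row_mxEr mxE; split.
  - by apply/(eE x (cX.1 _ Xx)).
  - by split=> [j ji|]; [apply: hi0 ji|rewrite x1' subrr].
  - by rewrite ec mxE mulf_neq0.
  - by move=> j; rewrite ec !mxE pj1 mulr1 mulrC subrr.
  - by split=> //; rewrite divfK // subrr.
apply: gen_mono (gen_and cY iY ex1 gj0) => y Yy [ext y1]; split=> // t Wt.
exact: sound Wt.
Qed.

(** Applied to a constant function, [definable_graph] says that the generic fibre is nonempty. *)
Lemma image_open : gen Y (fun y => exists2 x, X x & phi x = y).
Proof.
have [[x0 Xx0] _] := iX.
have [Gr [_ hGr]] := definable_graph Xx0 (regC X 0 x0).
apply: gen_mono hGr => y _ [[t Gt] h].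
have et : t = const_mx (t 0 ord0) by apply/rowP=> i; rewrite !mxE ord1.
by rewrite et in Gt; have [x [Xx px _]] := h _ Gt; exists x.
Qed.

(* If [g o phi] is regular, the value of [g] is the only root of a polynomial over the
   function field of [Y]; the root is purely inseparable. *)
Theorem purely_inseparable_descent p g x0 : p \in [pchar k] -> X x0 ->
  reg_at X (fun x => g (phi x)) x0 ->
  exists n, gen Y (fun y => reg_at Y (fun v => g v ^+ (p ^ n)) y).
Proof.
move=> hp Xx0 hg; have [Gr [dGr hGr]] := definable_graph Xx0 hg.
have eGr : gen Y (fun y => forall t, Gr (row_mx y (const_mx t)) <-> t = g y).
  apply: gen_mono hGr => y _ [[t0 Gt0] h] t; split=> [/h [x [_ <- <-]] //|->].
  have et : t0 = const_mx (t0 0 ord0) by apply/rowP=> i; rewrite !mxE ord1.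
  by rewrite et in Gt0; have [x [_ ex fx]] := h _ Gt0; rewrite ex in fx; rewrite fx.
have [n [a [l hal]]] := generic_root cY iY hp dGr eGr.
have [ma [Fa [hFa eFa]]] := pfun_form cY iY (ex_intro _ a (fun x => erefl (ev a x))).
have [ml [Fl [hFl eFl]]] := pfun_form cY iY (ex_intro _ l (fun x => erefl (ev l x))).
have [j0 [_ gj0]] := affine_chart cY iY.
exists n.
have [y Yy nr] := gen_and cY iY hal (gen_and cY iY eFa (gen_and cY iY eFl gj0)).
exists y => //; apply: near_mono (near_near nr) => v Yv nv.
have [[lv _] [_ [elv v1]]] := near_here Yv nv.
(* Powers of a coordinate that is generically 1 bring numerator and denominator to the same
   degree. *)
apply: (sec_near (t := fun v => (Fa v * v 0 j0 ^+ ml) / (Fl v * v 0 j0 ^+ ma))).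
  apply: near_mono nv => z Yz [[lz ez] [ea [el z1]]].
  by rewrite z1 !expr1n !mulr1 -ea -el -ez mulrC mulKf.
apply: (@secV _ _ _ (ma + ml)) => //; last by rewrite v1 expr1n mulr1 -elv.
  apply: secM; first exact: sec_form.
  by apply: sec_form; apply: fform_deg (fformXn ml (fformX k j0)); rewrite muln1.
rewrite addnC; apply: secM; first exact: sec_form.
by apply: sec_form; apply: fform_deg (fformXn ma (fformX k j0)); rewrite muln1.
Qed.

End Image.

Section Torsion.

Variables (k : closedFieldType) (d b : nat) (A : group_data k d) (B : group_data k b).
Variables (hA : agroup A) (hB : agroup B).
Variable D : 'rV[k]_(d * b) -> 'rV[k]_(d * b) -> k.
Hypothesis hD : dual_frames A B D.
Variables (lam : 'rV[k]_d -> 'rV[k]_b) (L : 'rV[k]_d -> 'rV[k]_d -> k).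
Hypothesis hpol : polarized A B D lam L.

Local Notation X := (pts A).
Local Notation GA := (Gp hA).
Local Notation GB := (Gp hB).
Local Notation Pf := (Pf D).
Local Notation cls := (cls A D).
Local Notation lamG := (@lamG k d b A B hA hB lam).

Implicit Types (x z t : GA) (y : GB) (N : 'rV[k]_d -> 'rV[k]_d -> k).

Lemma cohXn n N : coh X N -> coh X (fun u v => N u v ^+ n).
Proof.
move=> cN u Xu; apply: near_mono (cN u Xu) => z Xz h.
by apply: unit_ext (unitXn n h) => // v Xv; rewrite expr_div_n.
Qed.

Lemma cls_Xn n N y : coh X N -> cls N (val y) -> cls (fun u v => N u v ^+ n) (val (y *+ n)).
Proof.
move=> cN h; elim: n => [|n IH].
  apply: (cls_val0 hB hD); first exact: (cohXn 0 cN).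
  by apply: unit_triv => u Xu; apply: (unitC X u (oner_neq0 k)).
rewrite mulrS; have := cls_mul hA hD hpol cN (cohXn n cN) h IH.
by apply: triv_ext => u v _ _; rewrite exprS.
Qed.

(** The homomorphism attached to the pullback of [L] by [m] is [m ^ 2] times that of [L]. The
    quotient of the two bundles is therefore in Pic0, and [lam] reaches its class. *)
Lemma mult_bundle m : exists c, triv X (fun u v =>
  L (mult A m u) (mult A m v) / (L u v ^+ (m ^ 2) * Pf (val (lamG c)) u v)).
Proof.
have mm := morph_mult hA m; have cL := pol_coh hpol.
have cLm := coh_pull mm cL; have cLn := cohXn (m ^ 2) cL.
pose M u v := L (mult A m u) (mult A m v) / L u v ^+ (m ^ 2).
have cM : coh X M by have := cohM cLm (cohV cLn).
have pM : pic0 A M.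
  split=> // a Xa; set x := inG hA a.
  have ea : a = val x by rewrite inGK.
  have mt := trans_pts hA (ptsG x).
  have T1 := triv_pull mm (pol_eq hpol (ptsG (x *+ m))).
  have T2 := trivXn (m ^ 2) (pol_eq hpol (ptsG x)).
  have C1 := cls_mult hA hD hpol m (PfG_pic0 hD (lamG (x *+ m))) (cls_Pf hD (lamG (x *+ m))).
  have C2 := cls_Xn (m ^ 2) (PfG_coh hD (lamG x)) (cls_Pf hD (lamG x)).
  have ey : lamG (x *+ m) *+ m = lamG x *+ (m ^ 2) by rewrite (lamG_muln hB hpol) -mulrnA mulnn.
  rewrite ey in C1; set P := Pf (val (lamG x *+ m ^ 2)) in C1 C2.
  have cP : coh X P := PfG_coh hD _.
  have cPm := (PfG_coh hD (lamG (x *+ m))); rewrite (val_lamG hB hpol) in cPm C1.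
  have cPm' := coh_pull mm cPm.
  have cP1 := cohXn (m ^ 2) (PfG_coh hD (lamG x)); rewrite (val_lamG hB hpol) in cP1 C2.
  have cLt := cohXn (m ^ 2) (coh_pull mt cL).
  have cLmt := coh_pull mm (coh_pull (trans_pts hA (ptsG (x *+ m))) cL).
  rewrite ea; apply: triv_near (trivM (trivM (trivV T1) (trivV C1)) (trivM C2 T2)) => u Xu.
  apply: near_mono (near_and (coh_neq0 Xu cLm) (near_and (coh_neq0 Xu cLn)
    (near_and (coh_neq0 Xu cP) (near_and (coh_neq0 Xu cPm') (near_and (coh_neq0 Xu cP1)
    (near_and (coh_neq0 Xu cLt) (coh_neq0 Xu cLmt))))))) => v Xv [n1 [n2 [n3 [n4 [n5 [n6 n7]]]]]].
  have e w : X w -> mult A m (add A w (val x)) = add A (mult A m w) (val (x *+ m)).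
    by move=> Xw; rewrite -[w](inGK hA) // -valD -!valMn mulrnDl valD.
  rewrite /M !e // !expr_div_n.
  set a1 := L (mult A m u) _ in n1 *; set a2 := L u v ^+ _ in n2 *.
  set a3 := P u v in n3 *; set a4 := Pf _ (mult A m u) _ in n4 *.
  set a5 := Pf _ u v ^+ _ in n5 *; set a6 := L (add A u _) _ ^+ _ in n6 *.
  set a7 := L (add A _ _) _ in n7 *.
  by field; rewrite n1 n2 n3 n4 n5 n6 n7.
have [y hy] := pic0_cls hA hB hD pM.
have [g gK Kg] := lamG_bij hA hB hpol.
exists (g y); rewrite Kg; apply: triv_near (trivV hy) => u Xu.
apply: near_mono (near_and (coh_neq0 Xu (PfG_coh hD y)) (near_and (coh_neq0 Xu cLn)
  (coh_neq0 Xu cLm))) => v Xv [n1 [n2 n3]].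
by rewrite /M; field; rewrite n1 n2 n3.
Qed.

Record ample_frame (M e : nat) (Y : 'rV[k]_e -> Prop) (f : 'rV[k]_d -> 'rV[k]_e)
    (g : 'rV[k]_e -> 'rV[k]_d) : Prop := AmpleFrame {
  af_pos : (0 < M)%N;
  af_clo : clo Y;
  af_morph : morph X Y f;
  af_inv : morph Y X g;
  af_fK : forall u, X u -> g (f u) = u;
  af_gK : forall w, Y w -> f (g w) = w;
  af_triv : triv X (fun u v => L u v ^+ M / hyper_frame (f u) (f v)) }.

Variables (M e : nat) (Y : 'rV[k]_e -> Prop) (f : 'rV[k]_d -> 'rV[k]_e).
Variable (g : 'rV[k]_e -> 'rV[k]_d).
Hypothesis hL : ample_frame M Y f g.

Lemma reg_sub (Z : 'rV[k]_d -> Prop) h u : (forall v, Z v -> X v) -> reg_at X h u -> reg_at Z h u.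
Proof.
by move=> sZ [n [F [G [hF hG Gu eh]]]]; exists n, F, G; split=> // v /sZ; apply: eh.
Qed.

Lemma power_roots n (r : seq k) : (0 < n)%N -> exists s : seq k, forall z : k, z ^+ n \in r -> z \in s.
Proof.
move=> n0; pose p : {poly k} := \prod_(w <- r) ('X^n - w%:P).
have [s es] := closed_field_poly_normal p; exists s => z zr.
have p0 : p != 0.
  by apply: monic_neq0; apply: monic_prod => w _; apply: monicXnsubC.
have : root p z.
  rewrite /root /p horner_prod prodf_seq_eq0; apply/hasP; exists (z ^+ n) => //=.
  by rewrite !hornerE subrr.
by rewrite es rootZ ?lead_coef_eq0 // root_prod_XsubC.
Qed.

(* [L] is trivial up to a translate on [A[m]], which is therefore at once projective and
   quasi-affine. *)
Theorem torsion_finite m : (1 < m)%N -> exists s : seq GA, forall x, x *+ m = 0 -> x \in s.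
Proof.
move=> m1; have [c hc] := mult_bundle m; have cL := pol_coh hpol.
have mm := morph_mult hA m; have mc := trans_pts hA (ptsG c).
pose Z u := X u /\ mult A m u = zero A.
have cX := ag_clo hA; have mf := af_morph hL; have mfc := morph_comp mc mf.
have pY : forall w, Y w -> is_point w := (af_clo hL).1.
have sZ u : Z u -> X u by case.
have cZ : clo Z.
  apply: clo_ext (morph_clo mm.1 cX cX.1 mm.2 (clo_point (cX.1 _ (ag_zero hA)))) => u.
  by split=> -[].
(* The factor of class [lamG c] turns one of the [m ^ 2] copies of [L] into its translate by [c],
   which leaves the exponent [m ^ 2 - 1] on the others. Hyperplane frames replace the [M]-th powers
   of [L]. *)
have [Q hQ] : triv X (fun u v => L (mult A m u) (mult A m v) ^+ M /
    (hyper_frame (f u) (f v) ^+ (m ^ 2).-1 *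
     hyper_frame (f (add A u (val c))) (f (add A v (val c))))).
  have t1 := trivXn M (trivM hc (pol_eq hpol (ptsG c))).
  have t2 := trivM (trivXn (m ^ 2).-1 (af_triv hL)) (triv_pull mc (af_triv hL)).
  apply: triv_near (trivM t1 t2) => u Xu.
  apply: near_mono (near_and (coh_neq0 Xu (cohXn M cL)) (near_and
    (coh_neq0 Xu (cohXn M (coh_pull mc cL))) (coh_neq0 Xu (cohXn M (PfG_coh hD (lamG c))))))
    => v Xv [n1 [n2 n3]].
  rewrite -(val_lamG hB hpol c) !expr_div_n !exprMn.
  have -> : L u v ^+ (m ^ 2) = L u v ^+ (m ^ 2).-1 * L u v.
    by rewrite -exprSr prednK // expn_gt0 (ltnW m1).
  rewrite ?exprMn ?invfM ?invrK !exprMn !exprVn.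
  have -> : L u v ^+ (m ^ 2).-1 ^+ M = L u v ^+ M ^+ (m ^ 2).-1 by rewrite -!exprM mulnC.
  set a0 := _ ^+ M; set a1 := L u v ^+ M in n1 *; set a2 := L (add A u _) _ ^+ M in n2 *.
  set a3 := Pf _ u v ^+ M in n3 *.
  have n4 : a1 ^+ (m ^ 2).-1 != 0 by rewrite expf_neq0.
  set a4 := a1 ^+ _ in n4 *; set a5 := hyper_frame _ _ ^- _; set a6 := (hyper_frame _ _)^-1.
  by field; rewrite n1 n2 n3 n4.
(* Products of coordinates are sections of the bundle just trivialized. On [Z] the pullback of [L]
   is constant, so they become regular functions there and take finitely many values. *)
pose h ij v := (Q v)^-1 * f v 0 ij.1 ^+ (m ^ 2).-1 * f (add A v (val c)) 0 ij.2.
have regh ij u : Z u -> reg_at Z (h ij) u.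
  move=> Zu; have [Xu _] := Zu.
  have [i li fi] := lead_indexP (pY _ (mf.1 u Xu)).
  have [j lj fj] := lead_indexP (pY _ (mfc.1 u Xu)).
  have nfi : f u 0 i != 0 by rewrite fi oner_neq0.
  have nfj : f (add A u (val c)) 0 j != 0 by rewrite fj oner_neq0.
  have r1 := regXn (m ^ 2).-1 (coord_reg ij.1 Xu (mf.2 u Xu) nfi).
  have r2 := coord_reg ij.2 Xu (mfc.2 u Xu) nfj.
  have /(unitV Xu) [r0 _] := hQ u Xu.
  have := regM r0 (regM r1 r2).
  move=> /(reg_sub sZ) rr.
  have := regM (regC Z (L (zero A) (zero A) ^+ M) u) rr.
  apply: sec_near.
  have mulz v : Z v -> L (mult A m u) (mult A m v) = L (zero A) (zero A).
    by case: Zu => _ -> [_ ->].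
  have nz1 := near_mono (fun v (Zv : Z v) h => h)
    (sec_neq0 Zu (reg_sub sZ (hQ u Xu).1) (hQ u Xu).2).
  apply: near_mono nz1 => v Zv; rewrite mulz // /hyper_frame li lj /h.
  rewrite !mulf_eq0 !invr_eq0 mulf_eq0 !negb_or => /and3P [n1 n2 /andP [n3 n4]].
  rewrite expr_div_n; set a := L _ _ ^+ M in n2 *; set a1 := f v 0 i ^+ _ in n3 *.
  by field; rewrite n1 n2 n3 n4.
have /fchoice [r hr] : forall ij, exists r : seq k, forall u, Z u -> h ij u \in r.
  by move=> ij; have [r _ hr] := global_values cZ (regh ij); exists r.
pose R := [seq u / v | u <- flatten [seq r ij | ij <- enum {: 'I_e * 'I_e}],
  v <- flatten [seq r ij | ij <- enum {: 'I_e * 'I_e}]].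
have inR ij u : Z u -> h ij u \in flatten [seq r ij | ij <- enum {: 'I_e * 'I_e}].
  move=> Zu; apply/flattenP; exists (r ij); last exact: hr.
  by apply: map_f; rewrite mem_enum.
have [|S hS] := @power_roots (m ^ 2).-1 R.
  by rewrite -subn1 subn_gt0 -{1}(expn0 m) ltn_exp2l.
exists [seq inG hA (g (\row_a S`_(w a))) | w : {ffun 'I_e -> 'I_(size S)}] => x xm.
have Zx : Z (val x) by split; rewrite -?valMn ?xm ?val0 //; apply: ptsG.
have Xx := ptsG x.
have fS a : f (val x) 0 a \in S.
  apply: hS; apply/allpairsP.
  have [i li fi] := lead_indexP (pY _ (mf.1 _ Xx)).
  have [j lj fj] := lead_indexP (pY _ (mfc.1 _ Xx)).
  (* The quotient of the two values is the power of exponent [m ^ 2 - 1] of coordinate [a], because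
     coordinate [i] is 1. *)
  exists (h (a, j) (val x), h (i, j) (val x)); split; [exact: inR|exact: inR|].
  have Q0 : Q (val x) != 0 by have := (hQ _ Xx).2; rewrite mulf_eq0 => /norP [].
  by rewrite /h /= fi fj expr1n !mulr1 invrK mulrAC mulVf // mul1r.
have wlt a : (seq.index (f (val x) 0%R a) S < size S)%N by rewrite index_mem.
apply/mapP; exists [ffun a => Ordinal (wlt a)]; first by rewrite mem_enum.
have -> : \row_a S`_([ffun a => Ordinal (wlt a)] a) = f (val x).
  by apply/rowP=> a; rewrite mxE ffunE /= nth_index.
by rewrite (af_fK hL) // valGK.
Qed.

End Torsion.

(** * Frobenius descent *)

Section Frobenius.

Variables (k : closedFieldType) (q : nat).
Hypothesis hq : [pchar k].-nat q.

Lemma frob_sum (I : Type) (r : seq I) (F : I -> k) :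
  (\sum_(i <- r) F i) ^+ q = \sum_(i <- r) F i ^+ q.
Proof.
have q0 : (0 < q)%N by case/andP: hq.
elim: r => [|i r IH]; first by rewrite !big_nil expr0n; case: q q0.
by rewrite !big_cons exprDn_pchar ?IH.
Qed.

Lemma frobB (x y : k) : (x - y) ^+ q = x ^+ q - y ^+ q.
Proof. by apply/eqP; rewrite eq_sym subr_eq -exprDn_pchar // subrK. Qed.

Lemma frob_inj (x y : k) : x ^+ q = y ^+ q -> x = y.
Proof.
move=> e; apply/eqP; rewrite -subr_eq0.
have : (x - y) ^+ q == 0 by rewrite frobB e subrr.
by rewrite expf_eq0 => /andP [].
Qed.

Lemma ev_frobenius d (g : {mpoly k[d]}) x : g \is a mpolyOver d (Fq k q) ->
  ev g (frobenius q x) = ev g x ^+ q.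
Proof.
move=> /allP hg; rewrite !ev_homogE frob_sum; apply: eq_big_seq => u us.
have /eqP cu : g@_u \in Fq k q by have := hg g@_u (map_f _ us).
 rewrite exprMn cu; congr (_ * _).
rewrite -prodrXl; apply: eq_bigr => i _.
by rewrite mxE -!exprM mulnC.
Qed.

Lemma frobenius_point d (x : 'rV[k]_d) : is_point x -> is_point (frobenius q x).
Proof.
have q0 : (0 < q)%N by case/andP: hq.
move=> [i [xi h]]; exists i; split=> [|j ji]; first by rewrite mxE xi expr1n.
by rewrite mxE h // expr0n eqn0Ngt q0.
Qed.

Lemma frobenius_inj d : injective (@frobenius k q d).
Proof.
by move=> x y /rowP e; apply/rowP=> i; have := e i; rewrite !mxE => /frob_inj.
Qed.

Lemma frobenius_closed d (X : 'rV[k]_d -> Prop) x : closed_set (Fq k q) X ->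
  X x -> X (frobenius q x).
Proof.
have q0 : (0 < q)%N by case/andP: hq.
move=> [S [hS hX]] /hX [px Sx]; apply/hX; split=> [|g Sg]; first exact: frobenius_point.
have [m [_ og]] := hS g Sg.
by rewrite (ev_frobenius _ og) Sx // expr0n eqn0Ngt q0.
Qed.

Lemma frobenius_morph d e (X : 'rV[k]_d -> Prop) (Y : 'rV[k]_e -> Prop) f x :
  (forall y, X y -> X (frobenius q y)) -> (forall y, Y y -> is_point y) ->
  morphism_over (Fq k q) X Y f -> X x -> f (frobenius q x) = frobenius q (f x).
Proof.
move=> cX pY [f1 f2] Xx; have Xq := cX x Xx.
have [m [G [hG Gx eG]]] := f2 x Xx.
have eq : \row_j ev (G j) (frobenius q x) = frobenius q (\row_j ev (G j) x).
  by apply/rowP=> j; rewrite !mxE ev_frobenius //; case: (hG j).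
have nq : frobenius q (\row_j ev (G j) x) <> 0.
  move=> e0; apply: Gx; apply: (@frobenius_inj e); rewrite e0.
  apply/rowP=> j; rewrite !mxE expr0n.
  by have : (0 < q)%N by [case/andP: hq]; case: q.
have [|c ec] := eG _ Xq; first by rewrite eq.
have [c' ec'] := eG _ Xx Gx.
have c0 : c != 0 by apply/eqP=> c0; apply: nq; rewrite -eq ec c0 scale0r.
apply: (@is_point_eq _ _ (c^-1 * c' ^+ q)); [exact/pY/f1|exact/frobenius_point/pY/f1|].
apply: (scalerI c0); rewrite scalerA mulrA divff // mul1r -ec eq ec'.
by apply/rowP=> j; rewrite !mxE exprMn.
Qed.

End Frobenius.

Section FrobeniusGroup.

Variables (k : closedFieldType) (q d : nat) (A : group_data k d) (hA : agroup A).
Hypotheses (hq : [pchar k].-nat q) (q1 : (1 < q)%N).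
Hypothesis hAF : abelian_variety (Fq k q) A.
Hypothesis halg : forall x : k, exists2 m : nat, (0 < m)%N & x \in Fq k (q ^ m).

Local Notation GA := (Gp hA).
Local Notation X := (pts A).
Implicit Types x y z : GA.

Definition frobG x : GA := inG hA (frobenius q (val x)).

Lemma inG_frobenius u : X u -> inG hA (frobenius q u) = frobG (inG hA u).
Proof. by move=> Xu; rewrite /frobG inGK. Qed.

Lemma val_frobG x : val (frobG x) = frobenius q (val x).
Proof.
have [[cA _] _ _ _ _] := hAF.
by rewrite inGK //; apply: (frobenius_closed hq cA); apply: ptsG.
Qed.

Lemma frobG_inj : injective frobG.
Proof.
by move=> x y /(congr1 val); rewrite !val_frobG => /(frobenius_inj hq) /val_inj.
Qed.

Lemma frobenius_segre e (u : 'rV[k]_d) (v : 'rV[k]_e) :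
  frobenius q (segre u v) = segre (frobenius q u) (frobenius q v).
Proof.
apply/rowP=> l; case/mxvec_indexP: l => i j.
by rewrite mxE !segreE !mxE exprMn.
Qed.

Lemma frobGD x y : frobG (x + y) = frobG x + frobG y.
Proof.
have [[cA _] _ [h [mh eh]] _ _] := hAF.
have fX u : X u -> X (frobenius q u) by apply: (frobenius_closed hq cA).
have Xx := ptsG x; have Xy := ptsG y.
apply/val_inj; rewrite valD !val_frobG valD -!eh //; try exact: fX.
rewrite -frobenius_segre; symmetry.
apply: (frobenius_morph hq _ _ mh); last by exists (val x), (val y).
  by move=> _ [u [v [Xu Xv ->]]]; exists (frobenius q u), (frobenius q v);
    split; [exact: fX|exact: fX|exact: frobenius_segre].
exact: (ag_clo hA).1.
Qed.

Lemma frobG_Mn n x : frobG (x *+ n) = frobG x *+ n.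
Proof.
elim: n => [|n IH]; last by rewrite !mulrS frobGD IH.
by apply: (addrI (frobG 0)); rewrite -frobGD !mulr0n !addr0.
Qed.

Lemma iter_frobGD n x y : iter n frobG (x + y) = iter n frobG x + iter n frobG y.
Proof. by elim: n => //= n ->; apply: frobGD. Qed.

Lemma iter_frobG_Mn n m x : iter n frobG (x *+ m) = iter n frobG x *+ m.
Proof. by elim: n => //= n ->; apply: frobG_Mn. Qed.

Lemma iter_frobGN n x : iter n frobG (- x) = - iter n frobG x.
Proof.
apply: (addIr (iter n frobG x)); rewrite -iter_frobGD !addNr.
by apply: (addrI (iter n frobG 0)); rewrite -iter_frobGD !addr0.
Qed.

Lemma iter_frobenius n e (u : 'rV[k]_e) : iter n (@frobenius k q e) u = frobenius (q ^ n) u.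
Proof.
elim: n => [|n /= ->]; first by apply/rowP=> i; rewrite mxE expr1.
by apply/rowP=> i; rewrite !mxE -exprM expnSr.
Qed.

Lemma val_iter_frobG n x : val (iter n frobG x) = frobenius (q ^ n) (val x).
Proof. by rewrite -iter_frobenius; elim: n => //= n <-; apply: val_frobG. Qed.

Lemma fixed_mul m n x : iter m frobG x = x -> iter (m * n) frobG x = x.
Proof.
by move=> e; elim: n => [|n IH]; rewrite ?muln0 // mulnS iterD IH.
Qed.

Lemma rational_level x : exists2 m, (0 < m)%N & iter m frobG x = x.
Proof.
have /fchoice [m hm] : forall i, exists m, (0 < m)%N /\ val x 0 i \in Fq k (q ^ m).
  by move=> i; have [m m0 hm] := halg (val x 0 i); exists m.
exists (\prod_i m i)%N; first by rewrite prodn_gt0 // => i; case: (hm i).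
apply/val_inj; rewrite val_iter_frobG; apply/rowP=> i; rewrite mxE.
have [_ /eqP hi] := hm i; rewrite (bigD1 i) //=; set r := (\prod_(j < d | j != i) _)%N.
elim: r => [|r IH]; first by rewrite muln0 expr1.
by rewrite mulnS expnD exprM hi.
Qed.

Lemma common_level (s : seq GA) : exists2 m, (0 < m)%N & forall x, x \in s -> iter m frobG x = x.
Proof.
elim: s => [|x s [m m0 hm]]; first by exists 1%N.
have [n n0 hn] := rational_level x; exists (n * m)%N; first by rewrite muln_gt0 n0.
move=> y; rewrite inE => /orP [/eqP -> |/hm]; first exact: fixed_mul.
by rewrite mulnC; apply: fixed_mul.
Qed.

Lemma finite_level m : (0 < m)%N -> exists2 s : seq GA, uniq s &
  forall x, x \in s <-> iter m frobG x = x.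
Proof.
move=> m0; have [s hs] : exists s : seq GA, forall x, iter m frobG x = x -> x \in s.
  have [r hr] : exists r : seq k, forall c, c ^+ (q ^ m) = c -> c \in r.
    pose p : {poly k} := 'X^(q ^ m) - 'X.
    have [r er] := closed_field_poly_normal p; exists r => c ec.
    have sp : size p = (q ^ m).+1.
      have h1 : (1 < q ^ m)%N by rewrite -(expn0 q) ltn_exp2l.
      by rewrite size_polyDl ?size_polyXn // size_polyN size_polyX ltnS.
    have : root p c by rewrite /root !hornerE ec subrr.
    by rewrite er rootZ ?root_prod_XsubC // lead_coef_eq0 -size_poly_eq0 sp.
  exists [seq inG hA (\row_a r`_(w a)) | w : {ffun 'I_d -> 'I_(size r)}] => x xm.
  have inr a : val x 0 a \in r.
    by apply: hr; rewrite -[in RHS]xm val_iter_frobG mxE.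
  have wlt a : (seq.index (val x 0%R a) r < size r)%N by rewrite index_mem.
  apply/mapP; exists [ffun a => Ordinal (wlt a)]; first by rewrite mem_enum.
  rewrite -[LHS]valGK; congr (inG hA _).
  by apply/rowP=> a; rewrite mxE ffunE /= nth_index.
exists (undup [seq x <- s | iter m frobG x == x]); first exact: undup_uniq.
move=> x; rewrite mem_undup mem_filter; split=> [/andP [/eqP]//|e].
by rewrite e eqxx hs.
Qed.

Section Divisible.

Variables (m : nat) (tor : seq GA).
Hypothesis htor : forall x, x *+ m = 0 -> x \in tor.

(** In the finite group [H] of points fixed by a power of Frobenius, the subgroup of multiples of
    [m] has index equal to the number of [m]-torsion points of [H], hence at most [size tor]. *)
Lemma finite_cosets : exists r : seq GA, forall x, exists2 y, y \in r & exists z, x = y + z *+ m.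
Proof.
apply: NNPP => no.
pose inc (r : seq GA) := forall i j, (i < j < size r)%N -> forall z, r`_j - r`_i <> z *+ m.
have [r [sr hr]] : exists r, size r = (size tor).+1 /\ inc r.
  elim: (size tor).+1 => [|t [r [sr hr]]]; first by exists [::]; split=> // i j; rewrite ltn0 andbF.
  have [x hx] : exists x, forall y, y \in r -> forall z, x <> y + z *+ m.
    apply: NNPP => nx; apply: no; exists r => x; apply: NNPP => nxx; apply: nx.
    by exists x => y yr z e; apply: nxx; exists y => //; exists z.
  exists (rcons r x); rewrite size_rcons sr; split=> // i j.
  rewrite size_rcons sr ltnS => /andP [ij jt] z; rewrite !nth_rcons sr.
  rewrite (leq_trans ij jt); have [lt|] := ltnP j t.
    by apply: hr; rewrite ij sr.
  move=> tj; have -> : j = t by apply/eqP; rewrite eqn_leq jt.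
  rewrite eqxx => e; apply: (hx r`_i _ z); first by rewrite mem_nth // sr (leq_trans ij).
  by rewrite -e addrC subrK.
have [M M0 hM] := common_level r; have [H uH eH] := finite_level M0.
pose I := undup [seq x *+ m | x <- H].
have HD x y : x \in H -> y \in H -> x + y \in H.
  by move=> /eH hx /eH hy; apply/eH; rewrite iter_frobGD hx hy.
have HN x : x \in H -> - x \in H.
  by move=> /eH hx; apply/eH; rewrite iter_frobGN hx.
have HM x n : x \in H -> x *+ n \in H by move=> /eH hx; apply/eH; rewrite iter_frobG_Mn hx.
have H0 : 0 \in H.
  by apply/eH; apply: (addrI (iter M frobG 0)); rewrite -iter_frobGD !addr0.
have IH y : y \in I -> y \in H.
  by rewrite mem_undup => /mapP [x xH ->]; apply: HM.
have I0 : (0 < size I)%N.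
  have : 0 \in I by rewrite mem_undup; apply/mapP; exists 0; rewrite ?mul0rn.
  by case: (I).
have le1 : ((size tor).+1 * size I <= size H)%N.
  rewrite -sr -(size_allpairs (fun x y : GA => x + y)); apply: uniq_leq_size.
    apply: allpairs_uniq; [|exact: undup_uniq|].
      apply/(uniqP 0) => i j; rewrite !inE => si sj e.
      have [lt|lt|//] := ltngtP i j.
        by case: (hr i j _ 0); rewrite ?lt // e subrr mul0rn.
      by case: (hr j i _ 0); rewrite ?lt // e subrr mul0rn.
    move=> [x y] [x' y'] /allpairsP [[a b'] [/= ar bI [-> ->]]].
    move=> /allpairsP [[a' b''] [/= ar' bI' [-> ->]]] /= e.
    have ea : a = a'.
      have /(nthP 0) [i si ei] := ar; have /(nthP 0) [j sj ej] := ar'.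
      move: bI bI'; rewrite !mem_undup => /mapP [c _ ec] /mapP [c' _ ec'].
      have ed : a' - a = (c - c') *+ m.
        rewrite mulrnBl -ec -ec'; apply/eqP; rewrite subr_eq addrAC eq_sym subr_eq eq_sym.
        by rewrite addrC e addrC.
      have [lt|lt|eij] := ltngtP i j; last by rewrite -ei -ej eij.
        by case: (hr i j _ (c - c')); rewrite ?lt // ei ej.
      case: (hr j i _ (c' - c)); rewrite ?lt // ei ej.
      by rewrite -opprB ed -mulNrn opprB.
    by move: e; rewrite ea => /addrI ->.
  move=> _ /allpairsP [[x y] [/= xr yI ->]]; apply: HD; last exact: IH.
  by apply/eH; apply: hM.
have le2 : (size H <= size tor * size I)%N.
  pose sec y := nth 0 H (find (fun x => x *+ m == y) H).
  have hsec x : x \in H -> sec (x *+ m) *+ m = x *+ m.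
    move=> xH; apply/eqP; apply: (@nth_find _ 0 (fun z => z *+ m == x *+ m)).
    by apply/hasP; exists x.
  rewrite -(size_map (fun x => (x - sec (x *+ m), x *+ m))).
  rewrite -(size_allpairs (fun x y : GA => (x, y))); apply: uniq_leq_size.
    rewrite map_inj_in_uniq // => x y _ _ [e1 e2].
    by move: e1; rewrite e2 => /addIr.
  move=> _ /mapP [x xH ->]; apply/allpairsP; exists (x - sec (x *+ m), x *+ m); split=> //=.
    by apply: htor; rewrite mulrnBl hsec // subrr.
  by rewrite mem_undup; apply: map_f.
have := leq_trans le1 le2; rewrite leq_mul2r ltnn orbF => /eqP eI.
by rewrite eI in I0.
Qed.

(** Finitely many translates of the closure of the image cover the irreducible [A], so one of them,
    and then the closure itself, is everything. *)
Lemma divisible_dense n C : fform n C -> (exists2 u, X u & C u != 0) ->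
  exists2 u, X u & C (mult A m u) != 0.
Proof.
move=> hC [u Xu Cu]; apply: NNPP => no.
have [cX iX] := (ag_clo hA, ag_irr hA).
pose Z (v : 'rV[k]_d) := is_point v /\ forall n F, fform n F ->
  (forall w, X w -> F (mult A m w) = 0) -> F v = 0.
have cZ : clo Z.
  split=> [v []//|v pv nZ]; apply: NNPP => nF; apply: nZ; split=> // l F hF hw.
  apply/eqP/negbNE/negP => Fv; apply: nF; exists l, F; split=> // z [_ h]; exact: h hF hw.
have [r hr] := finite_cosets.
pose W i v := X v /\ Z (add A v (val (- r`_i : GA))).
have [|w Xw|i ir hi] := @irr_cover _ _ X (size r) W iX.
- by move=> i _; have mt := trans_pts hA (ptsG (- r`_i)); apply: (morph_clo mt.1 cX cX.1 mt.2 cZ).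
- have [y /(nthP 0) [i ir ei] [z ez]] := hr (inG hA w); exists i => //; split=> //.
  have -> : add A w (val (- r`_i)) = mult A m (val z).
    by rewrite -[w](inGK hA) // -valD ez ei addrAC subrr add0r valMn.
  split; first by apply: cX.1; apply: pts_mult => //; apply: ptsG.
  by move=> l F hF; apply; apply: ptsG.
have [_] := hi (val (inG hA u + r`_i)) (ptsG _).
rewrite -valD addrK inGK // => -[_ h].
move: Cu; rewrite (h n C hC) ?eqxx // => w Xw.
by apply/eqP/negbNE/negP => Cw; apply: no; exists w.
Qed.

(** The image of multiplication by [m] contains a dense open set [U], which meets [x - U]. *)
Theorem divisible x : exists y, x = y *+ m.
Proof.
have [cX iX] := (ag_clo hA, ag_irr hA); have mm := morph_mult hA m.
have [y Xy hy] := image_open cX iX cX iX mm divisible_dense.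
have mf : morph X X (fun u => add A (val x) (opp A u)).
  by have := morph_addG hA (morph_constG (hA := hA) X x) (ag_mopp hA).
pose y' := x - inG hA y.
have ey : add A (val x) (opp A (val y')) = y.
  by rewrite -valN -valD opprB addrC subrK inGK.
have h2 : near X (val y') (fun u => exists2 w, X w & mult A m w = add A (val x) (opp A u)).
  have hy' := hy; rewrite -ey in hy'.
  exact: (morph_near mf.1 (mf.2 _ (ptsG y')) hy' (ptsG y')).
have [u [Xu [w1 Xw1 e1] [w2 Xw2 e2]]] := irr_near cX iX Xy (ptsG y') hy h2.
exists (inG hA w1 + inG hA w2); apply/val_inj.
rewrite mulrnDl valD !valMn !inGK // e1 e2.
by rewrite -[u](inGK hA) // -!valN -!valD addrC subrK.
Qed.

End Divisible.

End FrobeniusGroup.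

Section Descent.

Variables (k : closedFieldType) (q : nat).
Hypotheses (hq : [pchar k].-nat q) (q1 : (1 < q)%N).
Hypothesis halg : forall x : k, exists2 m : nat, (0 < m)%N & x \in Fq k (q ^ m).

Let hqn n : [pchar k].-nat (q ^ n)%N.
Proof. by rewrite pnatX hq. Qed.

Definition twist d n (g : {mpoly k[d]}) : {mpoly k[d]} :=
  \sum_(u <- msupp g) g@_u ^+ n *: 'X_[u].

Lemma mcoeff_twist d n (g : {mpoly k[d]}) u : (0 < n)%N -> (twist n g)@_u = g@_u ^+ n.
Proof.
move=> n0; rewrite /twist linear_sum /=.
have [us|us] := boolP (u \in msupp g).
  rewrite (bigD1_seq u) ?msupp_uniq //= mcoeffZ mcoeffX eqxx mulr1.
  by rewrite big1 ?addr0 // => v vu; rewrite mcoeffZ mcoeffX (negPf vu) mulr0.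
rewrite (memN_msupp_eq0 us) expr0n eqn0Ngt n0 /= big_seq big1 // => v vs.
rewrite mcoeffZ mcoeffX; case: eqP => [e|_]; last by rewrite mulr0.
by rewrite -e vs in us.
Qed.

Lemma twist_homog d n m (g : {mpoly k[d]}) : g \is m.-homog -> twist n g \is m.-homog.
Proof.
move=> /dhomogP hg; rewrite /twist big_seq; apply: rpred_sum => u us.
by apply: rpredZ; rewrite dhomogX /= (hg u us).
Qed.

Lemma ev_twist d n (g : {mpoly k[d]}) x :
  ev (twist (q ^ n) g) (frobenius (q ^ n) x) = ev g x ^+ (q ^ n).
Proof.
rewrite {1}/ev /twist linear_sum /= ev_homogE (frob_sum (hqn n)); apply: eq_bigr => u _.
rewrite mevalZ mevalX exprMn; congr (_ * _).
by rewrite -prodrXl; apply: eq_bigr => i _; rewrite mxE -!exprM mulnC.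
Qed.

Lemma scalar_level (s : seq k) : exists2 m, (0 < m)%N & forall x, x \in s -> x ^+ (q ^ m) = x.
Proof.
have fmul m n (x : k) : x ^+ (q ^ m) = x -> x ^+ (q ^ (m * n)) = x.
  by move=> e; elim: n => [|n IH]; rewrite ?muln0 // mulnS expnD exprM e.
elim: s => [|x s [m m0 hm]]; first by exists 1%N.
have [n n0 /eqP hn] := halg x; exists (n * m)%N; first by rewrite muln_gt0 n0.
move=> y; rewrite inE => /orP [/eqP -> |/hm]; first exact: fmul.
by rewrite mulnC; apply: fmul.
Qed.

(** The separable polynomial [Q] has [q ^ M] roots, more than [P] can have. *)
Lemma finite_subfield M (P : {poly k}) : (0 < M)%N -> P != 0 -> (size P <= q ^ M)%N ->
  exists2 c : k, c ^+ (q ^ M) = c & P.[c] != 0.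
Proof.
move=> M0 P0 sP; pose Q : {poly k} := 'X^(q ^ M) - 'X.
have h1 : (1 < q ^ M)%N by rewrite -(expn0 q) ltn_exp2l.
have sQ : size Q = (q ^ M).+1.
  by rewrite size_polyDl ?size_polyXn // size_polyN size_polyX ltnS.
have Q0 : Q != 0 by rewrite -size_poly_eq0 sQ.
have [r er] := closed_field_poly_normal Q.
have qk : (q ^ M)%:R = 0 :> k.
  have /andP [_ /allP hall] := hqn M.
  have pd := pdiv_dvd (q ^ M); have /hall : pdiv (q ^ M) \in primes (q ^ M).
    by rewrite mem_primes pdiv_prime // pd (ltnW h1).
  move=> hp; apply/eqP; rewrite -(dvdn_pcharf hp); exact: pd.
have uQ : separable_poly Q.
  rewrite unlock /Q derivB derivXn derivX -mulr_natr.
  rewrite -(rmorph_nat (@polyC k)) /= qk mulr0 sub0r -polyCN -alg_polyC coprimepZr ?oppr_eq0 ?oner_neq0 //; exact: coprimep1.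
have ur : uniq r.
  rewrite -separable_prod_XsubC; move: uQ; rewrite er.
  by rewrite (eqp_separable (eqp_scale _ _)) ?lead_coef_eq0.
have sr : size r = (q ^ M)%N.
  have := sQ; rewrite er size_scale ?lead_coef_eq0 // size_prod_XsubC.
  by case.
have [/allP hall|/allPn [c cr nc]] := boolP (all (root P) r); last first.
  exists c => //; apply/eqP; rewrite -subr_eq0.
  have : root Q c by rewrite er rootZ ?lead_coef_eq0 // root_prod_XsubC.
  by rewrite /root !hornerE.
by have := max_poly_roots P0 (introT allP hall) ur; rewrite sr ltnNge sP.
Qed.

Lemma cyclic_sum M (F : nat -> k) : F M = F 0%N -> \sum_(j < M) F j.+1 = \sum_(j < M) F j.
Proof.
case: M => [|M] e; first by rewrite !big_ord0.
by rewrite big_ord_recr big_ord_recl /= e addrC.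
Qed.

Variables (d e : nat) (X : 'rV[k]_d -> Prop) (Y : 'rV[k]_e -> Prop) (f : 'rV[k]_d -> 'rV[k]_e).
Hypotheses (cX : closed_set (Fq k q) X) (mf : morph X Y f).
Hypothesis ff : forall x, X x -> f (frobenius q x) = frobenius q (f x).

Lemma frobenius_surj n x : X x -> exists2 y, X y & frobenius (q ^ n) y = x.
Proof.
have q0 : (0 < q)%N := ltnW q1.
elim: n x => [|n IH] x Xx.
  by exists x => //; apply/rowP=> i; rewrite mxE expr1.
suff [y Xy ey] : exists2 y, X y & frobenius q y = x.
  have [z Xz ez] := IH y Xy; exists z => //; rewrite -ey -ez.
  by apply/rowP=> i; rewrite !mxE -exprM expnSr.
have /fchoice [t ht] : forall i, exists c : k, c ^+ q = x 0 i.
  move=> i; have [c ec] := @solve_monicpoly k q (fun j => if j == 0%N then x 0 i else 0) q0.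
  exists c; rewrite ec -(prednK q0) big_ord_recl /= mulr1 big1 ?addr0 // => j _.
  by rewrite mul0r.
have ey : frobenius q (\row_i t i) = x by apply/rowP=> i; rewrite !mxE ht.
exists (\row_i t i) => //.
have [S [hS hX]] := cX; apply/hX; have [px Sx] := (hX x).1 Xx; split=> [|g Sg].
  have [i [xi hi]] := px; exists i; split=> [|j ji]; rewrite mxE; apply: (frob_inj hq).
    by rewrite ht xi expr1n.
  by rewrite ht hi // expr0n eqn0Ngt q0.
have [m [_ og]] := hS g Sg; apply: (frob_inj hq).
by rewrite -(ev_frobenius hq) // ey Sx // expr0n eqn0Ngt q0.
Qed.

(* Forms over [k] are replaced by the trace, from a finite field, of a multiple of them. *)
Theorem frobenius_descent : morphism_over (Fq k q) X Y f.
Proof.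
split=> [|x Xx]; first exact: mf.1.
have /morphP [_ hf] := mf.
have [m [G [hG Gx eG]]] := hf x Xx.
have hom j : G j \is m.-homog by case: (hG j).
pose cs := flatten [seq [seq (G j)@_u | u <- msupp (G j)] | j <- enum 'I_e].
have [M M0 hM] := scalar_level cs.
have cfix j u : (G j)@_u ^+ (q ^ M) = (G j)@_u.
  have [us|us] := boolP (u \in msupp (G j)); last first.
    by rewrite (memN_msupp_eq0 us) expr0n eqn0Ngt expn_gt0 (ltnW q1).
  apply: hM; apply/flattenP; exists [seq (G j)@_u | u <- msupp (G j)]; last exact: map_f.
  by apply: map_f; rewrite mem_enum.
have qn0 n : (0 < q ^ n)%N by rewrite expn_gt0 (ltnW q1).
pose V y j := \row_i ev (twist (q ^ j) (G i)) y.
have [i0 hi0] : exists i, ev (G i) x != 0.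
  by have [i] := rV_neq0 Gx; rewrite mxE => h; exists i.
(* The trace of [c] times the form [G i0], evaluated at [x], as a polynomial in [c]; its linear
   coefficient is the nonzero value [ev (G i0) x]. *)
pose P : {poly k} := \sum_(j < M) V x j 0 i0 *: 'X^(q ^ j).
have cP1 : P`_1 = ev (G i0) x.
  rewrite /P coef_sum -(prednK M0) big_ord_recl /= coefZ coefXn expn0 eqxx mulr1 big1 ?addr0.
    have := ev_twist 0 (G i0) x; rewrite expn0 expr1 => <-; rewrite mxE.
    by congr (ev _ _); apply/rowP=> i; rewrite mxE expr1.
  move=> j _; rewrite coefZ coefXn /= ltn_eqF ?mulr0 //.
  by rewrite -{1}(expn0 q) ltn_exp2l // /bump.
have [||c ec Pc] := @finite_subfield M P M0.
- by apply: contraNneq hi0 => P0; rewrite -cP1 P0 coef0.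
- apply: (leq_trans (size_sum _ _ _)); apply/bigmax_leqP => j _.
  apply: (leq_trans (size_scale_leq _ _)); rewrite size_polyXn.
  by rewrite ltn_exp2l.
pose T i := \sum_(j < M) c ^+ (q ^ j) *: twist (q ^ j) (G i).
have eT y : \row_i ev (T i) y = \sum_(j < M) c ^+ (q ^ j) *: V y j.
  apply/rowP=> i; rewrite mxE summxE /ev /T linear_sum /=.
  by apply: eq_bigr => j _; rewrite !mxE mevalZ.
exists m, T; split.
- move=> i; split.
    by apply: rpred_sum => j _; apply: rpredZ; apply: twist_homog.
  apply/allP => _ /mapP [u _ ->]; rewrite inE /=; apply/eqP.
  have cT : (T i)@_u = \sum_(j < M) (c * (G i)@_u) ^+ (q ^ j).
    by rewrite linear_sum; apply: eq_bigr => j _; rewrite /= mcoeffZ mcoeff_twist // exprMn.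
  rewrite cT (frob_sum hq).
  have := @cyclic_sum M (fun j => (c * (G i)@_u) ^+ (q ^ j)).
  rewrite expn0 expr1 [X in X = _ -> _]exprMn ec cfix => /(_ erefl) <-.
  by apply: eq_bigr => j _; rewrite -exprM -expnSr.
- move=> /rowP /(_ i0); rewrite eT mxE => T0; move: Pc.
  rewrite /P horner_sum; apply/negP; rewrite negbK; apply/eqP; rewrite -[RHS]T0 summxE.
  by apply: eq_bigr => j _; rewrite !hornerE !mxE mulrC.
move=> y Xy _; rewrite eT.
(* As [f] commutes with Frobenius, each conjugate of [G] is proportional to [f], and so is any
   combination of them. *)
have hV j : exists t, V y j = t *: f y.
  have [z Xz ez] := frobenius_surj j Xy.
  have fz : f y = frobenius (q ^ j) (f z).
    rewrite -ez; elim: (j) => [|n IH].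
      rewrite (_ : frobenius _ z = z); last by apply/rowP=> i; rewrite mxE expr1.
      by apply/rowP=> i; rewrite mxE expr1.
    have eF (d' : nat) (u : 'rV[k]_d') :
        frobenius (q ^ n.+1) u = frobenius q (frobenius (q ^ n) u).
      by apply/rowP=> i; rewrite !mxE -exprM expnSr.
    rewrite !eF ff ?IH //.
    by elim: n {IH eF} => [|n IH]; [rewrite (_ : frobenius _ z = z) //; apply/rowP=> i;
       rewrite mxE expr1 | rewrite (_ : frobenius _ z = frobenius q (frobenius (q ^ n) z));
       [exact: (frobenius_closed hq cX) | apply/rowP=> i; rewrite !mxE -exprM expnSr]].
  have [t et] : exists t, \row_i ev (G i) z = t *: f z.
    have [e0|n0] := classic (\row_i ev (G i) z = 0); last exact: eG.
    by exists 0; rewrite e0 scale0r.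
  exists (t ^+ (q ^ j)); rewrite fz -ez; apply/rowP=> i; rewrite !mxE ev_twist.
  by have /rowP/(_ i) := et; rewrite !mxE => ->; rewrite exprMn.
have /fchoice [t ht] : forall j : 'I_M, exists t, V y j = t *: f y by [].
exists (\sum_(j < M) c ^+ (q ^ j) * t j); rewrite scaler_suml.
by apply: eq_bigr => j _; rewrite ht scalerA.
Qed.

End Descent.

(** A common denominator turns the local quotients into forms of one degree; the factors [C] and
    [G i] confine their nonvanishing to the neighbourhood where the quotients are valid. *)
Lemma morph_at_reg (k : closedFieldType) (d e : nat) (X : 'rV[k]_d -> Prop)
    (f : 'rV[k]_d -> 'rV[k]_e) (c : 'I_e -> 'rV[k]_d -> k) x j0 : X x ->
  (forall j, reg_at X (c j) x) -> c j0 x != 0 ->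
  near X x (fun v => exists t, \row_j c j v = t *: f v) -> morph_at X f x.
Proof.
move=> Xx rc c0 [n [C [hC Cx hC']]].
have /fchoice [m /fchoice [F /fchoice [G hG]]] : forall j, exists m F G, [/\ fform m F,
    fform m G, G x != 0 & forall y, X y -> G y != 0 -> c j y = F y / G y].
  by move=> j; have [m [F [G [hF]]]] := rc j; rewrite addn0 in hF; exists m, F, G.
pose W y := \row_j (C y * (F j y * \prod_(i | i != j) G i y)).
have fG (P : pred 'I_e) : fform (\sum_(i | P i) m i) (fun y => \prod_(i | P i) G i y).
  rewrite -big_filter; have := @fform_prod k d _ [seq i <- index_enum _ | P i] m (fun i y => G i y).
  move=> /(_ (fun i => let: And4 _ h _ _ := hG i in h)).
  by apply: fform_ext => y; rewrite big_filter.
have eW y : X y -> (forall j, G j y != 0) -> W y = (C y * \prod_i G i y) *: \row_j c j y.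
  move=> Xy Gy; apply/rowP=> j; rewrite !mxE [in RHS](bigD1 j) //=.
  have [_ _ _ ->] := hG j; [|exact: Xy|exact: Gy].
  by field; exact: Gy.
pose W' y := \row_j ((\prod_i G i y) * W y 0 j).
exists (\sum_i m i + (n + \sum_i m i))%N, W'; split.
- move=> j; have := fformM (fG predT) (fformM hC (fformM (let: And4 h _ _ _ := hG j in h)
    (fG (fun i => i != j)))).
  move=> /fform_deg h; apply: (@fform_ext _ _ _ _ _ _ (h _ _)) => [y|]; first by rewrite !mxE.
  by congr (_ + (_ + _))%N; rewrite [RHS](bigD1 j).
- move=> /rowP /(_ j0); rewrite !mxE => /eqP; apply/negP.
  rewrite mulf_neq0 ?mulf_neq0 //; try by apply/prodf_neq0 => i _; case: (hG i).
  by have [_ _ Gx e0] := hG j0; move: c0; rewrite e0 // mulf_eq0 => /norP [].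
move=> y Xy nW.
have Gy j : G j y != 0.
  apply/eqP=> G0; apply: nW; apply/rowP=> i; rewrite !mxE (bigD1 j) //= G0.
  by rewrite !mul0r.
have Cy : C y != 0.
  by apply/eqP=> C0; apply: nW; apply/rowP=> i; rewrite !mxE C0 mul0r mulr0.
have [t et] := hC' y Xy Cy.
exists ((\prod_i G i y) * ((C y * \prod_i G i y) * t)).
rewrite -scalerA -[X in _ *: X]scalerA -et -eW //.
by apply/rowP=> j; rewrite !mxE.
Qed.

Section Isogeny.

Variables (k : closedFieldType) (q d : nat) (A : group_data k d) (hA : agroup A).
Hypotheses (hq : [pchar k].-nat q) (q1 : (1 < q)%N).
Hypothesis hAF : abelian_variety (Fq k q) A.
Hypothesis halg : forall x : k, exists2 m : nat, (0 < m)%N & x \in Fq k (q ^ m).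

Local Notation GA := (Gp hA).
Local Notation X := (pts A).
Local Notation frobG := (@frobG k q d A hA).
Implicit Types x y z : GA.

(** Translations carry regularity at one point to every point. *)
Lemma additive_morph (F : GA -> GA) (v1 : GA) : {morph F : x y / x + y} ->
  morph_at X (fun u => val (F (inG hA u))) (val v1) ->
  morph X X (fun u => val (F (inG hA u))).
Proof.
move=> addF m1; split=> u Xu; first exact: ptsG.
set a := v1 - inG hA u.
have mt := trans_pts hA (ptsG a); have mt' := trans_pts hA (ptsG (- F a)).
have ea : add A u (val a) = val (v1 : GA).
  by rewrite -[u](inGK hA) // -valD addrC subrK.
have h1 := mt.2 u Xu; rewrite -ea in m1.
have h2 : morph_at X (fun v => val (F (inG hA (add A v (val a))))) u := morph_comp_at mt.1 Xu h1 m1.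
have h3 := morph_comp_at (Y := X) (fun v _ => ptsG (F (inG hA (add A v (val a))))) Xu h2
  (mt'.2 _ (ptsG _)).
apply: morph_at_ext h3 => v Xv; rewrite -valD inGD ?valGK; [|exact: Xv|exact: ptsG].
by rewrite (addF _ a) addrK.
Qed.

Variable m : nat.
Hypothesis hdiv : forall x, exists y, x = y *+ m.

Lemma mult_surj u : X u -> exists2 v, X v & mult A m v = u.
Proof.
move=> Xu; have [y ey] := hdiv (inG hA u); exists (val y); first exact: ptsG.
by rewrite -valMn -ey inGK.
Qed.

Lemma dense_mult n (C : 'rV[k]_d -> k) : fform n C -> (exists2 u, X u & C u != 0) ->
  exists2 u, X u & C (mult A m u) != 0.
Proof. by move=> _ [u Xu Cu]; have [v Xv ev] := mult_surj Xu; exists v; rewrite ?ev. Qed.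

(** Descent yields a power of the characteristic; it is enlarged to a power of [q] so as to be a
    Frobenius over the base field. *)
Lemma mult_descent g u0 : X u0 -> reg_at X (fun u => g (mult A m u)) u0 ->
  exists n, gen X (fun w => reg_at X (fun v => g v ^+ (q ^ n)) w).
Proof.
move=> Xu0 hg; have [cX iX] := (ag_clo hA, ag_irr hA).
have pq := pdiv_prime q1.
have pk : pdiv q \in [pchar k].
  by have /andP [_ /allP] := hq; apply; rewrite mem_primes pq pdiv_dvd ltnW.
have [n hn] := purely_inseparable_descent cX iX cX iX (morph_mult hA m) dense_mult pk Xu0 hg.
exists n; apply: gen_mono hn => w Xw; have [t ->] : exists t, (q ^ n = pdiv q ^ n * t)%N.
  have /dvdnP [t et] : (pdiv q ^ n %| q ^ n)%N by rewrite dvdn_exp2r ?pdiv_dvd.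
  by exists t; rewrite mulnC.
by move=> h; have := regXn t h; apply: sec_ext => v _; rewrite exprM.
Qed.

Section Quotient.

Variables (alpha : GA -> GA).
Hypothesis malpha : morph X X (fun u => val (alpha (inG hA u))).
Hypothesis adda : {morph alpha : x y / x + y}.
Hypothesis kera : forall x, x *+ m = 0 -> alpha x = 0.

Lemma quotient_map : exists beta : GA -> GA, forall x, beta (x *+ m) = alpha x.
Proof.
have /fchoice [h hh] := hdiv; exists (fun x => alpha (h x)) => x.
have := kera (x := h (x *+ m) - x); rewrite mulrnBl -hh subrr => /(_ erefl) e.
by rewrite -[h _](subrK x) adda e add0r.
Qed.

(** On points [alpha] factors through multiplication by [m]. Ratios of coordinates of the factor
    [beta] become regular at a generic point after a power of Frobenius, and additivity extends this
    to all points. *)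
Lemma quotient_morph : exists n (beta : GA -> GA), [/\ forall x, beta (x *+ m) = alpha x,
  {morph beta : x y / x + y} & morph X X (fun u => frobenius (q ^ n) (val (beta (inG hA u))))].
Proof.
have [beta eb] := quotient_map; have [cX iX] := (ag_clo hA, ag_irr hA).
have addb : {morph beta : x y / x + y}.
  move=> x y; have [x' ->] := hdiv x; have [y' ->] := hdiv y.
  by rewrite -mulrnDl !eb adda.
have X0 := ag_zero hA.
have [i0 hi0] : exists i, val (alpha (inG hA (zero A))) 0 i != 0.
  by apply: rV_neq0; apply: is_point_neq0; apply: pointG.
pose g j (v : 'rV[k]_d) := val (beta (inG hA v)) 0 j / val (beta (inG hA v)) 0 i0.
have eg j u : X u -> g j (mult A m u) = val (alpha (inG hA u)) 0 j / val (alpha (inG hA u)) 0 i0.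
  by move=> Xu; rewrite /g -[u](inGK hA) // -valMn valGK eb valGK.
have /fchoice [n hn] : forall j, exists n, gen X (fun w => reg_at X (fun v => g j v ^+ (q ^ n)) w).
  move=> j; apply: (mult_descent X0).
  by apply: sec_ext (coord_reg j X0 (malpha.2 _ X0) hi0) => u Xu; apply: eg.
pose N := (\sum_j n j)%N.
have hN j : gen X (fun w => reg_at X (fun v => g j v ^+ (q ^ N)) w).
  apply: gen_mono (hn j) => w Xw /(regXn (q ^ (N - n j))); apply: sec_ext => v _.
  by rewrite -exprM -expnD subnKC // /N (bigD1 j) //= leq_addr.
have [w Xw hw] : gen X (fun w => forall j, reg_at X (fun v => g j v ^+ (q ^ N)) w).
  have := gen_seq cX iX (s := enum 'I_d)
    (P := fun j w => reg_at X (fun v => g j v ^+ (q ^ N)) w).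
  move=> /(_ (fun j _ => hN j)); apply: gen_mono => w Xw h j.
  by apply: h; rewrite mem_enum.
(* The point must also avoid the zeros of coordinate [i0] of [beta]. It is found before
   multiplication by [m], where this is a condition on the regular map [alpha]. *)
have [v1 [Xv1 hv1 b1]] : exists v, [/\ X v, forall j, reg_at X (fun v => g j v ^+ (q ^ N)) v &
    val (beta (inG hA v)) 0 i0 != 0].
  have [u1 Xu1 eu1] := mult_surj Xw.
  have mm := morph_mult hA m; rewrite -eu1 in hw.
  have h1 := morph_near mm.1 (mm.2 _ Xu1) hw Xu1.
  have h2 : near X (zero A) (fun u => val (alpha (inG hA u)) 0 i0 != 0).
    exact: (morph_near malpha.1 (malpha.2 _ X0) (near_form X (fformX k i0) hi0) X0).
  have [u [Xu hu1 hu2]] := irr_near cX iX Xu1 X0 h1 h2.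
  exists (mult A m u); split=> //; first exact: mm.1.
  by rewrite -[u](inGK hA) // -valMn valGK eb.
exists N, beta; split=> //.
apply: morph_ext (@additive_morph (fun x => iter N frobG (beta x)) (inG hA v1) _ _).
- by move=> u Xu; rewrite val_iter_frobG.
- by move=> x y; rewrite addb iter_frobGD.
rewrite inGK //; apply: (morph_at_reg (c := fun j v => g j v ^+ (q ^ N)) (j0 := i0)) => //.
  by rewrite /g divff // expr1n oner_neq0.
have := sec_neq0 Xv1 (hv1 i0); rewrite /g divff // expr1n => /(_ (oner_neq0 k)).
apply: near_mono => v Xv; rewrite expf_eq0 expn_gt0 (ltnW q1) mulf_eq0 => /norP [b0 _].
exists (val (beta (inG hA v)) 0 i0 ^- (q ^ N)).
rewrite val_iter_frobG //; apply/rowP=> j; rewrite !mxE expr_div_n mulrC; congr (_ * _).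
Qed.

(* The descended map commutes with the Frobenius since [alpha] does. *)
Theorem quotient_endomorphism : (forall x, alpha (frobG x) = frobG (alpha x)) ->
  exists n f, homomorphism_over (Fq k q) A A f /\
    forall x, iter n frobG (alpha x) = inG hA (f (val x)) *+ m.
Proof.
move=> af; have [n [beta [eb addb mb]]] := quotient_morph.
pose f u := val (iter n frobG (beta (inG hA u))).
have [[cA _] _ _ _ _] := hAF.
have mf : morph X X f.
  by apply: morph_ext mb => u Xu; rewrite /f val_iter_frobG.
have fb x : frobG (beta x) = beta (frobG x).
  by have [y ->] := hdiv x; rewrite (frobG_Mn hq hAF) !eb af.
have bM x n' : beta (x *+ n') = beta x *+ n'.
  elim: n' => [|n' IH]; last by rewrite !mulrS addb IH.
  by apply: (addrI (beta 0)); rewrite -addb !mulr0n !addr0.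
exists n, f; split; last first.
  by move=> x; rewrite /f !valGK -(iter_frobG_Mn hq hAF) -bM eb.
split; last first.
  by move=> u v Xu Xv; rewrite /f inGD // addb (iter_frobGD hq hAF) valD.
apply: (frobenius_descent hq q1 halg cA mf) => u Xu; rewrite /f.
rewrite (inG_frobenius q hA Xu).
by rewrite -fb -iterSr iterS (val_frobG hq hAF).
Qed.

End Quotient.

End Isogeny.

Lemma coprime_torsion (V : zmodType) (y : V) m n : (0 < m)%N -> coprime m n ->
  y *+ m = 0 -> y *+ n = 0 -> y = 0.
Proof.
move=> m0 /eqP cmn ym yn; have [a b e _] := egcdnP n m0; rewrite cmn in e.
have : y *+ (a * m) = y *+ (b * n + 1) by rewrite e.
by rewrite mulnC mulrnA ym mul0rn mulrnDr mulnC mulrnA yn mul0rn add0r mulr1n.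
Qed.

(** * Nondegeneracy of the Weil pairing *)

Section Nondegenerate.

Variables (k : closedFieldType) (q d b : nat) (A : group_data k d) (B : group_data k b).
Variables (hA : agroup A) (hB : agroup B).
Hypotheses (hq : [pchar k].-nat q) (q1 : (1 < q)%N).
Variable D : 'rV[k]_(d * b) -> 'rV[k]_(d * b) -> k.
Hypothesis hD : dual_frames A B D.
Variables (lam : 'rV[k]_d -> 'rV[k]_b) (L : 'rV[k]_d -> 'rV[k]_d -> k).
Hypothesis hpol : polarized A B D lam L.

Local Notation X := (pts A).
Local Notation GA := (Gp hA).
Local Notation GB := (Gp hB).
Local Notation Pf := (Pf D).
Local Notation we := (@we k d b A B hA hB D).
Implicit Types (x z t : GA) (y : GB).

Variable m : nat.
Hypothesis hdiv : forall x, exists z, x = z *+ m.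

(* A trivialization invariant under [A[m]] descends, up to a power of the characteristic,
   to a trivialization of the bundle itself. *)
Theorem weil_nondegenerate y : (0 < m)%N -> coprime m q -> y *+ m = 0 ->
  (forall t, t *+ m = 0 -> we m t y = 1) -> y = 0.
Proof.
move=> m0 cmq ym hw; have [H hH] := wtriv_exists hA hD hpol ym.
have [cX iX] := (ag_clo hA, ag_irr hA); have X0 := ag_zero hA.
have mm := morph_mult hA m; have cP := PfG_coh hD y; have cPm := coh_pull mm cP.
have [h hh] := fchoice hdiv.
(* [h] divides a point by [m]; triviality of the pairing makes the value of [H] independent of the
   choice. *)
pose g v := H (val (h (inG hA v))).
have eg u : X u -> g (mult A m u) = H u.
  move=> Xu; rewrite /g inGMn //; set z := inG hA u.
  have tm : (h (z *+ m) - z) *+ m = 0 by rewrite mulrnBl -hh subrr.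
  have := weP hD hpol z tm ym hH; rewrite hw // mul1r addrC subrK => ->.
  by rewrite inGK.
have Hnz u : X u -> H u != 0 by apply: wtriv_neq0 hH.
have gnz v : g v != 0 by apply: Hnz; apply: ptsG.
have [|n [w0 Xw0 hw0]] := mult_descent hq q1 hdiv
    (g := fun v => g v * Pf (val y) (zero A) v) X0.
  apply: sec_ext (hH _ X0).1 => u Xu; rewrite eg //.
  by rewrite -{2}val0 -valMn mul0rn val0.
have [w [Xw rw uw]] := irr_near cX iX Xw0 X0 hw0 (cP _ X0).
set Q := (q ^ n)%N in rw.
have uW : unit_at X (fun v => (g v * Pf (val y) w v) ^+ Q) w.
  split; last by rewrite expf_neq0 // mulf_neq0 ?gnz // (coh_self Xw cP).
  have := regM rw (regXn Q uw.1); apply: sec_near.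
  apply: near_mono (sec_neq0 Xw uw.1 uw.2) => v Xv.
  rewrite mulf_eq0 invr_eq0 => /norP [_ nz].
  by rewrite -exprMn; congr (_ ^+ _); field.
(* Regularity at the single point [w] is moved to any [x] by the translation [a]: the Pic0 property
   supplies [Ha], which compares the bundle with its translate, and [g] changes by a constant times
   [Ha]. *)
have tQ : triv X (fun u v => Pf (val y) u v ^+ Q).
  exists (fun v => g v ^+ Q) => x Xx.
  pose a := inG hA w - inG hA x; have [c ec] := hdiv a.
  have [Ha hHa] := (PfG_pic0 hD y).2 (val a) (ptsG a).
  have mc := trans_pts hA (ptsG c); have ma := trans_pts hA (ptsG a).
  have emc u : X u -> mult A m (add A u (val c)) = add A (mult A m u) (val a).
    by move=> Xu; rewrite -[u](inGK hA) // -valD -!valMn mulrnDl -ec valD.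
  have Hanz u : X u -> Ha u != 0.
    by move=> Xu; have := (hHa u Xu).2; rewrite mulf_eq0 => /norP [].
  have [kap ek] : exists kap, forall u, X u -> H (add A u (val c)) / (H u * Ha (mult A m u)) = kap.
    apply: global_const cX iX _ => u Xu.
    have h1 := morph_unit mc.1 Xu (mc.2 u Xu) (hH _ (mc.1 u Xu)).
    have h3 := morph_unit mm.1 Xu (mm.2 u Xu) (hHa _ (mm.1 u Xu)).
    have [r _] := unitM h1 (unitV Xu (unitM (hH u Xu) h3)).
    have cPa := coh_pull mm (coh_pull ma cP).
    apply: sec_near r; apply: near_mono (near_and (coh_neq0 Xu cPm) (coh_neq0 Xu cPa)) => v Xv.
    rewrite !emc // => -[n1 n2].
    by field; rewrite n1 n2 Hnz // Hanz //; apply: mm.1.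
  have k0 : kap != 0.
    rewrite -(ek _ X0) mulf_neq0 ?Hnz ?invr_eq0 ?mulf_neq0 ?Hnz ?Hanz //; [exact: mc.1|exact: mm.1].
  have ega v : X v -> g (add A v (val a)) = kap * (g v * Ha v).
    move=> Xv; have [u Xu <-] := mult_surj hdiv Xv.
    rewrite -emc // !eg //; last exact: mc.1.
    by rewrite -(ek u Xu) divfK // mulf_neq0 ?Hnz ?Hanz //; apply: mm.1.
  have exa : add A x (val a) = w.
    by rewrite -[x](inGK hA) // -valD addrC subrK inGK.
  have uW' := uW; rewrite -exa in uW'.
  have h1 := morph_unit ma.1 Xx (ma.2 x Xx) uW'.
  apply: unit_near (unitM h1 (unitV Xx (unitM (unitC X x (expf_neq0 Q k0)) (unitXn Q (hHa x Xx)))))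
    => //.
  apply: near_mono (near_and (coh_neq0 Xx cP) (coh_neq0 Xx (coh_pull ma cP))) => v Xv [n1 n2].
  rewrite ega // -!exprMn -exprVn -exprMn; congr (_ ^+ _).
  by field; rewrite n1 n2 k0 Hanz.
have yQ : y *+ Q = 0.
  have cQ := cohXn Q cP; apply: (cls_inj hA hD (triv_pic0 hA cQ tQ)).
    exact: (cls_Xn hA hD hpol Q cP (cls_Pf hD y)).
  exact: (cls_val0 hB hD cQ tQ).
exact: (coprime_torsion m0 (coprimeXr n cmq) ym yQ).
Qed.

End Nondegenerate.

(** * From cocycles to frames: dual variety, polarization, pairing *)

Section Conversion.

Variables (k : closedFieldType) (F : {pred k}) (d b : nat).
Variables (A : group_data k d) (B : group_data k b) (P : cocycle k (d * b)).
Hypotheses (hA : agroup A) (hB : agroup B).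

Local Notation X := (pts A).
Local Notation Y := (pts B).

Let pX x : X x -> is_point x. Proof. exact: (ag_clo hA).1. Qed.
Let pY y : Y y -> is_point y. Proof. exact: (ag_clo hB).1. Qed.

Lemma Pic0_pic0 L N : rep X L N -> (Pic0 A L <-> pic0 A N).
Proof.
move=> hL; split=> [[_ h]|[cN h]]; (split; first by [exact: rep_coh hL|exact: rep_line hL]);
  move=> a Xa; have := rep_iso (rep_pull (trans_pts hA Xa) hL) hL; move=> [h1 h2].
  by apply: h1; apply: h.
by apply: h2; apply: h.
Qed.

Lemma classifies_rep D e (S : 'rV[k]_e -> Prop) N M phi : rep (product X Y) P D ->
  (forall s, S s -> is_point s) -> rep (product X S) N M ->
  (morphism_over predT S Y phi /\ exists h : 'rV[k]_(d * e) -> 'rV[k]_(d * b),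
     (forall x s, X x -> S s -> h (segre x s) = segre x (phi s)) /\
     isomorphic_bundles (product X S) (pullback h P) N) <-> classifies A B D S M phi.
Proof.
move=> hP pS hN.
have ext h : (forall x s, X x -> S s -> h (segre x s) = segre x (phi s)) ->
    forall w, product X S w -> segre (fst_point w) (phi (snd_point w)) = h w.
  move=> eh _ [x [s [Xx Ss ->]]].
  by rewrite fst_segre ?snd_segre ?eh //; [exact: pX|exact: pS|exact: pX|exact: pS].
have mh h : morph S Y phi -> (forall x s, X x -> S s -> h (segre x s) = segre x (phi s)) ->
    morph (product X S) (product X Y) h.
  move=> mphi eh; apply: morph_ext (ext h eh) _.
  exact: morph_pair (morph_fst pX pS) (morph_comp (morph_snd pX pS) mphi).
split=> [[/morphP mphi [h [eh ih]]]|[mphi t]].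
  split=> //; have [h1 _] := rep_iso (rep_pull (mh h mphi eh) hP) hN.
  apply: triv_ext (h1 ih) => w v Ww Wv.
  by rewrite -!(ext h).
split; first exact/morphP.
pose h (w : 'rV[k]_(d * e)) := segre (fst_point w) (phi (snd_point w)).
have eh x s : X x -> S s -> h (segre x s) = segre x (phi s).
  by move=> Xx Ss; rewrite /h fst_segre ?snd_segre //; [exact: pX|exact: pS|exact: pX|exact: pS].
exists h; split=> //; have [_ h2] := rep_iso (rep_pull (mh h mphi eh) hP) hN.
exact: h2.
Qed.

Hypothesis hdual : dual_variety F A B P.

Theorem dual_frames_rep : exists2 D, rep (product X Y) P D & dual_frames A B D.
Proof.
have [_ lP hp [t1 t2] uni] := hdual.
have [D hD] := line_bundle_rep (product_point pX pY) lP.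
exists D => //; split.
- exact: rep_coh hD.
- move=> y Yy; have := rep_pull (slice_morph hA pY Yy) hD => hy.
  by have [h _] := Pic0_pic0 hy; apply: h; apply: hp.
- have := rep_pull (slice_morph hA pY (ag_zero hB)) hD => hy.
  by have [h _] := rep_triv hy; apply: h.
- have := rep_pull (slice_morph0 hA pY (ag_zero hA)) hD => hy.
  by have [h _] := rep_triv hy; apply: h.
move=> e S M cS iS cM hM tM.
have pS : forall s, S s -> is_point s := cS.1.
have pXS := product_point pX pS.
have hN := frame_bundle_rep cM; have lN := frame_bundle_line pXS cM.
have [|||[phi hphi] un] := uni e S _ _ lN.
- by split=> //; apply/cloP.
- move=> s Ss; have hs := rep_pull (slice_morph hA pS Ss) hN.
  by have [_ h] := Pic0_pic0 hs; apply: h; apply: hM.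
- have h0 := rep_pull (slice_morph0 hA pS (ag_zero hA)) hN.
  by have [_ h] := rep_triv h0; apply: h.
have ec psi := classifies_rep psi hD pS hN.
split; first by exists phi; apply/ec.
by move=> psi psi' /ec h1 /ec h2; apply: un.
Qed.

End Conversion.

Section WeilPairing.

Variables (k : closedFieldType) (d b : nat) (A : group_data k d) (B : group_data k b).
Variables (P : cocycle k (d * b)) (hA : agroup A) (hB : agroup B).
Variable D : 'rV[k]_(d * b) -> 'rV[k]_(d * b) -> k.
Hypotheses (hP : rep (product (pts A) (pts B)) P D) (hD : dual_frames A B D).

Local Notation X := (pts A).
Local Notation GA := (Gp hA).
Local Notation GB := (Gp hB).

Section Polarization.

Variables (F : {pred k}) (lam : 'rV[k]_d -> 'rV[k]_b).
Hypothesis hlam : principal_polarization F A B P lam.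

Theorem polarization_frames : exists2 L, polarized A B D lam L &
  exists M e (Y : 'rV[k]_e -> Prop) f g, ample_frame A L M Y f g.
Proof.
have [[mlam alam] [_ [mu [mmu muK lmu]]] [L [lL aL eL]]] := hlam.
have pX : forall x, X x -> is_point x := (ag_clo hA).1.
have pY : forall y, pts B y -> is_point y := (ag_clo hB).1.
have ml := morphism_over_morph mlam; have mm := morphism_over_morph mmu.
have [N hN] := line_bundle_rep pX lL; exists N; last first.
  have [M [M0 [e [Y [f [cY [/morphP mf [g [/morphP mg fK gK]]] iL]]]]]] := aL.
  exists M, e, Y, f, g; have cY' : clo Y by apply/cloP.
  split=> //.
  have [h _] := rep_iso (rep_power M hN) (rep_pull mf (rep_hyperplane cY'.1)).
  exact: h.
split=> //; first by exists mu.
  exact: rep_coh hN.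
move=> w Xw; have hw := rep_pull (slice_morph hA pY (ml.1 w Xw)) hP.
have [h _] := rep_iso hw (rep_tensor (rep_pull (trans_pts hA Xw) hN) (rep_dual hN)).
by apply: h; apply: eL.
Qed.

End Polarization.

Variables (lam : 'rV[k]_d -> 'rV[k]_b) (L : 'rV[k]_d -> 'rV[k]_d -> k).
Hypothesis hpol : polarized A B D lam L.

Theorem weil_pairingE m (x : GA) (y : GB) zeta :
  weil_pairing A B P m (val x) (val y) zeta <->
  [/\ x *+ m = 0, y *+ m = 0 & we D m x y = zeta].
Proof.
have pY : forall y, pts B y -> is_point y := (ag_clo hB).1.
have mm := morph_mult hA m.
have [u hu] := rep_pull (slice_morph hA pY (ptsG y)) hP.
have hu' := rep_by_pull mm hu.
have tor0 : (x *+ m = 0 <-> X (val x) /\ mult A m (val x) = zero A) /\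
    (y *+ m = 0 <-> pts B (val y) /\ mult B m (val y) = zero B).
  split; (split=> [e|[_ e]]; first by split; [exact: ptsG|rewrite -valMn e val0]);
    by apply/val_inj; rewrite valMn e val0.
have mx z : x *+ m = 0 -> X z -> mult A m (add A z (val x)) = mult A m z.
  by move=> xm Xz; rewrite -[z](inGK hA) // -valD -!valMn mulrnDl xm addr0.
split=> [[/tor0.1 xm /tor0.2 ym [h [th eh]]]|[xm ym ez]].
  have [H eH hH] := rep_trivialization hu' th.
  split=> //; apply: (we_eq hD hpol xm ym hH); exists 0.
  have [_ nu cov _ _] := hu'.
  have [i ci] := cov _ (ptsG (0 : GA)); have := eh i _ (ptsG (0 : GA)) ci.
  rewrite eH -?valD; [|exact: ptsG|by rewrite /= valD mx //; exact: ptsG].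
  rewrite eH //; last exact: ptsG.
  rewrite [in u i _](valD) mx //; last exact: ptsG.
  by rewrite mulrA => /(mulIf (nu i _ (ptsG _) ci)).
split; [exact/tor0.1|exact/tor0.2|].
have [H hH] := wtriv_exists hA hD hpol ym.
exists (fun i z => H z * u i (mult A m z)); split; first exact: trivialization_rep hu' hH.
move=> i z Xz ci; rewrite mx // mulrA; congr (_ * _).
by have := weP hD hpol (inG hA z) xm ym hH; rewrite ez valD inGK.
Qed.

End WeilPairing.

Section Commutative.

Variables (k : closedFieldType) (F : {pred k}) (d : nat) (A : group_data k d).
Hypothesis hA : abelian_variety F A.

(** Additivity of doubling reads [x + y + x + y = x + x + y + y], and cancellation gives the claim.
    It applies because [1 + 1] acts by an endomorphism. *)
Lemma double_commutative f : homomorphism_over F A A f ->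
  (forall x, pts A x -> f x = add A x x) ->
  forall x y, pts A x -> pts A y -> add A x y = add A y x.
Proof.
move=> [_ addf] ef x y Xx Xy; have [_ [z0 _] [h [mh eh]] mo ax] := hA.
have ad u v : pts A u -> pts A v -> pts A (add A u v).
  by move=> Xu Xv; rewrite -eh //; apply: mh.1; exists u, v.
have op u : pts A u -> pts A (opp A u) := mo.1 u.
have as_ u v w : pts A u -> pts A v -> pts A w -> add A u (add A v w) = add A (add A u v) w.
  by move=> Xu Xv Xw; have [] := ax u v w Xu Xv Xw.
have cl u v w : pts A u -> pts A v -> pts A w -> add A u v = add A u w -> v = w.
  move=> Xu Xv Xw /(congr1 (add A (opp A u))); rewrite !as_ //; try exact: op.
  have [_ _ _ -> _] := ax u u u Xu Xu Xu.
  by have [_ -> _ _ _] := ax v v v Xv Xv Xv; have [_ -> _ _ _] := ax w w w Xw Xw Xw.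
have cr u v w : pts A u -> pts A v -> pts A w -> add A v u = add A w u -> v = w.
  move=> Xu Xv Xw /(congr1 (fun t => add A t (opp A u))); rewrite -!as_ //; try exact: op.
  have [_ _ _ _ ->] := ax u u u Xu Xu Xu.
  by have [_ _ -> _ _] := ax v v v Xv Xv Xv; have [_ _ -> _ _] := ax w w w Xw Xw Xw.
have := addf x y Xx Xy; rewrite !ef //; last exact: ad.
rewrite -as_ //; last exact: ad.
rewrite -[RHS]as_ //; last exact: ad.
move/(cl _ _ _ Xx (ad _ _ Xy (ad _ _ Xx Xy)) (ad _ _ Xx (ad _ _ Xy Xy))).
rewrite as_ // [RHS]as_ //.
by move/(cr _ _ _ Xy (ad _ _ Xy Xx) (ad _ _ Xx Xy)).
Qed.

End Commutative.

(** * Degrees and the number of torsion points *)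

Section Hilbert.

Variables (k : closedFieldType) (e : nat) (Y : 'rV[k]_e -> Prop).
Hypotheses (cY : clo Y) (iY : irr Y).
Implicit Types (F G : 'rV[k]_e -> k).

Definition indep D (I : finType) (E : I -> 'rV[k]_e -> k) : Prop :=
  (forall i, fform D (E i)) /\
  forall c : I -> k, (forall y, Y y -> \sum_i c i * E i y = 0) -> forall i, c i = 0.

Definition spanned (I : finType) (E : I -> 'rV[k]_e -> k) F : Prop :=
  exists c : I -> k, forall y, Y y -> F y = \sum_i c i * E i y.

Lemma spanned_ext (I : finType) (E : I -> 'rV[k]_e -> k) F G :
  (forall y, Y y -> F y = G y) -> spanned E F -> spanned E G.
Proof. by move=> h [c hc]; exists c => y Yy; rewrite -h // hc. Qed.

Lemma spanned_gen (I : finType) (E : I -> 'rV[k]_e -> k) i : spanned E (E i).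
Proof.
exists (fun j => (j == i)%:R) => y _; rewrite (bigD1 i) //= eqxx mul1r big1 ?addr0 //.
by move=> j /negPf ->; rewrite mul0r.
Qed.

Lemma spanned_sum (I J : finType) (E : I -> 'rV[k]_e -> k) (a : J -> k)
    (F : J -> 'rV[k]_e -> k) : (forall j, spanned E (F j)) ->
  spanned E (fun y => \sum_j a j * F j y).
Proof.
move=> /fchoice [c hc]; exists (fun i => \sum_j a j * c j i) => y Yy.
rewrite (eq_bigr (fun j => \sum_i a j * c j i * E i y)).
  by rewrite exchange_big; apply: eq_bigr => i _; rewrite mulr_suml.
by move=> j _; rewrite hc // mulr_sumr; apply: eq_bigr => i _; rewrite mulrA.
Qed.

Lemma spanned_mul (I J : finType) (E : I -> 'rV[k]_e -> k) (E' : J -> 'rV[k]_e -> k) g F :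
  (forall i, spanned E' (fun y => g y * E i y)) -> spanned E F ->
  spanned E' (fun y => g y * F y).
Proof.
move=> h [c hc]; apply: spanned_ext (spanned_sum c h) => y Yy.
by rewrite hc // mulr_sumr; apply: eq_bigr => i _; rewrite mulrCA.
Qed.

Lemma indep_le (I J : finType) D (E : I -> 'rV[k]_e -> k) (E' : J -> 'rV[k]_e -> k) :
  indep D E -> (forall F, fform D F -> spanned E' F) -> (#|I| <= #|J|)%N.
Proof.
move=> [hE ind] sp; have /fchoice [c hc] := fun i => sp _ (hE i).
pose C := \matrix_(i < #|I|, j < #|J|) c (enum_val i) (enum_val j).
rewrite leqNgt; apply/negP => lt.
have : kermx C != 0.
  rewrite -mxrank_eq0 mxrank_ker subn_eq0 -ltnNge.
  exact: leq_ltn_trans (rank_leq_col C) lt.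
move=> /rowV0Pn [v /sub_kermxP vC]; apply/negP; rewrite negbK; apply/eqP/rowP => i.
rewrite [RHS]mxE -[i]enum_valK; set i' := enum_val i.
apply: (ind (fun i => v 0 (enum_rank i))) => y Yy.
rewrite (eq_bigr (fun i => \sum_j v 0 (enum_rank i) * c i j * E' j y)); last first.
  by move=> x _; rewrite hc // mulr_sumr; apply: eq_bigr => j _; rewrite mulrA.
rewrite exchange_big big1 // => j _; rewrite -mulr_suml.
have /rowP /(_ (enum_rank j)) := vC; rewrite !mxE => e0.
rewrite (reindex _ (onW_bij _ (@enum_rank_bij I))) /= in e0.
have -> : \sum_i v 0 (enum_rank i) * c i j = 0.
  by rewrite -[RHS]e0; apply: eq_bigr => x _; rewrite mxE !enum_rankK.
by rewrite mul0r.
Qed.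

Section Normalization.

Variable lf : 'I_3 -> 'rV[k]_e -> k.
Hypotheses (hlf : forall i, fform 1 (lf i)) (nz : forall y, Y y -> exists i, lf i y != 0).

(** Forms of degree [m - 1], where degree [-1] leaves only zero. *)
Let pform (m : nat) G := if m is m'.+1 then fform m' G else G = fun=> 0.

Let pformD m F G : pform m F -> pform m G -> pform m (fun x => F x + G x).
Proof.
case: m => [|m] /=; last exact: fformD.
by move=> -> ->; apply: functional_extensionality => x; rewrite addr0.
Qed.

Let pformM m n F G : fform m F -> pform n G -> pform (m + n)%N (fun x => F x * G x).
Proof.
case: n => [|n] /= hF hG; last by rewrite addnS /=; apply: fformM.
rewrite addn0 hG; case: m hF => [|m] /= _; first by
  apply: functional_extensionality => x; rewrite mulr0.
by apply: fform_ext (fform0 k e m) => x; rewrite mulr0.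
Qed.

(** The forms lying, modulo [Y], in the ideal of the three linear forms make a homogeneous ideal,
    which by [nz] has no zero. *)
Lemma linear_system : exists N, forall D F, (N <= D)%N -> fform D.+1 F ->
  exists G : 'I_3 -> 'rV[k]_e -> k, (forall i, fform D (G i)) /\
    forall y, Y y -> F y = \sum_i lf i y * G i y.
Proof.
pose J m F := fform m F /\ exists G : 'I_3 -> 'rV[k]_e -> k, (forall i, pform m (G i)) /\
    forall y, Y y -> F y = \sum_i lf i y * G i y.
have p0 m : pform m (fun=> 0) by case: m => //= m; apply: fform0.
have hJ : hideal J.
  split=> [m F []//|m|m F F' [hF [G [hG eG]]] [hF' [G' [hG' eG']]]|m n F F' hF [hF' [G [hG eG]]]].
  - split; first exact: fform0.
    by exists (fun _ _ => 0); split=> // y _; rewrite big1 // => i _; rewrite mulr0.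
  - split; first exact: fformD.
    exists (fun i x => G i x + G' i x); split=> [i|y Yy]; first exact: pformD.
    by rewrite eG // eG' // -big_split; apply: eq_bigr => i _; rewrite mulrDr.
  split; first exact: fformM.
  exists (fun i x => F x * G i x); split=> [i|y Yy]; first exact: pformM.
  by rewrite eG // mulr_sumr; apply: eq_bigr => i _; rewrite mulrCA.
have [x px|N fN] := projective_nullstellensatz hJ.
  have [Yx|/(cY.2 _ px) [m [F [hF Fx FY]]]] := classic (Y x).
    have [i li] := nz Yx; exists 1%N, (lf i); split=> //; split=> //.
    exists (fun j _ => (j == i)%:R); split=> [j|y Yy]; first exact: fformC.
    rewrite (bigD1 i) //= eqxx mulr1 big1 ?addr0 // => j /negPf ->; by rewrite mulr0.
  exists m, F; split=> //; split=> //.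
  exists (fun _ _ => 0); split=> // y Yy; rewrite FY // big1 // => i _.
  by rewrite mulr0.
exists N => D F ND hF.
have [_ [G [hG eG]]] := full_le hJ (leqW ND) fN hF.
by exists G.
Qed.

(** Linear factors [lf i] are split off until degree at most [N] is reached. Forms of degree [D] are
    thus spanned by monomials in three forms times a finite family, and the monomials have two free
    exponents. *)
Lemma quadratic_growth : exists C, forall D (I : finType) (E : I -> 'rV[k]_e -> k),
  indep D E -> (#|I| <= C * D.+1 ^ 2)%N.
Proof.
have [N hN] := linear_system.
have /fchoice [T /fchoice [u hu]] : forall m, exists T (u : nat -> 'rV[k]_e -> k),
    forall F, fform m F -> exists c : nat -> k, forall x, F x = \sum_(i < T) c i * u i x.
  move=> m; have [T [u [_ su]]] := fform_span k e m.
  exists T, (fun i => if insub i is Some j then u j else fun=> 0) => F /su [c ec].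
  exists (fun i => if insub i is Some j then c j else 0) => x; rewrite ec.
  by apply: eq_bigr => i _; rewrite !valK.
pose T0 := (\sum_(i < N.+1) T i)%N.
have leT (i : 'I_N.+1) : (T i <= T0)%N by rewrite /T0 (bigD1 i) //= leq_addr.
pose E0 D (t : 'I_D.+1 * 'I_D.+1 * 'I_N.+1 * 'I_T0) (y : 'rV[k]_e) :=
  let: (a, b, m, i) := t in
  if (a + b + m <= D)%N then lf 0 y ^+ a * lf 1 y ^+ b *
    lf (inord 2) y ^+ (D - (a + b + m)) * u m i y else 0.
have z0 D : spanned (@E0 D) (fun=> 0).
  by exists (fun=> 0) => y _; rewrite big1 // => i _; rewrite mul0r.
have shift D i t : spanned (@E0 D.+1) (fun y => lf i y * @E0 D t y).
  case: t => [[[a b] m] j]; have [le|gt] := leqP (a + b + m) D; last first.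
    by apply: spanned_ext (z0 _) => y _; rewrite /E0 leqNgt gt /= mulr0.
  have ci : i = 0 \/ i = 1 \/ i = inord 2.
    by case: i => -[|[|[|i]]] hi //; [left|right; left|right; right]; apply/val_inj;
      rewrite //= inordK.
  have [la lb] : (a.+1 < D.+2)%N /\ (b.+1 < D.+2)%N by split; rewrite ltnS ltn_ord.
  have wid (a' : 'I_D.+1) : (a' < D.+2)%N by apply: ltnW; rewrite ltnS ltn_ord.
  case: ci => [->|[->|->]].
  - apply: spanned_ext (spanned_gen _ (Ordinal la, Ordinal (wid b), m, j)) => y _.
    by rewrite /E0 /= !addSn ltnS le subSS exprS !mulrA.
  - apply: spanned_ext (spanned_gen _ (Ordinal (wid a), Ordinal lb, m, j)) => y _.
    rewrite /E0 /= addnS addSn ltnS le subSS exprS; by ring.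
  - apply: spanned_ext (spanned_gen _ (Ordinal (wid a), Ordinal (wid b), m, j)) => y _.
    rewrite /E0 /= leqW // le subSn // exprS; by ring.
have sp D F : fform D F -> spanned (@E0 D) F.
  elim: D F => [|D IH] F hF.
    have [c ec] := hu 0%N F hF; apply: spanned_ext (spanned_sum (J := 'I_(T 0%N)) (fun i => c i)
      (F := fun i y => u 0%N i y) _) => [y _|i]; first by rewrite ec.
    have li : (i < T0)%N by apply: leq_trans (leT ord0).
    apply: spanned_ext (spanned_gen _ (ord0, ord0, ord0, Ordinal li)) => y _.
    by rewrite /E0 /= !expr0 !mul1r.
  have [ND|DN] := leqP N D.
    have [G [hG eG]] := hN D F ND hF.
    have := @spanned_sum _ 'I_3 (@E0 D.+1) (fun=> 1) (fun i y => lf i y * G i y).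
    move=> h; apply: spanned_ext (h _) => [y Yy|i].
      by rewrite eG //; apply: eq_bigr => i _; rewrite mul1r.
    by apply: spanned_mul (IH _ (hG i)) => t; apply: shift.
  have [c ec] := hu D.+1 F hF; apply: spanned_ext (spanned_sum (J := 'I_(T D.+1)) (fun i => c i)
    (F := fun i y => u D.+1 i y) _) => [y _|i]; first by rewrite ec.
  have lD : (D.+1 < N.+1)%N by rewrite ltnS.
  have li : (i < T0)%N by apply: leq_trans (leT (Ordinal lD)).
  apply: spanned_ext (spanned_gen _ (ord0, ord0, Ordinal lD, Ordinal li)) => y _.
  by rewrite /E0 /= leqnn subnn !expr0 !mul1r.
exists (N.+1 * T0)%N => D I E hE; apply: leq_trans (indep_le hE (@sp D)) _.
by rewrite !card_prod !card_ord -mulnA mulnn mulnC.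
Qed.

End Normalization.

(* Three successive hyperplane sections of a surface have no common point. *)
Lemma three_forms : ~ has_chain Y 3 -> exists lf : 'I_3 -> 'rV[k]_e -> k,
  (forall i, fform 1 (lf i)) /\ forall y, Y y -> exists i, lf i y != 0.
Proof.
move=> nc.
have pick_form Z : clo Z -> exists n (C : nat -> 'rV[k]_e -> Prop) l, [/\ fform 1 l,
    forall i, (i < n)%N -> [/\ clo (C i), irr (C i), forall x, C i x -> Z x &
      exists2 x, C i x & l x != 0] & forall x, Z x -> exists2 i, (i < n)%N & C i x].
  move=> cZ; have [n [C [hC eC]]] := clo_components cZ.
  have /fchoice [w hw] : forall i, exists x, (i < n)%N -> C i x.
    move=> i; have [/hC [_ [[x Cx] _]]|ge] := ltnP i n; first by exists x.
    by exists 0.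
  have [x|l hl nl] := @exists_linear_form k e [seq w i | i <- iota 0 n].
    move=> /mapP [i]; rewrite mem_iota add0n => /andP [_ li] ->.
    by apply: is_point_neq0; apply: ((hC i li).1).1; apply: hw.
  exists n, C, l; split=> // [i li|x]; last by move=> /eC.
  have [c i'] := hC i li; split=> //; first by move=> x Cx; apply/eC; exists i.
  exists (w i); first exact: hw.
  by apply: nl; apply: map_f; rewrite mem_iota add0n.
have [[y0 Yy0] _] := iY; have py0 := cY.1 _ Yy0.
have [i0 [y01 _]] := py0; pose l0 (x : 'rV[k]_e) := x 0 i0.
have h0 : fform 1 l0 := fformX k i0.
have [n1 [C1 [l1 [h1 hC1 cov1]]]] := pick_form _ (clo_zero h0 cY).
have [n2 [C2 [l2 [h2 hC2 cov2]]]] := pick_form _ (clo_zero h1 (clo_zero h0 cY)).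
exists (fun i => if i == 0 then l0 else if i == 1 then l1 else l2); split.
  by move=> i; case: ifP => _ //; case: ifP.
move=> y Yy; apply: NNPP => no.
have z0 : l0 y = 0 by apply/eqP/negbNE/negP => nz; apply: no; exists 0.
have z1 : l1 y = 0 by apply/eqP/negbNE/negP => nz; apply: no; exists 1.
have z2 : l2 y = 0.
  by apply/eqP/negbNE/negP => nz; apply: no; exists (inord 2); rewrite -!val_eqE /= inordK.
have [j jn Cj] := cov2 y (conj (conj Yy z0) z1).
have [c2 ir2 s2 [w2 Cw2 lw2]] := hC2 j jn.
have [i ni si] : exists2 i, (i < n1)%N & forall x, C2 j x -> C1 i x.
  apply: irr_cover ir2 _ _ => [i /hC1 [] //|x /s2 [x0 _]]; exact: cov1.
have [c1 ir1 s1 [w1 Cw1 lw1]] := hC1 i ni.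
have irp : irr (eq y).
  split; first by exists y.
  by move=> Z1 Z2 _ _ h; have [h'|h'] := h _ erefl; [left|right]; move=> x <-.
have cp := clo_point (cY.1 _ Yy).
apply: nc; exists (fun m => match m with 0 => eq y | 1 => C2 j | 2 => C1 i | _ => Y end); split.
  case=> [|[|[|[|m]]]] // _; (split; [split=> //; exact/cloP|]) => x.
  - by move=> <-.
  - by move=> /s2 [[]].
  - by move=> /s1 [].
  - by [].
case=> [|[|[|m]]] // _; split.
- by move=> x <-.
- by exists w2; split=> // ew; move: lw2; rewrite -ew z2 eqxx.
- by [].
- by exists w1; split=> // /s2 [_ e1]; move: lw1; rewrite e1 eqxx.
- by move=> x /s1 [].
- by exists y0; split=> // /s1 [_]; rewrite /l0 y01 => /eqP; rewrite oner_eq0.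
Qed.

End Hilbert.

(** A constant factor does not affect the growth rate; [b] is a form of Bernoulli's inequality. *)
Lemma power_growth K n C : (forall t, (K ^ t <= C * (n ^ 2) ^ t)%N) -> (0 < n)%N -> (K <= n ^ 2)%N.
Proof.
move=> h n0; rewrite leqNgt; apply/negP => lt; set N := (n ^ 2)%N in h lt.
have N0 : (0 < N)%N by rewrite expn_gt0 n0.
have b t : (N ^ t * (N + t) <= N * K ^ t)%N.
  elim: t => [|t IH]; first by rewrite !expn0 addn0 muln1 mul1n.
  have le1 : (N * (N + t.+1) <= (N + t) * N.+1)%N by nia.
  rewrite !expnSr -mulnA; apply: (@leq_trans (N ^ t * ((N + t) * N.+1))).
    by rewrite leq_mul.
  by rewrite !mulnA; apply: leq_mul.
have := leq_trans (b (N * C).+1) (leq_mul (leqnn N) (h _)).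
rewrite mulnC mulnA leq_pmul2r ?expn_gt0 ?N0 //; lia.
Qed.

Section Degree.

Variables (k : closedFieldType) (e : nat) (Y : 'rV[k]_e -> Prop).
Hypotheses (cY : clo Y) (iY : irr Y) (dY : ~ has_chain Y 3).
Variables (n : nat) (psi : 'rV[k]_e -> 'rV[k]_e) (H : 'rV[k]_e -> k).
Hypotheses (n1 : (1 < n)%N) (mpsi : morph Y Y psi).
Hypothesis surj : forall y, Y y -> exists2 z, Y z & psi z = y.
Hypothesis Hnz : forall y, Y y -> H y != 0.
Hypothesis secH : forall j y, Y y -> sec_at Y n (fun z => H z * psi z 0 j) y.
Variables (K : nat) (tau : 'I_K -> 'rV[k]_e -> 'rV[k]_e).
Hypotheses (mtau : forall l, morph Y Y (tau l)) (K0 : (0 < K)%N).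
Hypothesis ptau : forall l y, Y y -> psi (tau l y) = psi y.
Hypothesis itau : forall l l' y, Y y -> tau l y = tau l' y -> l = l'.

Lemma linear_coefs (a : 'rV[k]_e -> k) : fform 1 a -> exists al, forall x, a x = \sum_i al i * x 0 i.
Proof.
move=> /fformS [G hG eG]; have /fchoice [al hal] := fun i => fform_deg0 (hG i).
by exists al => x; rewrite eG; apply: eq_bigr => i _; rewrite hal mulrC.
Qed.

(** One factor [U] of fixed degree clears the denominators of [H y *: psi y] in forms of every
    degree [D]; this uniformity allows the iteration in [degree_bound]. *)
Lemma section_forms : exists N, forall D F U, fform D F -> fform N U ->
  exists2 V, fform (N + D * n)%N V & forall y, Y y -> F (H y *: psi y) * U y = V y.
Proof.
have /fchoice [N hN] := fun j => global_sections cY (secH j).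
pose P j M := forall U, fform M U -> exists2 V, fform (M + n)%N V &
  forall y, Y y -> H y * psi y 0 j * U y = V y.
have PS j M : P j M -> P j M.+1.
  move=> hP U /fformS [G hG eG].
  have /fchoice [V hV] : forall i, exists V, fform (M + n)%N V /\
      forall y, Y y -> H y * psi y 0 j * G i y = V y.
    by move=> i; have [V] := hP _ (hG i); exists V.
  exists (fun y : 'rV[k]_e => \sum_i y 0 i * V i y).
    by apply: fform_sum => i _; apply: fformM (fformX k i) (hV i).1.
  move=> y Yy; rewrite eG mulr_sumr; apply: eq_bigr => i _.
  by rewrite -(hV i).2 // mulrCA.
pose N0 := (\sum_j N j)%N.
have PN M j : (N0 <= M)%N -> P j M.
  move=> le; have : (N j <= M)%N by apply: leq_trans le; rewrite /N0 (bigD1 j) //= leq_addr.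
  move=> /subnK <-; elim: (M - N j)%N => [|t IH]; [exact: hN|exact: PS].
exists N0 => D F U hF hU; elim: D F hF => [|D IH] F hF.
  have [c ec] := fform_deg0 hF; exists (fun y => c * U y); last by move=> y _; rewrite ec.
  by rewrite addn0; apply: fformZ.
have [G hG eG] := fformS hF.
have /fchoice [V hV] : forall i, exists V, fform (N0 + D * n + n)%N V /\
    forall y, Y y -> H y * psi y 0 i * (G i (H y *: psi y) * U y) = V y.
  move=> i; have [V1 hV1 e1] := IH _ (hG i).
  have [V hV eV] := PN _ i (leq_addr (D * n) N0) _ hV1.
  by exists V; split=> // y Yy; rewrite e1 ?eV.
exists (fun y => \sum_i V i y).
  apply: fform_sum => i _; apply: fform_deg (hV i).1; lia.
move=> y Yy; rewrite eG mulr_suml; apply: eq_bigr => i _.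
by rewrite -(hV i).2 // mxE mulrA.
Qed.

(* Products of pulled back forms with the powers of a ratio of linear forms separating the
   points of a general fibre are independent. *)
Lemma hilbert_step : exists W, forall D (I : finType) (E : I -> 'rV[k]_e -> k),
  indep Y D E -> exists E' : I * 'I_K -> 'rV[k]_e -> k, indep Y (D * n + W) E'.
Proof.
have [N hN] := section_forms; exists (N + K.-1)%N => D I E [hE ind].
have [[y0 Yy0] _] := iY.
have pt l y : Y y -> is_point (tau l y) by move=> Yy; apply: cY.1; apply: (mtau l).1.
have [|b hb nb] := @exists_linear_form k e [seq tau l y0 | l <- enum 'I_K].
  by move=> x /mapP [l _ ->]; apply: is_point_neq0; apply: pt.
have nb0 l : b (tau l y0) != 0 by apply: nb; apply: map_f; rewrite mem_enum.
(* Nonvanishing of [a] on these differences makes the ratios [a / b] distinct at the points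
   [tau l y0]. *)
pose w (t : 'I_K * 'I_K) := b (tau t.2 y0) *: tau t.1 y0 - b (tau t.1 y0) *: tau t.2 y0.
have [|a ha na] := @exists_linear_form k e [seq w t | t <- enum {: 'I_K * 'I_K} & t.1 != t.2].
  move=> x /mapP [t]; rewrite mem_filter => /andP [nt _] -> w0; move: nt; apply/negP.
  rewrite negbK; apply/eqP/(itau Yy0).
  apply: (@is_point_eq _ _ ((b (tau t.2 y0))^-1 * b (tau t.1 y0))); [exact: pt|exact: pt|].
  apply: (scalerI (nb0 t.2)); rewrite scalerA mulrA divff // mul1r.
  by apply/eqP; rewrite -subr_eq0; apply/eqP.
have [al hal] := linear_coefs ha; have [be hbe] := linear_coefs hb.
have na0 l l' : l != l' -> a (tau l y0) * b (tau l' y0) - b (tau l y0) * a (tau l' y0) != 0.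
  move=> nl; have := na (w (l, l')); rewrite map_f; last by rewrite mem_filter /= nl /= mem_enum.
  move=> /(_ isT).
  have -> : a (w (l, l')) = b (tau l' y0) * a (tau l y0) - b (tau l y0) * a (tau l' y0).
    rewrite !hal !mulr_sumr -sumrB; apply: eq_bigr => i _; rewrite !mxE /=; ring.
  by rewrite [b _ * a _]mulrC.
have /fchoice [V hV] : forall i, exists V, fform (N + D * n)%N V /\
    forall y, Y y -> E i (H y *: psi y) * b y ^+ N = V y.
  move=> i; have := fformXn N hb; rewrite muln1 => hbN.
  by have [V] := hN D _ _ (hE i) hbN; exists V.
exists (fun (t : I * 'I_K) y => V t.1 y * (a y ^+ t.2 * b y ^+ (K.-1 - t.2))); split.
  move=> [i j] /=.
  have := fformM (hV i).1 (fformM (fformXn j ha) (fformXn (K.-1 - j) hb)).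
  apply: fform_deg; have := ltn_ord j; lia.
move=> c hc.
have nr : near Y y0 (fun y => (forall l, b (tau l y) != 0) /\
    forall t : 'I_K * 'I_K, t.1 != t.2 ->
      a (tau t.1 y) * b (tau t.2 y) - b (tau t.1 y) * a (tau t.2 y) != 0).
  apply: near_and; apply: near_fin.
    by move=> l; apply: (morph_near (mtau l).1 ((mtau l).2 _ Yy0) (near_form Y hb (nb0 l)) Yy0).
  move=> [l l'] /=; have [->|nl] := eqVneq l l'; first by apply: near_all.
  pose Lam (v : 'rV[k]_(e * e)) :=
    \sum_i \sum_j (al i * be j - be i * al j) * v 0 (mxvec_index i j).
  have hLam : fform 1 Lam.
    by apply: fform_sum => i _; apply: fform_sum => j _; apply: fformZ; apply: fformX.
  have eLam x z : Lam (segre x z) = a x * b z - b x * a z.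
    rewrite !hal !hbe !big_distrlr /= -sumrB; apply: eq_bigr => i _.
    by rewrite -sumrB; apply: eq_bigr => j _; rewrite segreE; ring.
  have m2 := morph_pair (mtau l) (mtau l').
  have := near_form (product Y Y) hLam (x := segre (tau l y0) (tau l' y0)).
  rewrite eLam => /(_ (na0 l l' nl)) nL.
  apply: near_mono (morph_near m2.1 (m2.2 _ Yy0) nL Yy0) => y Yy.
  by rewrite eLam.
have van y : Y y -> (forall l, b (tau l y) != 0) /\ (forall t : 'I_K * 'I_K, t.1 != t.2 ->
      a (tau t.1 y) * b (tau t.2 y) - b (tau t.1 y) * a (tau t.2 y) != 0) ->
    forall j, \sum_i c (i, j) * E i (psi y) = 0.
  move=> Yy [nb1 na1].
  pose gam (j : 'I_K) := \sum_i c (i, j) * E i (psi y).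
  pose p : {poly k} := \sum_(j < K) gam j *: 'X^j.
  (* [p] has degree below [K], and the relation makes the [K] distinct ratios [a / b] on the fibre
     its roots. *)
  have p0 : p = 0.
    apply/eqP/negbNE/negP => np.
    have sp : (size p <= K)%N.
      apply: (leq_trans (size_sum _ _ _)); apply/bigmax_leqP => j _.
      by apply: (leq_trans (size_scale_leq _ _)); rewrite size_polyXn.
    have ur : uniq [seq a (tau l y) / b (tau l y) | l <- enum 'I_K].
      rewrite map_inj_uniq ?enum_uniq // => l l' el; apply/eqP/negbNE/negP => nl.
      have := na1 (l, l') nl; rewrite /= -[a (tau l y)](divfK (nb1 l)) el.
      by rewrite mulrAC divfK // mulrC subrr eqxx.
    suff /(max_poly_roots np) /(_ ur) : all (root p) [seq a (tau l y) / b (tau l y) | l <- enum 'I_K].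
      by rewrite size_map size_enum_ord ltnNge sp.
    apply/allP => _ /mapP [l _ ->]; rewrite /root /p horner_sum.
    have Yt := (mtau l).1 _ Yy; have := hc _ Yt.
    have fz : H (tau l y) ^+ D * b (tau l y) ^+ N * b (tau l y) ^+ K.-1 != 0.
      by rewrite !mulf_neq0 ?expf_neq0 ?nb1 // Hnz.
    have -> : \sum_i c i * (V i.1 (tau l y) * (a (tau l y) ^+ i.2 * b (tau l y) ^+ (K.-1 - i.2)))
        = H (tau l y) ^+ D * b (tau l y) ^+ N * b (tau l y) ^+ K.-1 *
          \sum_(j < K) (gam j *: 'X^j).[a (tau l y) / b (tau l y)].
      rewrite mulr_sumr; transitivity (\sum_j \sum_i c (i, j) * (V i (tau l y) *
          (a (tau l y) ^+ j * b (tau l y) ^+ (K.-1 - j)))).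
        by rewrite exchange_big pair_bigA; apply: eq_bigr => -[].
      apply: eq_bigr => j _; rewrite hornerZ hornerXn /gam mulr_suml mulr_sumr.
      apply: eq_bigr => i _; rewrite -(hV i).2 // (fform_scale _ _ (hE i)) ptau //.
      have {2}-> : K.-1 = (K.-1 - j + j)%N by rewrite subnK // -ltnS prednK.
      rewrite exprD expr_div_n.
      have nbj : b (tau l y) ^+ j != 0 by rewrite expf_neq0.
      set a1 := a _ ^+ j; set b1 := b _ ^+ j in nbj *; set b2 := b _ ^+ (_ - _).
      by field.
    by move=> /eqP; rewrite mulf_eq0 (negPf fz).
  move=> j; have := congr1 (fun p : {poly k} => p`_j) p0.
  rewrite coef0 /p coef_sum (bigD1 j) //= coefZ coefXn eqxx mulr1 big1 ?addr0 // => j' nj.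
  by rewrite coefZ coefXn val_eqE eq_sym (negPf nj) mulr0.
move=> [i j]; apply: (ind (fun i => c (i, j))) => y Yy.
have hF : fform D (fun y => \sum_i c (i, j) * E i y).
  by apply: fform_sum => i' _; apply: fformZ.
apply/eqP/negbNE/negP => nF; have [z Yz ez] := surj Yy.
have nz : near Y z (fun v => \sum_i c (i, j) * E i (psi v) != 0).
  by have := near_form Y hF nF; rewrite -ez => nz; apply: (morph_near mpsi.1 (mpsi.2 _ Yz) nz Yz).
have [v [Yv /(van v Yv) /(_ j) -> ]] := irr_near cY iY Yy0 Yz nr nz.
by rewrite eqxx.
Qed.

(** Each step multiplies the number of independent forms by [K] and the degree essentially by [n],
    while the space of forms grows only quadratically in the degree. *)
Theorem degree_bound : (K <= n ^ 2)%N.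
Proof.
have [lf [hlf nz]] := three_forms cY iY dY.
have [C hC] := quadratic_growth cY hlf nz.
have [W hW] := hilbert_step.
apply: (@power_growth _ _ (C * W.+1 ^ 2)); last exact: ltnW.
have [[y0 Yy0] _] := iY.
(* Adding [W] to [D] makes the bound stable under [D * n + W], because [n] is at least 2. *)
move=> t; have [D [I [E [ind cI leD]]]] : exists D (I : finType) (E : I -> 'rV[k]_e -> k),
    [/\ indep Y D E, #|I| = (K ^ t)%N & (D + W <= n ^ t * W)%N].
  elim: t => [|t [D [I [E [ind cI leD]]]]].
    exists 0%N, 'I_1, (fun _ _ => 1); split; rewrite ?card_ord ?expn0 ?mul1n //.
    split=> [_|c hc i]; first exact: fformC.
    by have := hc y0 Yy0; rewrite big_ord1 mulr1 [i]ord1.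
  have [E' ind'] := hW D I E ind; exists (D * n + W)%N, (I * 'I_K)%type, E'; split=> //.
    by rewrite card_prod card_ord cI expnSr.
  rewrite expnSr; apply: (@leq_trans ((D + W) * n)); first by nia.
  by rewrite mulnAC leq_mul.
have := hC D I E ind; rewrite cI => h; apply: leq_trans h _.
rewrite -mulnA leq_mul // -expnM mulnC mulnC [(2 * t)%N]mulnC expnM -expnMn leq_exp2r //.
have nt : (0 < n ^ t)%N by rewrite expn_gt0 (ltnW n1).
by nia.
Qed.

End Degree.

Section TorsionBound.

Variables (k : closedFieldType) (d b : nat) (A : group_data k d) (B : group_data k b).
Variables (hA : agroup A) (hB : agroup B).
Variable D : 'rV[k]_(d * b) -> 'rV[k]_(d * b) -> k.
Hypothesis hD : dual_frames A B D.
Variables (lam : 'rV[k]_d -> 'rV[k]_b) (L : 'rV[k]_d -> 'rV[k]_d -> k).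
Hypothesis hpol : polarized A B D lam L.

Local Notation X := (pts A).
Local Notation GA := (Gp hA).
Local Notation GB := (Gp hB).
Local Notation Pf := (Pf D).
Local Notation lamG := (@lamG k d b A B hA hB lam).

Implicit Types (x z t : GA).

Variable m : nat.
Hypothesis hdiv : forall x, exists z, x = z *+ m.

(** Taking [s] with [m s = - c] removes the Pic0 factor of [mult_bundle]: the map [u -> m u + s]
    pulls [L] back to exactly the power [m ^ 2] of [L]. *)
Lemma affine_mult_bundle : exists s : GA, triv X (fun u v =>
  L (add A (mult A m u) (val s)) (add A (mult A m v) (val s)) / L u v ^+ (m ^ 2)).
Proof.
have mm := morph_mult hA m; have cL := pol_coh hpol.
have [c T1] := mult_bundle hA hB hD hpol m.
have [s es] := hdiv (- c); exists s; have ms := trans_pts hA (ptsG s).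
have T0 := triv_pull mm (pol_eq hpol (ptsG s)).
have T2 := cls_mult hA hD hpol m (PfG_pic0 hD (lamG s)) (cls_Pf hD (lamG s)).
have T3 := Pf_add hA hD hpol (lamG c) (lamG s *+ m).
have e0 : lamG c + lamG s *+ m = 0.
  by rewrite -(lamG_muln hB hpol) -es -(lamG_add hB hpol) subrr (lamG0 hA hB hpol).
rewrite e0 val0 in T3; have T4 := df_triv0 hD.
have c1 := coh_pull mm (coh_pull ms cL); have c2 := coh_pull mm cL.
have c3 := coh_pull mm (PfG_coh hD (lamG s)).
have c4 := PfG_coh hD (lamG s *+ m); have c5 := PfG_coh hD (lamG c).
have c6 := df_pic0 hD (ag_zero hB); have c7 := cohXn (m ^ 2) cL.
rewrite -(val_lamG hB hpol) in T0.
apply: triv_near (trivM (trivM (trivV T0) (trivV T2)) (trivM (trivM T1 (trivV T3)) T4)) => u Xu.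
apply: near_mono (near_and (coh_neq0 Xu c1) (near_and (coh_neq0 Xu c2) (near_and (coh_neq0 Xu c3)
  (near_and (coh_neq0 Xu c4) (near_and (coh_neq0 Xu c5) (near_and (coh_neq0 Xu c6.1)
  (coh_neq0 Xu c7))))))) => v Xv [n1 [n2 [n3 [n4 [n5 [n6 n7]]]]]].
by field; rewrite n1 n2 n3 n4 n5 n6 n7.
Qed.

Variables (M e : nat) (Y : 'rV[k]_e -> Prop) (f : 'rV[k]_d -> 'rV[k]_e).
Variable (g : 'rV[k]_e -> 'rV[k]_d).
Hypothesis hL : ample_frame A L M Y f g.
Hypothesis hdim : ~ has_chain X 3.

Lemma ample_chain : ~ has_chain Y 3.
Proof.
move=> [Z [hZ sZ]]; apply: hdim; exists (fun i u => X u /\ Z i (f u)).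
have [cX [mf mg]] := (ag_clo hA, (af_morph hL, af_inv hL)).
have pY := (af_clo hL).1; split=> i li.
  have [[/cloP cZ iZ] sub] := hZ i li; split; last by move=> u [].
  split; first by apply/cloP; apply: (morph_clo mf.1 cX pY mf.2 cZ).
  have gZ y : Z i y -> X (g y) /\ Z i (f (g y)).
    by move=> Zy; split; [exact/mg.1/sub|rewrite (af_gK hL) //; exact: sub].
  apply: (irr_image (f := g) gZ cZ _ _ _ iZ).
  - by move=> u [/cX.1].
  - move=> y Zy; have [n [G [hG Gy eG]]] := mg.2 y (sub y Zy).
    by exists n, G; split=> // z /sub; apply: eG.
  - by move=> u [Xu Zu]; exists (f u) => //; apply: (af_fK hL).
have [sub1 [y [Zy nZy]]] := sZ i li; split; first by move=> u [Xu /sub1].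
have Yy : Y y by apply: (hZ i.+1 li).2.
exists (g y); rewrite (af_gK hL) //; split; last by case.
by split=> //; apply: mg.1.
Qed.

(** In the projective embedding the map [u -> m u + t] is given by sections of degree [m ^ 2], and
    translations by torsion points preserve its fibres; [degree_bound] then gives the square of
    [m ^ 2]. *)
Theorem torsion_bound (s : seq GA) : (1 < m)%N -> uniq s -> (forall x, x \in s -> x *+ m = 0) ->
  (size s <= m ^ 4)%N.
Proof.
move=> m1 us ts; have [->|s0] := eqVneq (size s) 0%N; first by [].
have [t Ht] := affine_mult_bundle.
have [cX [mf mg]] := (ag_clo hA, (af_morph hL, af_inv hL)).
have pY := (af_clo hL).1; have mm := morph_mult hA m; have mt := trans_pts hA (ptsG t).
pose phi u := add A (mult A m u) (val t).
have mphi : morph X X phi := morph_comp mm mt.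
have [H hH] : triv X (fun u v => hyper_frame (f (phi u)) (f (phi v)) /
    hyper_frame (f u) (f v) ^+ (m ^ 2)).
  have t1 := trivXn M Ht; have t2 := triv_pull mphi (af_triv hL).
  have t3 := trivXn (m ^ 2) (af_triv hL); have cL := pol_coh hpol.
  have c1 := cohXn M (coh_pull mphi cL); have c2 := cohXn (m ^ 2) (cohXn M cL).
  apply: triv_near (trivM t3 (trivM t1 (trivV t2))) => u Xu.
  apply: near_mono (near_and (coh_neq0 Xu c1) (coh_neq0 Xu c2)) => v Xv [n1 n2].
  rewrite !expr_div_n -!/(phi _).
  have -> : L u v ^+ (m ^ 2) ^+ M = L u v ^+ M ^+ (m ^ 2) by rewrite -!exprM mulnC.
  rewrite invf_div; set a1 := L (phi u) _ ^+ M in n1 *; set a2 := L u v ^+ M ^+ _ in n2 *.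
  set a3 := (hyper_frame (f u) (f v) ^+ _)^-1.
  by field; rewrite n1 n2.
pose psi y := f (phi (g y)).
have mpsi : morph Y Y psi := morph_comp mg (morph_comp mphi mf).
have iY : irr Y.
  apply: (irr_image mf.1 cX pY mf.2 _ (ag_irr hA)) => y Yy; exists (g y); first exact: mg.1.
  exact: (af_gK hL).
have Hnz u : X u -> H u != 0 by move=> Xu; have := (hH u Xu).2; rewrite mulf_eq0 => /norP [].
have st : size s = (size s).-1.+1 by rewrite prednK // lt0n.
pose tau (l : 'I_(size s)) y := f (add A (g y) (val (nth 0 s l))).
rewrite -[4%N]/(2 * 2)%N expnM; apply: (@degree_bound k e Y (af_clo hL) iY ample_chain (m ^ 2) psi
  (fun y => H (g y)) _ mpsi _ _ _ (size s) tau).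
- by rewrite -(exp1n 2) ltn_exp2r.
- move=> y Yy; have [z ez] := hdiv (inG hA (g y) - t).
  exists (f (val z)); first by apply: mf.1; apply: ptsG.
  rewrite /psi (af_fK hL (ptsG z)) /phi -(valMn z) -ez -valD subrK inGK ?(af_gK hL) //.
  exact: mg.1.
- by move=> y Yy; apply: Hnz; apply: mg.1.
- move=> j y Yy; have Xg := mg.1 _ Yy.
  have h1 := morph_unit mg.1 Yy (mg.2 y Yy) (hH _ Xg).
  have [i li yi] := lead_indexP (pY _ Yy).
  have [i' li' yi'] := lead_indexP (pY _ (mpsi.1 _ Yy)).
  have pn : psi y 0 i' != 0 by rewrite yi' oner_neq0.
  have yn : y 0 i != 0 by rewrite yi oner_neq0.
  have h2 := coord_reg j Yy (mpsi.2 y Yy) pn.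
  have h3 := sec_form Y y (fformXn (m ^ 2) (fformX k i)).
  have := secM (regM h1.1 h2) h3; rewrite muln1; apply: sec_near.
  have np := morph_near mpsi.1 (mpsi.2 y Yy) (near_form Y (fformX k i') pn) Yy.
  apply: near_mono (near_and np (near_form Y (fformX k i) yn)) => z Yz [n1 n2].
  rewrite /hyper_frame (af_gK hL) // li -/(psi y) li' (af_gK hL) // -/(psi z).
  have n3 : z 0 i ^+ (m ^ 2) != 0 by rewrite expf_neq0.
  by field; rewrite n1 n3.
- move=> l; exact: (morph_comp mg (morph_comp (trans_pts hA (ptsG _)) mf)).
- by rewrite lt0n.
- move=> l y Yy; rewrite /psi /tau (af_fK hL); last first.
    by apply: (trans_pts hA (ptsG _)).1; apply: mg.1.
  rewrite /phi -[g y](inGK hA); last exact: mg.1.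
  by rewrite -valD -!valMn mulrnDl (ts s`_l) ?addr0 ?mem_nth.
move=> l l' y Yy /(congr1 g); rewrite /tau.
have Xg := mg.1 _ Yy; have Xt x := (trans_pts hA (ptsG x)).1 _ Xg.
rewrite !(af_fK hL) //; rewrite -[g y](inGK hA) // -!valD => /val_inj /addrI /eqP.
by rewrite nth_uniq // => /eqP /val_inj.
Qed.

End TorsionBound.

(** * The Rosati involution *)

Section OrderRing.

Variables (K : fieldExtType rat) (O : K -> Prop).
Hypothesis hO : is_order O.

Lemma order1 : O 1. Proof. by case: hO. Qed.
Lemma orderB x y : O x -> O y -> O (x - y). Proof. by case: hO => _ h _ _ Ox Oy; case: (h x y). Qed.
Lemma orderM x y : O x -> O y -> O (x * y). Proof. by case: hO => _ h _ _ Ox Oy; case: (h x y). Qed.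
Lemma order0 : O 0. Proof. by rewrite -(subrr 1); apply: orderB; apply: order1. Qed.
Lemma orderN x : O x -> O (- x). Proof. by rewrite -sub0r; apply: orderB; apply: order0. Qed.
Lemma orderD x y : O x -> O y -> O (x + y).
Proof. by move=> Ox Oy; rewrite -[y]opprK; apply: orderB => //; apply: orderN. Qed.
Lemma orderMn x n : O x -> O (x *+ n).
Proof.
by move=> Ox; elim: n => [|n IH]; [apply: order0|rewrite mulrS; apply: orderD].
Qed.
Lemma order_nat n : O n%:R. Proof. by apply: orderMn; apply: order1. Qed.
Lemma orderXn x n : O x -> O (x ^+ n).
Proof.
by move=> Ox; elim: n => [|n IH]; [apply: order1|rewrite exprS; apply: orderM].
Qed.

End OrderRing.

Section Rosati.

Variables (k : closedFieldType) (q d b : nat).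
Variables (A : group_data k d) (B : group_data k b) (P : cocycle k (d * b)).
Variables (hA : agroup A) (hB : agroup B).
Hypotheses (hq : [pchar k].-nat q) (q1 : (1 < q)%N).
Hypothesis halg : forall x : k, exists2 m : nat, (0 < m)%N & x \in Fq k (q ^ m).
Hypotheses (hAF : abelian_variety (Fq k q) A) (hBF : abelian_variety (Fq k q) B).
Variable D : 'rV[k]_(d * b) -> 'rV[k]_(d * b) -> k.
Hypotheses (hP : rep (product (pts A) (pts B)) P D) (hD : dual_frames A B D).
Hypothesis lP : line_bundle (Fq k q) (product (pts A) (pts B)) P.
Variables (lam : 'rV[k]_d -> 'rV[k]_b) (L : 'rV[k]_d -> 'rV[k]_d -> k).
Hypothesis hpol : polarized A B D lam L.
Hypothesis lamF : homomorphism_over (Fq k q) A B lam.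

Local Notation X := (pts A).
Local Notation Y := (pts B).
Local Notation GA := (Gp hA).
Local Notation GB := (Gp hB).
Local Notation Pf := (Pf D).
Local Notation cls := (cls A D).
Local Notation frobG := (@frobG k q d A hA).
Local Notation lamG := (@lamG k d b A B hA hB lam).
Local Notation we := (@we k d b A B hA hB D).
Implicit Types (x z t : GA).

Hypothesis hdiv : forall m x, (1 < m)%N -> exists z, x = z *+ m.

Let fA u : X u -> X (frobenius q u).
Proof. by case: hAF => -[cA _] _ _ _ _; apply: (frobenius_closed hq cA). Qed.

Let fB u : Y u -> Y (frobenius q u).
Proof. by case: hBF => -[cB _] _ _ _ _; apply: (frobenius_closed hq cB). Qed.

Lemma morph_frobenius e (Z : 'rV[k]_e -> Prop) : (forall u, Z u -> is_point u) ->
  (forall u, Z u -> Z (frobenius q u)) -> morph Z Z (@frobenius k q e).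
Proof.
move=> pZ fZ; split=> // u Zu; exists q, (fun v => frobenius q v); split.
- move=> j; have := fformXn q (fformX k j); rewrite muln1; apply: fform_ext => v.
  by rewrite mxE.
- by apply: is_point_neq0; apply: pZ; apply: fZ.
by move=> v Zv _; exists 1; rewrite scale1r.
Qed.

Lemma open_frobenius e (Z U : 'rV[k]_e -> Prop) u : (forall u, Z u -> Z (frobenius q u)) ->
  open_in (Fq k q) Z U -> Z u -> U u -> U (frobenius q u).
Proof.
move=> fZ [C [[S [hS hC]] hU]] Zu /(hU u Zu) nC; apply/hU; first exact: fZ.
move=> /hC [pu Su]; apply: nC; apply/hC; split; last first.
  move=> g Sg; have [m [_ og]] := hS g Sg; apply: (frob_inj hq).
  rewrite -(ev_frobenius hq) // Su // expr0n.
  by have : (0 < q)%N := ltnW q1; case: (q).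
have [i [ui hi]] := pu; exists i; split=> [|j ji]; apply: (frob_inj hq).
  by move: ui; rewrite mxE expr1n.
have := hi j ji; rewrite mxE expr0n => ->.
by have : (0 < q)%N := ltnW q1; case: (q).
Qed.

Lemma regular_frobenius e (Z U : 'rV[k]_e -> Prop) h u : (forall u, Z u -> Z (frobenius q u)) ->
  regular_on (Fq k q) Z U h -> (forall u, Z u -> U u -> U (frobenius q u)) ->
  Z u -> U u -> h (frobenius q u) = h u ^+ q.
Proof.
move=> fZ hr fU Zu Uu; have [m [g [f [[_ og] [_ of_] fu eh]]]] := hr u Zu Uu.
rewrite !eh //; [|exact: fZ|exact: fU|].
  by rewrite !(ev_frobenius hq) // expr_div_n.
rewrite (ev_frobenius hq) // => /eqP; rewrite expf_eq0 => /andP [_ /eqP].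
exact: fu.
Qed.

(** The transition functions of [P] are defined over the finite field, so pulling [P] back by
    Frobenius raises them to the power [q]. *)
Lemma frobenius_class y : Y y ->
  triv X (fun u v => Pf (frobenius q y) (frobenius q u) (frobenius q v) / Pf y u v ^+ q).
Proof.
move=> Yy; set XY := product X Y.
have pX : forall u, X u -> is_point u := (ag_clo hA).1.
have pY : forall u, Y u -> is_point u := (ag_clo hB).1.
have fXY w : XY w -> XY (frobenius q w).
  move=> [u [v [Xu Yv ->]]]; exists (frobenius q u), (frobenius q v).
  by rewrite frobenius_segre; split; [exact: fA|exact: fB|].
have mf := morph_frobenius (product_point pX pY) fXY.
have [u hu] := hP; have [eu nu cov op un] := hu.
have [lo _ lr _ _] := lP.
have fch (i : Defs.index P) w : XY w -> chart i w -> chart i (frobenius q w).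
  by move=> XYw ci; apply: (open_frobenius fXY (lo i) XYw ci).
have eq (i j : Defs.index P) w : XY w -> chart i w -> chart j w ->
    u j (frobenius q w) / u i (frobenius q w) = (u j w / u i w) ^+ q.
  move=> XYw ci cj; have ci' := fch i w XYw ci; have cj' := fch j w XYw cj.
  have XYf := fXY w XYw.
  rewrite -(eu i j (frobenius q w)) // -(eu i j w) // !mulfK ?nu //.
  apply: (regular_frobenius fXY (lr i j)) => // v XYv [? ?].
  by split; apply: fch.
(* The quotient does not depend on the chart, because the transition functions commute with
   Frobenius. *)
have /fchoice [H hH] : forall w, exists c, XY w -> forall i : Defs.index P, chart i w ->
    c = u i w ^+ q / u i (frobenius q w).
  move=> w; have [XYw|] := classic (XY w); last by exists 0.
  have [i ci] := cov w XYw; exists (u i w ^+ q / u i (frobenius q w)) => _ j cj.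
  have := eq i j w XYw ci cj; rewrite expr_div_n.
  have n1 := nu i _ XYw ci; have n2 := nu i _ (fXY _ XYw) (fch _ _ XYw ci).
  have n3 := nu j _ (fXY _ XYw) (fch _ _ XYw cj).
  move=> /eqP; rewrite eqr_div ?expf_neq0 // => /eqP e.
  by apply/eqP; rewrite eqr_div // mulrC e.
have tXY : triv XY (fun w v => D (frobenius q w) (frobenius q v) / D w v ^+ q).
  exists H => w XYw; have [i ci] := cov w XYw; have ci' := fch i w XYw ci.
  have h1 := unitXn q (un i w XYw ci).
  have h2 := morph_unit mf.1 XYw (mf.2 w XYw) (un i _ (fXY w XYw) ci').
  apply: unit_near (unitM h1 (unitV XYw h2)) => //.
  apply: near_mono (near_and (op i w XYw ci) (near_and (sec_neq0 XYw h1.1 h1.2)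
    (sec_neq0 XYw h2.1 h2.2))) => v XYv [cv [n1 n2]].
  rewrite (hH v XYv i cv); move: n1 n2; rewrite expf_eq0 (ltnW q1) !mulf_eq0 !invr_eq0.
  move=> /norP [n1 n2] /norP [n3 n4].
  rewrite expr_div_n invf_div.
  have n5 : D w v ^+ q != 0 by rewrite expf_neq0.
  by field; rewrite n3 n5.
apply: triv_ext (triv_pull (slice_morph hA pY Yy) tXY) => v v' Xv Xv'.
by rewrite !frobenius_segre.
Qed.

Variables (K : fieldExtType rat) (O : K -> Prop) (iota : K -> 'rV[k]_d -> 'rV[k]_d).
Hypotheses (hO : is_order O) (hcm : complex_multiplication (Fq k q) A O iota).

Definition act (a : K) x : GA := inG hA (iota a (val x)).

Lemma iota_hom a : O a -> hom A A (iota a).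
Proof.
by case: hcm => h _ _ _ _ /h [m ad]; split=> //; apply: morphism_over_morph m.
Qed.

Lemma val_act a x : O a -> val (act a x) = iota a (val x).
Proof. by move=> Oa; rewrite inGK //; apply: (iota_hom Oa).1.1; apply: ptsG. Qed.

Lemma actD a : O a -> {morph act a : x z / x + z}.
Proof.
move=> Oa x z; apply/val_inj; rewrite valD !val_act // valD.
by apply: (iota_hom Oa).2; apply: ptsG.
Qed.

Lemma act0 a : O a -> act a 0 = 0.
Proof. by move=> Oa; apply: (addrI (act a 0)); rewrite -actD // !addr0. Qed.

Lemma actMn a x n : O a -> act a (x *+ n) = act a x *+ n.
Proof.
by move=> Oa; elim: n => [|n IH]; rewrite ?mulr0n ?act0 // !mulrS actD // IH.
Qed.

Lemma act_add a c x : O a -> O c -> act (a + c) x = act a x + act c x.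
Proof.
move=> Oa Oc; apply/val_inj; rewrite valD !val_act //; last exact: (orderD hO).
by case: hcm => _ _ h _ _; case: (h a c (val x)) => //; apply: ptsG.
Qed.

Lemma act_mul a c x : O a -> O c -> act (a * c) x = act a (act c x).
Proof.
move=> Oa Oc; apply/val_inj; rewrite !val_act //; last exact: (orderM hO).
by case: hcm => _ _ h _ _; case: (h a c (val x)) => //; apply: ptsG.
Qed.

Lemma act1 x : act 1 x = x.
Proof. by case: hcm => _ h1 _ _ _; rewrite /act h1 ?valGK //; apply: ptsG. Qed.

Lemma act_zero x : act 0 x = 0.
Proof.
by apply: (addrI (act 0 x)); rewrite -act_add ?addr0 //; apply: (order0 hO).
Qed.

Lemma act_sub a c x : O a -> O c -> act (a - c) x = act a x - act c x.
Proof.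
move=> Oa Oc; apply: (addIr (act c x)); rewrite -act_add ?subrK //; exact: (orderB hO).
Qed.

Lemma act_muln a n x : O a -> act (a *+ n) x = act a x *+ n.
Proof.
move=> Oa; elim: n => [|n IH]; first by rewrite !mulr0n act_zero.
by rewrite !mulrS act_add ?IH //; apply: (orderMn hO).
Qed.

Lemma act_nat n x : act n%:R x = x *+ n.
Proof. by rewrite act_muln ?act1 //; apply: order1 hO. Qed.

Lemma act_inj a c : O a -> O c -> (forall x, act a x = act c x) -> a = c.
Proof.
move=> Oa Oc h; case: hcm => _ _ _ inj _; apply: inj => // u Xu.
by have := congr1 val (h (inG hA u)); rewrite !val_act // inGK.
Qed.

Lemma act_frob a x : O a -> act a (frobG x) = frobG (act a x).
Proof.
move=> Oa; apply/val_inj; rewrite val_act // !(val_frobG hq hAF) val_act //.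
case: hcm => h _ _ _ _; have [mi _] := h a Oa.
by apply: (frobenius_morph hq fA _ mi); [exact: (ag_clo hA).1|exact: ptsG].
Qed.

Lemma endomorphism_act f : homomorphism_over (Fq k q) A A f ->
  exists2 a, O a & forall x, act a x = inG hA (f (val x)).
Proof.
case: hcm => _ _ _ _ h /h [a Oa ea]; exists a => // x.
by rewrite /act -ea //; apply: ptsG.
Qed.

(** Commuting with Frobenius supplies the descent to the finite field that membership in [O]
    requires. *)
Lemma descended_act (F : GA -> GA) : {morph F : x z / x + z} ->
  morph X X (fun u => val (F (inG hA u))) -> (forall x, F (frobG x) = frobG (F x)) ->
  exists2 a, O a & forall x, act a x = F x.
Proof.
move=> aF mF fF; have [[cA _] _ _ _ _] := hAF.
have [|a Oa ea] := @endomorphism_act (fun u => val (F (inG hA u))).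
  split; last by move=> u v Xu Xv; rewrite inGD // aF valD.
  apply: (frobenius_descent hq q1 halg cA mF) => u Xu.
  rewrite (inG_frobenius q hA Xu).
  by rewrite fF (val_frobG hq hAF).
by exists a => // x; rewrite ea !valGK.
Qed.

Lemma frob_act : exists2 pi, O pi & forall x, act pi x = frobG x.
Proof.
apply: descended_act => // [x z|]; first exact: (frobGD hq hAF).
have mf := morph_frobenius (ag_clo hA).1 fA.
by apply: morph_ext mf => u Xu; rewrite (val_frobG hq hAF) inGK.
Qed.

Lemma lamG_frob x : lamG (frobG x) = inG hB (frobenius q (val (lamG x))).
Proof.
apply/val_inj; rewrite [in RHS]inGK; last by apply: fB; apply: ptsG.
rewrite !(val_lamG hB hpol) (val_frobG hq hAF).
by apply: (frobenius_morph hq fA (ag_clo hB).1 lamF.1); apply: ptsG.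
Qed.

(** The dual homomorphism transported by [lam]; it is additive because classes are unique. *)
Lemma adjoint_exists a : O a -> exists F : GA -> GA, [/\ {morph F : x z / x + z},
  morph X X (fun u => val (F (inG hA u))) &
  forall x, cls (fun u v => Pf (val (lamG x)) (iota a u) (iota a v)) (val (lamG (F x)))].
Proof.
move=> Oa; have ha := iota_hom Oa; have [phi mphi hphi] := dual_hom hA hB hD ha.
have [mu [mmu muK lmu]] := pol_inv hpol; have [ml al] := pol_hom hpol.
pose F x : GA := inG hA (mu (phi (lam (val x)))).
have Yl x : Y (lam (val x)) by apply: ml.1; apply: ptsG.
have lF x : val (lamG (F x)) = phi (lam (val x)).
  rewrite (val_lamG hB hpol) inGK; first by rewrite lmu //; apply: mphi.1.
  by apply: mmu.1; apply: mphi.1.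
have hF x : cls (fun u v => Pf (val (lamG x)) (iota a u) (iota a v)) (val (lamG (F x))).
  by rewrite lF (val_lamG hB hpol); apply: hphi.
exists F; split=> // [x z|]; last first.
  apply: morph_ext (morph_comp ml (morph_comp mphi mmu)) => u Xu.
  by rewrite /F !inGK //; apply: mmu.1; apply: mphi.1; apply: ml.1.
have [g gK _] := lamG_bij hA hB hpol; apply: (can_inj gK); rewrite (lamG_add hB hpol).
have pN t := pic0_pull ha (PfG_pic0 hD (lamG t)).
apply: (cls_inj hA hD (pN (x + z)) (hF _)).
have := cls_mul hA hD hpol (pN x).1 (pN z).1 (hF x) (hF z).
apply: (cls_equiv _ (pN (x + z)).1 (cohM (pN x).1 (pN z).1)); first exact: ptsG.
have := triv_pull ha.1 (Pf_add hA hD hpol (lamG x) (lamG z)).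
by rewrite -(lamG_add hB hpol) => /trivV; apply: triv_ext => u v _ _; rewrite invf_div.
Qed.

(** [F] is the Rosati adjoint of [a], on points. *)
Definition adjoint a (F : GA -> GA) : Prop := forall x,
  cls (fun u v => Pf (val (lamG x)) (iota a u) (iota a v)) (val (lamG (F x))).

Let lam_inj x z : lamG x = lamG z -> x = z.
Proof. by have [g gK _] := lamG_bij hA hB hpol; apply: (can_inj gK). Qed.

Let pa a t : O a -> pic0 A (fun u v => Pf (val (lamG t)) (iota a u) (iota a v)).
Proof. by move=> Oa; apply: (pic0_pull (iota_hom Oa) (PfG_pic0 hD (lamG t))). Qed.

Lemma iota_act a u : X u -> iota a u = iota a (val (inG hA u)).
Proof. by move=> Xu; rewrite inGK. Qed.

Lemma adjoint_comp a c F G : O a -> O c -> adjoint a F -> adjoint c G ->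
  adjoint (a * c) (fun x => G (F x)).
Proof.
move=> Oa Oc hF hG x; have hc := iota_hom Oc.
have t := triv_pull hc.1 (hF x).
have e u : X u -> iota (a * c) u = iota a (iota c u).
  by case: hcm => _ _ h _ _ Xu; case: (h a c u).
have h := cls_equiv (ptsG _) (coh_pull hc.1 (pa x Oa).1) (pa (F x) Oc).1 t (hG (F x)).
by apply: triv_ext h => u v Xu Xv; rewrite !e.
Qed.

Lemma adjoint_unique a F G : O a -> adjoint a F -> adjoint a G -> F =1 G.
Proof.
by move=> Oa hF hG x; apply: lam_inj; apply: (cls_inj hA hD (pa x Oa) (hF x) (hG x)).
Qed.

(** The adjoint of Frobenius is the Verschiebung: by [frobenius_class], pulling the class of
    [frobG x] back by Frobenius gives the [q]-th power of that of [x]. *)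
Lemma frob_adjoint pi F x : O pi -> (forall z, act pi z = frobG z) -> adjoint pi F ->
  F (frobG x) = x *+ q.
Proof.
move=> Opi epi hF; apply: lam_inj; rewrite (lamG_muln hB hpol).
have ei u : X u -> iota pi u = frobenius q u.
  by move=> Xu; rewrite iota_act // -val_act // epi (val_frobG hq hAF) inGK.
set y := lamG x; have cP := PfG_coh hD y.
have hy : val (lamG (frobG x)) = frobenius q (val y).
  by rewrite lamG_frob inGK //; apply: fB; apply: ptsG.
have t := trivV (frobenius_class (ptsG y)).
apply: (cls_inj hA hD (pa (frobG x) Opi) (hF _)).
have h := cls_Xn hA hD hpol q cP (cls_Pf hD y).
apply: (cls_equiv (ptsG _) (pa (frobG x) Opi).1 (cohXn q cP) _ h).
apply: triv_ext t => u v Xu Xv.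
by rewrite invf_div !ei // hy.
Qed.

Lemma frobG_surj x : exists z, x = frobG z.
Proof.
have [[|m] // _ em] := rational_level hq hAF halg x.
by exists (iter m frobG x); rewrite -{1}em.
Qed.

(** [F] commutes with the adjoint [Fp] of Frobenius, and the composite of [Fp] with Frobenius is
    multiplication by [q]; as the latter is onto, it can be cancelled. *)
Lemma adjoint_frob a F x : O a -> {morph F : x z / x + z} -> adjoint a F ->
  F (frobG x) = frobG (F x).
Proof.
move=> Oa aF hF; have [pi Opi epi] := frob_act.
have [Fp [_ _ hFp]] := adjoint_exists Opi.
have FpK z : Fp (frobG z) = z *+ q := frob_adjoint z Opi epi hFp.
have Kfp z : frobG (Fp z) = z *+ q.
  by have [w ->] := frobG_surj z; rewrite FpK (frobG_Mn hq hAF).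
have com z : F (Fp z) = Fp (F z).
  have h1 := adjoint_comp Oa Opi hF hFp; have h2 := adjoint_comp Opi Oa hFp hF.
  rewrite mulrC in h1.
  by rewrite (adjoint_unique (orderM hO Opi Oa) h2 h1).
have FM z m : F (z *+ m) = F z *+ m.
  elim: m => [|m IH]; last by rewrite !mulrS aF IH.
  by apply: (addrI (F 0)); rewrite -aF !mulr0n !addr0.
have h z : F (frobG z) *+ q = frobG (F z) *+ q.
  by rewrite -Kfp -com FpK FM (frobG_Mn hq hAF).
have [z ->] := hdiv x q1.
by rewrite (frobG_Mn hq hAF) !FM h (frobG_Mn hq hAF).
Qed.

Lemma rosati_exists a : exists a', O a -> O a' /\ adjoint a (act a').
Proof.
have [Oa|] := classic (O a); last by exists 0.
have [F [aF mF hF]] := adjoint_exists Oa.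
have [a' Oa' ea] := descended_act aF mF (fun x => adjoint_frob x Oa aF hF).
by exists a' => _; split=> // x; rewrite ea.
Qed.

(** The adjoint reverses products, but [K] is commutative, so [sg] is multiplicative. *)
Theorem rosati_involution : exists sg : K -> K, [/\ forall a, O a -> O (sg a),
  sg 1 = 1, forall a c, O a -> O c -> sg (a + c) = sg a + sg c /\ sg (a * c) = sg a * sg c,
  forall a m t t', O a -> t *+ m = 0 -> t' *+ m = 0 ->
    we m (act a t) (lamG t') = we m t (lamG (act (sg a) t')) &
  forall pi, O pi -> (forall x, act pi x = frobG x) -> sg pi * pi = q%:R].
Proof.
have /fchoice [sg hsg] := rosati_exists.
have Os a : O a -> O (sg a) by move=> /hsg [].
have As a : O a -> adjoint a (act (sg a)) by move=> /hsg [].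
have uniq_ a c : O a -> O c -> adjoint a (act c) -> sg a = c.
  move=> Oa Oc h; apply: (act_inj (Os a Oa) Oc); exact: (adjoint_unique Oa (As a Oa) h).
exists sg; split=> //.
- apply: uniq_; try exact: (order1 hO); move=> x; rewrite act1.
  apply: triv_ext (cls_Pf hD (lamG x)) => u v Xu Xv.
  by case: hcm => _ h1 _ _ _; rewrite !h1.
- move=> a c Oa Oc; split; apply: uniq_; try exact: (orderD hO); try exact: (orderM hO);
    try (by apply: (orderD hO); apply: Os); try (by apply: (orderM hO); apply: Os); move=> x.
    rewrite act_add ?(lamG_add hB hpol); [|exact: Os|exact: Os].
    have h := cls_mul hA hD hpol (pa x Oa).1 (pa x Oc).1 (As a Oa x) (As c Oc x).
    apply: (cls_equiv (ptsG _) (pa x (orderD hO Oa Oc)).1 (cohM (pa x Oa).1 (pa x Oc).1) _ h).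
    have ha := iota_hom Oa; have hc := iota_hom Oc.
    have t := trivV (pic0_add hA hB hD (PfG_pic0 hD (lamG x)) ha.1 hc.1).
    apply: triv_ext t => u v Xu Xv; rewrite invf_div.
    by case: hcm => _ _ h1 _ _; have [-> _] := h1 a c u Oa Oc Xu; have [-> _] := h1 a c v Oa Oc Xv.
  rewrite [sg a * _]mulrC act_mul; [|exact: Os|exact: Os].
  exact: (adjoint_comp Oa Oc (As a Oa) (As c Oc) x).
- move=> a m t t' Oa tm tm'; have ym : lamG t' *+ m = 0.
    by rewrite -(lamG_muln hB hpol) tm' (lamG0 hA hB hpol).
  have ym' : lamG (act (sg a) t') *+ m = 0.
    by rewrite -(lamG_muln hB hpol) -actMn ?tm' ?act0 ?(lamG0 hA hB hpol) //; apply: Os.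
  exact: (we_adjoint hD hpol (iota_hom Oa) (As a Oa t') tm ym ym').
move=> pi Opi epi; apply: act_inj; first by apply: (orderM hO) => //; apply: Os.
  exact: (order_nat hO).
move=> x; rewrite act_mul ?act_nat //; last exact: Os.
by rewrite epi (frob_adjoint x Opi epi (As pi Opi)).
Qed.

(** Dividing [a] by [m] on points succeeds up to a factor [pi ^ n]. Multiplying by [sg pi ^ n]
    replaces this factor by [q ^ n], which is prime to [m]. *)
Theorem kills_torsion m a : (1 < m)%N -> coprime m q -> O a ->
  (forall x, x *+ m = 0 -> act a x = 0) -> exists2 c, O c & a = c *+ m.
Proof.
move=> m1 cmq Oa ha.
have [sg [Os _ _ _ hpi]] := rosati_involution; have [pi Opi epi] := frob_act.
have mact : morph X X (fun u => val (act a (inG hA u))).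
  apply: morph_ext (iota_hom Oa).1 => u Xu; by rewrite val_act // inGK.
have [n [f [hf ef]]] := quotient_endomorphism hq q1 hAF halg (fun x => hdiv x m1) mact
  (actD Oa) ha (fun x => act_frob x Oa).
have [dl Odl edl] := endomorphism_act hf.
have e1 : pi ^+ n * a = dl *+ m.
  apply: act_inj; [by apply: (orderM hO) => //; apply: (orderXn hO)|exact: (orderMn hO)|].
  move=> x; rewrite act_muln // edl -ef act_mul //; last exact: (orderXn hO).
  elim: n {ef} => [|n IH]; first by rewrite expr0 act1.
  by rewrite exprS act_mul //= -?IH ?epi //; apply: (orderXn hO).
have e2 : a *+ (q ^ n) = (sg pi ^+ n * dl) *+ m.
  rewrite -mulrnAr -e1 mulrA -exprMn hpi // -natrX.
  by rewrite mulr_natl.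
have [u v e _] := egcdnP (q ^ n) (ltnW m1); rewrite (eqP (coprimeXr n cmq)) in e.
exists (a *+ u - (sg pi ^+ n * dl) *+ v).
  by apply: (orderB hO); apply: (orderMn hO) => //; apply: (orderM hO) => //;
    apply: (orderXn hO); apply: Os.
rewrite mulrnBl -!mulrnA e [(v * m)%N]mulnC [in X in _ - X]mulrnA -e2 -mulrnA.
by rewrite mulnC mulrnDr addrC addKr.
Qed.

End Rosati.

(** * Local structure of the ideal torsion *)

Section Field.

Variable K : fieldExtType rat.

(** On generators of [O], multiplication by [x] is an integral matrix with [x] as an eigenvalue. *)
Lemma order_integral (O : K -> Prop) x : is_order O -> O x -> integralOver (intr : int -> K) x.
Proof.
move=> hO Ox; have [O1 hBM [s hs] _] := hO.
have Os (i : 'I_(size s)) : O s`_i.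
  apply/hs; exists (fun j => (j == i :> nat)%:R); rewrite (bigD1 i) //= eqxx mulr1z big1 ?addr0 //.
  by move=> j nji; rewrite val_eqE (negPf nji) mulr0z.
have /fchoice [c hc] : forall i : 'I_(size s), exists c : nat -> int,
    x * s`_i = \sum_(j < size s) s`_j *~ c j.
  by move=> i; apply/hs; apply: (hBM x s`_i Ox (Os i)).2.
pose C : 'M[int]_(size s) := \matrix_(j, i) c i j.
exists (char_poly C); first exact: char_poly_monic.
rewrite -[map_poly _ _]/(map_poly intr (char_poly C)) map_char_poly -eigenvalue_root_char.
apply/eigenvalueP; exists (\row_j s`_j).
  apply/rowP=> i; rewrite !mxE hc; apply: eq_bigr => j _.
  by rewrite !mxE mulrzr.
apply/eqP=> /rowP v0; have /hs [c1 e1] := O1.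
have : (1 : K) = 0.
  by rewrite e1 big1 // => i _; have := v0 i; rewrite !mxE => ->; rewrite mul0rz.
by move/eqP; rewrite oner_eq0.
Qed.

Section Extension.

Variables (O : K -> Prop) (sg : K -> K).
Hypotheses (hO : is_order O) (sg1 : sg 1 = 1).
Hypothesis sgDM : forall a c, O a -> O c -> sg (a + c) = sg a + sg c /\ sg (a * c) = sg a * sg c.

Lemma extend_order_morphism : exists h : {rmorphism K -> K}, forall x, O x -> h x = sg x.
Proof.
have [_ _ _ hN] := hO.
have /fchoice [N hN'] : forall x, exists N : nat, (0 < N)%N /\ O (x *+ N).
  by move=> x; have [N N0 ON] := hN x; exists N.
have sgMn a n : O a -> sg (a *+ n) = sg a *+ n.
  move=> Oa; elim: n => [|n IH].
    have := (sgDM (order0 hO) (order0 hO)).1; rewrite addr0 => /eqP.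
    by rewrite -subr_eq0 opprD addrA subrr sub0r oppr_eq0 => /eqP.
  by rewrite !mulrS (sgDM Oa (orderMn hO n Oa)).1 IH.
pose h x := sg (x *+ N x) / (N x)%:R.
have Kn n : (0 < n)%N -> n%:R != 0 :> K.
  by move=> n0; rewrite -(rmorph_nat (in_alg K)) fmorph_eq0 pnatr_eq0 -lt0n.
have hE x n : (0 < n)%N -> O (x *+ n) -> h x = sg (x *+ n) / n%:R.
  move=> n0 On; have [N0 ON] := hN' x.
  apply/eqP; rewrite /h eqr_div ?Kn // !mulr_natr -!sgMn // -!mulrnA.
  by rewrite mulnC.
have hD : {morph h : x y / x + y}.
  move=> x y; have [N0 ON] := hN' x; have [M0 OM] := hN' y.
  have NM : (0 < N x * N y)%N by rewrite muln_gt0 N0.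
  have Ox : O (x *+ (N x * N y)) by rewrite mulrnA; apply: orderMn.
  have Oy : O (y *+ (N x * N y)) by rewrite mulnC mulrnA; apply: orderMn.
  rewrite !(hE _ (N x * N y)%N) ?mulrnDl //; last exact: orderD.
  by rewrite (sgDM Ox Oy).1 mulrDl.
have hM x y : h (x * y) = h x * h y.
  have [N0 ON] := hN' x; have [M0 OM] := hN' y.
  have NM : (0 < N x * N y)%N by rewrite muln_gt0 N0.
  have e : (x * y) *+ (N x * N y) = (x *+ N x) * (y *+ N y).
    by rewrite mulrnAr mulrnAl -mulrnA.
  rewrite (hE _ (N x * N y)%N) // e; last exact: orderM.
  by rewrite (sgDM ON OM).2 natrM invfM mulrACA.
have h1 : h 1 = 1 by rewrite (hE _ 1%N) ?mulr1n ?sg1 ?divr1 //; apply: order1.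
have hB : zmod_morphism h.
  by move=> x y; apply: (addIr (h y)); rewrite -hD !subrK.
pose m1 := GRing.isZmodMorphism.Build K K h hB.
pose m2 := GRing.isMonoidMorphism.Build K K h (conj h1 hM).
pose hh : {rmorphism K -> K} := HB.pack h m1 m2.
by exists hh => x Ox; rewrite -[LHS]/(h x) (hE _ 1%N) ?mulr1n ?divr1.
Qed.

End Extension.

Section Involution.

Variables (K0 : {subfield K}) (sg : {rmorphism K -> K}) (theta : K).
Hypotheses (hK : quartic_CM K0) (hprim : primitive_field K).
Hypotheses (ntheta : theta \notin K0) (sg2 : sg (sg theta) = theta).

Let two0 : (2%:R : K) != 0.
Proof. by rewrite -(rmorph_nat (in_alg K)) fmorph_eq0. Qed.

(** Completing the square in a quadratic equation over the rationals. *)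
Lemma quadratic_generator (E : {subfield K}) : \dim E = 2 -> exists c D,
  [/\ c \in E, c ^+ 2 = D%:A, c \notin (1%VS : {vspace K}) &
    forall x, x \in E -> exists u v : rat, x = u%:A + v%:A * c].
Proof.
move=> dE.
have [x xE x1] : exists2 x, x \in E & x \notin (1%VS : {vspace K}).
  apply/subvPn; apply/negP => /dimvS; by rewrite dE dimv1.
have sp y : y \in E -> exists u v : rat, y = u%:A + v%:A * x.
  have sE : (1 + <[x]> <= E)%VS.
    by rewrite subv_add sub1v -memvE.
  have x0 : x != 0 by apply: contraNneq x1 => ->; apply: mem0v.
  have d2 : \dim (1 + <[x]>)%VS = 2.
    rewrite dimv_disjoint_sum ?dimv1 ?dim_vline ?x0 //.
    apply/eqP; rewrite -subv0; apply/subvP => z; rewrite memv_cap => /andP [z1 /vlineP [t ez]].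
    rewrite memv0; apply/negPn/negP => z0.
    have t0 : t != 0 by apply: contraNneq z0 => t0; rewrite ez t0 scale0r.
    move: x1; apply/negP; rewrite negbK.
    have -> : x = t^-1 *: z by rewrite ez scalerA mulVf // scale1r.
    exact: memvZ.
  have -> : (E : {vspace K}) = (1 + <[x]>)%VS.
    by apply/eqP; rewrite eq_sym eqEdim sE dE d2.
  move=> /memv_addP [z /vlineP [u ->] [w /vlineP [v ->] ->]].
  by exists u, v; rewrite mulr_algl.
have [u [v e]] : exists u v : rat, x ^+ 2 = u%:A + v%:A * x by apply: sp; rewrite rpredX.
set w : rat := v / 2%:R; have ev : v = w + w by rewrite /w; field.
have wE : w%:A \in E by apply: (subvP (sub1v E)); apply: rpredZ; apply: mem1v.
exists (x - w%:A), (u + w ^+ 2); split.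
- exact: rpredB.
- have -> : ((u + w ^+ 2)%:A : K) = u%:A + w%:A ^+ 2.
    by rewrite scalerDl -[(w ^+ 2)%:A]/(in_alg K (w ^+ 2)) rmorphXn.
  rewrite sqrrB e ev scalerDl -mulr_natr; ring.
- apply: contraNN x1 => xw; rewrite -(subrK w%:A x); apply: rpredD => //.
  by apply: rpredZ; apply: mem1v.
move=> y /sp [u' [v' ->]]; exists (u' + v' * w), v'.
have -> : ((u' + v' * w)%:A : K) = u'%:A + v'%:A * w%:A.
  by rewrite scalerDl -[(v' * w)%:A]/(in_alg K (v' * w)) rmorphM.
ring.
Qed.

Lemma sg_scalar u : sg u%:A = u%:A.
Proof. by rewrite rmorphZ_num rmorph1 mulr1 alg_num_field. Qed.

Lemma real_sqrt (D : rat) : 0 < D -> exists2 r : algC, r ^+ 2 = ratr D & r \is Num.real.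
Proof.
move=> D0; exists (sqrtC (ratr D)); first exact: sqrtCK.
by apply: ger0_real; rewrite sqrtC_ge0 ler0q ltW.
Qed.

Lemma totally_real_square_pos c D : totally_real K0 -> c \in K0 -> c ^+ 2 = D%:A ->
  c \notin (1%VS : {vspace K}) -> (0 < D)%R.
Proof.
have [_ d2 _ _] := hK => tr cK0 c2 c1.
rewrite ltNge; apply/negP => D0; apply: hprim; exists K0; split=> // s.
exists (vsproj K0 c); apply/negP => rc.
have e : s (vsproj K0 c) ^+ 2 = ratr D.
  rewrite -rmorphXn; have -> : vsproj K0 c ^+ 2 = D%:A.
    by apply: val_inj; rewrite /= vsprojK // -expr2 c2 algid1.
  by rewrite rmorphZ_num rmorph1 mulr1.
have : 0 <= s (vsproj K0 c) ^+ 2 by rewrite -realEsqr.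
rewrite e ler0q => D1; have D0' : D = 0 by apply/eqP; rewrite eq_le D0.
move: c1; have -> : c = 0.
  by apply/eqP; rewrite -[_ == 0](expf_eq0 c 2) c2 D0' scale0r.
by rewrite mem0v.
Qed.

Lemma quadratic_decomposition (E : {subfield K}) c : \dim E = 2 -> c \notin E ->
  forall x, exists u v, [/\ u \in E, v \in E & x = u + v * c].
Proof.
have [d4 _ _ _] := hK => dE cE x.
have c0 : c != 0 by apply: contraNneq cE => ->; apply: mem0v.
have cap0 : (E :&: E * <[c]> = 0)%VS.
  apply/eqP; rewrite -subv0; apply/subvP => z; rewrite memv_cap => /andP [zE /memv_cosetP [v vE ez]].
  rewrite memv0; apply: contraNT cE => z0.
  have v0 : v != 0 by apply: contraNneq z0 => v0; rewrite ez v0 mul0r.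
  by rewrite -[c](mulKf v0) -ez rpredM ?rpredV.
have full : (E + E * <[c]> = fullv)%VS.
  apply/eqP; rewrite eqEdim subvf dimv_disjoint_sum // dim_cosetv_unit ?unitfE //.
  by rewrite dE d4.
have : x \in (E + E * <[c]>)%VS by rewrite full memvf.
by move=> /memv_addP [u uE [w /memv_cosetP [v vE ->] ->]]; exists u, v.
Qed.

Lemma fixed_subfield : exists E : {subfield K}, forall x, x \in E <-> sg x = x.
Proof.
pose m1 := GRing.isScalable.Build rat K K *:%R sg (fmorph_numZ sg).
pose f : {lrmorphism K -> K} := HB.pack (sg : K -> K) m1 (GRing.RMorphism.class sg).
exists (fixedSpace_aspace (linfun_ahom f)) => x.
have e : linfun f x = sg x by rewrite lfunE.
split=> [/fixedSpaceP h|h]; first exact: etrans (esym e) h.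
by apply/fixedSpaceP; apply: etrans e h.
Qed.

(** [sg] acts by a sign on the square root [c] that generates [K0]. With the sign minus, its fixed
    field [E] is quadratic and, by primitivity, not imaginary, so [E] has a real embedding. Sending
    [c] to a real square root of [D] extends it to a real embedding of [K], which has none. *)
Theorem involution_fixes : forall x, x \in K0 -> sg x = x.
Proof.
have [d4 d2 tr ti] := hK.
have [c [D [cK0 c2 c1 hc]]] := quadratic_generator d2.
have fixc : sg c = c -> forall x, x \in K0 -> sg x = x.
  by move=> ec x /hc [u [v ->]]; rewrite rmorphD rmorphM !sg_scalar ec.
have : (sg c - c) * (sg c + c) = 0.
  by rewrite -subr_sqr -rmorphXn c2 sg_scalar subrr.
move/eqP; rewrite mulf_eq0 subr_eq0 addr_eq0 => /orP [/eqP/fixc //|/eqP sc].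
exfalso; have c0 : c != 0 by apply: contraNneq c1 => ->; apply: mem0v.
have D0 := totally_real_square_pos tr cK0 c2 c1.
have [r r2 rr] := real_sqrt D0.
(* Involutivity is given at [theta] only, but [theta] and [c] generate [K]. *)
have inv x : sg (sg x) = x.
  have [u [v [uK vK ->]]] := quadratic_decomposition d2 ntheta x.
  have sK w : w \in K0 -> sg (sg w) = w.
    by move=> /hc [a [a' ->]]; rewrite !(rmorphD, rmorphM, sg_scalar) sc rmorphN sc opprK.
  by rewrite !rmorphD !rmorphM sg2 !sK.
have [E hE] := fixed_subfield.
have cE : c \notin E.
  apply/negP => /hE; rewrite sc => /eqP; rewrite eq_sym -subr_eq0 opprK -mulr2n -mulr_natl.
  by rewrite mulf_eq0 (negPf two0) (negPf c0).
(* The components of [x] in the eigenspaces [E] and [E c] of [sg]. *)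
pose pp x := (x + sg x) / 2%:R; pose mm x := (x - sg x) / (2%:R * c).
have ppE x : pp x \in E.
  by apply/hE; rewrite /pp fmorph_div rmorphD inv rmorph_nat addrC.
have mmE x : mm x \in E.
  apply/hE; rewrite /mm fmorph_div rmorphB inv rmorphM rmorph_nat sc.
  by field; rewrite oppr_eq0 c0 two0.
have pm x : x = pp x + mm x * c by rewrite /pp /mm; field; rewrite c0 two0.
have dE : \dim E = 2.
  have cap0 : (E :&: E * <[c]> = 0)%VS.
    apply/eqP; rewrite -subv0; apply/subvP => z.
    rewrite memv_cap => /andP [zE /memv_cosetP [v vE ez]].
    rewrite memv0; apply: contraNT cE => z0.
    have v0 : v != 0 by apply: contraNneq z0 => v0; rewrite ez v0 mul0r.
    by rewrite -[c](mulKf v0) -ez rpredM ?rpredV.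
  have full : (E + E * <[c]> = fullv)%VS.
    apply/eqP; rewrite eqEsubv subvf /=; apply/subvP => x _; rewrite [x]pm.
    by apply: memv_add => //; apply/memv_cosetP; exists (mm x).
  have := dimv_disjoint_sum cap0.
  rewrite full d4 dim_cosetv_unit ?unitfE //; lia.
have [s hs] : exists s : embeddings E, forall x : subvs_of E, s x \is Num.real.
  apply: NNPP => no; apply: hprim; exists E; split=> // s; apply: NNPP => nx.
  by apply: no; exists s => x; apply/negP => rx; apply: nx; exists x; apply/negP.
pose p x := s (vsproj E (pp x)); pose m x := s (vsproj E (mm x)).
have sM x y : x \in E -> y \in E -> s (vsproj E (x * y)) = s (vsproj E x) * s (vsproj E y).
  move=> xE yE; rewrite -[RHS]rmorphM; congr (s _); apply: val_inj.
  by rewrite /= !vsprojK // rpredM.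
have sD x : s (vsproj E (x * D%:A)) = s (vsproj E x) * r ^+ 2.
  by rewrite r2 mulrC mulr_algl linearZ /= rmorphZ_num mulrC.
pose t (x : subvs_of {:K}%AS) := p (vsval x) + m (vsval x) * r.
have ppM x y : pp (x * y) = pp x * pp y + mm x * mm y * D%:A.
  by rewrite -c2 /pp /mm rmorphM; field; rewrite c0 two0.
have mmM x y : mm (x * y) = pp x * mm y + mm x * pp y.
  by rewrite /pp /mm rmorphM; field; rewrite c0 two0.
have tM : {morph t : x y / x * y}.
  move=> x y; rewrite /t /p /m /= ppM mmM !linearD !rmorphD /= sD.
  rewrite (sM _ _ (ppE _) (ppE _)) (sM _ _ (mmE _) (mmE _)) (sM _ _ (ppE _) (mmE _)).
  by rewrite (sM _ _ (mmE _) (ppE _)); ring.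
have tB : zmod_morphism t.
  move=> x y; have pB u v : pp (u - v) = pp u - pp v by rewrite /pp rmorphB; field; rewrite two0.
  have mB u v : mm (u - v) = mm u - mm v by rewrite /mm rmorphB; field; rewrite c0 two0.
  rewrite /t /p /m /= pB mB !linearB !rmorphB /=; ring.
have t1 : t 1 = 1.
  have p1 : pp 1 = 1 by rewrite /pp rmorph1; field; rewrite two0.
  have m1 : mm 1 = 0 by rewrite /mm rmorph1 subrr mul0r.
  rewrite /t /p /m /= algid1 p1 m1 linear0 rmorph0 mul0r addr0.
  have -> : vsproj E 1 = 1 by apply: val_inj; rewrite /= vsprojK ?rpred1 // algid1.
  exact: rmorph1.
pose b1 := GRing.isZmodMorphism.Build _ _ t tB.
pose b2 := GRing.isMonoidMorphism.Build _ _ t (conj t1 tM).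
pose tt : embeddings {:K}%AS := HB.pack t b1 b2.
have [x /negP] := ti tt; apply.
by apply: rpredD; [apply: hs|apply: rpredM => //; apply: hs].
Qed.

End Involution.

End Field.

(** * Splitting of [ell] in the real quadratic field *)

Section Arithmetic.

Variables (K : fieldExtType rat) (K0 : {subfield K}).
Local Notation R0 := (ring_of_integers K0).
Local Notation dv := (principal_ideal R0).

Lemma ri_nat n : R0 n%:R.
Proof. by split; [apply: rpred_nat|apply: integral_nat]. Qed.

Lemma riB x y : R0 x -> R0 y -> R0 (x - y).
Proof. by move=> [xK ix] [yK iy]; split; [apply: rpredB|apply: integral_sub]. Qed.

Lemma riM x y : R0 x -> R0 y -> R0 (x * y).
Proof. by move=> [xK ix] [yK iy]; split; [apply: rpredM|apply: integral_mul]. Qed.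

Lemma riD x y : R0 x -> R0 y -> R0 (x + y).
Proof. by move=> [xK ix] [yK iy]; split; [apply: rpredD|apply: integral_add]. Qed.

Lemma ri1 : R0 1. Proof. exact: (ri_nat 1). Qed.
Lemma ri0 : R0 0. Proof. exact: (ri_nat 0). Qed.

Lemma riXn x n : R0 x -> R0 (x ^+ n).
Proof. by move=> hx; elim: n => [|n IH]; [apply: ri1|rewrite exprS; apply: riM]. Qed.

Lemma riMn x n : R0 x -> R0 (x *+ n).
Proof. by move=> hx; rewrite -mulr_natl; apply: riM => //; apply: ri_nat. Qed.

Lemma dvD a x y : dv a x -> dv a y -> dv a (x + y).
Proof. by move=> [u hu ->] [v hv ->]; exists (u + v); rewrite ?mulrDr //; apply: riD. Qed.

Lemma dvB a x y : dv a x -> dv a y -> dv a (x - y).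
Proof. by move=> [u hu ->] [v hv ->]; exists (u - v); rewrite ?mulrBr //; apply: riB. Qed.

Lemma dvM a x y : R0 y -> dv a x -> dv a (x * y).
Proof. by move=> hy [u hu ->]; exists (u * y); rewrite ?mulrA //; apply: riM. Qed.

Lemma dv_self a x : R0 x -> dv a (a * x). Proof. by move=> hx; exists x. Qed.

Lemma ideal_powE (I : K -> Prop) a M x : R0 a -> (forall y, I y <-> dv a y) ->
  ideal_pow R0 I M x <-> dv (a ^+ M) x.
Proof.
move=> Ra hI; elim: M x => [|M IH] x /=.
  by rewrite expr0; split=> [hx|[y hy ->]]; [exists x; rewrite ?mul1r|rewrite mul1r].
split=> [[s [hs ->]]|[y hy ->]].
  rewrite big_seq; apply: (big_ind (dv (a ^+ M.+1))) => [|u v|u us].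
  - by exists 0; rewrite ?mulr0 //; apply: ri0.
  - exact: dvD.
  have [/hI [y hy ->] /IH [z hz ->]] := hs u us; exists (y * z); first exact: riM.
  by rewrite exprS; ring.
exists [:: (a, a ^+ M * y)]; split; last by rewrite big_seq1 /= exprS mulrA.
move=> u; rewrite inE => /eqP -> /=; split; last by apply/IH; exists y.
by apply/hI; exists 1; rewrite ?mulr1 //; apply: ri1.
Qed.

Lemma natK0 n : (0 < n)%N -> n%:R != 0 :> K.
Proof. by move=> n0; rewrite -(rmorph_nat (in_alg K)) fmorph_eq0 pnatr_eq0 -lt0n. Qed.

(** Adding [x] permutes the [m] cosets; summing [x + s_i - s_(g i)] over representatives leaves
    [m x]. *)
Lemma rm_index (O : K -> Prop) m : is_order O -> index_is R0 (real_suborder K0 O) m ->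
  forall x, R0 x -> O (x *+ m).
Proof.
move=> hO [s [ss hs ns cs]] x hx.
have O0B u v : real_suborder K0 O u -> real_suborder K0 O v -> real_suborder K0 O (u - v).
  by move=> [Ou uK] [Ov vK]; split; [apply: orderB|apply: rpredB].
have O00 : real_suborder K0 O 0 by split; [apply: order0|apply: mem0v].
have O0D u v : real_suborder K0 O u -> real_suborder K0 O v -> real_suborder K0 O (u + v).
  by move=> Ou Ov; rewrite -[v]opprK; apply: (O0B) => //; rewrite -sub0r; apply: O0B.
have /fchoice [g hg] : forall i : 'I_m, exists j : 'I_m, real_suborder K0 O (x + s`_i - s`_j).
  move=> i; have [|y ys hy] := cs (x + s`_i); first by apply: riD => //; apply: hs; rewrite mem_nth ?ss.
  have lt : (seq.index y s < m)%N by rewrite -ss index_mem.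
  by exists (Ordinal lt); rewrite /= nth_index.
have ig : injective g.
  move=> i j e; have h1 := hg i; have h2 := hg j; rewrite e in h1.
  have h : real_suborder K0 O (s`_i - s`_j).
    by have := O0B _ _ h1 h2; rewrite opprB addrA subrK opprD addrACA subrr add0r.
  apply/val_inj; have [lt|lt|//] := ltngtP i j.
    by case: (ns i j _ h); rewrite lt ltn_ord.
  have h' : real_suborder K0 O (s`_j - s`_i).
    by have := O0B _ _ O00 h; rewrite sub0r opprB.
  by case: (ns j i _ h'); rewrite lt ltn_ord.
have : real_suborder K0 O (\sum_(i < m) (x + s`_i - s`_(g i))).
  by apply: (big_ind (real_suborder K0 O)).
rewrite sumrB big_split /= sumr_const card_ord.
have -> : \sum_(i < m) s`_(g i) = \sum_(i < m) s`_i by rewrite [RHS](reindex_inj ig).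
by rewrite addrK => -[].
Qed.

Section Uniformizers.

Variables (ell : nat) (a b v w : K).
Hypotheses (hell : prime ell) (Ra : R0 a) (Rb : R0 b) (ab : a * b = ell%:R).
Hypotheses (Rv : R0 v) (Rw : R0 w) (vw : v * a + w * b = 1) (na : ~ dv a 1).

Let a0 : a != 0.
Proof.
apply: contra_eq_neq ab => ->; rewrite mul0r eq_sym; apply: natK0; exact: prime_gt0.
Qed.

Lemma coprime_pow M N : exists V W, [/\ R0 V, R0 W & V * a ^+ M + W * b ^+ N = 1].
Proof.
have [V [W [RV RW e]]] : exists V W, [/\ R0 V, R0 W & V * a ^+ M + W * b = 1].
  elim: M => [|M [V [W [RV RW e]]]].
    by exists 1, 0; split; [exact: ri1|exact: ri0|rewrite mul1r mul0r addr0].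
  exists (V * v), (V * a ^+ M * w + W); split; [exact: riM| |].
    by apply: riD => //; apply: riM => //; apply: riM => //; apply: riXn.
  rewrite -[RHS]e -[V in RHS]mulr1 -vw exprS; ring.
elim: N => [|N [V' [W' [RV' RW' e']]]].
  by exists 0, 1; split; [exact: ri0|exact: ri1|rewrite mul1r mul0r add0r].
exists (W' * b ^+ N * V + V'), (W' * W); split; [|exact: riM|].
  by apply: riD => //; apply: riM => //; apply: riM => //; apply: riXn.
rewrite -[RHS]e' -[W' in RHS]mulr1 -e exprS; ring.
Qed.

(** As [b] is prime to [a], the [a]-adic valuation of an integer is its [ell]-adic one. *)
Lemma nat_dv M N : dv (a ^+ M) N%:R -> (ell ^ M %| N)%N.
Proof.
elim: M N => [|M IH] N; first by rewrite expn0 dvd1n.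
move=> [y Ry ey]; have [/dvdnP [N' eN]|nd] := boolP (ell %| N)%N; last first.
  case: na; have [s t es _] := egcdnP N (prime_gt0 hell).
  have cp : gcdn ell N = 1%N by apply/eqP; rewrite -/(coprime ell N) prime_coprime.
  rewrite cp in es; have -> : 1 = (s * ell)%:R - (t * N)%:R :> K.
    by rewrite es natrD addrAC subrr add0r.
  apply: dvB; rewrite natrM mulrC; apply: dvM; try exact: ri_nat.
    by rewrite -ab; apply: dv_self.
  by rewrite ey exprS -mulrA; apply: dv_self; apply: riM => //; apply: riXn.
have e : b * N'%:R = a ^+ M * y.
  apply: (mulfI a0); rewrite mulrA ab mulrA -exprS -ey eN natrM; ring.
rewrite eN expnSr dvdn_mul //; apply: IH.
have [V [W [RV RW eV]]] := coprime_pow M 1; rewrite expr1 in eV.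
exists (V * N'%:R + W * y).
  by apply: riD; apply: riM => //; apply: ri_nat.
have e' : W * b * N'%:R = W * (a ^+ M * y) by rewrite -mulrA e.
transitivity ((V * a ^+ M + W * b) * N'%:R); first by rewrite eV mul1r.
by rewrite mulrDl e'; ring.
Qed.

Hypothesis int_mod1 : forall x, R0 x -> exists j : nat, dv a (x - j%:R).

(** Digits in base [ell]: the correction [s * ell ^ M] is determined modulo [a], where [b ^ M] is
    invertible. *)
Lemma int_mod M x : R0 x -> exists j : nat, dv (a ^+ M) (x - j%:R).
Proof.
move=> Rx; elim: M => [|M [j [y Ry ey]]].
  by exists 0%N; rewrite subr0 expr0; exists x; rewrite ?mul1r.
have [V [W [RV RW eV]]] := coprime_pow 1 M; rewrite expr1 in eV.
have [s [z Rz ez]] := int_mod1 (riM Ry RW).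
exists (j + s * ell ^ M)%N; exists (y * V + z * b ^+ M).
  by apply: riD; apply: riM => //; apply: riXn.
rewrite natrD natrM natrX -ab exprMn opprD addrA ey.
transitivity (a ^+ M * (y * (V * a + W * b ^+ M)) - s%:R * (a ^+ M * b ^+ M)).
  by rewrite eV mulr1.
transitivity (a ^+ M * (y * V * a) + a ^+ M * b ^+ M * (y * W - s%:R)); first by ring.
by rewrite ez exprSr; ring.
Qed.

Variables (O : K -> Prop) (m0 : nat).
Hypotheses (hO : is_order O) (m0O : forall x, R0 x -> O (x *+ m0)) (cm0 : coprime m0 ell).

Lemma m0_gt0 : (0 < m0)%N.
Proof.
by case: m0 cm0 => //; rewrite /coprime gcd0n => /eqP e; move: hell; rewrite e.
Qed.

(** Chinese remainders give [W * b ^+ M]. A multiple of [m0] congruent to 1 modulo [ell ^ M] brings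
    it into [O] and keeps both congruences. *)
Lemma projector M : exists u, [/\ O u, u \in K0, dv (b ^+ M) u & dv (a ^+ M) (1 - u)].
Proof.
have [V [W [RV RW e]]] := coprime_pow M M.
have [N t et _] := egcdnP (ell ^ M) m0_gt0; rewrite (eqP (coprimeXr M cm0)) in et.
have Rbm := riXn M Rb; have RWb := riM RW Rbm.
exists (W * b ^+ M *+ m0 *+ N); split.
- by apply: orderMn => //; apply: m0O.
- by case: (riMn N (riMn m0 RWb)).
- by rewrite -mulrnA -mulr_natr [W * _]mulrC -mulrA; apply: dv_self; apply: riM => //; apply: ri_nat.
have -> : W * b ^+ M *+ m0 *+ N = W * b ^+ M * (t%:R * (a ^+ M * b ^+ M) + 1).
  rewrite -mulrnA [(m0 * N)%N]mulnC et -[LHS]mulr_natr natrD natrM natrX -ab exprMn; ring.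
exists (V - W * b ^+ M * t%:R * b ^+ M).
  by apply: riB => //; apply: riM => //; apply: riM => //; apply: ri_nat.
transitivity (V * a ^+ M + W * b ^+ M - W * b ^+ M * (t%:R * (a ^+ M * b ^+ M) + 1)).
  by rewrite e.
ring.
Qed.

Lemma order_ri x : O x -> x \in K0 -> R0 x.
Proof. by move=> Ox xK; split=> //; apply: order_integral Ox. Qed.

End Uniformizers.

Section Split.

Variables (ell : nat) (l1 l2 : K -> Prop).
Hypothesis hell : prime ell.
Hypothesis hsplit : forall x : K, dv ell%:R x <-> ideal_mul l1 l2 x.
Hypothesis hneq : ~ (forall x : K, l1 x <-> l2 x).
Hypothesis hprime : forall l : K -> Prop, l = l1 \/ l = l2 ->
  prime_ideal R0 l /\ index_is R0 l ell.
Hypothesis hgen : forall l : K -> Prop, l = l1 \/ l = l2 -> exists2 a, a \in K0 & forall x, l x <-> dv a x.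

(** The integers below [ell] are pairwise incongruent modulo [l], hence fill its [ell] classes. *)
Lemma prime_residues l : l = l1 \/ l = l2 -> l ell%:R -> forall x, R0 x -> exists j : nat, l (x - j%:R).
Proof.
move=> hl lell x Rx; have [[[sub l0 lD lM] nl1 _] [s [ss hs ns cs]]] := hprime hl.
have lN u : l u -> l (- u).
  move=> lu; rewrite -mulN1r; apply: lM => //.
  by rewrite -sub0r; apply: riB; [exact: ri0|exact: ri1].
have /fchoice [g hg] : forall j : 'I_ell, exists i : 'I_ell, l (j%:R - s`_i).
  move=> j; have [y ys hy] := cs _ (ri_nat j).
  have lt : (seq.index y s < ell)%N by rewrite -ss index_mem.
  by exists (Ordinal lt); rewrite /= nth_index.
have small j : (0 < j < ell)%N -> ~ l j%:R.
  move=> /andP [j0 jl] lj; apply: nl1.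
  have cp : coprime j ell.
    by rewrite coprime_sym prime_coprime // gtnNdvd.
  have [p' t et _] := egcdnP ell j0; rewrite (eqP cp) in et.
  have -> : 1 = p'%:R * j%:R - t%:R * ell%:R :> K.
    by rewrite -!natrM et natrD addrAC subrr add0r.
  by apply: lD; [|apply: lN]; apply: lM => //; apply: ri_nat.
have ig : injective g.
  move=> i j e; have h1 := hg i; have h2 := hg j; rewrite e in h1.
  apply/val_inj; have [lt|lt|//] := ltngtP i j.
    case: (@small (j - i)%N); first by rewrite subn_gt0 lt (leq_ltn_trans (leq_subr _ _)) ?ltn_ord.
    rewrite natrB ?(ltnW lt) //; have := lD _ _ h2 (lN _ h1).
    by rewrite opprB addrA subrK.
  case: (@small (i - j)%N); first by rewrite subn_gt0 lt (leq_ltn_trans (leq_subr _ _)) ?ltn_ord.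
  rewrite natrB ?(ltnW lt) //; have := lD _ _ h1 (lN _ h2).
  by rewrite opprB addrA subrK.
have [y ys hy] := cs x Rx.
have lt : (seq.index y s < ell)%N by rewrite -ss index_mem.
have [h gK Kg] := injF_bij ig; exists (h (Ordinal lt)).
have := lD _ _ hy (lN _ (hg (h (Ordinal lt)))).
by rewrite Kg /= nth_index // opprB addrA subrK.
Qed.

(** The two generators multiply to [ell] up to a unit, which is absorbed into [b] so that
    [a * b = ell] exactly. As the ideals are distinct, [b] is congruent modulo [a] to an integer
    prime to [ell], which can be inverted. *)
Theorem split_uniformizers l : l = l1 \/ l = l2 -> exists a b v w, [/\ [/\ R0 a, R0 b, R0 v & R0 w],
  a * b = ell%:R, v * a + w * b = 1, ~ dv a 1 /\ ~ dv b 1 &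
  (forall x, l x <-> dv a x) /\ forall x, R0 x -> exists j : nat, dv a (x - j%:R)].
Proof.
move=> hl.
have [a1 _ h1] := hgen (or_introl erefl); have [a2 _ h2] := hgen (or_intror erefl).
have [[[s1 z1 D1 M1] n1 p1] _] := hprime (or_introl erefl).
have [[[s2 z2 D2 M2] n2 p2] _] := hprime (or_intror erefl).
have Ra1 : R0 a1 by apply: s1; apply/h1; exists 1; rewrite ?mulr1 //; apply: ri1.
have Ra2 : R0 a2 by apply: s2; apply/h2; exists 1; rewrite ?mulr1 //; apply: ri1.
have l0 : ell%:R != 0 :> K by apply: natK0; apply: prime_gt0.
have [e1 Re1 ee1] : exists2 e1, R0 e1 & ell%:R = a1 * a2 * e1.
  have /hsplit [s [hs ->]] : dv ell%:R ell%:R by exists 1; rewrite ?mulr1 //; apply: ri1.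
  have : dv (a1 * a2) (\sum_(u <- s) u.1 * u.2); last by move=> [y Ry ->]; exists y.
  rewrite big_seq; apply: (big_ind (dv (a1 * a2))) => [|u v|u us].
  - by exists 0; rewrite ?mulr0 //; apply: ri0.
  - exact: dvD.
  have [/h1 [y hy ->] /h2 [z hz ->]] := hs u us; exists (y * z); [exact: riM|ring].
have [e2 Re2 ee2] : exists2 e2, R0 e2 & a1 * a2 = ell%:R * e2.
  suff /hsplit : ideal_mul l1 l2 (a1 * a2) by [].
  exists [:: (a1, a2)]; split; last by rewrite big_seq1.
  move=> u; rewrite inE => /eqP -> /=; split; [apply/h1|apply/h2];
    by exists 1; rewrite ?mulr1 //; apply: ri1.
have ee : e1 * e2 = 1.
  by apply: (mulfI l0); rewrite mulr1 {2}ee1 ee2; ring.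
have key (l' l'' : K -> Prop) c c' : (forall x, l' x <-> dv c x) -> (forall x, l'' x <-> dv c' x) ->
    R0 c -> R0 c' -> ~ l' 1 -> ~ l'' 1 ->
    (forall x y, R0 x -> R0 y -> l'' (x * y) -> l'' x \/ l'' y) ->
    ~ (forall x, l' x <-> l'' x) -> c * c' * e1 = ell%:R ->
    l' ell%:R /\ ~ dv c (c' * e1).
  move=> hc hc' Rc Rc' nc nc' pc' nn ec; split.
    by apply/hc; rewrite -ec -mulrA; apply: dv_self; apply: riM.
  move=> /(dvM Re2); rewrite -mulrA ee mulr1 => -[z Rz ez].
  have [|/hc' [y Ry ey]|/hc' [y Ry ey]] := pc' c z Rc Rz.
  - by apply/hc'; rewrite -ez; exists 1; rewrite ?mulr1 //; apply: ri1.
  - apply: nn => x; rewrite hc hc'; split=> -[t Rt ->].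
      by rewrite ey -mulrA; apply: dv_self; apply: riM.
    by rewrite ez -mulrA; apply: dv_self; apply: riM.
  apply: nc; apply/hc; exists y => //.
  have c'0 : c' != 0 by apply: contra_eq_neq ec => ->; rewrite mulr0 mul0r eq_sym.
  by apply: (mulfI c'0); rewrite mulr1 {1}ez ey; ring.
have fin_ (l' : K -> Prop) c c' : (l' = l1 \/ l' = l2) -> (forall x, l' x <-> dv c x) -> R0 c -> R0 c' ->
    ~ l' 1 -> ~ dv c' 1 -> c * c' * e1 = ell%:R -> l' ell%:R -> ~ dv c (c' * e1) ->
    exists a b v w, [/\ [/\ R0 a, R0 b, R0 v & R0 w],
      a * b = ell%:R, v * a + w * b = 1, ~ dv a 1 /\ ~ dv b 1 &
      (forall x, l' x <-> dv a x) /\ forall x, R0 x -> exists j : nat, dv a (x - j%:R)].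
  move=> hl' hc Rc Rc' nc nc' ec lell nd.
  have im x : R0 x -> exists j : nat, dv c (x - j%:R).
    by move=> Rx; have [j /hc hj] := prime_residues hl' lell Rx; exists j.
  have Rb := riM Rc' Re1; have [j [y Ry ey]] := im _ Rb.
  have nj : ~~ (ell %| j)%N.
    apply/negP => /dvdnP [t et]; apply: nd; rewrite -(subrK j%:R (c' * e1)) ey.
    apply: dvD; first exact: dv_self.
    by rewrite et natrM mulrC; apply: dvM; [exact: ri_nat|apply/hc].
  have j0 : (0 < j)%N by rewrite lt0n; apply: contraNneq nj => ->; rewrite dvdn0.
  have cj : coprime j ell by rewrite coprime_sym prime_coprime.
  have [s t est _] := egcdnP ell j0; rewrite (eqP cj) in est.
  exists c, (c' * e1), (- (s%:R * y + t%:R * (c' * e1))), s%:R; split.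
  - split=> //; last exact: ri_nat.
    rewrite -sub0r; apply: riB; first exact: ri0.
    by apply: riD; apply: riM => //; apply: ri_nat.
  - by rewrite mulrA.
  - have ej : c' * e1 = c * y + j%:R by rewrite -ey subrK.
    have : s%:R * j%:R = t%:R * (c * (c' * e1)) + 1 :> K.
      by rewrite [c * _]mulrA ec -!natrM est natrD.
    rewrite [X in _ + _ * X = _]ej => h; rewrite mulrDr h; ring.
  - split; first by move/hc.
    by move=> [z Rz ez]; apply: nc'; exists (e1 * z); [exact: riM|rewrite ez mulrA].
  by split.
have [la na1] := key l1 l2 a1 a2 h1 h2 Ra1 Ra2 n1 n2 p2 hneq (esym ee1).
have e21 : a2 * a1 * e1 = ell%:R by rewrite [a2 * _]mulrC ee1.
have hneq' : ~ (forall x, l2 x <-> l1 x) by move=> h; apply: hneq => x; rewrite h.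
have [lb nb1] := key l2 l1 a2 a1 h2 h1 Ra2 Ra1 n2 n1 p1 hneq' e21.
have na2 : ~ dv a2 1 by move/h2. have na1' : ~ dv a1 1 by move/h1.
case: (hl) => el; rewrite el.
  by apply: (fin_ l1 a1 a2) => //; left.
by apply: (fin_ l2 a2 a1) => //; right.
Qed.

End Split.

End Arithmetic.

(** * Groups killed by a power of [ell] *)

Section Torsion_combinatorics.

Variables (G : zmodType) (ell : nat).
Hypothesis hell : prime ell.
Implicit Types x y : G.

Lemma mulrn_mod x i : x *+ ell = 0 -> x *+ (i %% ell) = x *+ i.
Proof. by move=> xl; rewrite {2}(divn_eq i ell) mulrnDr mulnC mulrnA xl mul0rn add0r. Qed.

Lemma mulrn_inv x i : x *+ ell = 0 -> ~~ (ell %| i)%N -> exists t, x *+ (i * t) = x.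
Proof.
move=> xl nd; have i0 : (0 < i)%N by rewrite lt0n; apply: contraNneq nd => ->; rewrite dvdn0.
have ci : coprime i ell by rewrite coprime_sym prime_coprime.
have [t s e _] := egcdnP ell i0; rewrite (eqP ci) in e.
by exists t; rewrite mulnC e mulrnDr mulnC mulrnA xl mul0rn add0r.
Qed.

(** The gcd of [c] and [ell ^ M] also kills [x], and it is a smaller power of [ell]. *)
Lemma order_dvd x M c : x *+ (ell ^ M) = 0 -> x *+ c = 0 -> ~~ (ell ^ M %| c)%N ->
  (0 < M)%N /\ x *+ (ell ^ M.-1) = 0.
Proof.
move=> xM xc nd; have lM : (0 < ell ^ M)%N by rewrite expn_gt0 prime_gt0.
have [i iM eg] : exists2 i, (i <= M)%N & gcdn (ell ^ M) c = (ell ^ i)%N.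
  by apply/(dvdn_pfactor _ _ hell); apply: dvdn_gcdl.
have xg : x *+ gcdn (ell ^ M) c = 0.
  have [s t e _] := egcdnP c lM.
  have : x *+ (s * ell ^ M) = x *+ (t * c) + x *+ gcdn (ell ^ M) c by rewrite e mulrnDr.
  by rewrite mulnC mulrnA xM mul0rn mulnC mulrnA xc mul0rn add0r.
have iM' : (i < M)%N.
  rewrite ltn_neqAle iM andbT; apply: contraNneq nd => ei.
  by rewrite -ei -eg dvdn_gcdr.
split; first exact: leq_ltn_trans iM'.
have -> : M.-1 = (i + (M.-1 - i))%N by rewrite subnKC // -ltnS prednK // (leq_ltn_trans _ iM').
by rewrite expnD mulrnA -eg xg mul0rn.
Qed.

(** Finite subspaces over the field with [ell] elements, as lists; [grow] adjoins one generator and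
    multiplies the size by [ell]. *)
Definition sgroup (s : seq G) := [/\ uniq s, 0 \in s,
  forall x y, x \in s -> y \in s -> x - y \in s & forall x, x \in s -> x *+ ell = 0].

Definition grow (s : seq G) x := [seq y + x *+ i | y <- s, i <- iota 0 ell].

Lemma sgroupMn s x i : sgroup s -> x \in s -> x *+ i \in s.
Proof.
move=> [_ s0 sB _] xs; have sD a c : a \in s -> c \in s -> a + c \in s.
  by move=> ha hc; rewrite -[c]opprK; apply: (sB) => //; rewrite -sub0r; apply: sB.
by elim: i => [|i IH]; rewrite ?mulr0n // mulrS; apply: sD.
Qed.

Lemma mem_growP s x z : sgroup s -> x *+ ell = 0 ->
  reflect (exists y i, y \in s /\ z = y + x *+ i) (z \in grow s x).
Proof.
move=> hs xl; apply: (iffP allpairsP) => [[[y i] [/= ys _ ->]]|[y [i [ys ->]]]].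
  by exists y, i.
exists (y, i %% ell)%N; rewrite /= mem_iota add0n ltn_mod prime_gt0 //.
by split=> //; rewrite mulrn_mod.
Qed.

Lemma sgroup_grow s x : sgroup s -> x *+ ell = 0 -> x \notin s ->
  sgroup (grow s x) /\ size (grow s x) = (size s * ell)%N.
Proof.
move=> hs xl nx; have [us s0 sB sl] := hs; split; last by rewrite size_allpairs size_iota.
split.
- apply: allpairs_uniq => // [|[y i] [y' i']]; first exact: iota_uniq.
  move=> /allpairsP [[y0 i0] [/= ys + [-> ->]]] /allpairsP [[y1 i1] [/= ys' + [-> ->]]] /= e.
  rewrite !mem_iota !add0n /= => li li'.
  have key a c j1 i2 : a \in s -> c \in s -> (j1 < i2 < ell)%N -> a + x *+ j1 <> c + x *+ i2.
    move=> ha hc /andP [lt l2] ee.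
    have nd : ~~ (ell %| i2 - j1)%N.
      by rewrite gtnNdvd ?subn_gt0 // (leq_ltn_trans (leq_subr _ _)).
    have [t et] := mulrn_inv xl nd.
    move: nx; rewrite -et mulrnA sgroupMn // mulrnBr ?(ltnW lt) //.
    have -> : x *+ i2 - x *+ j1 = a - c; last exact: sB.
    by apply/eqP; rewrite subr_eq addrAC eq_sym subr_eq ee addrC.
  move: li li' e; case: (ltngtP i0 i1) => [lt li li' e|lt li li' e|-> _ _ /addIr -> //].
    by case: (key _ _ _ _ ys ys' _ e); rewrite lt.
  by case: (key _ _ _ _ ys' ys _ (esym e)); rewrite lt.
- by apply/(mem_growP _ hs xl); exists 0, 0%N; rewrite mulr0n addr0.
- move=> _ _ /(mem_growP _ hs xl) [y [i [ys ->]]] /(mem_growP _ hs xl) [y' [i' [ys' ->]]].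
  apply/(mem_growP _ hs xl); exists (y - y'), (i + i' * ell.-1)%N; split; first exact: sB.
  rewrite opprD addrACA; congr (_ + _); rewrite mulrnDr; congr (_ + _).
  apply: (addrI (x *+ i')); rewrite subrr -mulrnDr -mulnS prednK ?prime_gt0 //.
  by rewrite mulnC mulrnA xl mul0rn.
by move=> _ /(mem_growP _ hs xl) [y [i [ys ->]]]; rewrite mulrnDl sl // mulrnAC xl mul0rn addr0.
Qed.

Lemma sgroup0 : sgroup [:: 0].
Proof.
split=> // [|x y|x]; rewrite ?inE // => /eqP ->; last by rewrite mul0rn.
by move=> /eqP ->; rewrite subrr.
Qed.

(** The eigenvalue at [x + x1] must agree with those at [x] and at a fixed nonzero [x1], unless [x]
    and [x1] are proportional. Natural numbers stand for scalars, so multiples are compared rather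
    than eigenvalues. *)
Lemma all_eigenvectors (T : G -> Prop) (g : G -> G) :
  (forall x y, T x -> T y -> T (x + y)) -> (forall x, T x -> x *+ ell = 0) ->
  (forall x y, T x -> T y -> g (x + y) = g x + g y) -> (forall x n, T x -> g (x *+ n) = g x *+ n) ->
  (forall x, T x -> exists i, g x = x *+ i) -> exists s : nat, forall x, T x -> g x = x *+ s.
Proof.
move=> TD Tl gD gM ge; have [[x1 Tx1 n1]|no] := classic (exists2 x, T x & x <> 0); last first.
  exists 0%N => x Tx; have x0 : x = 0 by apply: NNPP => nx; apply: no; exists x.
  by have [i ->] := ge x Tx; rewrite x0 !mul0rn.
have [i1 e1] := ge x1 Tx1; exists i1 => x Tx; have [ix ex] := ge x Tx.
have same i j y : T y -> x1 *+ i = x1 *+ j -> y *+ i = y *+ j.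
  move=> Ty; wlog le : i j / (i <= j)%N.
    by move=> h e; have [/h|/ltnW/h] := leqP i j; [apply|move=> h'; apply/esym/h'].
  move=> e; have [d|nd] := boolP (ell %| j - i)%N.
    have /dvdnP [t et] := d; rewrite -(subnKC le) mulrnDr et mulnC mulrnA Tl // mul0rn.
    by rewrite addr0.
  have [t et] := mulrn_inv (Tl _ Tx1) nd; case: n1.
  by rewrite -et mulrnA mulrnBr // e subrr mul0rn.
have [i ei] := ge _ (TD _ _ Tx Tx1).
rewrite gD // ex e1 mulrnDl in ei.
have [e|ne] := eqVneq (x1 *+ i1) (x1 *+ i).
  by rewrite ex; move: ei; rewrite e => /addIr ->; apply/esym/same.
have [t et] : exists t, x1 = x *+ t.
  have opp_ (y : G) n : T y -> - (y *+ n) = y *+ (n * ell.-1).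
    move=> Ty; apply: (addrI (y *+ n)); rewrite subrr -mulrnDr -mulnS prednK ?prime_gt0 //.
    by rewrite mulnC mulrnA Tl // mul0rn.
  have e2 : x1 *+ (i1 + i * ell.-1) = x *+ (i + ix * ell.-1).
    rewrite !mulrnDr -!opp_ //; apply/eqP; rewrite subr_eq addrAC eq_sym subr_eq.
    by rewrite -ei addrC.
  have nd : ~~ (ell %| i1 + i * ell.-1)%N.
    apply: contraNN ne => /dvdnP [t et]; rewrite -subr_eq0 opp_ // -mulrnDr et mulnC mulrnA.
    by rewrite Tl // mul0rn.
  have [t et] := mulrn_inv (Tl _ Tx1) nd.
  by exists ((i + ix * ell.-1) * t)%N; rewrite -[LHS]et mulrnA e2 -mulrnA.
rewrite ex; apply: same => //.
by rewrite -e1 et gM // ex mulrnAC.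
Qed.

End Torsion_combinatorics.

(** * The action of [O] on the torsion at [l] *)

Section LocalAction.

Variables (K : fieldExtType rat) (K0 : {subfield K}) (O : K -> Prop) (ell m0 : nat).
Variables (a b v w : K) (G : zmodType) (act : K -> G -> G).
Local Notation R0 := (ring_of_integers K0).
Local Notation dv := (principal_ideal R0).
Implicit Types x y z : G.

Hypotheses (hO : is_order O) (hell : prime ell).
Hypotheses (Ra : R0 a) (Rb : R0 b) (ab : a * b = ell%:R).
Hypotheses (Rv : R0 v) (Rw : R0 w) (vw : v * a + w * b = 1) (na : ~ dv a 1) (nb : ~ dv b 1).
Hypothesis int_mod1 : forall r, R0 r -> exists j : nat, dv a (r - j%:R).
Hypotheses (m0O : forall r, R0 r -> O (r *+ m0)) (cm0 : coprime m0 ell).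
Hypothesis actD : forall c, O c -> {morph act c : x y / x + y}.
Hypothesis act_add : forall c e x, O c -> O e -> act (c + e) x = act c x + act e x.
Hypothesis act_mul : forall c e x, O c -> O e -> act (c * e) x = act c (act e x).
Hypothesis act1 : forall x, act 1 x = x.
Hypothesis divG : forall x, exists y, x = y *+ ell.
Hypothesis kills : forall c, O c -> (forall x, x *+ ell = 0 -> act c x = 0) ->
  exists2 e, O e & c = e *+ ell.

Let act0 c : O c -> act c 0 = 0.
Proof. by move=> Oc; apply: (addrI (act c 0)); rewrite -actD // !addr0. Qed.

Let actMn c x n : O c -> act c (x *+ n) = act c x *+ n.
Proof. by move=> Oc; elim: n => [|n IH]; rewrite ?mulr0n ?act0 // !mulrS actD // IH. Qed.

Let act_zero x : act 0 x = 0.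
Proof. by apply: (addrI (act 0 x)); rewrite -act_add ?addr0 //; apply: (order0 hO). Qed.

Let act_sub c e x : O c -> O e -> act (c - e) x = act c x - act e x.
Proof.
move=> Oc Oe; apply: (addIr (act e x)); rewrite -act_add ?subrK //; exact: (orderB hO).
Qed.

Let act_muln c n x : O c -> act (c *+ n) x = act c x *+ n.
Proof.
move=> Oc; elim: n => [|n IH]; first by rewrite !mulr0n act_zero.
by rewrite !mulrS act_add ?IH //; apply: (orderMn hO).
Qed.

Let act_nat n x : act n%:R x = x *+ n.
Proof. by rewrite act_muln ?act1 //; apply: (order1 hO). Qed.

(** [c ^+ M] need not lie in [O], so only its multiples in [O] are required to kill [x]. *)
Definition tors (c : K) M x := forall e : K, R0 e -> O (c ^+ M * e) -> act (c ^+ M * e) x = 0.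

Lemma tors_dv c M x e : tors c M x -> dv (c ^+ M) e -> O e -> act e x = 0.
Proof. by move=> h [y Ry ->] Oe; apply: h. Qed.

Lemma tors_le c M N x : R0 c -> (M <= N)%N -> tors c M x -> tors c N x.
Proof.
move=> Rc le h y Ry; rewrite -{1 2}(subnKC le) exprD -mulrA => Oy; apply: h => //.
by apply: riM => //; apply: riXn.
Qed.

Lemma tors_add c M x y : tors c M x -> tors c M y -> tors c M (x + y).
Proof. by move=> hx hy z Rz Oz; rewrite actD // hx // hy // addr0. Qed.

Lemma tors_muln c M x n : tors c M x -> tors c M (x *+ n).
Proof. by move=> hx z Rz Oz; rewrite actMn // hx // mul0rn. Qed.

Lemma tors_act c M x e : O e -> tors c M x -> tors c M (act e x).
Proof.
move=> Oe hx z Rz Oz; rewrite -act_mul // mulrC act_mul // hx // act0 //.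
Qed.

Lemma tors_ell c c' M x : R0 c' -> c * c' = ell%:R -> tors c M x -> x *+ (ell ^ M) = 0.
Proof.
move=> Rc' cc h; rewrite -act_nat natrX -cc exprMn; apply: h; first exact: riXn.
by rewrite -exprMn cc -natrX; apply: (order_nat hO).
Qed.

(** The product of [u] with a multiple of [c ^+ M] is [ell ^ M] times an element that is sure to lie
    in [O] only after multiplication by [m0]; this suffices because [m0] is prime to [ell]. *)
Lemma tors_proj c c' M x u : R0 c -> R0 c' -> c * c' = ell%:R -> O u -> dv (c' ^+ M) u ->
  x *+ (ell ^ M) = 0 -> tors c M (act u x).
Proof.
move=> Rc Rc' cc Ou [z Rz ez] xl y Ry Oy; rewrite -act_mul //.
have Ocu : O (c ^+ M * y * u) by apply: (orderM hO).
apply: (@coprime_torsion G _ m0 (ell ^ M) (m0_gt0 hell cm0)); first exact: coprimeXr.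
  rewrite -act_muln //.
  have -> : c ^+ M * y * u *+ m0 = (y * z) *+ m0 *+ (ell ^ M).
    by rewrite ez -[RHS]mulr_natr natrX -cc exprMn mulrnAl; congr (_ *+ _); ring.
  have Oyz : O ((y * z) *+ m0) by apply: m0O; apply: riM.
  by rewrite act_muln // -actMn // xl act0.
by rewrite -actMn // xl act0.
Qed.

Lemma tors_fix c M x u : O u -> dv (c ^+ M) (1 - u) -> tors c M x -> act u x = x.
Proof.
move=> Ou h hx; have O1 := order1 hO.
have := tors_dv hx h (orderB hO O1 Ou); rewrite act_sub // act1 => /eqP.
by rewrite subr_eq0 => /eqP.
Qed.

Lemma div_pow x M : exists y, x = y *+ (ell ^ M).
Proof.
elim: M => [|M [y ->]]; first by exists x; rewrite expn0.
by have [z ->] := divG y; exists z; rewrite -mulrnA -expnS.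
Qed.

Lemma kills_pow c M : O c -> (forall x, x *+ (ell ^ M) = 0 -> act c x = 0) ->
  exists2 e, O e & c = e *+ (ell ^ M).
Proof.
elim: M c => [|M IH] c Oc h; first by exists c; rewrite ?expn0.
have [|e Oe ee] := kills Oc.
  by move=> x xl; apply: h; rewrite expnS mulrnA xl mul0rn.
have [|f Of ef] := IH e Oe.
  move=> x xM; have [y ey] := divG x; rewrite ey actMn // -act_muln // -ee.
  by apply: h; rewrite expnS mulrnA -ey.
by exists f => //; rewrite ee ef -mulrnA -expnSr.
Qed.

Let proj M := projector hell Ra Rb ab Rv Rw vw hO m0O cm0 M.

Lemma tors_a_ell M x : tors a M x -> x *+ (ell ^ M) = 0.
Proof. exact: tors_ell Rb ab. Qed.

(** Divide by [ell ^ t] in the whole group, then project to the [a]-part. *)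
Lemma tors_lift M t x : tors a M x -> exists2 z, tors a (M + t) z & z *+ (ell ^ t) = x.
Proof.
move=> hx; have [u [Ou _ ub ua]] := proj (M + t); have [z ez] := div_pow x t.
exists (act u z).
  apply: (tors_proj Ra Rb ab Ou ub); rewrite addnC expnD mulrnA -ez.
  exact: tors_a_ell.
by rewrite -actMn // -ez; apply: (tors_fix Ou ua); apply: tors_le hx; rewrite ?leq_addr.
Qed.

Lemma tors_disjoint x : tors a 1 x -> tors b 1 x -> x = 0.
Proof.
move=> ha hb; have [u [Ou _ ub ua]] := proj 1.
by rewrite -(tors_fix Ou ua ha) (tors_dv hb ub Ou).
Qed.

Lemma int_act M r j x : O r -> dv (a ^+ M) (r - j%:R) -> tors a M x -> act r x = x *+ j.
Proof.
move=> Or h hx; have := tors_dv hx h (orderB hO Or (order_nat hO j)).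
by rewrite act_sub ?act_nat; [move=> /eqP; rewrite subr_eq0 => /eqP|exact: Or|exact: (order_nat hO)].
Qed.

Lemma int_cong M i j x : dv (a ^+ M) (i%:R - j%:R) -> tors a M x -> x *+ i = x *+ j.
Proof. by move=> h hx; rewrite -act_nat; apply: int_act h hx; apply: (order_nat hO). Qed.

Section Exponent.

Variables (I : K -> Prop) (theta : K).
Hypotheses (hI : forall r, I r <-> dv a r) (Ot : O theta).

Let ipE M r : ideal_pow R0 I M r <-> dv (a ^+ M) r. Proof. exact: (ideal_powE M r Ra hI). Qed.

(** The tensor identity is evaluated by the balanced map that sends [c] and [s] to the action of [c]
    composed with an integer approximating [s] modulo [a ^+ M]. *)
Lemma local_action M nu : (nu <= M)%N -> in_local_suborder K0 O I nu theta ->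
  exists c gamma, O gamma /\ forall x, tors a M x ->
    act theta x = x *+ c + act gamma x *+ (ell ^ nu).
Proof.
move=> nuM [r [u [hr hu ht]]].
have /fchoice [j hj] : forall s, exists j : nat, R0 s -> dv (a ^+ M) (s - j%:R).
  move=> s; have [Rs|] := classic (R0 s); last by exists 0%N.
  by have [j hj] := int_mod Ra Rb ab Rv Rw vw int_mod1 M Rs; exists j.
have Rc s : in_completion K0 I s -> R0 (s M) by move=> h; case: (h M).
have cong s t x : R0 s -> R0 t -> dv (a ^+ M) (s - t) -> tors a M x -> x *+ j s = x *+ j t.
  move=> Rs Rt h; apply: int_cong.
  have := dvB (dvD h (hj t Rt)) (hj s Rs); congr (dv _ _); ring.
have bal x : tors a M x -> balanced K0 O I (fun c s => act c (x *+ j (s M))).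
  move=> hx; split.
  - move=> c s t Oc hs ht' e; congr (act c _); apply: cong => //; try exact: Rc.
    by apply/ipE; apply: e.
  - by move=> c e s Oc Oe _; rewrite act_add.
  - move=> c s t Oc hs ht'; rewrite -actD // -mulrnDr; congr (act c _).
    have Rs := Rc s hs; have Rt := Rc t ht'.
    apply: int_cong hx; rewrite natrD.
    have := dvB (dvD (hj _ Rs) (hj _ Rt)) (hj _ (riD Rs Rt)); congr (dv _ _); ring.
  move=> c e s [Oc cK] Oe hs; have Rs := Rc s hs; have Rcc := order_ri hO Oc cK.
  rewrite mulrC act_mul //; congr (act e _).
  rewrite actMn // (int_act Oc (hj c Rcc) hx) -mulrnA.
  apply: int_cong hx; rewrite natrM.
  have := dvB (dvB (hj _ (riM Rcc Rs)) (dvM Rs (hj c Rcc))) (dvM (ri_nat K0 (j c)) (hj _ Rs)).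
  congr (dv _ _); ring.
have comb (U : seq (K * K * (nat -> K))) : (forall i, (i < size U)%N ->
      let t := nth (0, 0, fun=> 0) U i in
      [/\ ideal_pow R0 I nu t.1.1, O t.1.2 & in_completion K0 I t.2]) ->
    exists2 g, O g & forall x, tors a M x ->
      \sum_(t <- [seq (t.1.2, fun j => t.1.1 * t.2 j) | t <- U]) act t.1 (x *+ j (t.2 M)) =
      act g x *+ (ell ^ nu).
  elim: U => [|[[c e] s] U IH] hU.
    by exists 0; [exact: (order0 hO)|move=> x _; rewrite big_nil act_zero mul0rn].
  have [|g Og eg] := IH; first by move=> i li; apply: (hU i.+1).
  have [/= /ipE hc Oe hs] := hU 0%N isT; have Rs := Rc s hs.
  have Rcc : R0 c by case: hc => t Rt ->; apply: riM => //; apply: riXn.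
  (* An integer approximating an element of [I ^ nu] is itself divisible by [ell ^ nu], since [nu]
     is at most [M]. *)
  have dj : dv (a ^+ nu) (j (c * s M))%:R.
    have [t Rt et] := hj _ (riM Rcc Rs).
    have := dvB (dvM Rs hc) (dv_self (a ^+ nu) (riM (riXn (M - nu) Ra) Rt)).
    by rewrite mulrA -exprD subnKC // -et subKr.
  have /dvdnP [t et] := nat_dv hell Ra Rb ab Rv Rw vw na dj.
  exists (e *+ t + g); first by apply: (orderD hO) => //; apply: (orderMn hO).
  move=> x hx; rewrite /= big_cons eg //= et act_add //; last exact: (orderMn hO).
  by rewrite mulrnDl act_muln // -mulrnA actMn.
have [g Og eg] := comb u hu; exists (j (r M)), g; split=> // x hx.
have := ht G _ (bal x hx); rewrite big_seq1 big_cons /= eg // act1 => <-.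
congr (act theta _).
(* The integer chosen to approximate 1 need not be 1. *)
have := int_cong (M := M) (i := 1) (j := j 1) (x := x); rewrite mulr1n; apply=> //.
exact: (hj _ (ri1 K0)).
Qed.

Lemma constant_completion c : R0 c -> in_completion K0 I (fun=> c).
Proof.
by move=> Rc M; split=> //; apply/ipE; rewrite subrr; exists 0; rewrite ?mulr0 //; apply: ri0.
Qed.

(* The projector is inverted in the completion by a geometric series. *)
Lemma local_suborder_of_action M nu c gamma : (nu <= M)%N -> (0 < M)%N -> O gamma ->
  (forall x, tors a M x -> act theta x = x *+ c + act gamma x *+ (ell ^ nu)) ->
  in_local_suborder K0 O I nu theta.
Proof.
move=> nuM M0 Og h; have [u [Ou uK ub ua]] := proj M.
have Ru := order_ri hO Ou uK; have R1 := ri1 K0.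
have Ol t : O (ell ^ t)%:R by apply: (order_nat hO).
pose beta := theta - c%:R - gamma *+ (ell ^ nu).
have Ogl : O (gamma *+ (ell ^ nu)) by apply: (orderMn hO).
have Oc : O c%:R by apply: (order_nat hO).
have Ob : O beta by apply: (orderB hO) => //; apply: (orderB hO).
have [|dl Odl edl] := @kills_pow (u * beta) M (orderM hO Ou Ob).
  move=> x xl; rewrite mulrC act_mul //.
  have hx := tors_proj Ra Rb ab Ou ub xl.
  rewrite !act_sub ?act_nat ?act_muln //; last exact: (orderB hO).
  by rewrite h // [X in X - _ - _]addrC addrK subrr.
pose s m := \sum_(i < m) (1 - u) ^+ i.
have Rs m : R0 (s m).
  by apply: (big_ind R0) => [|? ? ? ?|i _]; [exact: ri0|exact: riD|apply: riXn; apply: riB].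
have us m : u * s m = 1 - (1 - u) ^+ m.
  have := subrXX 1 (1 - u) m; rewrite expr1n subKr => ->.
  by congr (_ * _); apply: eq_bigr => i _; rewrite expr1n mul1r.
have dvu m : dv (a ^+ m) ((1 - u) ^+ m).
  have [t Rt ->] := ua; rewrite -(prednK M0) exprS -mulrA exprMn.
  by apply: dv_self; apply: riXn; apply: riM => //; apply: riXn.
have hs : in_completion K0 I s.
  move=> m; split=> //; apply/ipE; rewrite /s big_ord_recr /= addrAC subrr add0r; exact: dvu.
have hus : completion_eq K0 I (fun=> 1) (fun m => u * s m).
  by move=> m; apply/ipE; rewrite us subKr; apply: dvu.
pose L t := (ell ^ t)%:R : K.
have RL t : R0 (L t) by apply: ri_nat.
have hM (t : K) s' : R0 t -> in_completion K0 I s' -> in_completion K0 I (fun m => t * s' m).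
  move=> Rt h' m; have [R' /ipE d'] := h' m; split; first exact: riM.
  by apply/ipE; rewrite -mulrBr mulrC; apply: dvM.
have dL : ideal_pow R0 I nu (L nu).
  by apply/ipE; rewrite /L natrX -ab exprMn; apply: dv_self; apply: riXn.
have h1 := constant_completion R1.
(* Since [u * beta = dl * ell ^ M] and the limit of [s] inverts [u], the remainder [beta] is
   [ell ^ nu] times the tensor of [dl] with [ell ^ (M - nu) * s]. *)
exists (fun=> c%:R), [:: (L nu, gamma, fun=> 1); (L nu, dl, fun m => L (M - nu)%N * s m)]; split.
- exact: constant_completion (ri_nat K0 c).
- case=> [|[|i]] // _; split=> //=; exact: hM.
move=> N F [F1 F2 F3 F4]; rewrite big_seq1 !big_cons big_nil addr0 /=.
have O1 := order1 hO.
have -> : theta = c%:R + gamma *+ (ell ^ nu) + beta by rewrite /beta; ring.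
rewrite F2 //; last exact: (orderD hO).
rewrite F2 // -addrA; congr (_ + (_ + _)).
- rewrite -[c%:R in LHS]mulr1 F4 //; last by split=> //; apply: rpred_nat.
  by congr (F 1 _); apply: functional_extensionality => m; rewrite mulr1.
- rewrite -[gamma *+ _]mulr_natl F4 //; split; first exact: Ol.
  by apply: rpred_nat.
rewrite (F1 beta (fun=> 1) (fun m => u * s m)) //; last exact: hM.
rewrite -F4 // edl -mulr_natl F4 //; last by split; [exact: Ol|apply: rpred_nat].
congr (F dl _); apply: functional_extensionality => m.
by rewrite mulrA /L -natrM -expnD subnKC.
Qed.

End Exponent.

Section Structure.

Variables (sg : {rmorphism K -> K}) (theta : K).
Hypotheses (sgO : forall c, O c -> O (sg c)) (sgK : forall c, c \in K0 -> sg c = c).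
Hypotheses (Ot : O theta) (st : sg theta != theta).
Hypothesis count : forall s : seq G, uniq s -> (forall x, x \in s -> x *+ ell = 0) ->
  (size s <= ell ^ 4)%N.

Let oneB u : O u -> O (1 - u). Proof. by apply: (orderB hO); apply: (order1 hO). Qed.

(* If [O] acted on [A[b]] by integers, the [j]-th power of a projector would map [O] into
   [K0 + ell^j O], which is impossible by comparing with the conjugation [sg]. *)
Lemma nonscalar_b : exists2 e, O e & ~ exists s : nat, forall x, tors b 1 x -> act e x = x *+ s.
Proof.
apply: NNPP => no; have sc e : O e -> exists s : nat, forall x, tors b 1 x -> act e x = x *+ s.
  by move=> Oe; apply: NNPP => ns; apply: no; exists e.
have [u [Ou uK ub ua]] := proj 1; pose u' := 1 - u.
have Ou' := oneB Ou : O u'.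
have u'K : u' \in K0 by apply: rpredB => //; apply: rpred1.
have Ru' : R0 u' := order_ri hO Ou' u'K.
have step e : O e -> exists (s : nat) dl, O dl /\ u' * e = u' *+ s + dl *+ ell.
  move=> Oe; have [s hs] := sc e Oe; have Os := orderMn hO s (order1 hO).
  have [|dl Odl edl] := kills (orderM hO Ou' (orderB hO Oe Os)).
    move=> x xl; rewrite mulrC act_mul //; last exact: (orderB hO).
    have hx : tors b 1 (act u' x).
      by apply: (tors_proj Rb Ra _ Ou' ua); rewrite ?expn1 // mulrC.
    by rewrite act_sub // act_nat hs // subrr.
  by exists s, dl; split=> //; rewrite -edl mulrBr mulr_natr addrC subrK.
have pow j e : O e -> exists c dl, [/\ c \in K0, O dl & u' ^+ j * e = c + dl *+ (ell ^ j)].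
  move=> Oe; elim: j => [|j [c [dl [cK Odl ej]]]].
    by exists 0, e; rewrite mem0v mul1r add0r expn0.
  have [s [dl' [Odl' e']]] := step dl Odl.
  exists (u' * c + u' *+ s *+ (ell ^ j)), dl'; split=> //.
    by rewrite rpredD ?rpredM ?rpredMn.
  by rewrite exprS -mulrA ej mulrDr mulrnAr e' mulrnDl addrA expnS mulrnA.
(* [N / (theta - sg theta)] lies in [O]. Comparing [u' ^+ j * theta] with its conjugate then shows
   that [u' ^+ j * N] is [ell ^ j] times an integer of [K0]; as [u'] is 1 modulo [b], every power of
   [b] would divide [N]. *)
have [_ _ _ hN] := hO; have [N N0 ON] := hN (theta - sg theta)^-1.
set eta := theta - sg theta in ON; have eta0 : eta != 0 by rewrite subr_eq0 eq_sym.
have dN j : dv (b ^+ j) N%:R.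
  have [c [dl [cK Odl ej]]] := pow j theta Ot.
  pose f := (dl - sg dl) * (eta^-1 *+ N).
  have Of : O f by apply: (orderM hO) => //; apply: (orderB hO) => //; apply: sgO.
  have ef : u' ^+ j * N%:R = f *+ (ell ^ j).
    have e1 : u' ^+ j * eta = (dl - sg dl) *+ (ell ^ j).
      have t1 : sg (u' ^+ j * theta) = u' ^+ j * sg theta by rewrite rmorphM rmorphXn (sgK u'K).
      have t2 : sg (c + dl *+ (ell ^ j)) = c + sg dl *+ (ell ^ j).
        by rewrite rmorphD /= (sgK cK) raddfMn.
      have ej' : u' ^+ j * sg theta = c + sg dl *+ (ell ^ j) by rewrite -t1 ej t2.
      by rewrite /eta mulrBr ej ej' mulrnBl; ring.
    by rewrite /f -mulrnAl -e1 -[eta^-1 *+ N]mulr_natr mulrA mulfK.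
  have l0 : (ell ^ j)%:R != 0 :> K by apply: natK0; rewrite expn_gt0 prime_gt0.
  have fK : f \in K0.
    have -> : f = u' ^+ j * N%:R / (ell ^ j)%:R by rewrite ef -[f *+ _]mulr_natr mulfK.
    by rewrite rpredM ?rpredV ?rpredM ?rpredX ?rpred_nat.
  have Rf := order_ri hO Of fK.
  have [y Ry ey] : dv b (1 - u') by rewrite /u' subKr -[b]expr1.
  have cop : 1 * u' + y * b = 1 by rewrite mul1r mulrC -ey addrC subrK.
  have [V [W [RV RW eV]]] := coprime_pow Ru' Rb (ri1 K0) Ry cop j j.
  have Ral : R0 (a ^+ j) by apply: riXn.
  exists (V * (a ^+ j * f) + W * N%:R).
    by apply: riD; apply: riM => //; [apply: riM|apply: ri_nat].
  transitivity ((V * u' ^+ j + W * b ^+ j) * N%:R); first by rewrite eV mul1r.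
  rewrite mulrDl -[V * _ * _]mulrA ef -[f *+ _]mulr_natr natrX -ab exprMn; ring.
have := nat_dv hell Rb Ra (etrans (mulrC _ _) ab) Rw Rv (etrans (addrC _ _) vw) nb (dN N).
move=> /(dvdn_leq N0); rewrite leqNgt => /negP; apply.
exact: ltn_expl (prime_gt1 hell).
Qed.

Lemma eigen_free c e : R0 c -> c = a \/ c = b -> O e ->
  ~ (exists s : nat, forall x, tors c 1 x -> act e x = x *+ s) ->
  exists2 x, tors c 1 x & forall i : nat, act e x <> x *+ i.
Proof.
move=> Rc hc Oe ns; apply: NNPP => no; apply: ns.
have ne x : tors c 1 x -> x *+ ell = 0.
  rewrite -(expn1 ell); case: hc => ->; first exact: tors_ell Rb ab.
  exact: tors_ell Ra (etrans (mulrC _ _) ab).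
apply: (all_eigenvectors hell (T := tors c 1) (g := act e)) => //.
- by move=> x y; apply: tors_add.
- by move=> x y _ _; apply: actD.
- by move=> x n _; apply: actMn.
move=> x hx; apply: NNPP => nx; apply: no; exists x => // i ei.
by apply: nx; exists i.
Qed.

(* Otherwise the torsion would contain [ell^5] points. *)
Lemma tors_basis gamma x0 : O gamma -> tors a 1 x0 -> (forall i : nat, act gamma x0 <> x0 *+ i) ->
  forall x, tors a 1 x -> exists i j : nat, x = x0 *+ i + act gamma x0 *+ j.
Proof.
(* The five generators are [x0], [gamma x0] and a hypothetical independent [x] in [A[a]], together
   with [x1] and [e x1] in [A[b]]. *)
move=> Og h0 ng x hx; have [e Oe nse] := nonscalar_b.
have [x1 h1 nx1] := eigen_free Rb (or_intror erefl) Oe nse.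
have la y : tors a 1 y -> y *+ ell = 0 by rewrite -(expn1 ell); apply: tors_a_ell.
have lb y : tors b 1 y -> y *+ ell = 0.
  by rewrite -(expn1 ell); apply: tors_ell Ra (etrans (mulrC _ _) ab).
have hg := tors_act Og h0; have he := tors_act Oe h1.
have ng0 (z t : G) : (forall i : nat, t <> z *+ i) -> z <> 0 \/ t <> 0.
  by move=> h; right=> t0; apply: (h 0%N); rewrite mulr0n.
have x00 : x0 <> 0 by move=> e0; apply: (ng 0%N); rewrite e0 act0 // mul0rn.
have x10 : x1 <> 0 by move=> e0; apply: (nx1 0%N); rewrite e0 act0 // mul0rn.
have s0 := sgroup0 G ell.
have [s1 z1] : sgroup ell (grow ell [:: 0] x0) /\ size (grow ell [:: 0] x0) = (1 * ell)%N.
  by apply: (sgroup_grow hell s0 (la _ h0)); rewrite inE; apply/eqP.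
set S1 := grow _ _ _ in s1 z1.
have m1 y : y \in S1 -> exists i, y = x0 *+ i.
  move=> /(mem_growP hell _ s0 (la _ h0)) [t [i [+ ->]]]; rewrite inE => /eqP ->.
  by exists i; rewrite add0r.
have [|s2 z2] := sgroup_grow hell s1 (la _ hg).
  by apply/negP => /m1 [i ei]; apply: (ng i).
set S2 := grow _ _ _ in s2 z2.
have m2 y : y \in S2 -> exists i j, y = x0 *+ i + act gamma x0 *+ j.
  by move=> /(mem_growP hell _ s1 (la _ hg)) [t [j [/m1 [i ->] ->]]]; exists i, j.
have [/m2 //|nx] := boolP (x \in S2); exfalso.
have [s3 z3] := sgroup_grow hell s2 (la _ hx) nx.
set S3 := grow _ _ _ in s3 z3.
have m3 y : y \in S3 -> tors a 1 y.
  move=> /(mem_growP hell _ s2 (la _ hx)) [t [i [/m2 [i1 [i2 ->]] ->]]].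
  by apply: tors_add; [apply: tors_add|]; apply: tors_muln.
have [|s4 z4] := sgroup_grow hell s3 (lb _ h1).
  by apply/negP => /m3 h; apply: x10; apply: tors_disjoint.
set S4 := grow _ _ _ in s4 z4.
have [|s5 z5] := sgroup_grow hell s4 (lb _ he).
  apply/negP => /(mem_growP hell _ s3 (lb _ h1)) [t [i [/m3 ht et]]].
  have hd : tors b 1 (act e x1 + x1 *+ (i * ell.-1)) by apply: tors_add => //; apply: tors_muln.
  have ed : act e x1 + x1 *+ (i * ell.-1) = t.
    rewrite et -addrA -mulrnDr -mulnS prednK ?prime_gt0 // mulnC mulrnA lb // mul0rn.
    by rewrite addr0.
  rewrite ed in hd; have t0 := tors_disjoint ht hd.
  by apply: (nx1 i); rewrite et t0 add0r.
have [u5 _ _ l5] := s5; have := count u5 l5.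
rewrite z5 z4 z3 z2 z1 mul1n.
have -> : (ell * ell * ell * ell * ell = ell ^ 5)%N by rewrite !expnS expn0 muln1 !mulnA.
by rewrite leq_exp2l ?prime_gt1.
Qed.

Variables (I : K -> Prop) (n nu : nat).
Hypothesis hI : forall r, I r <-> dv a r.
Hypotheses (hnu : in_local_suborder K0 O I nu theta).
Hypothesis hnu1 : ~ in_local_suborder K0 O I nu.+1 theta.
Hypotheses (n0 : (0 < n)%N) (nu2 : (nu < 2 * n)%N).
Hypothesis fixn : forall x, tors a n x -> act theta x = x.

(** Maximality of [nu] makes [gamma] nonscalar on the [l]-torsion. As [theta] fixes the points of
    level [n], this forces [n <= nu], and then [ell ^ n] divides the scalar part of [theta - 1]. *)
Theorem local_structure : exists gamma (c : nat) x0, [/\ O gamma, (n <= nu)%N,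
  forall x, tors a (2 * n) x -> act theta x - x = x *+ (ell ^ n * c) + act gamma x *+ (ell ^ nu),
  tors a 1 x0 /\ x0 <> 0 &
  forall x, tors a 1 x -> exists i j : nat, x = x0 *+ i + act gamma x0 *+ j].
Proof.
set M := (2 * n)%N; have M0 : (0 < M)%N by rewrite muln_gt0.
have nM : (n <= M)%N by rewrite /M mul2n -addnn leq_addr.
have [c0 [gamma [Og h0]]] := local_action hI (ltnW nu2) hnu.
(* [ell ^ M - 1] acts as [-1] on this torsion; the scalar part of [theta - 1] thus stays a natural
   number. *)
pose c := (c0 + (ell ^ M).-1)%N.
have lM : (0 < ell ^ M)%N by rewrite expn_gt0 prime_gt0.
have h x : tors a M x -> act theta x - x = x *+ c + act gamma x *+ (ell ^ nu).
  move=> hx; rewrite h0 // addrAC; congr (_ + _).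
  apply: (addIr x); rewrite subrK /c -mulrSr -addnS prednK // mulrnDr tors_a_ell //.
  by rewrite addr0.
have ns : ~ exists s : nat, forall x, tors a 1 x -> act gamma x = x *+ s.
  move=> [s hs]; apply: hnu1; have [u [Ou uK ub ua]] := proj M.
  have Os := orderMn hO s (order1 hO).
  have ub1 : dv (b ^+ 1) u.
    by case: ub => t Rt ->; rewrite expr1 -(prednK M0) exprS -mulrA; apply: dv_self;
      apply: riM => //; apply: riXn.
  have [|dl Odl edl] := kills (orderM hO Ou (orderB hO Og Os)).
    move=> x xl; rewrite mulrC act_mul //; last exact: (orderB hO).
    have hx : tors a 1 (act u x) by apply: (tors_proj Ra Rb ab Ou ub1); rewrite expn1.
    by rewrite act_sub // act_nat hs // subrr.
  (* On this torsion [gamma] would be [s + ell * dl], which raises the exponent to [nu + 1]. *)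
  apply: (@local_suborder_of_action I theta hI Ot M nu.+1 (c0 + s * ell ^ nu) dl) => // x hx.
  have hgx : act gamma x = x *+ s + act dl x *+ ell.
    have hs' := tors_act (orderB hO Og Os) hx.
    rewrite -act_muln // -edl act_mul //; last exact: (orderB hO).
    by rewrite (tors_fix Ou ua hs') act_sub // act_nat addrC subrK.
  by rewrite h0 // hgx mulrnDl mulrnDr addrA -!mulrnA -expnS.
have [x0 hx0 nx0] := eigen_free Ra (or_introl erefl) Og ns.
have x00 : x0 <> 0 by move=> e0; apply: (nx0 0%N); rewrite e0 act0 // mul0rn.
have la y : tors a 1 y -> y *+ ell = 0 by rewrite -(expn1 ell); apply: tors_a_ell.
have hn x : tors a n x -> x *+ c + act gamma x *+ (ell ^ nu) = 0.
  by move=> hx; rewrite -h ?fixn ?subrr //; apply: tors_le hx.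
have dvc N : (0 < N)%N -> (forall x, tors a N x -> x *+ c = 0) -> (ell ^ N %| c)%N.
  move=> N0 hc; apply: contraT => nd.
  have [z hz ez] := tors_lift N.-1 hx0; rewrite add1n prednK // in hz.
  have [_] := order_dvd hell (tors_a_ell hz) (hc z hz) nd.
  by rewrite ez.
(* Otherwise [theta] fixes the points of level [nu + 1], and there the relation reads
   [gamma x = - s x] on the [l]-torsion. *)
have nnu : (n <= nu)%N.
  rewrite leqNgt; apply/negP => lt.
  have /dvdnP [s es] : (ell ^ nu %| c)%N.
    have [->|nu0] := posnP nu; first by rewrite expn0 dvd1n.
    apply: dvc => // x hx; have hx' := tors_le Ra (ltnW lt) hx.
    by have := hn x hx'; rewrite -actMn // tors_a_ell // act0 // addr0.
  apply: ns; exists (s * ell.-1)%N => x hx; have [z hz ez] := tors_lift nu hx.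
  rewrite add1n in hz; have := hn z (tors_le Ra lt hz).
  rewrite es -actMn // ez [(s * _)%N]mulnC mulrnA ez => e.
  apply: (addrI (x *+ s)); rewrite e -mulrnDr -mulnS prednK ?prime_gt0 //.
  by rewrite mulnC mulrnA la // mul0rn.
have /dvdnP [s es] : (ell ^ n %| c)%N.
  apply: dvc => // x hx; have := hn x hx.
  by rewrite -actMn // -(subnKC nnu) expnD mulrnA (tors_a_ell hx) mul0rn act0 // addr0.
exists gamma, s, x0; split=> //; last exact: tors_basis.
by move=> x hx; rewrite h // es mulnC.
Qed.

End Structure.

End LocalAction.

(** * Self-pairings in an abstract group with a pairing *)

Section SelfPairing.

Variables (k : fieldType) (G : zmodType) (ell n nu c : nat) (E : nat -> G -> G -> k).
Variables (tors : nat -> G -> Prop) (T g : G -> G) (u : nat -> G -> G) (x0 : G).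
Implicit Types t x y z : G.

Hypotheses (EDl : forall m t t' y, t *+ m = 0 -> t' *+ m = 0 -> y *+ m = 0 ->
    E m (t + t') y = E m t y * E m t' y)
  (E0l : forall m y, y *+ m = 0 -> E m 0 y = 1)
  (EMl : forall m t y j, t *+ m = 0 -> y *+ m = 0 -> E m (t *+ j) y = E m t y ^+ j)
  (EMr : forall m t y j, t *+ m = 0 -> y *+ m = 0 -> E m t (y *+ j) = E m t y ^+ j)
  (Elevel : forall m m' t y, t *+ (m * m') = 0 -> y *+ m = 0 -> E (m * m') t y = E m (t *+ m') y)
  (Ealt : forall m t, t *+ m *+ m = 0 -> E m (t *+ m) (t *+ m) = 1)
  (Enondeg : forall y, y *+ ell = 0 -> (forall t, t *+ ell = 0 -> E ell t y = 1) -> y = 0)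
  (Eadj : forall M m t y, t *+ m = 0 -> y *+ m = 0 -> E m (u M t) y = E m t (u M y)).
Hypotheses (uD : forall M t t', u M (t + t') = u M t + u M t')
  (utors : forall M t, t *+ (ell ^ M) = 0 -> tors M (u M t))
  (ufix : forall M t, tors M t -> u M t = t) (uT : forall M t, u M (T t) = T (u M t))
  (torsn : forall M t, tors M t -> t *+ (ell ^ M) = 0)
  (torsle : forall M N t, (M <= N)%N -> tors M t -> tors N t)
  (TD : forall t t', T (t + t') = T t + T t') (gD : forall t t', g (t + t') = g t + g t')
  (divG : forall M x, exists z, x = z *+ (ell ^ M))
  (lift : exists2 x, tors n x & x *+ (ell ^ n.-1) = x0).
Hypotheses (n0 : (0 < n)%N) (nnu : (n <= nu)%N) (nu2 : (nu < 2 * n)%N)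
  (structT : forall x, tors (2 * n) x -> T x - x = x *+ (ell ^ n * c) + g x *+ (ell ^ nu))
  (tx0 : tors 1 x0) (nx0 : x0 <> 0)
  (basis : forall x, tors 1 x -> exists i j : nat, x = x0 *+ i + g x0 *+ j).

Let addM (h : G -> G) x j : (forall t t', h (t + t') = h t + h t') -> h (x *+ j) = h x *+ j.
Proof.
move=> hD; elim: j => [|j IH]; last by rewrite !mulrS hD IH.
by apply: (addrI (h 0)); rewrite -hD !mulr0n !addr0.
Qed.

Let add0 (h : G -> G) : (forall t t', h (t + t') = h t + h t') -> h 0 = 0.
Proof. by move=> hD; apply: (addrI (h 0)); rewrite -hD !addr0. Qed.

Let addN (h : G -> G) x : (forall t t', h (t + t') = h t + h t') -> h (- x) = - h x.
Proof. by move=> hD; apply: (addIr (h x)); rewrite -hD !addNr add0. Qed.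

(** [u M] approximates the projector onto the [l]-part; being self-adjoint, it makes its kernel
    orthogonal to its fixed points. *)
Let orth M m t x : t *+ m = 0 -> x *+ m = 0 -> u M t = 0 -> u M x = x -> E m t x = 1.
Proof. by move=> tm xm t0 ex; rewrite -ex -Eadj // t0 E0l. Qed.

(** The lift [z] is determined only up to all [ell ^ n]-torsion, so it may leave the [l]-part; the
    component [z2] outside is orthogonal to [x], and [T] preserves this. *)
Lemma self_pairingE x z : tors n x -> z *+ (ell ^ n) = x ->
  E (ell ^ n) (T z - z) x = E (ell ^ n) (g x) x ^+ (ell ^ (nu - n)).
Proof.
move=> hx ez; set N := (ell ^ n)%N in ez *; have xN : x *+ N = 0 by apply: torsn.
have gxN : g x *+ N = 0 by rewrite -addM // xN add0.
have z2N : z *+ (ell ^ (2 * n)) = 0 by rewrite mul2n -addnn expnD mulrnA ez.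
set z1 := u (2 * n) z; have hz1 : tors (2 * n) z1 := utors z2N.
have uxx : u (2 * n) x = x.
  by apply: ufix; apply: torsle hx; rewrite mul2n -addnn leq_addr.
have z1N : z1 *+ N = x by rewrite -addM // ez uxx.
set z2 := z - z1; have uz2 : u (2 * n) z2 = 0.
  by rewrite uD addN // -/z1 (ufix hz1) subrr.
have z2N0 : z2 *+ N = 0 by rewrite mulrnBl ez z1N subrr.
have -> : T z - z = T z1 - z1 + (T z2 - z2).
  by rewrite -[in LHS](subrK z1 z) -/z2 TD opprD addrACA addrC.
have -> : T z1 - z1 = x *+ c + g x *+ (ell ^ (nu - n)).
  rewrite structT // (mulrnA z1) -/N z1N; congr (_ + _).
  by rewrite -{1}(subnKC nnu) expnD mulrnA -/N -(addM z1 N gD) z1N.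
have Tz2 : (T z2 - z2) *+ N = 0 by rewrite mulrnBl -addM // z2N0 add0 // subrr.
have uTz2 : u (2 * n) (T z2 - z2) = 0 by rewrite uD addN // uT uz2 add0 // subrr.
rewrite EDl ?(orth Tz2 xN uTz2 uxx) //; last first.
  by rewrite mulrnDl mulrnAC xN mul0rn mulrnAC gxN mul0rn addr0.
rewrite mulr1 EDl ?EMl //; try by rewrite mulrnAC ?xN ?gxN mul0rn.
have := @Ealt N z; rewrite ez => /(_ xN) ->; by rewrite expr1n mul1r.
Qed.

Lemma self_pairing_order x z : tors n x -> z *+ (ell ^ n) = x ->
  E (ell ^ n) (T z - z) x ^+ (ell ^ (2 * n - nu)) = 1.
Proof.
move=> hx ez; have xN := torsn hx.
have gxN : g x *+ (ell ^ n) = 0 by rewrite -addM // xN add0.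
rewrite (self_pairingE hx ez) -exprM -expnD.
have -> : (nu - n + (2 * n - nu) = n)%N by lia.
by rewrite -EMl // gxN E0l.
Qed.

Lemma self_pairing_nontrivial : exists x z, [/\ tors n x, z *+ (ell ^ n) = x &
  forall i, (i < 2 * n - nu)%N -> E (ell ^ n) (T z - z) x ^+ (ell ^ i) != 1].
Proof.
have [x hx ex] := lift; have [z ez] := divG n x; exists x, z; split=> // i li.
have xN := torsn hx; have gxN : g x *+ (ell ^ n) = 0 by rewrite -addM // xN add0.
rewrite (self_pairingE hx (esym ez)) -exprM -expnD; apply/eqP => e1.
(* A smaller order would make [g x0] orthogonal to [x0] at level [ell]. As [x0] is also orthogonal
   to itself and to the part outside [l], it would lie in the radical of the pairing. *)
have e2 : E (ell ^ n) (g x) x ^+ (ell ^ n.-1) = 1.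
  have -> : n.-1 = (nu - n + i + (n.-1 - (nu - n + i)))%N by lia.
  by rewrite expnD exprM e1 expr1n.
have x0l : x0 *+ ell = 0 by have := torsn tx0; rewrite expn1.
have gx0l : g x0 *+ ell = 0 by rewrite -addM // x0l add0.
rewrite -EMr // ex in e2.
have nS : (ell ^ n = ell * ell ^ n.-1)%N by rewrite -expnS prednK.
rewrite nS Elevel -?nS // -addM // ex in e2.
apply: nx0; apply: Enondeg => // t tl.
have tl1 : t *+ (ell ^ 1) = 0 by rewrite expn1.
have ht := utors tl1; set t1 := u 1 t in ht.
have t1l : t1 *+ ell = 0 by have := torsn ht; rewrite expn1.
rewrite -(subrK t1 t) EDl //; last by rewrite mulrnBl tl t1l subrr.
rewrite (orth (M := 1)) //; first last.
- exact: ufix.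
- by rewrite uD addN // -/t1 (ufix ht) subrr.
- by rewrite mulrnBl tl t1l subrr.
have [i' [j' ->]] := basis ht.
rewrite mul1r EDl ?EMl // ?e2 ?expr1n ?mulr1; try by rewrite mulrnAC ?x0l ?gx0l mul0rn.
have [w ew] := divG 1 x0; rewrite expn1 in ew.
by have := @Ealt ell w; rewrite -ew => /(_ x0l) ->; rewrite expr1n.
Qed.

End SelfPairing.

(** * Ideal torsion points and the order of their self-pairings *)

Section IdealTorsion.

Variables (k : closedFieldType) (d : nat) (A : group_data k d) (hA : agroup A).
Variables (K : fieldExtType rat) (K0 : {subfield K}) (O I : K -> Prop).
Variables (iota : K -> 'rV[k]_d -> 'rV[k]_d) (a : K).
Hypotheses (Ra : ring_of_integers K0 a).
Hypothesis hI : forall r, I r <-> principal_ideal (ring_of_integers K0) a r.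
Hypothesis hO : forall e x, O e -> val (act (hA := hA) iota e x) = iota e (val x).

Lemma ideal_torsion_tors m (x : Gp hA) :
  ideal_torsion A K0 O I iota m (val x) <-> tors K0 O (act (hA := hA) iota) a m x.
Proof.
split=> [[_ h] e Re Oe|h].
  apply/val_inj; rewrite hO // val0; apply: h; first by apply/(ideal_powE _ _ Ra hI); exists e.
  by split=> //; case: (riM (riXn m Ra) Re).
split=> [|e /(ideal_powE _ _ Ra hI) he [Oe _]]; first exact: ptsG.
by rewrite -hO // (tors_dv h he Oe) val0.
Qed.

End IdealTorsion.

Theorem proposition35
  (* the CM field and its real quadratic subfield *)
  (K : fieldExtType rat) (K0 : {subfield K})
  (hK : quartic_CM K0) (hprim : primitive_field K)
  (hclass : class_number_one K0)
  (* the prime ell and the ideals above it *)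
  (ell : nat) (hell : prime ell)
  (l1 l2 : K -> Prop)
  (hsplit : forall x : K,
     principal_ideal (ring_of_integers K0) ell%:R x <-> ideal_mul l1 l2 x)
  (hneq : ~ (forall x : K, l1 x <-> l2 x))
  (hprime : forall l : K -> Prop, l = l1 \/ l = l2 ->
     prime_ideal (ring_of_integers K0) l /\
     index_is (ring_of_integers K0) l ell)
  (htotpos : forall l : K -> Prop, l = l1 \/ l = l2 ->
     exists a : subvs_of K0, totally_positive a /\
       forall x : K, l x <-> principal_ideal (ring_of_integers K0) (vsval a) x)
  (l : K -> Prop) (hl : l = l1 \/ l = l2)
  (* the finite field with q = p ^ f elements and its algebraic closure k *)
  (p f q : nat) (hp : prime p) (hf : (0 < f)%N) (hq : q = (p ^ f)%N)
  (hpell : p <> ell)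
  (k : closedFieldType) (hchar : p \in [pchar k])
  (halg : forall x : k, exists2 m : nat, (0 < m)%N & x \in Fq k (q ^ m))
  (* the principally polarized ordinary abelian surface *)
  (d : nat) (A : group_data k d)
  (hA : abelian_surface (Fq k q) A) (hord : ordinary_surface p A)
  (b : nat) (B : group_data k b) (P : cocycle k (d * b))
  (hdual : dual_variety (Fq k q) A B P)
  (lam : 'rV[k]_d -> 'rV[k]_b)
  (hlam : principal_polarization (Fq k q) A B P lam)
  (* complex multiplication *)
  (O : K -> Prop) (hO : is_order O) (hrm : locally_maximal_rm K0 O ell)
  (iota : K -> 'rV[k]_d -> 'rV[k]_d)
  (hcm : complex_multiplication (Fq k q) A O iota)
  (r n nu : nat)
  (hr : is_min (fun s => (0 < s)%N /\
     forall x, ideal_torsion A K0 O l iota 1 x ->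
       rational_point (q ^ s) A x) r)
  (hn : is_max (fun m =>
     forall x, ideal_torsion A K0 O l iota m x ->
       rational_point (q ^ r) A x) n)
  (hnu : adic_exponent A K0 O l iota (iter r (@frobenius k q d)) nu)
  (hlt : (nu < 2 * n)%N) :
  self_pairing_exponent A B P lam q r K0 O l iota ell n (2 * n - nu)%N.
Proof.
have hqn : [pchar k].-nat q by rewrite hq pnatX pnatE // hchar.
have q1 : (1 < q)%N by rewrite hq -(expn0 p) ltn_exp2l ?prime_gt1.
have [hAF [_ hdim2]] := hA.
have hdim : ~ has_chain (pts A) 3 by move=> /hdim2.
have comA : forall x y, pts A x -> pts A y -> add A x y = add A y x.
  have O2 := orderD hO (order1 hO) (order1 hO); have [c1 c2 c3 _ _] := hcm.
  apply: (double_commutative hAF (c1 _ O2)) => x Xx.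
  by have [-> _] := c3 1 1 x (order1 hO) (order1 hO) Xx; rewrite c2.
have gA := abelian_agroup hAF comA.
have [hBF lP _ _ _] := hdual; have [lamF [_ [mu [mmu _ lmu]]] _] := hlam.
have comB : forall x y, pts B x -> pts B y -> add B x y = add B y x.
  move=> x y Yx Yy; have [_ al] := lamF; have [m1 _] := mmu.
  have [Mx My] : pts A (mu x) /\ pts A (mu y) by split; apply: m1.
  have e1 := al _ _ Mx My; have e2 := al _ _ My Mx.
  by move: e1 e2; rewrite comA // !lmu // => -> ->.
have gB := abelian_agroup hBF comB.
have [D hP hD] := dual_frames_rep gA gB hdual.
have [L hpol [M [e [Y [ff [gg hL]]]]]] := polarization_frames gA gB hP hlam.
have hdiv m (x : Gp gA) : (1 < m)%N -> exists z, x = z *+ m.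
  move=> m1; have [s hs] := torsion_finite gA gB hD hpol hL m1.
  exact: (divisible hqn q1 hAF halg hs x).
have ell1 := prime_gt1 hell.
have divG (x : Gp gA) : exists z, x = z *+ ell by apply: hdiv.
have cpq : coprime ell q.
  rewrite hq; apply: coprimeXr; rewrite prime_coprime // dvdn_prime2 //.
  by apply/eqP => h; apply: hpell.
pose ac : K -> Gp gA -> Gp gA := act iota.
have aD (c : K) : O c -> {morph ac c : x y / x + y} := @actD _ _ _ _ gA _ _ _ hcm c.
have aA (c e' : K) x : O c -> O e' -> ac (c + e') x = ac c x + ac e' x := act_add hO hcm x.
have aM (c e' : K) x : O c -> O e' -> ac (c * e') x = ac c (ac e' x) := act_mul hO hcm x.
have a1 x : ac 1 x = x := act1 hcm x.
have aN m x : ac m%:R x = x *+ m := act_nat hO hcm m x.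
have kills (c : K) : O c -> (forall x, x *+ ell = 0 -> ac c x = 0) -> exists2 e', O e' & c = e' *+ ell.
  exact: (kills_torsion gB hqn q1 halg hAF hBF hP hD lP hpol lamF (fun m x => hdiv m x) hO hcm
    ell1 cpq).
have [sg [sgO sg1 sgDM sgadj sgpi]] := rosati_involution (hA := gA) gB hqn q1 halg hAF hBF hP hD lP
  hpol lamF (fun m x => hdiv m x) hO hcm.
have [h hh] := extend_order_morphism hO sg1 sgDM.
have [pi Opi epi] := frob_act gA hqn q1 halg hAF hcm.
have [theta [Ot et mx]] := hnu.
have etG x : ac theta x = iter r (@frobG k q d A gA) x.
  apply/val_inj; rewrite (val_act hcm) // et; last exact: ptsG.
  by rewrite (val_iter_frobG hqn hAF) iter_frobenius.
have tpi : theta = pi ^+ r.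
  apply: (act_inj (hA := gA) hcm Ot (orderXn hO r Opi)) => x; rewrite -/(ac _) etG -/(ac _).
  elim: (r) => [|i IH]; first by rewrite expr0 a1.
  by rewrite exprS aM //= ?IH -?epi //; apply: (orderXn hO).
have hth : h theta * theta = (q ^ r)%:R.
  by rewrite tpi rmorphXn -exprMn hh // sgpi // natrX.
have qr0 : (q ^ r)%:R != 0 :> K by apply: natK0; rewrite expn_gt0 (ltnW q1).
have ht0 : h theta != 0 by apply: contraNneq qr0 => e0; rewrite -hth e0 mul0r.
(* [h] fixes the rational number [h theta * theta], and [h theta] can be cancelled. *)
have hhth : h (h theta) = theta.
  apply: (mulIf ht0); rewrite -rmorphM hth rmorph_nat -hth mulrC; congr (_ * _).
have hgen l' : l' = l1 \/ l' = l2 -> exists2 a : K, a \in K0 &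
    forall x, l' x <-> principal_ideal (ring_of_integers K0) a x.
  by move=> /htotpos [a [_ ha]]; exists (vsval a); first exact: subvsP.
have [a [b' [v [w [[Ra Rb Rv Rw] ab vw [na nb] [hI int1]]]]]] :=
  split_uniformizers hell hsplit hneq hprime hgen hl.
have [m0 /(rm_index hO) m0O cm0] := hrm.
(* An element of [K0] lies in every local suborder, so no maximal exponent would exist. *)
have ntheta : theta \notin K0.
  apply/negP => tK; have Rt := order_ri hO Ot tK.
  suff : in_local_suborder K0 O l nu.+1 theta by move=> /mx.2; rewrite ltnn.
  exists (fun=> theta), [::]; split=> //; first exact: (constant_completion Ra hI Rt).
  move=> N F [_ _ _ F4]; rewrite !big_seq1 /=.
  rewrite -[theta in LHS]mulr1 F4 //; [|exact: (order1 hO)|].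
    by congr (F 1 _); apply: functional_extensionality => m; rewrite mulr1.
  exact: (constant_completion Ra hI (ri1 K0)).
have hfix := involution_fixes hK hprim ntheta hhth.
(* Otherwise [theta ^ 2 = q ^ r]; Frobenius being injective on points, there would be no nonzero
   [p]-torsion, against ordinarity. *)
have st : h theta != theta.
  apply/eqP => eh; rewrite eh in hth.
  have z0 (x : Gp gA) : x *+ p = 0 -> x = 0.
    move=> xp; have inj := frobG_inj (hA := gA) hqn hAF.
    have f0 : @frobG k q d A gA 0 = 0.
      by apply: (addrI (@frobG k q d A gA 0)); rewrite -(frobGD hqn hAF) !addr0.
    have injr i y : iter i (@frobG k q d A gA) y = 0 -> y = 0.
      by elim: i => //= i IH e0; apply/IH/inj; rewrite e0 f0.
    apply: (injr r); apply: (injr r); rewrite -!etG -aM // hth.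
    rewrite aN hq -expnM.
    have [[r0 _] _] := hr; rewrite -(prednK (n := (f * r)%N)) ?muln_gt0 ?hf //.
    by rewrite expnS mulrnA xp mul0rn.
  have [s [us ss hs]] := hord.
  have s1 : (size s <= 1)%N.
    apply: (@leq_trans (size [:: zero A])) => //; apply: uniq_leq_size => // x /hs [Xx xp].
    rewrite inE; apply/eqP/(inG_eq0 gA Xx); apply: z0; rewrite -inGMn //.
    by rewrite xp.
  by move: s1; rewrite ss leqNgt -(expn0 p) ltn_exp2l ?prime_gt1.
have hgO c : O c -> O (h c) by move=> Oc; rewrite hh //; apply: sgO.
have count (s : seq (Gp gA)) : uniq s -> (forall x, x \in s -> x *+ ell = 0) -> (size s <= ell ^ 4)%N.
  exact: (torsion_bound gB hD hpol divG hL hdim ell1).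
have vact (c : K) (x : Gp gA) : O c -> val (ac c x) = iota c (val x).
  by move=> Oc; apply: (val_act hcm).
have itE m (x : Gp gA) : ideal_torsion A K0 O l iota m (val x) <-> tors K0 O ac a m x.
  exact: (ideal_torsion_tors Ra hI (fun c x => @vact c x)).
(* The choice of [r] makes level 1 rational. *)
have n1 : (0 < n)%N by apply: hn.2; case: hr => -[].
have fixn x : tors K0 O ac a n x -> ac theta x = x.
  move=> /itE /hn.1 [_ hx]; rewrite etG; apply/val_inj; rewrite (val_iter_frobG hqn hAF).
  by apply/rowP=> i; rewrite mxE; apply/eqP/hx.
have nlocal : ~ in_local_suborder K0 O l nu.+1 theta by move=> /mx.2; rewrite ltnn.
have [gam [c [x0 [Ogam nnu struct_ [tx0 nx0] basis]]]] := local_structure hO hell Ra Rb ab Rv Rw vw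
  na nb int1 m0O cm0 aD aA aM a1 divG kills hgO hfix Ot st count hI mx.1 nlocal n1 hlt fixn.
(* Approximate projectors onto the [l]-part; lying in [K0], they are self-adjoint. *)
have [u hu] : exists u : nat -> K, forall m, [/\ O (u m), u m \in K0,
    principal_ideal (ring_of_integers K0) (b' ^+ m) (u m) &
    principal_ideal (ring_of_integers K0) (a ^+ m) (1 - u m)].
  exact: (fchoice (projector hell Ra Rb ab Rv Rw vw hO m0O cm0)).
have Ou m : O (u m) by case: (hu m).
pose lG := @lamG k d b A B gA gB lam.
have lt m t : t *+ m = 0 -> lG t *+ m = 0.
  by move=> tm; rewrite /lG -(lamG_muln gB hpol) tm (lamG0 gA gB hpol).
pose E m t t' := @we k d b A B gA gB D m t (lG t').
have EDl m t t' y : t *+ m = 0 -> t' *+ m = 0 -> y *+ m = 0 -> E m (t + t') y = E m t y * E m t' y.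
  by move=> h1 h2 /lt h3; apply: (weDl hD hpol).
have E0l m y : y *+ m = 0 -> E m 0 y = 1 by move=> /lt h1; apply: (we0l gA hD hpol).
have EMl m t y j : t *+ m = 0 -> y *+ m = 0 -> E m (t *+ j) y = E m t y ^+ j.
  by move=> h1 /lt h2; apply: (weMnl hD hpol).
have EMr m t y j : t *+ m = 0 -> y *+ m = 0 -> E m t (y *+ j) = E m t y ^+ j.
  by move=> h1 /lt h2; rewrite /E /lG (lamG_muln gB hpol); apply: (weMnr hD hpol).
have Elev m m' t y : t *+ (m * m') = 0 -> y *+ m = 0 -> E (m * m')%N t y = E m (t *+ m') y.
  by move=> h1 /lt h2; apply: (we_level hD hpol).
have Ealt m t : t *+ m *+ m = 0 -> E m (t *+ m) (t *+ m) = 1.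
  by move=> h1; apply: (we_alternating gB hD hpol).
have End y : y *+ ell = 0 -> (forall t, t *+ ell = 0 -> E ell t y = 1) -> y = 0.
  move=> h1 h2; have [g gK _] := lamG_bij gA gB hpol; apply: (can_inj gK).
  rewrite (lamG0 gA gB hpol).
  exact: (weil_nondegenerate hqn q1 hD hpol divG (prime_gt0 hell) cpq (lt _ _ h1) h2).
have Eadj N m t y : t *+ m = 0 -> y *+ m = 0 -> E m (ac (u N) t) y = E m t (ac (u N) y).
  move=> h1 h2; have [Ou' uK _ _] := hu N.
  by rewrite /E /lG (sgadj _ _ _ _ Ou' h1 h2) -hh // hfix.
have uD N t t' : ac (u N) (t + t') = ac (u N) t + ac (u N) t' by apply: aD.
have ut N t : t *+ (ell ^ N) = 0 -> tors K0 O ac a N (ac (u N) t).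
  move=> tN; have [Ou' _ ub _] := hu N.
  by move=> e'; apply: (tors_proj hO hell m0O cm0 aD aA aM Ra Rb ab Ou' ub tN).
have uf N t : tors K0 O ac a N t -> ac (u N) t = t.
  by move=> ht; have [Ou' _ _ ua] := hu N; apply: (tors_fix hO aA a1 Ou' ua ht).
have uT N t : ac (u N) (ac theta t) = ac theta (ac (u N) t) by rewrite -!aM // mulrC.
have tn N t : tors K0 O ac a N t -> t *+ (ell ^ N) = 0 := tors_a_ell hO Rb ab aA a1 (x := t).
have tle N N' t : (N <= N')%N -> tors K0 O ac a N t -> tors K0 O ac a N' t.
  by move=> le ht e'; apply: (tors_le Ra le ht).
have dG N x : exists z : Gp gA, x = z *+ (ell ^ N).
  have [->|N0] := posnP N; first by exists x; rewrite expn0.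
  by apply: hdiv; rewrite -(expn0 ell) ltn_exp2l.
have lift : exists2 x, tors K0 O ac a n x & x *+ (ell ^ n.-1) = x0.
  have := tors_lift hO hell Ra Rb ab Rv Rw vw m0O cm0 aD aA aM a1 divG n.-1 tx0.
  by rewrite add1n prednK.
have tate x z zeta : mult A (ell ^ n) (val z) = val x ->
    weil_pairing A B P (ell ^ n) (add A (iter r (@frobenius k q d) (val z)) (opp A (val z)))
      (lam (val x)) zeta -> E (ell ^ n)%N (ac theta z - z) x = zeta.
  move=> ez; have -> : add A (iter r (@frobenius k q d) (val z)) (opp A (val z)) =
      val (ac theta z - z).
    by rewrite valD valN etG (val_iter_frobG hqn hAF) iter_frobenius.
  by rewrite -(val_lamG (hA := gA) gB hpol) => /(weil_pairingE hP hD hpol) [].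
have gD t t' : ac gam (t + t') = ac gam t + ac gam t' by apply: aD.
have tD t t' : ac theta (t + t') = ac theta t + ac theta t' by apply: aD.
split.
  have [x [z [hx ez hnt]]] := self_pairing_nontrivial EDl E0l EMl EMr Elev Ealt End Eadj uD ut uf uT
    tn tle tD gD dG lift n1 nnu hlt struct_ tx0 nx0 basis.
  have xN := tn _ _ hx.
  exists (val x), (E (ell ^ n)%N (ac theta z - z) x); split.
  - exact/itE.
  - exists (val z); split; [exact: ptsG|by rewrite -valMn ez|].
    have -> : add A (iter r (@frobenius k q d) (val z)) (opp A (val z)) = val (ac theta z - z).
      by rewrite valD valN etG (val_iter_frobG hqn hAF) iter_frobenius.
    rewrite -(val_lamG (hA := gA) gB hpol); apply/(weil_pairingE hP hD hpol); split=> //.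
      have tN : z *+ (ell ^ (2 * n)) = 0 by rewrite mul2n -addnn expnD mulrnA ez.
      have -> : (ac theta z - z) *+ (ell ^ n) = ac theta (z *+ (ell ^ n)) - z *+ (ell ^ n).
        by rewrite mulrnBl; congr (_ - _); symmetry; apply: (actMn hcm).
      by rewrite ez fixn ?subrr.
    exact: lt.
  split; last by move=> i /hnt /eqP.
  exact: (self_pairing_order EDl E0l EMl Ealt Eadj uD ut uf uT tn tle tD gD n1 nnu hlt struct_ hx ez).
(* Every self-pairing is killed by [ell ^ (2 n - nu)], so no larger exact order occurs. *)
move=> j [x [zeta [hx [z [Xz ez wz]] [z1 z2]]]].
have [Xx _] := hx; rewrite leqNgt; apply/negP => lt'.
apply: (z2 _ lt'); pose xG := inG gA x; pose zG := inG gA z.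
have exG : val xG = x by rewrite inGK.
have ezG : val zG = z by rewrite inGK.
rewrite -exG -ezG in ez wz hx; rewrite -(tate _ _ _ ez wz).
have ez' : zG *+ (ell ^ n) = xG by apply/val_inj; rewrite valMn.
have hx' : tors K0 O ac a n xG by apply/itE.
exact: (self_pairing_order EDl E0l EMl Ealt Eadj uD ut uf uT tn tle tD gD n1 nnu hlt struct_ hx' ez').
Qed.
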